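(* Let $M$ be an $n$-dimensional Frobenius manifold of charge $d$ as in the context and let $X^a,Y_a$ be the canonical coordinates on $M\otimes QH^*(\mathbb{CP}^1)$ given by odd periods described in the context. The generating function $S=S(X,Q)$, $Q=e^s$, of the family of Lagrangian manifolds $$L_s=\Big\{Y_a=\frac{\partial S(X,Q)}{\partial X^a},\ a=1,\dots,n\Big\}$$ admits an expansion $$S=\frac12G_{ab}X^aX^b\log Q-2F_*(X)+\sum_{k\ge1}S_k(X)Q^k,\qquad Q\to0 .$$ The coefficients $S_k(X)$ can be uniquely determined from the Hamilton–Jacobi equation $$\frac{\partial S}{\partial s}=H$$ with the Hamiltonian $$H=\frac2{1-d}\,t_1=\frac12G_{ab}x^ax^b$$ (evaluated on $L_s$ and expressed through $X,Q$) and from the expansions $$X^a=x^a+\sum_{k=1}^\infty\frac{Q^k}{(k!)^2}\,\partial_1^{2k}x^a,\qquad a=1,\dots,n .$$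
   Context: A Frobenius manifold of charge $d$: complex manifold $M$ with a commutative associative product with unity $e$ and an invariant nondegenerate symmetric form $\langle\ ,\ \rangle$ on each $T_tM$, such that $\langle\ ,\ \rangle$ is flat with Levi-Civita connection $\nabla$, $\nabla e=0$; $(\nabla_wc)(x,y,z)$ is totally symmetric for $c(x,y,z)=\langle x\cdot y,z\rangle$; and an Euler field $E$ is given with $\nabla\nabla E=0$, $[E,x\cdot y]-[E,x]\cdot y-x\cdot[E,y]=x\cdot y$, $E\langle x,y\rangle-\langle[E,x],y\rangle-\langle x,[E,y]\rangle=(2-d)\langle x,y\rangle$. In flat coordinates $t^\alpha$ with $e=\partial_1$: $\partial_\alpha\cdot\partial_\beta=c_{\alpha\beta}^\gamma\partial_\gamma$; matrices acting on row vectors from the right: $(C_\alpha)^\beta_\gamma=c^\beta_{\alpha\gamma}$, $\mathcal U^\alpha_\beta=E^\epsilon c^\alpha_{\epsilon\beta}$, $\mathcal V=\frac{2-d}2-\nabla E$; $t_1=\eta_{1\alpha}t^\alpha$. The product on $T^*M$ is transported from $TM$ by $\langle\ ,\ \rangle$; the intersection form on $T^*M$ is $(\omega_1,\omega_2)=i_E(\omega_1\cdot\omega_2)$; the discriminant $\Sigma$ is the locus where it degenerates, and off $\Sigma$ its inverse is a flat metric. Let $x^1(t),\dots,x^n(t)$ be its local flat coordinates on $M\setminus\Sigma$ with $E\,x^a=\frac{1-d}2x^a$, $G^{ab}=(dx^a,dx^b)$, $(G_{ab})=(G^{ab})^{-1}$. The dual potential $F_*(x)$ is defined, up to quadratic polynomials,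 by $\frac{\partial}{\partial x^a}*\frac{\partial}{\partial x^b}=G^{cd}\frac{\partial^3F_*}{\partial x^d\partial x^a\partial x^b}\frac{\partial}{\partial x^c}$, where $u*v=E^{-1}\cdot u\cdot v$. An odd period is a function $\varpi$ on an open subset of the complement of the discriminant whose gradient row vector $\xi$ satisfies $\partial_\alpha\xi\cdot\mathcal U=\xi\cdot\mathcal V\,C_\alpha$ for all $\alpha$. The Poisson bracket on a Frobenius manifold is $\{f,g\}=\langle df,\mathcal V\,dg\rangle$, i.e. $\{t^\alpha,t^\beta\}=\eta^{\alpha\gamma}\mathcal V^\beta_\gamma$. Here $M$ is assumed to have $\mathcal V=\mathrm{diag}(\mu_1,\dots,\mu_n)$ diagonalizable with eigenvalues different from $\frac12$ (in particular $d\ne1$), and flat coordinates with $\eta_{\alpha\beta}=\delta_{\alpha+\beta,n+1}$, $\mu_\alpha+\mu_{n+1-\alpha}=0$. $QH^*(\mathbb{CP}^1)$ is the Frobenius manifold of charge $1$ with flat coordinates $(t^1,s)$, potential $\frac12(t^1)^2s+e^s$ and Euler field $t^1\partial_1+2\partial_s$. The tensor product $M\otimes QH^*(\mathbb{CP}^1)$ is the $2n$-dimensional Frobenius manifold of charge $d+1$ with flat coordinates $t^{\alpha'\alpha''}$, $\alpha'=1,\dots,n$, $\alpha''=1,2$, with $t^{\alpha'1''}=t^\alpha$, $t^{1'2''}=s$, defined near the coordinate cross $\{t^{\alpha'2''}=0,\ \alpha'\ge2\}$, uniquely determined by the condition that on the cross $\frac{\partial}{\partial t^{\alpha'\alpha''}}\mapsto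 e_\alpha\otimes e_{\alpha''}$ ($e_1=\partial_1,e_2=\partial_s$ on the second factor) is an isomorphism of Frobenius algebras with $T_tM\otimes T_sQH^*(\mathbb{CP}^1)$; its Euler field on the cross is $E+2\partial_s$ and its operator $\mathcal V$ acts by $e_\alpha\otimes e_1\mapsto(\mu_\alpha-\frac12)e_\alpha\otimes e_1$, $e_\alpha\otimes e_2\mapsto(\mu_\alpha+\frac12)e_\alpha\otimes e_2$. The Poisson bracket is $\{t^{\alpha'1''},t^{\beta'2''}\}=\eta^{\alpha\beta}(\mu_\beta+\frac12)$, $\{t^{\alpha'2''},t^{\beta'1''}\}=\eta^{\alpha\beta}(\mu_\beta-\frac12)$, other brackets zero; the corresponding symplectic form is $\Omega=\frac2{1-d}ds\wedge dt^n+\sum_{\alpha=2}^n(\mu_\alpha+\frac12)^{-1}dt^{\alpha'2''}\wedge dt^{(n-\alpha+1)'1''}$. For fixed $s$, $L_s=\{s\text{ fixed},\ t^{\alpha'2''}=0\ (\alpha\ge2),\ t^{\beta'1''}\text{ arbitrary}\}$ is a Lagrangian submanifold. The coordinates $(X^a,Y_a)$ are a basis of odd periods on $M\otimes QH^*(\mathbb{CP}^1)$ with $\{X^a,Y_b\}=\delta^a_b$, $\{X^a,X^b\}=\{Y_a,Y_b\}=0$ and, on the coordinate cross as $Q\to0$, $X^a=x^a(t)+O(Q)$, $Y_a=G_{ab}x^b(t)\log Q-2\frac{\partial F_*(x)}{\partial x^a}+o(1)$.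
   Formalization: Flat coordinates are normalized so that E^α = ((2−d)/2 − μ_α)t^α where that coefficient is nonzero; otherwise 2t_1/(1−d) = ½G_ab x^a x^b fails by a constant. Q → 0 is taken in bounded sectors of arg Q, locally uniformly in t. *)

(* Defs.v *)
From HB Require Import structures.
From mathcomp Require Import all_boot all_order all_algebra.
From mathcomp Require Import complex.
From mathcomp Require Import all_classical all_reals all_analysis.
Import Order.TTheory GRing.Theory Num.Theory.
Import numFieldNormedType.Exports.

Set Implicit Arguments.
Unset Strict Implicit.
Unset Printing Implicit Defensive.

Local Open Scope classical_set_scope.
Local Open Scope ring_scope.
Local Open Scope complex_scope.

(** Conventions.  A Frobenius manifold is given in a flat chart: points are the
    row vectors of flat coordinates, so that the Levi-Civita connection acts
    componentwise as [D_v].  Tangent vectors and covectors are row vectors as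
    well; a matrix [A], with [A a b] the entry of upper index [a] and lower
    index [b], acts on covectors by [xi *m A]. *)

(* The complex numbers, packed as a numFieldType: the normed structure attached
   to this interface is the one on which derive.v is built. *)
Definition Cplx (R : realType) : numFieldType := R[i].

Section ComplexAnalysis.
Variable R : realType.
Local Notation C := (Cplx R).

(* For [A] open and [V] of finite dimension: continuously complex
   differentiable. *)
Definition holomorphic (V W : normedModType C) (A : set V) (f : V -> W) : Prop :=
  forall z, A z ->
    differentiable f z /\ forall v : V, {for z, continuous ('D_v f)}.

Definition cexp (z : C) : C :=
  (expR (complex.Re z))%:C *
    (cos (complex.Im z) +i* sin (complex.Im z)).

Definition gradient (m : nat) (f : 'rV[C]_m -> C) (t : 'rV[C]_m) : 'rV[C]_m :=
  \row_a 'D_(delta_mx 0 a) f t.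

Definition lie_bracket (m : nat) (v w : 'rV[C]_m -> 'rV[C]_m) (t : 'rV[C]_m) :
    'rV[C]_m :=
  'D_(v t) w t - 'D_(w t) v t.

(* log Q is multivalued, so the limit Q -> 0 is taken in the variable
   s = log Q, on a branch over a sector p < arg Q < q.  The sector must be
   bounded: |s| is not controlled by |Q| when Im s is unbounded. *)
Definition Qto0 (p q : R) : set_system C :=
  [set B | exists rho : R, forall s : C,
    p < complex.Im s < q -> complex.Re s < rho -> B s].

(* An open set of pairs (z, s) which is a neighbourhood of A x {Q = 0}, in the
   sectorial sense above. *)
Definition Q0_nbhd (p q : R) (V : normedModType C) (A : set V)
    (B : set (V * C)) : Prop :=
  open B /\ forall z, A z -> \forall y \near z & s \near Qto0 p q, B (y, s).

End ComplexAnalysis.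

Section FrobeniusManifolds.
Variable R : realType.
Local Notation C := (Cplx R).

Record frobenius_data (m : nat) := FrobeniusData {
  fdom : set 'rV[C]_m;
  flat_metric : 'M[C]_m;
  (* [strc t a b g] is the coefficient of the g-th coordinate field in the
     product of the a-th and the b-th ones. *)
  strc : 'rV[C]_m -> 'I_m -> 'I_m -> 'I_m -> C;
  (* constant, being covariantly constant *)
  funity : 'rV[C]_m;
  feuler : 'rV[C]_m -> 'rV[C]_m;
  fcharge : C }.

Section Structure.
Variables (m : nat) (M : frobenius_data m).
Local Notation vfield := ('rV[C]_m -> 'rV[C]_m).

Definition fmul (t u v : 'rV[C]_m) : 'rV[C]_m :=
  \row_g \sum_a \sum_b u 0 a * v 0 b * strc M t a b g.

Definition fpair (u v : 'rV[C]_m) : C := (u *m flat_metric M *m v^T) 0 0.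

Record frobenius_manifold : Prop := {
  fdom_open : open (fdom M);
  eta_sym : (flat_metric M)^T = flat_metric M;
  eta_nondegenerate : flat_metric M \in unitmx;
  strc_holomorphic : forall a b g, holomorphic (fdom M) (fun t => strc M t a b g);
  fmulC : forall t u v, fdom M t -> fmul t u v = fmul t v u;
  fmulA : forall t u v w, fdom M t ->
    fmul t u (fmul t v w) = fmul t (fmul t u v) w;
  fmul1 : forall t u, fdom M t -> fmul t (funity M) u = u;
  fpair_invariant : forall t u v w, fdom M t ->
    fpair (fmul t u v) w = fpair u (fmul t v w);
  (* Together with the symmetry of c(x,y,z) in x, y, z, this is the total
     symmetry of (nabla_w c)(x,y,z). *)
  nabla_c_sym : forall t w x y z, fdom M t ->
    'D_w (fun t' => fpair (fmul t' x y) z) t =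
    'D_x (fun t' => fpair (fmul t' w y) z) t;
  euler_holomorphic : holomorphic (fdom M) (feuler M);
  nabla_nabla_euler : forall t u v, fdom M t -> 'D_u ('D_v (feuler M)) t = 0;
  euler_fmul : forall (x y : vfield) t,
    holomorphic (fdom M) x -> holomorphic (fdom M) y -> fdom M t ->
    lie_bracket (feuler M) (fun t' => fmul t' (x t') (y t')) t
      - fmul t (lie_bracket (feuler M) x t) (y t) - fmul t (x t) (lie_bracket (feuler M) y t)
    = fmul t (x t) (y t);
  euler_fpair : forall (x y : vfield) t,
    holomorphic (fdom M) x -> holomorphic (fdom M) y -> fdom M t ->
    'D_(feuler M t) (fun t' => fpair (x t') (y t')) t
      - fpair (lie_bracket (feuler M) x t) (y t) - fpair (x t) (lie_bracket (feuler M) y t)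
    = (2 - fcharge M) * fpair (x t) (y t) }.

Definition Cmx (t : 'rV[C]_m) (a : 'I_m) : 'M[C]_m :=
  \matrix_(b, g) strc M t a g b.

Definition Umx (t : 'rV[C]_m) : 'M[C]_m :=
  \matrix_(a, b) \sum_e feuler M t 0 e * strc M t e b a.

(* The Jacobian has the differentiation index as row index, hence the
   transposition. *)
Definition Vmx (t : 'rV[C]_m) : 'M[C]_m :=
  ((2 - fcharge M) / 2)%:M - ('J (feuler M) t)^T.

Definition sharp (w : 'rV[C]_m) : 'rV[C]_m := w *m invmx (flat_metric M).

Definition comul (t w1 w2 : 'rV[C]_m) : 'rV[C]_m :=
  fmul t (sharp w1) (sharp w2) *m flat_metric M.

Definition intersection_form (t w1 w2 : 'rV[C]_m) : C :=
  (comul t w1 w2 *m (feuler M t)^T) 0 0.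

Definition discriminant : set 'rV[C]_m :=
  [set t | fdom M t /\
    (\matrix_(a, b) intersection_form t (delta_mx 0 a) (delta_mx 0 b))
      \notin unitmx].

Definition odd_period (D : set 'rV[C]_m) (w : 'rV[C]_m -> C) : Prop :=
  [/\ open D, D `<=` fdom M `\` discriminant, holomorphic D w &
      forall t a, D t ->
        'D_(delta_mx 0 a) (gradient w) t *m Umx t
        = gradient w t *m Vmx t *m Cmx t a].

Definition poisson_bracket (f g : 'rV[C]_m -> C) (t : 'rV[C]_m) : C :=
  (gradient f t *m invmx (flat_metric M) *m (gradient g t *m Vmx t)^T) 0 0.

Definition euler_inv (t : 'rV[C]_m) : 'rV[C]_m :=
  funity M *m invmx (lin1_mx (fmul t (feuler M t))).

Definition star (t u v : 'rV[C]_m) : 'rV[C]_m :=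
  fmul t (euler_inv t) (fmul t u v).

(* [x] is a chart on [A], off the discriminant, in which the intersection form
   has the constant Gram matrix [G] (upper indices). *)
Record flat_chart (A : set 'rV[C]_m) (x : vfield) (G : 'M[C]_m) : Prop := {
  chart_open : open A;
  chart_regular : A `<=` fdom M `\` discriminant;
  chart_holomorphic : holomorphic A x;
  chart_inj : forall t t', A t -> A t' -> x t = x t' -> t = t';
  chart_image_open : open (x @` A);
  chart_jacobian : forall t, A t -> 'J x t \in unitmx;
  chart_gram : forall t a b, A t ->
    intersection_form t (gradient (fun t' => x t' 0 a) t)
                        (gradient (fun t' => x t' 0 b) t) = G a b;
  chart_euler : forall t, A t ->
    'D_(feuler M t) x t = ((1 - fcharge M) / 2) *: x t }.

Definition coord_field (x : vfield) (t : 'rV[C]_m) (a : 'I_m) : 'rV[C]_m :=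
  row a (invmx ('J x t)).

Definition dual_potential (A : set 'rV[C]_m) (x : vfield) (G : 'M[C]_m)
    (F : 'rV[C]_m -> C) : Prop :=
  holomorphic (x @` A) F /\
  forall t a b, A t ->
    star t (coord_field x t a) (coord_field x t b)
    = \sum_c (\sum_e G c e *
        'D_(delta_mx 0 e) ('D_(delta_mx 0 a) ('D_(delta_mx 0 b) F)) (x t))
        *: coord_field x t c.

End Structure.

Definition data_of_potential (m : nat) (A : set 'rV[C]_m) (h : 'M[C]_m)
    (F : 'rV[C]_m -> C) (e : 'rV[C]_m) (E : 'rV[C]_m -> 'rV[C]_m) (d : C) :
    frobenius_data m :=
  FrobeniusData A h
    (fun t a b g => \sum_k
      'D_(delta_mx 0 a) ('D_(delta_mx 0 b) ('D_(delta_mx 0 k) F)) t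
      * invmx h k g)
    e E d.

(* Coordinates (t^1, s), potential (t^1)^2 s / 2 + exp s. *)
Definition QHP1 : frobenius_data 2 :=
  data_of_potential setT (\matrix_(i, j) (i != j)%:R)
    (fun t => t 0 0 ^+ 2 * t 0 1 / 2 + cexp (t 0 1))
    (delta_mx 0 0) (fun t => t 0 0 *: delta_mx 0 0 + 2 *: delta_mx 0 1) 1.

End FrobeniusManifolds.

Section TensorQHP1.
Variables (R : realType) (n : nat).
Local Notation C := (Cplx R).
Local Notation vec := ('rV[C]_n.+1).
(* The coordinates t^{a'1''} come first, then the coordinates t^{a'2''}. *)
Local Notation vec2 := ('rV[C]_(n.+1 + n.+1)).

Definition tens (u : vec) (w : 'rV[C]_2) : vec2 :=
  row_mx (w 0 0 *: u) (w 0 1 *: u).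

(* The point of the coordinate cross with t^{a'1''} = t^a and t^{1'2''} = s. *)
Definition cross_pt (t : vec) (s : C) : vec2 :=
  row_mx t (s *: delta_mx 0 ord0).

Record tensor_QHP1 (M : frobenius_data R n.+1) (mu : vec)
    (N : frobenius_data R (n.+1 + n.+1)) : Prop := {
  tensor_frobenius : frobenius_manifold N;
  tensor_charge : fcharge N = fcharge M + 1;
  tensor_dom : forall t s, fdom M t -> fdom N (cross_pt t s);
  tensor_unity : funity N = tens (funity M) (funity (QHP1 R));
  tensor_fpair : forall u u' w w',
    fpair N (tens u w) (tens u' w') = fpair M u u' * fpair (QHP1 R) w w';
  tensor_fmul : forall t s u u' w w', fdom M t ->
    fmul N (cross_pt t s) (tens u w) (tens u' w')
    = tens (fmul M t u u') (fmul (QHP1 R) (s *: delta_mx 0 1) w w');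
  tensor_euler : forall t s, fdom M t ->
    feuler N (cross_pt t s) = row_mx (feuler M t) (2 *: delta_mx 0 ord0);
  tensor_V : forall y, fdom N y ->
    Vmx N y = diag_mx (row_mx (mu - const_mx 2^-1) (mu + const_mx 2^-1)) }.

Definition lagrangian (M : frobenius_data R n.+1) (s : C) : set vec2 :=
  [set y | exists2 t, fdom M t & y = cross_pt t s].

Definition Gquad (G : 'M[C]_n.+1) (x : vec) : C := (x *m invmx G *m x^T) 0 0.

Record canonical_coordinates (p q : R) (N : frobenius_data R (n.+1 + n.+1))
    (A : set vec) (x : vec -> vec) (G : 'M[C]_n.+1) (F : vec -> C)
    (D : set vec2) (X Y : vec2 -> vec) : Prop := {
  canonical_X : forall a, odd_period N D (fun y => X y 0 a);
  canonical_Y : forall a, odd_period N D (fun y => Y y 0 a);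
  canonical_XY : forall a b y, D y ->
    poisson_bracket N (fun z => X z 0 a) (fun z => Y z 0 b) y = (a == b)%:R;
  canonical_XX : forall a b y, D y ->
    poisson_bracket N (fun z => X z 0 a) (fun z => X z 0 b) y = 0;
  canonical_YY : forall a b y, D y ->
    poisson_bracket N (fun z => Y z 0 a) (fun z => Y z 0 b) y = 0;
  canonical_dom : forall t0, A t0 ->
    \forall t \near t0 & s \near Qto0 p q, D (cross_pt t s);
  canonical_X_asymptotic : forall t0 a, A t0 -> exists K : C,
    \forall t \near t0 & s \near Qto0 p q,
      `|X (cross_pt t s) 0 a - x t 0 a| <= K * `|cexp s|;
  canonical_Y_asymptotic : forall t0 a, A t0 ->
    (fun z : vec * C => Y (cross_pt z.1 z.2) 0 a -
       ((invmx G *m (x z.1)^T) a 0 * z.2 - 2 * 'D_(delta_mx 0 a) F (x z.1)))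
      @ filter_prod (nbhs t0) (Qto0 p q) --> (0 : C) }.

(* [Xv] is the sum of the series x^a + sum_k Q^k / (k!)^2 d_1^{2k} x^a at t. *)
Definition X_expansion (x : vec -> vec) (t : vec) (s : C) (Xv : vec) : Prop :=
  forall a, (fun K : nat => x t 0 a +
      \sum_(1 <= k < K) cexp s ^+ k / (k`!%:R ^+ 2) *
        iter (2 * k) (fun f : vec -> C => 'D_(delta_mx 0 ord0) f)
          (fun t' => x t' 0 a) t) @ \oo --> Xv 0 a.

(* Functions of (X, Q) are written as functions of (X, s), s = log Q; the value
   [Sk 0] plays no role. *)
Definition generating_expansion (p q : R) (B : set vec) (G : 'M[C]_n.+1)
    (F : vec -> C) (Sk : nat -> vec -> C) (D : set (vec * C))
    (S : vec * C -> C) : Prop :=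
  [/\ Q0_nbhd p q B D, holomorphic D S,
      forall k, (0 < k)%N -> holomorphic B (Sk k) &
      forall z, D z ->
        (fun K : nat => Gquad G z.1 / 2 * z.2 - 2 * F z.1 +
           \sum_(1 <= k < K) Sk k z.1 * cexp z.2 ^+ k) @ \oo --> S z].

(* dS/ds = H, where H, given as a function of t, is expressed through (X, Q) by
   means of the expansions of X alone. *)
Definition hamilton_jacobi (p q : R) (A : set vec) (x : vec -> vec)
    (H : vec -> C) (D : set (vec * C)) (S : vec * C -> C) : Prop :=
  exists2 T : set (vec * C), Q0_nbhd p q A T &
    forall t s Xv, T (t, s) -> X_expansion x t s Xv -> D (Xv, s) ->
      'D_(0, 1) S (Xv, s) = H t.

End TensorQHP1.

(* Main.v *)
Require Import Defs.
From HB Require Import structures.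
From mathcomp Require Import all_boot all_order all_algebra.
From mathcomp Require Import complex ring lra.
From mathcomp Require Import all_classical all_reals all_analysis.
Import Order.TTheory GRing.Theory Num.Theory.
Import numFieldNormedType.Exports.

Set Implicit Arguments.
Unset Strict Implicit.
Unset Printing Implicit Defensive.

Local Open Scope classical_set_scope.
Local Open Scope ring_scope.

(** Along the coordinate cross every odd period satisfies d_s^2 w = Q d_1^2 w,
    Q = e^s: off the discriminant the gradient xi obeys d_a xi = d_1 xi C_a, and
    e_2 * e_2 = Q in the quantum cohomology of CP^1.  Integrating twice from
    Q = 0, again and again, yields the expansion of X^a, which converges; hence
    (t, Q) |-> (X, Q) is a local biholomorphism along Q = 0.  Expressing the
    Hamiltonian H through (X, Q), H = sum_k h_k(X) Q^k with h_0 = G_ab X^a X^b / 2,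
    one puts S_k = h_k / k, which is forced by dS/ds = H.  Restricted to the cross
    the symplectic form is ds /\ dH, so that at fixed X the s-derivative of Y_a is
    dH/dX^a.  Thus Y_a and dS/dX^a have the same derivative along the rays
    Q -> 0, where they also have the same asymptotics: they are equal. *)

(** * Strict differentiability *)

(** Three obstacles shape the development. (1) The asymptotics of X bound X - x by a multiple of |Q|
    and say nothing of derivatives in s. Along a ray the first derivative is controlled all the
    same: if it did not tend to 0, the function would grow linearly as s -> -oo. (2) X and Y are
    known only on a sector in log Q, whereas the inverse function theorem requires a full
    neighbourhood of Q = 0. The expansion of X, summed as a function of (t, Q), provides one: it is
    holomorphic for all small Q and agrees with X on the sector. (3) The term of Y in log Q is
    unbounded; replacing x by X in it costs O(Q log Q), which still tends to 0. The coefficients S_k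
    are global on the image of the chart although the inverse of (t, Q) |-> (X, Q) is only local:
    injectivity of the chart makes the local choices agree. Complex analysis is reached through
    strict differentiability, which is stable under composition and inversion, and through averages
    over roots of unity, whose limit along an ultrafilter always exists for bounded data. *)

Section RealNorm.
Variable R : realType.
Local Notation C := (Cplx R).

(* The norm of a [Cplx R]-normed module takes its values in [Cplx R]; [nr] is
   the same norm as a real number. *)
Definition nr (V : normedModType C) (v : V) : R := complex.Re (`|v| : C).

Definition rc (x : R) : C := (x%:C)%C.

Lemma nrE (V : normedModType C) (v : V) : `|v| = rc (nr v).
Proof. by rewrite /rc /nr RRe_real // ger0_real. Qed.

Lemma le_rc x y : (rc x <= rc y) = (x <= y).
Proof. exact: lecR. Qed.

Lemma lt_rc x y : (rc x < rc y) = (x < y).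
Proof. exact: ltcR. Qed.

Lemma rcD x y : rc (x + y) = rc x + rc y.
Proof. exact: (rmorphD (real_complex R)). Qed.
Lemma rcB x y : rc (x - y) = rc x - rc y.
Proof. exact: (rmorphB (real_complex R)). Qed.
Lemma rcM x y : rc (x * y) = rc x * rc y.
Proof. exact: (rmorphM (real_complex R)). Qed.
Lemma rcV x : rc x^-1 = (rc x)^-1.
Proof. exact: (fmorphV (real_complex R)). Qed.
Lemma rc0 : rc 0 = 0. Proof. by []. Qed.
Lemma rc1 : rc 1 = 1. Proof. by []. Qed.
Lemma rc_nat n : rc n%:R = n%:R.
Proof. exact: (rmorph_nat (real_complex R)). Qed.
Lemma rcI : injective rc.
Proof. exact: complexI. Qed.

Lemma nr_ge0 (V : normedModType C) (v : V) : 0 <= nr v.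
Proof. by rewrite -le_rc -nrE rc0. Qed.

Lemma nrD (V : normedModType C) (u v : V) : nr (u + v) <= nr u + nr v.
Proof. by rewrite -le_rc rcD -!nrE ler_normD. Qed.

Lemma nrN (V : normedModType C) (u : V) : nr (- u) = nr u.
Proof. by rewrite /nr normrN. Qed.

Lemma nrBC (V : normedModType C) (u v : V) : nr (u - v) = nr (v - u).
Proof. by rewrite /nr distrC. Qed.

Lemma nrB (V : normedModType C) (u v : V) : nr (u - v) <= nr u + nr v.
Proof. by rewrite -(nrN v) nrD. Qed.

Lemma nr_tri (V : normedModType C) (w u v : V) :
  nr (u - v) <= nr (u - w) + nr (w - v).
Proof. by rewrite -(subrKA w) nrD. Qed.

Lemma nrZ (V : normedModType C) (c : C) (v : V) : nr (c *: v) = nr c * nr v.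
Proof. by apply: rcI; rewrite rcM -!nrE normrZ. Qed.

Lemma nrM (c d : C) : nr (c * d) = nr c * nr d.
Proof. by apply: rcI; rewrite rcM -!nrE normrM. Qed.

Lemma nr0 (V : normedModType C) : nr (0 : V) = 0.
Proof. by rewrite /nr normr0. Qed.

Lemma nr_le0 (V : normedModType C) (v : V) : nr v <= 0 -> v = 0.
Proof.
move=> h; apply/eqP; rewrite -normr_eq0 nrE.
by have /eqP -> : nr v == 0 by rewrite eq_le h nr_ge0.
Qed.

Lemma nr_gt0 (V : normedModType C) (v : V) : v != 0 -> 0 < nr v.
Proof.
move=> v0; rewrite lt_neqAle nr_ge0 andbT; apply: contraNneq v0 => h.
by apply/eqP/nr_le0; rewrite -h.
Qed.

Lemma nr1 : nr (1 : C) = 1.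
Proof. by apply: rcI; rewrite -nrE normr1. Qed.

Lemma nrX (c : C) n : nr (c ^+ n) = nr c ^+ n.
Proof. by elim: n => [|n IH]; rewrite ?expr0 ?nr1 // !exprS nrM IH. Qed.

Lemma nrV (c : C) : nr c^-1 = (nr c)^-1.
Proof. by apply: rcI; rewrite rcV -!nrE normfV. Qed.

Lemma nr_rc x : nr (rc x) = `|x|.
Proof.
rewrite /nr /rc normc_def /= expr0n addr0 sqrtr_sqr.
by [].
Qed.

Lemma nr_nat n : nr (n%:R : C) = n%:R.
Proof. by rewrite -rc_nat nr_rc ger0_norm. Qed.

Lemma nr_sum (V : normedModType C) (I : Type) (r : seq I) (P : pred I)
    (F : I -> V) : nr (\sum_(i <- r | P i) F i) <= \sum_(i <- r | P i) nr (F i).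
Proof.
elim/big_ind2 : _ => [|u x v y ux vy|//]; first by rewrite nr0.
by rewrite (le_trans (nrD _ _)) // lerD.
Qed.

Lemma Re_le_nr (z : C) : `|complex.Re z| <= nr z.
Proof.
have : rc `|complex.Re z| <= rc (nr z) by rewrite -nrE; exact: normc_ge_Re.
by rewrite le_rc.
Qed.

Lemma nr_ReIm (z : C) : nr z <= `|complex.Re z| + `|complex.Im z|.
Proof.
rewrite {1}[z]complexE; apply: le_trans (nrD _ _) _.
rewrite [X in _ + X <= _]nrM !nr_rc.
suff -> : nr ('i%C : C) = 1 by rewrite mul1r.
by apply: rcI; rewrite -nrE normc_def /= expr0n expr1n add0r sqrtr1.
Qed.

Lemma Im_le_nr (z : C) : `|complex.Im z| <= nr z.
Proof.
rewrite -normrN -ReiNIm; apply: le_trans (Re_le_nr _) _.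
rewrite nrM.
suff -> : nr ('i%C : C) = 1 by rewrite mulr1.
by apply: rcI; rewrite -nrE normc_def /= expr0n expr1n add0r sqrtr1.
Qed.

(** The phase |z| / z rotates z onto its modulus; complex increments are thus estimated through a
    real part. *)
Lemma nr_Re_rot (z : C) : exists2 c : C, nr c <= 1 & complex.Re (c * z) = nr z.
Proof.
have [->|z0] := eqVneq z 0; first by exists 0; rewrite ?nr0 // mulr0.
exists (`|z| / z); last by rewrite divfK.
by rewrite nrM nrV nrE nr_rc ger0_norm ?nr_ge0 // divff // gt_eqF ?nr_gt0.
Qed.

(** Balls of a [Cplx R]-normed module have complex radii; from here on neighbourhoods are handled
    with real ones. *)
Lemma nbhs_nrP (V : normedModType C) (x : V) (B : set V) :
  nbhs x B <-> exists2 d, 0 < d & forall y, nr (y - x) < d -> B y.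
Proof.
split => [/nbhs_ballP[e /= e0 eB]|[d d0 dB]].
  exists (complex.Re e).
    by rewrite -ltcR RRe_real // gtr0_real.
  move=> y yx; apply: eB; rewrite -ball_normE /= nrE nrBC.
  by rewrite -(RRe_real (gtr0_real e0)) ltcR.
apply/nbhs_ballP; exists (rc d); first by rewrite /= -rc0 lt_rc.
by move=> y; rewrite -ball_normE /= nrE lt_rc nrBC => /dB.
Qed.

Lemma open_nrP (V : normedModType C) (A : set V) :
  open A <-> forall x, A x -> exists2 d, 0 < d & forall y, nr (y - x) < d -> A y.
Proof.
rewrite openE; split => h x Ax.
  by have /nbhs_nrP := h x Ax.
by apply/nbhs_nrP; exact: h.
Qed.

Lemma cvg_nrP (T : Type) (F : set_system T) (V : normedModType C) (f : T -> V) (l : V) :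
  Filter F ->
  f @ F --> l <-> forall e, 0 < e -> \forall x \near F, nr (f x - l) < e.
Proof.
move=> FF; split => h.
  move=> e e0; have := h [set y | nr (y - l) < e]; rewrite /= => {}h.
  by apply: h; apply/nbhs_nrP; exists e.
move=> B /nbhs_nrP[d d0 dB]; have := h d d0; rewrite /nbhs /=.
by apply: filterS => x; exact: dB.
Qed.

Lemma cvg_seqP (V : normedModType C) (f : nat -> V) (l : V) :
  f @ \oo --> l <->
  forall e, 0 < e -> exists N, forall n, (N <= n)%N -> nr (f n - l) < e.
Proof.
apply: iff_trans (cvg_nrP _ _ _) _; split => h e e0; have [N] := h e e0.
  by move=> _ hN; exists N.
by move=> hN; exists N.
Qed.

End RealNorm.

Section StrictDifferentiability.
Variable R : realType.
Local Notation C := (Cplx R).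
Implicit Types U V W : normedModType C.

(** Boundedness belongs to the predicate because the spaces are arbitrary normed modules, where a
    linear map may be discontinuous. A predicate on plain functions lets derivatives be given as
    explicit lambda terms. *)
Definition blin V W (L : V -> W) : Prop :=
  linear L /\ exists2 K, 0 < K & forall v, nr (L v) <= K * nr v.

(* Strict differentiability.  In finite dimension a holomorphic function is
   strictly differentiable at each point, and the converse holds without any
   continuity of the derivative to check. *)
Definition sdiff V W (f : V -> W) (a : V) (L : V -> W) : Prop :=
  blin L /\ forall e, 0 < e -> exists2 d, 0 < d & forall x y,
    nr (x - a) < d -> nr (y - a) < d ->
    nr (f x - f y - L (x - y)) <= e * nr (x - y).

(** The derivative being unique, it can be taken to be the directional derivative, and no linear map
    has to be carried along. *)
Definition sd V W (f : V -> W) (a : V) := sdiff f a (fun v => 'D_v f a).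

Lemma blin0 V W (L : V -> W) : blin L -> L 0 = 0.
Proof. by case=> lL _; have := lL (-1) 0 0; rewrite !scaleN1r oppr0 addr0 addNr. Qed.

Lemma blinZ V W (L : V -> W) c v : blin L -> L (c *: v) = c *: L v.
Proof. by move=> bL; have [lL _] := bL; rewrite -[c *: v]addr0 lL blin0 // addr0. Qed.

Lemma blinD V W (L : V -> W) u v : blin L -> L (u + v) = L u + L v.
Proof. by case=> lL _; rewrite -[u]scale1r lL !scale1r. Qed.

Lemma blinN V W (L : V -> W) v : blin L -> L (- v) = - L v.
Proof. by move=> bL; rewrite -scaleN1r blinZ // scaleN1r. Qed.

Lemma blinB V W (L : V -> W) u v : blin L -> L (u - v) = L u - L v.
Proof. by move=> bL; rewrite blinD // blinN. Qed.

Lemma blin_sum V W (L : V -> W) (I : Type) (r : seq I) (P : pred I) (F : I -> V) :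
  blin L -> L (\sum_(i <- r | P i) F i) = \sum_(i <- r | P i) L (F i).
Proof.
move=> bL; elim/big_ind2 : _ => [|u x v y|//]; first exact: blin0.
by move=> <- <-; rewrite blinD.
Qed.

Lemma blin_cst0 V W : blin (fun _ : V => 0 : W).
Proof.
split; first by move=> ? ? ?; rewrite scaler0 addr0.
by exists 1 => // v; rewrite nr0 mul1r nr_ge0.
Qed.

Lemma blin_id V : blin (fun v : V => v).
Proof. by split => //; exists 1 => // v; rewrite mul1r. Qed.

Lemma blin_comp U V W (L : U -> V) (M : V -> W) :
  blin L -> blin M -> blin (fun u => M (L u)).
Proof.
move=> [lL [K K0 hK]] [lM [K' K'0 hK']]; split.
  by move=> c u v; rewrite lL lM.
exists (K' * K); first exact: mulr_gt0.
move=> v; apply: le_trans (hK' _) _.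
by rewrite -mulrA ler_pM2l.
Qed.

Lemma blin_add V W (L M : V -> W) : blin L -> blin M -> blin (fun v => L v + M v).
Proof.
move=> [lL [K K0 hK]] [lM [K' K'0 hK']]; split.
  by move=> c u v; rewrite lL lM scalerDr addrACA.
exists (K + K'); first exact: addr_gt0.
by move=> v; apply: le_trans (nrD _ _) _; rewrite mulrDl lerD.
Qed.

Lemma blin_scale V W (L : V -> W) (c : C) : blin L -> blin (fun v => c *: L v).
Proof.
move=> [lL [K K0 hK]]; split.
  by move=> d u v; rewrite lL scalerDr !scalerA mulrC.
exists ((nr c + 1) * K).
  by rewrite mulr_gt0 // ltr_wpDl // nr_ge0.
move=> v; rewrite nrZ -mulrA ler_pM ?nr_ge0 //.
by rewrite lerDl.
Qed.

Lemma blin_scalel V W (L : V -> C) (w : W) : blin L -> blin (fun v => L v *: w).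
Proof.
move=> [lL [K K0 hK]]; split.
  by move=> d u v; rewrite lL scalerDl scalerA.
exists (K * (nr w + 1)).
  by rewrite mulr_gt0 // ltr_wpDl // nr_ge0.
move=> v; rewrite nrZ mulrAC ler_pM ?nr_ge0 //.
by rewrite lerDl.
Qed.

Lemma sdiff_cont V W (f : V -> W) a L : sdiff f a L ->
  exists K, 0 < K /\ exists2 d, 0 < d & forall x y, nr (x - a) < d -> nr (y - a) < d ->
    nr (f x - f y) <= K * nr (x - y).
Proof.
move=> [[lL [K K0 hK]] h]; have [d d0 hd] := h 1 ltr01.
exists (1 + K); split; first exact: addr_gt0.
exists d => // x y xa ya; rewrite -[f x - f y](subrK (L (x - y))).
apply: le_trans (nrD _ _) _; rewrite mulrDl lerD //.
exact: hd.
Qed.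

Lemma sdiff_continuous V W (f : V -> W) a L : sdiff f a L ->
  forall e, 0 < e -> exists2 d, 0 < d & forall x, nr (x - a) < d -> nr (f x - f a) < e.
Proof.
move=> /sdiff_cont[K [K0 [d d0 hd]]] e e0.
exists (Num.min d (e / K)); first by rewrite lt_min d0 divr_gt0.
move=> x; rewrite lt_min => /andP[xd xe].
apply: le_lt_trans (hd x a xd _) _; first by rewrite subrr nr0.
by rewrite mulrC -ltr_pdivlMr.
Qed.

Lemma sdiff_littleo V W (f : V -> W) a L : sdiff f a L ->
  exists g : {linear V -> W}, g = L :> (V -> W) /\ continuous g /\
  f \o shift a = cst (f a) + g +o_ 0 id.
Proof.
move=> [[lL [K K0 hK]] h].
pose LM := GRing.isLinear.Build _ _ _ _ _ lL.
pose g : {linear V -> W} := HB.pack L LM.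
exists g; split => //; split.
  move=> x; apply/cvg_nrP => e e0; apply/nbhs_nrP.
  exists (e / K); first by rewrite divr_gt0.
  move=> y yx; rewrite -linearB; apply: le_lt_trans (hK _) _.
  by rewrite mulrC -ltr_pdivlMr.
apply/eqaddoP => eps eps0; apply/nbhs_nrP.
have re0 : 0 < complex.Re eps by rewrite -ltcR RRe_real // gtr0_real.
have [d d0 hd] := h _ re0; exists d => // y; rewrite subr0 => yd /=.
rewrite !nrE -(RRe_real (gtr0_real eps0)) -[(_%:C)%C]/(rc _) -rcM le_rc.
have := hd (y + a) a; rewrite addrK subrr nr0 => /(_ yd d0).
by rewrite !fctE /= opprD addrA.
Qed.

Lemma sdiff_differentiable V W (f : V -> W) a L : sdiff f a L ->
  differentiable f a /\ 'd f a = L :> (V -> W).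
Proof.
move=> /sdiff_littleo [g [gL [cg hg]]].
have dE := diff_unique cg hg; rewrite -gL; split => //.
by apply/diff_locallyP; rewrite dE.
Qed.

Lemma sdiff_derive V W (f : V -> W) a L v : sdiff f a L -> 'D_v f a = L v.
Proof. by move=> /sdiff_differentiable[df <-]; rewrite deriveE. Qed.

Lemma sdiff_sd V W (f : V -> W) a L : sdiff f a L -> sd f a.
Proof.
move=> h; rewrite /sd.
by rewrite (_ : (fun v => _) = L) //; apply/funext => v; exact: sdiff_derive.
Qed.

Lemma sdiff_unique V W (f : V -> W) a L L' : sdiff f a L -> sdiff f a L' -> L =1 L'.
Proof. by move=> h h' v; rewrite -(sdiff_derive v h) (sdiff_derive v h'). Qed.

(** Both linear maps approximate the same increment of [f] between b and b + t v, [L] with error e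
    and [L'] with an arbitrarily small one; dividing by t gives the bound. This is how continuity of
    the derivative comes for free. *)
Lemma sdiff_near V W (f : V -> W) a (L : V -> W) e d b L' :
  (forall x y, nr (x - a) < d -> nr (y - a) < d ->
    nr (f x - f y - L (x - y)) <= e * nr (x - y)) ->
  linear L -> nr (b - a) < d -> sdiff f b L' ->
  forall v, nr (L' v - L v) <= e * nr v.
Proof.
move=> h lL ba [[lL' [K' K'0 hK']] h'] v.
have LZ c u : L (c *: u) = c *: L u.
  have L0 : L 0 = 0 by have := lL (-1) 0 0; rewrite !scaleN1r oppr0 addr0 addNr.
  by rewrite -[c *: u]addr0 lL L0 addr0.
have L'Z c u : L' (c *: u) = c *: L' u by rewrite blinZ //; split => //; exists K'.
apply/ler_addgt0Pr => _/posnumP[eps].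
have [->|v0] := eqVneq v 0.
  have := LZ 0 0; have := L'Z 0 0; rewrite !scale0r => -> ->.
  by rewrite subrr !nr0 mulr0 add0r.
have [d' d'0 hd'] := h' (eps%:num / nr v) (divr_gt0 [gt0 of eps%:num] (nr_gt0 v0)).
(* Half of the admissible length: b + t v then lies in the disc around b given by [L'] and in the
   disc around a given by [L]. *)
pose t := Num.min d' (d - nr (b - a)) / 2 / nr v.
have m0 : 0 < Num.min d' (d - nr (b - a)) by rewrite lt_min d'0 subr_gt0.
have t0 : 0 < t by rewrite !divr_gt0 // nr_gt0.
have tv : nr (rc t *: v) = Num.min d' (d - nr (b - a)) / 2.
  by rewrite nrZ nr_rc gtr0_norm // divfK // gt_eqF // nr_gt0.
have tlt : nr (rc t *: v) < Num.min d' (d - nr (b - a)).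
  by rewrite tv; lra.
move: (tlt); rewrite lt_min => /andP[td' td].
have := hd' (b + rc t *: v) b; rewrite subrr nr0 [b + _ - b]addrAC subrr add0r.
move=> /(_ td' d'0) H1.
have := h (b + rc t *: v) b; rewrite [b + _ - b]addrAC subrr add0r.
have -> : nr (b + rc t *: v - a) < d.
  rewrite addrAC; apply: le_lt_trans (nrD _ _) _; lra.
move=> /(_ isT ba) H2.
have : nr (rc t *: (L' v - L v)) <= (eps%:num / nr v + e) * nr (rc t *: v).
  rewrite mulrDl scalerBr -LZ -L'Z.
  set D := f (b + rc t *: v) - f b in H1 H2.
  rewrite (_ : _ - _ = (D - L (rc t *: v)) - (D - L' (rc t *: v))); last first.
    by rewrite opprB [in RHS]addrC addrA subrK.
  by apply: le_trans (nrB _ _) _; rewrite addrC lerD.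
rewrite !nrZ mulrCA ler_pM2l; last by rewrite nr_rc gtr0_norm.
by rewrite mulrDl divfK ?gt_eqF ?nr_gt0 // [e * _ + _]addrC.
Qed.

Lemma sd_holomorphic V W (f : V -> W) (A : set V) : open A ->
  (forall a, A a -> sd f a) -> holomorphic A f.
Proof.
move=> oA h a Aa; split; first by have [] := sdiff_differentiable (h a Aa).
move=> v; apply/cvg_nrP => e e0; apply/nbhs_nrP.
have [bL hL] := h a Aa.
have e1 : 0 < e / (nr v + 1) by rewrite divr_gt0 // ltr_wpDl // nr_ge0.
have [d d0 hd] := hL _ e1; have /open_nrP/(_ a Aa)[d' d'0 hA] := oA.
exists (Num.min d d'); first by rewrite lt_min d0.
move=> b; rewrite lt_min => /andP[bd bd'].
apply: le_lt_trans (sdiff_near hd (proj1 bL) bd (h b (hA _ bd')) v) _.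
by rewrite mulrAC ltr_pdivrMr ?ltr_wpDl ?nr_ge0 // ltr_pM2l // ltrDl.
Qed.

End StrictDifferentiability.

(** * Rules of strict differentiation *)

Section Calculus.
Variable R : realType.
Local Notation C := (Cplx R).
Local Notation rc := (@rc R).
Implicit Types U V W : normedModType C.

Lemma sdiff_ext V W (f g : V -> W) a L :
  (exists2 d, 0 < d & forall x, nr (x - a) < d -> f x = g x) ->
  sdiff f a L -> sdiff g a L.
Proof.
move=> [d d0 fg] [bL h]; split => // e e0.
have [d' d'0 h'] := h e e0; exists (Num.min d d'); first by rewrite lt_min d0.
move=> x y; rewrite !lt_min => /andP[xd xd'] /andP[yd yd'].
by rewrite -!fg //; exact: h'.
Qed.

Lemma sdiff_eq V W (f : V -> W) a L L' : sdiff f a L -> L =1 L' -> sdiff f a L'.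
Proof. by move=> h /funext <-. Qed.

Lemma sdiff_cst V W (c : W) (a : V) : sdiff (fun _ => c) a (fun _ => 0).
Proof.
split; first exact: blin_cst0.
move=> e e0; exists 1 => // x y _ _.
by rewrite !subr0 subrr nr0 mulr_ge0 ?nr_ge0 // ltW.
Qed.

Lemma sdiff_lin V W (L : V -> W) (a : V) : blin L -> sdiff L a L.
Proof.
move=> bL; split => // e e0; exists 1 => // x y _ _.
by rewrite blinB // subrr nr0 mulr_ge0 ?nr_ge0 // ltW.
Qed.

Lemma sdiff_id V (a : V) : sdiff (fun v => v) a (fun v => v).
Proof. exact/sdiff_lin/blin_id. Qed.

Lemma sdiffD V W (f g : V -> W) a L M : sdiff f a L -> sdiff g a M ->
  sdiff (fun x => f x + g x) a (fun v => L v + M v).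
Proof.
move=> [bL hf] [bM hg]; split; first exact: blin_add.
move=> e e0; have e2 : 0 < e / 2 by rewrite divr_gt0.
have [d d0 hd] := hf _ e2; have [d' d'0 hd'] := hg _ e2.
exists (Num.min d d'); first by rewrite lt_min d0.
move=> x y; rewrite !lt_min => /andP[xd xd'] /andP[yd yd'].
rewrite (_ : _ - _ = (f x - f y - L (x - y)) + (g x - g y - M (x - y))).
  apply: le_trans (nrD _ _) _.
  by rewrite [X in X * _]splitr mulrDl lerD // ?hd ?hd'.
by rewrite !opprD [X in X + _]addrACA [LHS]addrACA.
Qed.

Lemma sdiff_comp U V W (f : U -> V) (g : V -> W) a L M :
  sdiff f a L -> sdiff g (f a) M -> sdiff (fun x => g (f x)) a (fun v => M (L v)).
Proof.
move=> hf [bM hg]; have [K [K0 [d0 d00 hK]]] := sdiff_cont hf.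
have [bL hf'] := hf; split; first exact: blin_comp.
have [lM [K' K'0 hK']] := bM.
move=> e e0.
have e1 : 0 < e / 2 / K by rewrite !divr_gt0.
have e2 : 0 < e / 2 / K' by rewrite !divr_gt0.
have [d1 d10 h1] := hg _ e1; have [d2 d20 h2] := hf' _ e2.
have [d3 d30 h3] := sdiff_continuous hf d10.
exists (Num.min d0 (Num.min d2 d3)); first by rewrite !lt_min d00 d20.
move=> x y; rewrite !lt_min => /and3P[x0 x2 x3] /and3P[y0 y2 y3].
have -> : g (f x) - g (f y) - M (L (x - y)) =
    (g (f x) - g (f y) - M (f x - f y)) + M (f x - f y - L (x - y)).
  by rewrite [M (_ - L _)]blinB // addrA subrK.
apply: le_trans (nrD _ _) _; rewrite [X in X * _]splitr mulrDl lerD //.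
  apply: le_trans (h1 _ _ (h3 _ x3) (h3 _ y3)) _.
  by rewrite -mulrA ler_pM2l ?divr_gt0 // ler_pdivrMl // hK.
apply: le_trans (hK' _) _; apply: le_trans (ler_wpM2l (ltW K'0) (h2 _ _ x2 y2)) _.
by rewrite mulrA mulrCA divff ?mulr1 ?gt_eqF.
Qed.

Lemma sdiffZ V W (f : V -> W) a L (c : C) : sdiff f a L ->
  sdiff (fun x => c *: f x) a (fun v => c *: L v).
Proof.
move=> hf; apply: (sdiff_comp hf (@sdiff_lin _ _ (fun w => c *: w) _ _)).
exact: (blin_scale c (blin_id W)).
Qed.

Lemma sdiffN V W (f : V -> W) a L : sdiff f a L ->
  sdiff (fun x => - f x) a (fun v => - L v).
Proof.
move=> /(sdiffZ (-1)) h; apply: sdiff_ext (sdiff_eq h _) => [|v]; last exact: scaleN1r.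
by exists 1 => // x _; rewrite scaleN1r.
Qed.

Lemma sdiffB V W (f g : V -> W) a L M : sdiff f a L -> sdiff g a M ->
  sdiff (fun x => f x - g x) a (fun v => L v - M v).
Proof. by move=> hf hg; apply: sdiffD => //; exact: sdiffN. Qed.

Lemma sdiff_sum V W (I : Type) (r : seq I) (P : pred I) (f : I -> V -> W) a
    (L : I -> V -> W) : (forall i, P i -> sdiff (f i) a (L i)) ->
  sdiff (fun x => \sum_(i <- r | P i) f i x) a (fun v => \sum_(i <- r | P i) L i v).
Proof.
move=> h; elim: r => [|i r IH].
  apply: sdiff_ext (sdiff_eq (sdiff_cst 0 a) _) => [|v]; last by rewrite big_nil.
  by exists 1 => // x _; rewrite big_nil.
case Pi : (P i).
  apply: sdiff_ext (sdiff_eq (sdiffD (h i Pi) IH) _) => [|v]; last by rewrite big_cons Pi.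
  by exists 1 => // x _; rewrite big_cons Pi.
apply: sdiff_ext (sdiff_eq IH _) => [|v]; last by rewrite big_cons Pi.
by exists 1 => // x _; rewrite big_cons Pi.
Qed.

Lemma sdiffM V (f g : V -> C) a L M : sdiff f a L -> sdiff g a M ->
  sdiff (fun x => f x * g x) a (fun v => f a * M v + L v * g a).
Proof.
move=> hf hg; have [bL hf'] := hf; have [bM hg'] := hg; split.
  apply: blin_add; first exact: (blin_scale (f a) bM).
  exact: (blin_scalel (g a) bL).
have [_ [K K0 hK]] := bL; have [_ [K' K'0 hK']] := bM.
move=> e e0.
pose B := nr (f a) + 1; pose B' := nr (g a) + 1.
have B0 : 0 < B by rewrite ltr_wpDl ?nr_ge0.
have B'0 : 0 < B' by rewrite ltr_wpDl ?nr_ge0.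
have e4 : 0 < e / 4 by rewrite divr_gt0.
have [d1 d10 h1] := hf' _ (divr_gt0 e4 B'0).
have [d2 d20 h2] := hg' _ (divr_gt0 e4 B0).
have [d3 d30 h3] := sdiff_continuous hf (divr_gt0 e4 K'0).
have [d4 d40 h4] := sdiff_continuous hg (divr_gt0 e4 K0).
have [d5 d50 h5] := sdiff_continuous hf ltr01.
have [d6 d60 h6] := sdiff_continuous hg ltr01.
exists (Num.min d1 (Num.min d2 (Num.min d3 (Num.min d4 (Num.min d5 d6))))).
  by rewrite !lt_min d10 d20 d30 d40 d50.
move=> x y; rewrite !lt_min => /and5P[x1 x2 x3 x4 /andP[x5 x6]] /and5P[y1 y2 y3 y4 /andP[y5 y6]].
have fB : nr (f x) <= B.
  rewrite -[f x](subrK (f a)); apply: le_trans (nrD _ _) _.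
  by rewrite addrC lerD2l ltW // h5.
have gB : nr (g y) <= B'.
  rewrite -[g y](subrK (g a)); apply: le_trans (nrD _ _) _.
  by rewrite addrC lerD2l ltW // h6.
set F := f x - f y - L (x - y); set G := g x - g y - M (x - y).
(* The increment of the product leaves four error terms, each allotted e / 4. *)
have -> : f x * g x - f y * g y - (f a * M (x - y) + L (x - y) * g a) =
    f x * G + (f x - f a) * M (x - y) + (F * g y + (g y - g a) * L (x - y)).
  by rewrite /F /G; ring.
have n1 : nr (f x * G) <= e / 4 * nr (x - y).
  rewrite nrM; apply: le_trans (ler_pM (nr_ge0 _) (nr_ge0 _) fB (h2 _ _ x2 y2)) _.
  by rewrite mulrA mulrCA divff ?mulr1 // gt_eqF.
have n2 : nr ((f x - f a) * M (x - y)) <= e / 4 * nr (x - y).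
  rewrite nrM; apply: le_trans (ler_pM (nr_ge0 _) (nr_ge0 _) (ltW (h3 _ x3)) (hK' _)) _.
  by rewrite mulrA divfK // gt_eqF.
have n3 : nr (F * g y) <= e / 4 * nr (x - y).
  rewrite nrM; apply: le_trans (ler_pM (nr_ge0 _) (nr_ge0 _) (h1 _ _ x1 y1) gB) _.
  by rewrite mulrAC divfK // gt_eqF.
have n4 : nr ((g y - g a) * L (x - y)) <= e / 4 * nr (x - y).
  rewrite nrM; apply: le_trans (ler_pM (nr_ge0 _) (nr_ge0 _) (ltW (h4 _ y4)) (hK _)) _.
  by rewrite mulrA divfK // gt_eqF.
apply: le_trans (nrD _ _) _; apply: le_trans (lerD (nrD _ _) (nrD _ _)) _.
lra.
Qed.

Lemma sdiff_inv (z : C) : z != 0 -> sdiff (fun x : C => x^-1) z (fun h => - (h / z ^+ 2)).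
Proof.
move=> z0; have nz0 := nr_gt0 z0; split.
  have h := blin_scale (- (z ^+ 2)^-1) (blin_id C).
  suff <- : (fun v => - (z ^+ 2)^-1 *: v) = (fun h : C => - (h / z ^+ 2)) by [].
  by apply/funext => v; rewrite /GRing.scale /= mulNr mulrC.
(* In the half disc |y| <= 3/2 |z| and the denominator is at least |z|^4 / 4; the two terms of the
   numerator give (3/20 + 1/10) e |z|^4 = e |z|^4 / 4. *)
move=> e e0; exists (Num.min (nr z / 2) (e * nr z ^+ 3 / 10)).
  by rewrite lt_min !divr_gt0 // mulr_gt0 // exprn_gt0.
move=> x y; rewrite !lt_min => /andP[x1 x2] /andP[y1 y2].
have big u : nr (u - z) < nr z / 2 -> nr z / 2 < nr u.
  move=> h; have := nrB u (u - z); rewrite opprB addrCA subrr addr0; lra.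
have xb := big _ x1; have yb := big _ y1.
have h2 : 0 < nr z / 2 by rewrite divr_gt0.
have x0 : x != 0 by apply/eqP => x0; move: xb; rewrite x0 nr0; lra.
have y0 : y != 0 by apply/eqP => y0; move: yb; rewrite y0 nr0; lra.
have -> : x^-1 - y^-1 - (- ((x - y) / z ^+ 2)) =
    (x - y) * (((x - z) * y + z * (y - z)) / (z ^+ 2 * (x * y))).
  by field; rewrite x0 y0 z0.
rewrite nrM mulrC ler_wpM2r ?nr_ge0 //.
rewrite nrM nrV ler_pdivrMr; last first.
  by rewrite nr_gt0 // !mulf_neq0 ?expf_neq0.
have hy : nr y <= 3 / 2 * nr z.
  by rewrite -[y](subrK z); apply: le_trans (nrD _ _) _; lra.
have hden : nr z ^+ 4 / 4 <= nr (z ^+ 2 * (x * y)).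
  rewrite nrM nrX nrM (_ : _ / 4 = nr z ^+ 2 * (nr z / 2 * (nr z / 2))); last by field.
  by rewrite ler_wpM2l ?exprn_ge0 ?nr_ge0 // ler_pM ?(ltW h2) // ltW.
have d0 : 0 < e * nr z ^+ 3 / 10 by rewrite divr_gt0 // mulr_gt0 // exprn_gt0.
apply: le_trans (nrD _ _) _; rewrite (nrM (x - z)) (nrM z).
have A1 : nr (x - z) * nr y <= e * nr z ^+ 3 / 10 * (3 / 2 * nr z).
  by rewrite ler_pM ?nr_ge0 // ltW.
have A2 : nr z * nr (y - z) <= nr z * (e * nr z ^+ 3 / 10).
  by rewrite ler_pM2l // ltW.
have A3 : e * (nr z ^+ 4 / 4) <= e * nr (z ^+ 2 * (x * y)) by rewrite ler_pM2l.
apply: le_trans (lerD A1 A2) (le_trans _ A3).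
have -> : e * nr z ^+ 3 / 10 * (3 / 2 * nr z) + nr z * (e * nr z ^+ 3 / 10) =
  e * (nr z ^+ 4 / 4) by field.
by [].
Qed.

Lemma nr_pair V W (v : V) (w : W) : nr ((v, w) : (V * W)%type) = Num.max (nr v) (nr w).
Proof.
apply: rcI; rewrite -nrE /rc.
have -> : `|(v, w)| = Num.max (`|v| : C) `|w| by [].
rewrite !nrE; have [h|h] := leP (nr v) (nr w).
  by rewrite max_r // le_rc.
by rewrite max_l // le_rc ltW.
Qed.

Lemma nr_pairl V W (z : (V * W)%type) : nr z.1 <= nr z.
Proof. by case: z => v w; rewrite nr_pair le_max lexx. Qed.

Lemma nr_pairr V W (z : (V * W)%type) : nr z.2 <= nr z.
Proof. by case: z => v w; rewrite nr_pair le_max lexx orbT. Qed.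

Lemma nr_rowP m (v : 'rV[C]_m) e : 0 <= e ->
  (forall j, nr (v 0 j) <= e) -> nr v <= e.
Proof.
move=> e0 h; have [->|v0] := eqVneq v 0; first by rewrite nr0.
have /mx_norm_neq0[[i j] hij] : mx_norm v != 0.
  by apply: contraNneq v0 => /mx_norm_eq0 ->.
have -> : nr v = nr (v i j) by rewrite /nr -hij.
by rewrite ord1.
Qed.

Lemma nr_coord m (v : 'rV[C]_m) j : nr (v 0 j) <= nr v.
Proof.
rewrite -le_rc -!nrE [leRHS]/Num.norm /= mx_normE.
by rewrite -[leLHS]nngE num_le (le_bigmax _ (fun i => `|v i.1 i.2|%:nng) (0, j)).
Qed.

Lemma blin_coord m j : blin (fun v : 'rV[C]_m => v 0 j).
Proof.
split; first by move=> c u v; rewrite !mxE.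
by exists 1 => // v; rewrite mul1r nr_coord.
Qed.

Lemma sdiff_coord V m (f : V -> 'rV[C]_m) a L j : sdiff f a L ->
  sdiff (fun v => f v 0 j) a (fun v => L v 0 j).
Proof.
by move=> h; exact: (sdiff_comp h (sdiff_lin _ (blin_coord j))).
Qed.

(** The smallest of finitely many radii serves them all; the initial value 1 of the minimum keeps it
    positive when [I] is empty. *)
Lemma finite_min (I : finType) (P : I -> R -> Prop) :
  (forall i e e', e' <= e -> P i e -> P i e') ->
  (forall i, exists2 e, 0 < e & P i e) -> exists2 e, 0 < e & forall i, P i e.
Proof.
move=> mono h.
have [d hd] := choice (fun i => let: ex_intro2 e e0 he := h i in ex_intro (fun e => 0 < e /\ P i e) e (conj e0 he)).
exists (\big[Num.min/1]_i d i).
  by elim/big_ind : _ => // [x y x0 y0|i _]; [rewrite lt_min x0|case: (hd i)].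
move=> i; apply: (mono i (d i)); last by case: (hd i).
by apply: bigmin_le_cond.
Qed.

Lemma blin_row V m (L : V -> 'rV[C]_m) :
  (forall j, blin (fun v => L v 0 j)) -> blin L.
Proof.
move=> bL; split.
  move=> c u v; apply/rowP => j; rewrite !mxE.
  by have [-> _] := bL j.
have h j : exists K, 0 < K /\ forall v, nr (L v 0 j) <= K * nr v.
  by have [_ [K K0 hK]] := bL j; exists K.
have [K hK] := choice h.
have s0 : 0 <= \sum_j K j by rewrite sumr_ge0 // => j _; rewrite ltW //; case: (hK j).
exists (1 + \sum_j K j); first by rewrite ltr_pwDl.
move=> v; apply: nr_rowP => [|j]; first by rewrite mulr_ge0 ?nr_ge0 // addr_ge0.
case: (hK j) => K0 hv; apply: le_trans (hv v) _.
rewrite ler_wpM2r ?nr_ge0 // (bigD1 j) //= addrCA lerDl addr_ge0 // sumr_ge0 // => i _.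
by rewrite ltW //; case: (hK i).
Qed.

Lemma sdiff_row V m (f : V -> 'rV[C]_m) a (L : V -> 'rV[C]_m) :
  (forall j, sdiff (fun v => f v 0 j) a (fun v => L v 0 j)) -> sdiff f a L.
Proof.
move=> h; split; first by apply: blin_row => j; case: (h j).
move=> e e0.
have [|j|d d0 hd] := @finite_min 'I_m (fun j d => forall x y,
    nr (x - a) < d -> nr (y - a) < d ->
    nr (f x 0 j - f y 0 j - L (x - y) 0 j) <= e * nr (x - y)).
- by move=> j d d' dd' hd x y xd yd; apply: hd; exact: lt_le_trans dd'.
- by have [_ /(_ e e0)] := h j.
exists d => // x y xd yd; apply: nr_rowP => [|j]; first by rewrite mulr_ge0 ?nr_ge0 ?ltW.
by rewrite !mxE; exact: hd.
Qed.

Lemma blin_pair U V W (L : U -> V) (M : U -> W) : blin L -> blin M ->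
  blin (fun u => (L u, M u) : (V * W)%type).
Proof.
move=> [lL [K K0 hK]] [lM [K' K'0 hK']]; split.
  by move=> c u v; rewrite lL lM.
exists (Num.max K K'); first by rewrite lt_max K0.
move=> v; rewrite nr_pair ge_max; apply/andP; split.
  by apply: le_trans (hK v) _; rewrite ler_wpM2r ?nr_ge0 // le_max lexx.
by apply: le_trans (hK' v) _; rewrite ler_wpM2r ?nr_ge0 // le_max lexx orbT.
Qed.

Lemma sdiff_pair U V W (f : U -> V) (g : U -> W) a L M :
  sdiff f a L -> sdiff g a M ->
  sdiff (fun u => (f u, g u) : (V * W)%type) a (fun u => (L u, M u)).
Proof.
move=> [bL hf] [bM hg]; split; first exact: blin_pair.
move=> e e0; have [d d0 hd] := hf _ e0; have [d' d'0 hd'] := hg _ e0.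
exists (Num.min d d'); first by rewrite lt_min d0.
move=> x y; rewrite !lt_min => /andP[xd xd'] /andP[yd yd'].
rewrite (_ : _ - _ = (f x - f y - L (x - y), g x - g y - M (x - y))) //.
by rewrite nr_pair ge_max hd ?hd'.
Qed.

Lemma blin_fst V W : blin (fun z : (V * W)%type => z.1).
Proof. by split => //; exists 1 => // z; rewrite mul1r nr_pairl. Qed.

Lemma blin_snd V W : blin (fun z : (V * W)%type => z.2).
Proof. by split => //; exists 1 => // z; rewrite mul1r nr_pairr. Qed.

End Calculus.

(** * Mean value inequality, and strict differentiability of holomorphic functions *)

Section MeanValue.
Variable R : realType.
Local Notation C := (Cplx R).
Local Notation rc := (@rc R).

Lemma is_derive_epsP (f : R -> R) (x l : R) :
  is_derive x 1 f l <->
  forall e, 0 < e -> exists2 d, 0 < d & forall y, `|y - x| < d ->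
    `|f y - f x - (y - x) * l| <= e * `|y - x|.
Proof.
split => [[dv dl]|h].
  have cv : (fun h => h^-1 *: (f (h *: 1 + x) - f x)) @ 0^' --> l.
    by rewrite -dl; exact: dv.
  move=> e e0; move/cvgrPdist_le : cv => /(_ e e0) /nbhs_ballP[d /= d0 hd].
  exists d => // y yd; have [->|yx] := eqVneq y x.
    by rewrite !subrr mul0r subr0 normr0 mulr0.
  have yx0 : y - x != 0 by rewrite subr_eq0.
  have := hd (y - x); rewrite /ball /= sub0r normrN => /(_ yd yx0).
  rewrite [_ *: 1]mulr1 subrK => hh.
  rewrite -ler_pdivrMr ?normr_gt0 // -normfV -normrM mulrC mulrBr mulrA.
  by rewrite mulVf // mul1r distrC.
have cv : (fun h => h^-1 *: (f (h *: 1 + x) - f x)) @ 0^' --> l.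
  apply/cvgrPdist_le => e e0; have [d d0 hd] := h e e0.
  apply/nbhs_ballP; exists d => //= k; rewrite /ball /= sub0r normrN => kd k0.
  have := hd (k + x); rewrite addrK => /(_ kd).
  rewrite -ler_pdivrMr ?normr_gt0 // -normfV -normrM mulrC mulrBr mulrA.
  by rewrite mulVf // mul1r distrC [k *: 1]mulr1.
apply: DeriveDef; first by apply/cvg_ex; exists l.
exact: cvg_lim cv.
Qed.

(** Differentiability along a ray: the parameter is real and the values are complex, so increments
    of the parameter enter through [rc]. *)
Definition rderiv (g : R -> C) (x : R) (l : C) := forall e, 0 < e ->
  exists2 d, 0 < d & forall y, `|y - x| < d ->
    nr (g y - g x - rc (y - x) * l) <= e * `|y - x|.

Lemma rderivB (g h : R -> C) x l m : rderiv g x l -> rderiv h x m ->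
  rderiv (fun y => g y - h y) x (l - m).
Proof.
move=> hg hh e e0; have e2 : 0 < e / 2 by rewrite divr_gt0.
have [d d0 hd] := hg _ e2; have [d' d'0 hd'] := hh _ e2.
exists (Num.min d d'); first by rewrite lt_min d0.
move=> y; rewrite lt_min => /andP[yd yd'].
have -> : g y - h y - (g x - h x) - rc (y - x) * (l - m) =
  (g y - g x - rc (y - x) * l) - (h y - h x - rc (y - x) * m) by ring.
apply: le_trans (nrB _ _) _.
by rewrite [X in _ <= X * _]splitr mulrDl lerD ?hd ?hd'.
Qed.

(** After a rotation that makes g b - g a real and nonnegative, Re (c g) - h has nonpositive
    derivative. Integrals are thereby avoided: a bound [h'] on the derivative is integrated by
    exhibiting its primitive [h]. *)
Lemma mean_value (g g' : R -> C) (h h' : R -> R) a b : a <= b ->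
  (forall x, a <= x <= b -> rderiv g x (g' x)) ->
  (forall x, a <= x <= b -> is_derive x 1 h (h' x)) ->
  (forall x, a <= x <= b -> nr (g' x) <= h' x) ->
  nr (g b - g a) <= h b - h a.
Proof.
move=> ab hg hh hle.
have [c c1 hc] := nr_Re_rot (g b - g a).
pose phi x := complex.Re (c * g x) - h x.
have dphi x : a <= x <= b -> is_derive x 1 phi (complex.Re (c * g' x) - h' x).
  move=> xab; apply/is_derive_epsP => e e0.
  have e2 : 0 < e / 2 by rewrite divr_gt0.
  have [d d0 hd] := hg x xab _ e2.
  have /is_derive_epsP /(_ _ e2)[d' d'0 hd'] := hh x xab.
  exists (Num.min d d'); first by rewrite lt_min d0.
  move=> y; rewrite lt_min => /andP[yd yd'].
  have -> : phi y - phi x - (y - x) * (complex.Re (c * g' x) - h' x) =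
      complex.Re (c * (g y - g x - rc (y - x) * g' x)) - (h y - h x - (y - x) * h' x).
    rewrite /phi /rc.
    case: (c) (g y) (g x) (g' x) => [c1' c2] [a1 a2] [b1 b2] [l1 l2] /=.
    by ring.
  have h1 : `|complex.Re (c * (g y - g x - rc (y - x) * g' x))| <= e / 2 * `|y - x|.
    apply: le_trans (Re_le_nr _) _; rewrite nrM; apply: le_trans (hd y yd).
    by rewrite -[leRHS]mul1r ler_wpM2r ?nr_ge0.
  apply: le_trans (ler_normB _ _) _; apply: le_trans (lerD h1 (hd' y yd')) _; lra.
have : phi b <= phi a.
  apply: (@ler0_derive1_nincr _ phi a b) => //.
  - by move=> x /[!in_itv]/= /andP[/ltW ax /ltW xb]; have [] := dphi x; rewrite ?ax.
  - move=> x /[!in_itv]/= /andP[/ltW ax /ltW xb]; rewrite derive1E.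
    have xab : a <= x <= b by rewrite ax.
    have [_ ->] := dphi x xab; rewrite subr_le0.
    apply: le_trans (ler_norm _) _; apply: le_trans (Re_le_nr _) _; rewrite nrM.
    apply: le_trans (hle x xab); by rewrite -[leRHS]mul1r ler_wpM2r ?nr_ge0.
  - apply: derivable_within_continuous => x /[!in_itv]/= xab.
    by have [] := dphi x xab.
rewrite /phi -hc mulrBr raddfB /=; lra.
Qed.

Implicit Types V W : normedModType C.

Lemma mean_value_segment V (f : V -> C) (D : V -> C) (x y : V) K :
  (forall t, 0 <= t <= 1 -> rderiv (fun t => f (y + rc t *: (x - y))) t
     (D (y + rc t *: (x - y)))) ->
  (forall t, 0 <= t <= 1 -> nr (D (y + rc t *: (x - y))) <= K) ->
  nr (f x - f y) <= K.
Proof.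
move=> hd hK.
have := @mean_value (fun t => f (y + rc t *: (x - y))) (fun t => D (y + rc t *: (x - y)))
  (fun t => K * t) (fun _ => K) 0 1 ler01 hd.
rewrite scale0r addr0 scale1r (addrC y) subrK !mulr0 mulr1 subr0; apply => //.
move=> t _; apply/is_derive_epsP => e e0; exists 1 => // z _.
have -> : K * z - K * t - (z - t) * K = 0 by ring.
by rewrite normr0 mulr_ge0 // ltW.
Qed.

Lemma sdiff_rderiv V (f : V -> C) (z w : V) L t : sdiff f (z + rc t *: w) L ->
  rderiv (fun t => f (z + rc t *: w)) t (L w).
Proof.
move=> [bL h] e e0.
have w1 : 0 < nr w + 1 by rewrite ltr_wpDl // nr_ge0.
have [d d0 hd] := h _ (divr_gt0 e0 w1).
exists (d / (nr w + 1)); first exact: divr_gt0.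
move=> s st.
have E : z + rc s *: w - (z + rc t *: w) = rc (s - t) *: w.
  by rewrite opprD addrACA subrr add0r -scalerBl -rcB.
have := hd (z + rc s *: w) (z + rc t *: w); rewrite subrr nr0 E => /(_ _ d0).
rewrite (blinZ _ _ bL) nrZ nr_rc => h1.
have st' : `|s - t| * (nr w + 1) < d by rewrite -ltr_pdivlMr.
apply: le_trans (h1 _) _.
  by apply: le_lt_trans st'; rewrite ler_wpM2l // lerDl.
rewrite mulrCA -!mulrA mulrC ler_wpM2r //.
by rewrite ler_piMr ?(ltW e0) // mulrC ler_pdivrMr // mul1r lerDl.
Qed.

Lemma convex_ball V (a x y : V) d t : 0 <= t <= 1 -> nr (x - a) < d -> nr (y - a) < d ->
  nr (y + rc t *: (x - y) - a) < d.
Proof.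
move=> /andP[t0 t1] xd yd.
have -> : y + rc t *: (x - y) - a = rc t *: (x - a) + rc (1 - t) *: (y - a).
  rewrite rcB rc1 scalerBl scale1r {1}(_ : x - y = (x - a) - (y - a)).
    by rewrite scalerBr addrAC addrCA.
  by rewrite opprB addrA subrK.
apply: le_lt_trans (nrD _ _) _; rewrite !nrZ !nr_rc !ger0_norm ?subr_ge0 //.
have [->|t0'] := eqVneq t 0; first by rewrite mul0r add0r subr0 mul1r.
have : t * nr (x - a) < t * d by rewrite ltr_pM2l // lt_neqAle eq_sym t0'.
have : (1 - t) * nr (y - a) <= (1 - t) * d by rewrite ler_wpM2l ?subr_ge0 // ltW.
lra.
Qed.

Lemma mean_value_sdiff V (f : V -> C) (x y : V) K :
  (forall t, 0 <= t <= 1 -> sd f (y + rc t *: (x - y))) ->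
  (forall t, 0 <= t <= 1 -> nr ('D_(x - y) f (y + rc t *: (x - y))) <= K) ->
  nr (f x - f y) <= K.
Proof.
move=> h hK; apply: (@mean_value_segment _ f (fun z => 'D_(x - y) f z)) => // t t01.
exact: (sdiff_rderiv (h t t01)).
Qed.

Lemma differentiable_rderiv V (f : V -> C) (z w : V) t : differentiable f (z + rc t *: w) ->
  rderiv (fun t => f (z + rc t *: w)) t ('d f (z + rc t *: w) w).
Proof.
set b := z + rc t *: w => df e e0.
have /diff_locallyP[_ /eqaddoP hd] := df.
have w1 : 0 < nr w + 1 by rewrite ltr_wpDl // nr_ge0.
have e1 : 0 < rc (e / (nr w + 1)) by rewrite -rc0 lt_rc divr_gt0.
have /nbhs_nrP[d d0 {}hd] := hd _ e1.
exists (d / (nr w + 1)); first exact: divr_gt0.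
move=> s st.
have E : z + rc s *: w = rc (s - t) *: w + b.
  by rewrite /b rcB scalerBl [_ - _ + _]addrC addrA [z + _ + _]addrAC addrK.
have st' : `|s - t| * (nr w + 1) < d by rewrite -ltr_pdivlMr.
have /= := hd (rc (s - t) *: w).
rewrite !nrE -rcM le_rc !fctE /= linearZ subr0 !nrZ nr_rc -E => h1.
have {}h1 := h1 (le_lt_trans (ler_wpM2l (normr_ge0 _) _) st').
have {h1} := h1; rewrite lerDl ler01 => /(_ isT) h1.
rewrite [X in nr X](_ : _ = f (z + rc s *: w) - (f b + rc (s - t) *: 'd f b w)); last first.
  by rewrite opprD addrA.
apply: le_trans h1 _.
rewrite mulrCA -!mulrA mulrC ler_wpM2r //.
by rewrite ler_piMr ?(ltW e0) // mulrC ler_pdivrMr // mul1r lerDl.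
Qed.

Lemma row_sum_coord m (v : 'rV[C]_m) : v = \sum_j v 0 j *: delta_mx 0 j.
Proof. exact: row_sum_delta. Qed.

Lemma diff_rowE m (f : 'rV[C]_m -> C) (a v : 'rV[C]_m) : differentiable f a ->
  'd f a v = \sum_j v 0 j * 'D_(delta_mx 0 j) f a.
Proof.
move=> df; rewrite {1}[v]row_sum_coord linear_sum; apply: eq_bigr => j _.
by rewrite linearZ deriveE.
Qed.

(** Continuity of the finitely many partial derivatives controls the differential of f - L near a,
    and the mean value inequality on segments turns this into a strict estimate. *)
Lemma holomorphic_sd m (f : 'rV[C]_m -> C) (A : set 'rV[C]_m) : open A ->
  holomorphic A f -> forall a, A a -> sd f a.
Proof.
move=> oA hf a Aa.
have [dfa _] := hf a Aa.
pose L := ('d f a : _ -> _).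
have LE v : L v = \sum_j v 0 j * 'D_(delta_mx 0 j) f a.
  exact: diff_rowE.
have bL : blin L.
  split; first by move=> c u v; rewrite /L linearP.
  exists (1 + \sum_j nr ('D_(delta_mx 0 j) f a)).
    by rewrite ltr_pwDl // sumr_ge0 // => j _; exact: nr_ge0.
  move=> v; rewrite LE; apply: le_trans (nr_sum _ _ _) _.
  rewrite mulrDl mul1r mulr_suml ler_wpDl ?nr_ge0 // ler_sum // => j _.
  by rewrite nrM mulrC ler_wpM2l ?nr_ge0 // nr_coord.
suff h : sdiff f a L by exact: sdiff_sd h.
split => // e e0.
(* The m partial derivatives add up to e m / (m + 1), and m + 1 is nonzero even for m = 0. *)
pose e' := e / (m%:R + 1).
have m1 : 0 < m%:R + 1 :> R by rewrite ltr_wpDl.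
have e'0 : 0 < e' by rewrite divr_gt0.
have [|j|d d0 hd] := @finite_min R 'I_m (fun j d => forall z, nr (z - a) < d ->
    nr ('D_(delta_mx 0 j) f z - 'D_(delta_mx 0 j) f a) <= e').
- by move=> j d d' dd' h z zd; apply: h; exact: lt_le_trans dd'.
- have [_ /(_ (delta_mx 0 j))] := hf a Aa.
  move=> /cvg_nrP /(_ e' e'0) /nbhs_nrP[d d0 hd].
  by exists d => // z zd; rewrite ltW // hd.
have /open_nrP/(_ a Aa)[d' d'0 hA] := oA.
exists (Num.min d d'); first by rewrite lt_min d0.
move=> x y; rewrite !lt_min => /andP[xd xd'] /andP[yd yd'].
have -> : f x - f y - L (x - y) = (f x - L x) - (f y - L y).
  by rewrite (blinB _ _ bL); ring.
apply: (@mean_value_segment _ (fun z => f z - L z) (fun z => 'd f z (x - y) - L (x - y))).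
  move=> t t01; apply: rderivB.
    by apply: differentiable_rderiv; have [] := hf _ (hA _ (convex_ball t01 xd' yd')).
  exact: (sdiff_rderiv (sdiff_lin _ bL)).
move=> t t01; set z := y + _.
have Az : A z by exact: hA (convex_ball t01 xd' yd').
have zd : nr (z - a) < d by exact: convex_ball.
have -> : 'd f z (x - y) = \sum_j (x - y) 0 j * 'D_(delta_mx 0 j) f z.
  by apply: diff_rowE; have [] := hf z Az.
rewrite LE -sumrB; apply: le_trans (nr_sum _ _ _) _.
apply: (@le_trans _ _ (\sum_(j < m) (nr (x - y) * e'))).
  by apply: ler_sum => j _; rewrite -mulrBr nrM ler_pM ?nr_ge0 ?nr_coord // hd.
rewrite sumr_const card_ord -[_ *+ m]mulr_natr -mulrA mulrC.
rewrite ler_wpM2r ?nr_ge0 // /e' mulrAC ler_pdivrMr //.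
by rewrite ler_pM2l // lerDl.
Qed.

End MeanValue.

(** * The complex exponential *)

Section ComplexExponential.
Variable R : realType.
Local Notation C := (Cplx R).
Local Notation rc := (@rc R).

Lemma cexpD (z w : C) : cexp (z + w) = cexp z * cexp w.
Proof.
rewrite /cexp; case: z w => [a b] [c d] /=.
rewrite expRD cosD sinD; apply/eqP; rewrite eq_complex /=.
by apply/andP; split; apply/eqP; ring.
Qed.

Lemma cexp0 : cexp (0 : C) = 1.
Proof. by rewrite /cexp /= expR0 cos0 sin0 mul1r. Qed.

Lemma cexp_sum n (z : C) : cexp (n%:R * z) = cexp z ^+ n.
Proof.
elim: n => [|n IH]; first by rewrite mul0r cexp0 expr0.
by rewrite -natr1 mulrDl mul1r cexpD IH exprSr.
Qed.

Lemma nr_cexp (z : C) : nr (cexp z) = expR (complex.Re z).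
Proof.
rewrite /cexp nrM -[(_%:C)%C]/(rc _) nr_rc gtr0_norm ?expR_gt0 //.
suff -> : nr (cos (complex.Im z) +i* sin (complex.Im z) : C)%C = 1 by rewrite mulr1.
by apply: rcI; rewrite -nrE normc_def /= cos2Dsin2 sqrtr1.
Qed.

Lemma cexp_neq0 (z : C) : cexp z != 0.
Proof.
by apply/eqP => h; have := nr_cexp z; rewrite h nr0 => /esym/eqP; rewrite gt_eqF ?expR_gt0.
Qed.

(** The first-order expansions at 0 of the real exponential, cosine and sine combine; with e / 10
    allotted to each, the errors sum to 7/10 e |h|. *)
Lemma cexp_littleo e : 0 < e -> exists2 d, 0 < d & forall h : C, nr h < d ->
  nr (cexp h - 1 - h) <= e * nr h.
Proof.
move=> e0; have e5 : 0 < e / 10 by rewrite divr_gt0.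
have /is_derive_epsP/(_ _ e5)[d1 d10 h1] := is_derive_expR (0 : R).
have /is_derive_epsP/(_ _ e5)[d2 d20 h2] := is_derive_cos (0 : R).
have /is_derive_epsP/(_ _ e5)[d3 d30 h3] := is_derive_sin (0 : R).
exists (Num.min d1 (Num.min d2 (Num.min d3 (Num.min 1 (e / 10))))).
  by rewrite !lt_min d10 d20 d30 ltr01 divr_gt0.
move=> h; rewrite !lt_min => /and5P[n1 n2 n3 n4 n5].
have ha := Re_le_nr h; have hb := Im_le_nr h.
move: n1 n2 n3 n4 n5 ha hb; set n := nr h => n1 n2 n3 n4 n5.
case Eh : h => [a b] /= ha hb.
have n0 : 0 <= n := nr_ge0 h.
have := h1 a; rewrite subr0 expR0 mulr1 => /(_ (le_lt_trans ha n1)) H1.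
have := h2 b; rewrite subr0 cos0 sin0 oppr0 mulr0 subr0 => /(_ (le_lt_trans hb n2)) H2.
have := h3 b; rewrite subr0 cos0 sin0 mulr1 subr0 => /(_ (le_lt_trans hb n3)) H3.
have K1 : `|expR a - 1 - a| <= e / 10 * n.
  by apply: le_trans H1 _; rewrite ler_pM2l.
have K2 : `|cos b - 1| <= e / 10 * n.
  by apply: le_trans H2 _; rewrite ler_pM2l.
have K3 : `|sin b - b| <= e / 10 * n.
  by apply: le_trans H3 _; rewrite ler_pM2l.
have c1 : `|cos b| <= 1 by rewrite ler_norml cos_geN1 cos_le1.
have s1 : `|sin b| <= 1 by rewrite ler_norml sin_geN1 sin_le1.
have a1 : `|1 + a| <= 2.
  by apply: le_trans (ler_normD _ _) _; rewrite normr1; lra.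
apply: le_trans (nr_ReIm _) _; rewrite /cexp /=.
have -> : expR a * cos b - 0 * sin b - 1 - a =
  (expR a - 1 - a) * cos b + (1 + a) * (cos b - 1) by ring.
have -> : expR a * sin b + 0 * cos b - 0 - b =
  (expR a - 1 - a) * sin b + (a * sin b + (sin b - b)) by ring.
have M1 : `|(expR a - 1 - a) * cos b| <= e / 10 * n.
  by rewrite normrM -[leRHS]mulr1 ler_pM.
have M2 : `|(1 + a) * (cos b - 1)| <= 2 * (e / 10 * n).
  by rewrite normrM ler_pM.
have M3 : `|(expR a - 1 - a) * sin b| <= e / 10 * n.
  by rewrite normrM -[leRHS]mulr1 ler_pM.
have n2e : n * n <= e / 10 * n by rewrite ler_wpM2r // ltW.
have n3e : n * (e / 10 * n) <= e / 10 * n.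
  by rewrite -[leRHS]mul1r ler_wpM2r ?mulr_ge0 ?(ltW e5) // ltW.
have M4 : `|a * sin b| <= e / 5 * n.
  have sb : `|sin b| <= n + e / 10 * n.
    rewrite -[sin b](subrK b); apply: le_trans (ler_normD _ _) _.
    by rewrite addrC lerD.
  rewrite normrM; apply: le_trans (ler_pM _ _ ha sb) _ => //.
  by rewrite mulrDr; lra.
apply: le_trans (lerD (ler_normD _ _) (le_trans (ler_normD _ _) (lerD M3 (ler_normD _ _)))) _.
apply: le_trans (lerD (lerD M1 M2) (lerD (lexx _) (lerD M4 K3))) _.
have : 0 <= e * n by rewrite mulr_ge0 // ltW.
lra.
Qed.

Lemma sdiff_cexp (a : C) : sdiff (@cexp R) a (fun h => cexp a * h).
Proof.
split; first exact: (blin_scale (cexp a) (blin_id _)).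
have [d1 d10 h1] := cexp_littleo (ltr01 : (0 : R) < 1).
have cc h : nr h < d1 -> nr (cexp h - 1) <= 2 * nr h.
  move=> hd; rewrite -[cexp h - 1](subrK h); apply: le_trans (nrD _ _) _.
  by have := h1 h hd; lra.
move=> e e0.
have E0 : 0 < nr (cexp a) by rewrite nr_cexp expR_gt0.
(* The functional equation transports the expansion at 0 to the point a; with |exp (y - a)| <= 3 the
   bracket below is at most 6 e1 |x - y|. *)
pose e1 := e / (6 * nr (cexp a)).
have e10 : 0 < e1 by rewrite divr_gt0 // mulr_gt0.
have [d2 d20 h2] := cexp_littleo e10.
exists (Num.min (d1 / 2) (Num.min (d2 / 2) (Num.min 1 e1))).
  by rewrite !lt_min !divr_gt0 //; lra.
move=> x y; rewrite !lt_min => /and4P[x1 x2 x3 x4] /and4P[y1 y2 y3 y4].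
have xy : nr (x - y) <= nr (x - a) + nr (y - a).
  by rewrite (nrBC y); exact: nr_tri.
have Ex : cexp x = cexp y * cexp (x - y) by rewrite -cexpD addrC subrK.
have Ey : cexp y = cexp a * cexp (y - a) by rewrite -cexpD addrC subrK.
have -> : cexp x - cexp y - cexp a * (x - y) =
    cexp a * (cexp (y - a) * (cexp (x - y) - 1 - (x - y))
      + (cexp (y - a) - 1) * (x - y)).
  by rewrite Ex Ey; ring.
have b1 : nr (cexp (y - a) - 1) <= 2 * nr (y - a) by apply: cc; lra.
have b2 : nr (cexp (y - a)) <= 3.
  rewrite -[cexp (y - a)](subrK 1); apply: le_trans (nrD _ _) _.
  by rewrite nr1; lra.
have b3 : nr (cexp (x - y) - 1 - (x - y)) <= e1 * nr (x - y) by apply: h2; lra.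
have b4 : nr (cexp (y - a) - 1) <= 2 * e1 by lra.
rewrite nrM; have : nr (cexp (y - a) * (cexp (x - y) - 1 - (x - y))
      + (cexp (y - a) - 1) * (x - y)) <= 6 * e1 * nr (x - y).
  apply: le_trans (nrD _ _) _; rewrite (nrM (cexp (y - a))) (nrM (cexp (y - a) - 1)).
  have c1 : nr (cexp (y - a)) * nr (cexp (x - y) - 1 - (x - y)) <= 3 * (e1 * nr (x - y)).
    by rewrite ler_pM ?nr_ge0.
  have c2 : nr (cexp (y - a) - 1) * nr (x - y) <= 2 * e1 * nr (x - y).
    by rewrite ler_wpM2r ?nr_ge0.
  have : 0 <= e1 * nr (x - y) by rewrite mulr_ge0 ?nr_ge0 // ltW.
  lra.
move=> /(ler_wpM2l (ltW E0)) h; apply: le_trans h _.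
by rewrite le_eqVlt; apply/orP; left; apply/eqP; rewrite /e1; field; rewrite gt_eqF.
Qed.

End ComplexExponential.

(** * Cauchy's theory by averages over roots of unity *)

Section GeneralizedLimit.
Variable R : realType.
Local Notation C := (Cplx R).

Definition bdd (u : nat -> C) := exists M, forall n, nr (u n) <= M.

(** A cluster point exists because the segment is compact, and an ultrafilter converges to each of
    its cluster points. *)
Lemma ultra_cvg_bdd (U : set_system nat) (u : nat -> R) M : UltraFilter U ->
  (forall n, `|u n| <= M) -> exists l, forall e, 0 < e -> U [set n | `|u n - l| < e].
Proof.
move=> UU hM; have PU := @ultra_proper _ _ UU.
have /(_ (u @ U))[] := @segment_compact R (- M) M.
  apply: (@filterS _ U _ setT); last exact: filterT.
  by move=> n _ /=; rewrite in_itv /= -ler_norml.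
move=> l [_ hl]; exists l => e e0.
have [//|hU] := in_ultra_setVsetC [set n | `|u n - l| < e] UU.
have [] := hl (u @` ~` [set n | `|u n - l| < e]) (ball l e).
- by rewrite /fmap /=; apply: filterS hU => n hn; exists n.
- exact: nbhsx_ballx.
by move=> _ [[n hn <-]]; rewrite /ball /= distrC.
Qed.

(** Take the limit along an ultrafilter finer than [\oo]: real and imaginary parts converge by
    compactness of segments, and linearity and eventual bounds pass to the limit. *)
Lemma glim_ex : exists L : (nat -> C) -> C,
  (forall a u v, bdd u -> bdd v -> L (fun n => a * u n + v n) = a * L u + L v) /\
  (forall u K N, bdd u -> (forall n, (N <= n)%N -> nr (u n) <= K) -> nr (L u) <= K) /\
  (forall c, L (fun _ => c) = c).
Proof.
have [U [UU Uoo]] := ultraFilterLemma (@eventually_filter : ProperFilter \oo).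
have PU := @ultra_proper _ _ UU.
have lim_ex u : exists l : C, bdd u -> forall e, 0 < e -> U [set n | nr (u n - l) < e].
  case: (pselect (bdd u)) => [[M hM]|]; last by exists 0.
  have [a ha] := @ultra_cvg_bdd U (fun n => complex.Re (u n)) M UU
    (fun n => le_trans (Re_le_nr _) (hM n)).
  have [b hb] := @ultra_cvg_bdd U (fun n => complex.Im (u n)) M UU
    (fun n => le_trans (Im_le_nr _) (hM n)).
  exists (a +i* b)%C => _ e e0.
  have e2 : 0 < e / 2 by rewrite divr_gt0.
  apply: filterS (filterI (ha _ e2) (hb _ e2)) => n [/= h1 h2].
  apply: le_lt_trans (nr_ReIm _) _; move: h1 h2; case: (u n) => x y /=; lra.
have [L hL] := choice lim_ex.
have uniq (l l' : C) (u : nat -> C) : (forall e, 0 < e -> U [set n | nr (u n - l) < e]) ->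
    (forall e, 0 < e -> U [set n | nr (u n - l') < e]) -> l = l'.
  move=> h h'; apply/eqP; rewrite -subr_eq0; apply/eqP/nr_le0.
  apply/ler_addgt0Pr => e e0; have e2 : 0 < e / 2 by rewrite divr_gt0.
  have [n [/= h1 h2]] := filter_ex (filterI (h _ e2) (h' _ e2)).
  have := nr_tri (u n) l l'; rewrite (nrBC l (u n)); lra.
exists L; split; last split.
- move=> a u v [M hM] [M' hM'].
  apply: (uniq _ _ (fun n => a * u n + v n)).
    apply: hL; exists (nr a * M + M') => n; apply: le_trans (nrD _ _) _.
    by rewrite lerD // nrM ler_wpM2l ?nr_ge0.
  move=> e e0; have e1 : 0 < e / 2 / (nr a + 1).
    by rewrite !divr_gt0 // ltr_wpDl ?nr_ge0.
  have e2 : 0 < e / 2 by rewrite divr_gt0.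
  apply: filterS (filterI (hL u (ex_intro _ M hM) _ e1) (hL v (ex_intro _ M' hM') _ e2)).
  move=> n [/= h1 h2].
  have -> : a * u n + v n - (a * L u + L v) = a * (u n - L u) + (v n - L v) by ring.
  apply: le_lt_trans (nrD _ _) _; rewrite nrM.
  have : nr a * nr (u n - L u) <= e / 2.
    apply: le_trans (_ : (nr a + 1) * nr (u n - L u) <= _).
      by rewrite ler_wpM2r ?nr_ge0 // lerDl.
    by rewrite mulrC -ler_pdivlMr ?ltW // ltr_wpDl ?nr_ge0.
  lra.
- move=> u K N bu hK; apply/ler_addgt0Pr => e e0.
  have hN : U [set n | (N <= n)%N] by apply: Uoo; exists N.
  have [n [/= h1 h2]] := filter_ex (filterI (hL u bu e e0) hN).
  have := nrB (u n) (u n - L u); rewrite opprB addrCA subrr addr0.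
  have := hK n h2; lra.
- move=> c; apply: (uniq _ _ (fun _ => c)).
    by apply: hL; exists (nr c).
  move=> e e0; apply: filterS filterT => n _ /=.
  by rewrite subrr nr0.
Qed.

(* A linear extension of the limit to all bounded sequences, so that averages
   over roots of unity define Cauchy integrals without any convergence proof. *)
Definition glim : (nat -> C) -> C := sval (cid glim_ex).

Lemma glim_lin a u v : bdd u -> bdd v ->
  glim (fun n => a * u n + v n) = a * glim u + glim v.
Proof. by rewrite /glim; case: cid => L [h _] /=; exact: h. Qed.

Lemma glim_bound u K N : bdd u -> (forall n, (N <= n)%N -> nr (u n) <= K) ->
  nr (glim u) <= K.
Proof. by rewrite /glim; case: cid => L [_ [h _]] /=; exact: h. Qed.

Lemma glim_cst c : glim (fun _ => c) = c.
Proof. by rewrite /glim; case: cid => L [_ [_ h]] /=; exact: h. Qed.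

Lemma bdd_cst (c : C) : bdd (fun _ => c).
Proof. by exists (nr c). Qed.

Lemma bddD u v : bdd u -> bdd v -> bdd (fun n => u n + v n).
Proof.
by move=> [M hM] [M' hM']; exists (M + M') => n; apply: le_trans (nrD _ _) (lerD _ _).
Qed.

Lemma bddM u v : bdd u -> bdd v -> bdd (fun n => u n * v n).
Proof.
move=> [M hM] [M' hM']; exists (M * M') => n; rewrite nrM ler_pM ?nr_ge0 //.
Qed.

Lemma bddZ c u : bdd u -> bdd (fun n => c * u n).
Proof. by move=> h; apply: bddM => //; exact: bdd_cst. Qed.

Lemma bdd_sum (I : Type) (r : seq I) (P : pred I) (F : I -> nat -> C) :
  (forall i, P i -> bdd (F i)) -> bdd (fun n => \sum_(i <- r | P i) F i n).
Proof.
move=> h; elim: r => [|i r IH].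
  by exists 0 => n; rewrite big_nil nr0.
have [Pi|nPi] := boolP (P i); last first.
  by have [M hM] := IH; exists M => n; rewrite big_cons (negbTE nPi).
have [M hM] := bddD (h i Pi) IH.
by exists M => n; rewrite big_cons Pi.
Qed.

Lemma glim0 : glim (fun _ => 0) = 0.
Proof.
by apply: nr_le0; apply: (@glim_bound _ _ 0) => [|n _]; [exact: bdd_cst | rewrite nr0].
Qed.

Lemma glimZ c u : bdd u -> glim (fun n => c * u n) = c * glim u.
Proof.
move=> bu; rewrite -[RHS]addr0 -glim0 -glim_lin //; last exact: bdd_cst.
by congr glim; apply/funext => n; rewrite addr0.
Qed.

Lemma glimD u v : bdd u -> bdd v -> glim (fun n => u n + v n) = glim u + glim v.
Proof.
move=> bu bv; rewrite -[glim u]mul1r -glim_lin //.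
by congr glim; apply/funext => n; rewrite mul1r.
Qed.

Lemma glimB u v : bdd u -> bdd v -> glim (fun n => u n - v n) = glim u - glim v.
Proof.
move=> bu bv; rewrite -mulN1r addrC -glim_lin //.
by congr glim; apply/funext => n; rewrite mulN1r addrC.
Qed.

Lemma glim_sum (I : Type) (r : seq I) (P : pred I) (F : I -> nat -> C) :
  (forall i, P i -> bdd (F i)) ->
  glim (fun n => \sum_(i <- r | P i) F i n) = \sum_(i <- r | P i) glim (F i).
Proof.
move=> h; elim: r => [|i r IH].
  transitivity (glim (fun _ => 0)); last by rewrite big_nil glim0.
  by congr glim; apply/funext => n; rewrite big_nil.
rewrite big_cons; have [Pi|nPi] := boolP (P i); last first.
  by rewrite -IH; congr glim; apply/funext => n; rewrite big_cons (negbTE nPi).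
rewrite -IH -glimD; [|exact: h|exact: bdd_sum].
by congr glim; apply/funext => n; rewrite big_cons Pi.
Qed.

Lemma glim_near u v e N : bdd u -> bdd v ->
  (forall n, (N <= n)%N -> nr (u n - v n) <= e) -> nr (glim u - glim v) <= e.
Proof.
move=> bu bv h; rewrite -glimB //; apply: glim_bound h.
have [M hM] := bu; have [M' hM'] := bv; exists (M + M') => n.
by apply: le_trans (nrB _ _) (lerD _ _).
Qed.

Lemma glim_null u : bdd u ->
  (forall e, 0 < e -> exists N, forall n, (N <= n)%N -> nr (u n) <= e) -> glim u = 0.
Proof.
move=> bu h; apply: nr_le0; apply/ler_addgt0Pr => e e0.
by have [N hN] := h e e0; rewrite add0r; exact: glim_bound hN.
Qed.

End GeneralizedLimit.

(** * Averages over roots of unity *)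

Section RootsOfUnity.
Variable R : realType.
Local Notation C := (Cplx R).
Local Notation rc := (@rc R).

Definition uroot (N : nat) : C := cexp (0 +i* (2 * pi / N%:R))%C.

(** The N-th Riemann sum of the normalized integral over the unit circle. For N = 0 it is 0, the
    inverse of 0 being 0. *)
Definition mean (N : nat) (f : C -> C) : C :=
  N%:R^-1 * \sum_(j < N) f (uroot N ^+ j).

Lemma nr_uroot N : nr (uroot N) = 1.
Proof. by rewrite /uroot nr_cexp /= expR0. Qed.

Lemma nr_urootX N j : nr (uroot N ^+ j) = 1.
Proof. by rewrite nrX nr_uroot expr1n. Qed.

Lemma uroot_powE N k : uroot N ^+ k = cexp (0 +i* (k%:R * (2 * pi / N%:R)))%C.
Proof.
rewrite /uroot -cexp_sum; congr cexp.
rewrite -rc_nat /rc; apply/eqP; rewrite eq_complex /=.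
by apply/andP; split; apply/eqP; ring.
Qed.

Lemma uroot_order N : (0 < N)%N -> uroot N ^+ N = 1.
Proof.
move=> N0; rewrite uroot_powE mulrC divfK ?pnatr_eq0 -?lt0n //.
rewrite /cexp /= expR0 -mulr_natl mulr_natl.
by rewrite mulr_natl cos2pi -[pi *+ 2]add0r sinD2pi sin0 mul1r.
Qed.

(** For 2 k < N the angle 2 pi k / N lies strictly between 0 and pi, where the sine is positive.
    Only limits in N are taken, so this half range is enough. *)
Lemma uroot_pow_neq1 N k : (0 < k)%N -> (2 * k < N)%N -> uroot N ^+ k != 1.
Proof.
move=> k0 kN; rewrite uroot_powE; apply/eqP => h.
have N0 : 0 < N%:R :> R by rewrite ltr0n (leq_ltn_trans _ kN).
have hs : sin (k%:R * (2 * pi / N%:R)) = 0 :> R.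
  by have := congr1 (@complex.Im R) h; rewrite /cexp /= expR0 mul1r mul0r addr0.
have : 0 < sin (k%:R * (2 * pi / N%:R)) :> R.
  apply: sin_gt0_pi; apply/andP; split.
    by rewrite !mulr_gt0 ?invr_gt0 ?pi_gt0 // ltr0n.
  rewrite (_ : _ * _ = pi * (2 * k)%:R / N%:R); last by rewrite natrM; ring.
  by rewrite ltr_pdivrMr // ltr_pM2l ?pi_gt0 // ltr_nat.
by rewrite hs ltxx.
Qed.

Lemma uroot_cvg1 e : 0 < e -> exists N0, forall N, (N0 <= N)%N -> nr (uroot N - 1) < e.
Proof.
move=> e0; have [d d0 hd] := sdiff_continuous (sdiff_cexp (0 : C)) e0.
have b0 : 0 <= 2 * pi / d :> R by rewrite divr_ge0 ?mulr_ge0 ?pi_ge0 // ltW.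
have [N0 hN] : exists n : nat, 2 * pi / d < n%:R by exists (Num.bound (2 * pi / d)); exact: archi_boundP.
exists N0.+1 => N hNN; rewrite /uroot -(@cexp0 R); apply: hd.
rewrite subr0; apply: le_lt_trans (nr_ReIm _) _; rewrite /= normr0 add0r.
have p0 : 0 < pi :> R := pi_gt0 R.
have N0' : 0 < N%:R :> R by rewrite ltr0n (leq_trans _ hNN).
rewrite ger0_norm; last by rewrite divr_ge0 ?mulr_ge0 // ltW.
rewrite ltr_pdivrMr // [d * _]mulrC -ltr_pdivrMr //.
by apply: lt_le_trans hN _; rewrite ler_nat ltnW.
Qed.

Lemma mean_bound N (f : C -> C) K : 0 <= K -> (forall z, nr z = 1 -> nr (f z) <= K) ->
  nr (mean N f) <= K.
Proof.
move=> K0 h; rewrite /mean nrM nrV nr_nat.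
have [->|N0] := eqVneq N 0%N; first by rewrite big_ord0 nr0 mulr0.
rewrite mulrC ler_pdivrMr ?ltr0n ?lt0n //; apply: le_trans (nr_sum _ _ _) _.
apply: (@le_trans _ _ (\sum_(j < N) K)).
  by apply: ler_sum => j _; apply: h; rewrite nr_urootX.
by rewrite sumr_const card_ord mulr_natr.
Qed.

Lemma eq_mean N f g : (forall z : C, nr z = 1 -> f z = g z) -> mean N f = mean N g.
Proof.
by move=> h; rewrite /mean; congr (_ * _); apply: eq_bigr => j _; rewrite h // nr_urootX.
Qed.

Lemma meanD N f g : mean N (fun z => f z + g z) = mean N f + mean N g.
Proof. by rewrite /mean big_split mulrDr. Qed.

Lemma meanZ N c f : mean N (fun z => c * f z) = c * mean N f.
Proof. by rewrite /mean -mulr_sumr mulrCA. Qed.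

Lemma meanB N f g : mean N (fun z => f z - g z) = mean N f - mean N g.
Proof.
rewrite -mulN1r -meanZ -meanD; apply: eq_mean => z _; by rewrite mulN1r.
Qed.

Lemma mean_sum N (I : Type) (r : seq I) (P : pred I) (F : I -> C -> C) :
  mean N (fun z => \sum_(i <- r | P i) F i z) = \sum_(i <- r | P i) mean N (F i).
Proof. by rewrite /mean exchange_big mulr_sumr. Qed.

Lemma mean_cst N c : (0 < N)%N -> mean N (fun _ => c) = c.
Proof.
move=> N0; rewrite /mean sumr_const card_ord -[c *+ N]mulr_natl mulKf //.
by rewrite pnatr_eq0 -lt0n.
Qed.

(** A geometric sum whose ratio is an N-th root of unity other than 1. *)
Lemma mean_pow N k : (0 < k)%N -> (2 * k < N)%N -> mean N (fun z => z ^- k) = 0.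
Proof.
move=> k0 kN; have N0 : (0 < N)%N by exact: leq_ltn_trans kN.
rewrite /mean; set s := \sum_(j < N) _.
suff : s = 0 by move=> ->; rewrite mulr0.
pose q := (uroot N ^- k).
have -> : s = \sum_(j < N) q ^+ j.
  by apply: eq_bigr => j _; rewrite /q -!exprVn -!exprM mulnC.
have q1 : q - 1 != 0.
  rewrite subr_eq0; apply: contraNneq (uroot_pow_neq1 k0 kN) => h.
  by rewrite -[X in X == _]invrK -/q h invr1.
apply: (mulfI q1); rewrite mulr0 -subrX1 /q -exprVn -exprM mulnC exprM exprVn.
by rewrite uroot_order // invr1 expr1n subrr.
Qed.

(* Summing the increments of [phi] around the circle gives zero. *)
Lemma mean_derivative N (phi phi' : C -> C) e d : 0 <= e -> (2 < N)%N ->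
  nr (uroot N - 1) < d ->
  (forall z z', nr z = 1 -> nr z' = 1 -> nr (z' - z) < d ->
    nr (phi z' - phi z - phi' z * (z' - z)) <= e * nr (z' - z)) ->
  nr (mean N (fun z => z * phi' z)) <= e.
Proof.
move=> e0 N2 wd h; set w := uroot N.
have N0 : (0 < N)%N by exact: leq_trans N2.
have w1 : w - 1 != 0 by rewrite subr_eq0 -[w]expr1 uroot_pow_neq1.
have tel : \sum_(j < N) (phi (w ^+ j.+1) - phi (w ^+ j)) = 0.
  rewrite -(big_mkord xpredT (fun j => phi (w ^+ j.+1) - phi (w ^+ j))).
  by rewrite telescope_sumr // expr0 /w uroot_order // subrr.
pose er j := phi (w ^+ j.+1) - phi (w ^+ j) - phi' (w ^+ j) * (w ^+ j.+1 - w ^+ j).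
have dw j : w ^+ j.+1 - w ^+ j = w ^+ j * (w - 1) by rewrite exprSr mulrBr mulr1.
have ndw j : nr (w ^+ j.+1 - w ^+ j) = nr (w - 1).
  by rewrite dw nrM nr_urootX mul1r.
have E : (w - 1) * \sum_(j < N) w ^+ j * phi' (w ^+ j) = - \sum_(j < N) er j.
  rewrite /er sumrB tel sub0r opprK mulr_sumr; apply: eq_bigr => j _.
  by rewrite dw; ring.
have E' : nr (\sum_(j < N) er j) <= N%:R * (e * nr (w - 1)).
  apply: le_trans (nr_sum _ _ _) _.
  apply: (@le_trans _ _ (\sum_(j < N) (e * nr (w - 1)))).
    apply: ler_sum => j _; rewrite -(ndw j); apply: h; rewrite ?nr_urootX //.
    by rewrite ndw.
  by rewrite sumr_const card_ord mulr_natl.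
have n0 : 0 < nr (w - 1) := nr_gt0 w1.
have : nr ((w - 1) * \sum_(j < N) w ^+ j * phi' (w ^+ j)) <= N%:R * (e * nr (w - 1)).
  by rewrite E nrN.
rewrite nrM mulrA mulrC ler_pM2r // => h'.
rewrite /mean nrM nrV nr_nat mulrC ler_pdivrMr ?ltr0n //.
by rewrite [e * _]mulrC.
Qed.

End RootsOfUnity.

(** * Uniform estimates on the closed unit disc *)

Section UniformityOnDisc.
Variable R : realType.
Local Notation C := (Cplx R).

(** A Lebesgue number argument. The disc is placed in the square [-1, 1]^2, compact as a product of
    segments, on which the property is made vacuous outside the disc. *)
Lemma disc_uniform (P : C -> R -> Prop) :
  (forall z d d', 0 < d' -> d' <= d -> P z d -> P z d') ->
  (forall z, nr z <= 1 -> exists2 d, 0 < d &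
     forall z', nr (z' - z) < d -> nr z' <= 1 -> P z' d) ->
  exists2 d, 0 < d & forall z, nr z <= 1 -> P z d.
Proof.
move=> mono h.
pose K : set (R * R) := `[-1, 1] `*` `[-1, 1].
have cK : compact K by apply: compact_setX; exact: segment_compact.
pose Q (d : R) (x : R * R) := nr (x.1 +i* x.2 : C)%C <= 1 -> P (x.1 +i* x.2)%C d.
have key z : exists2 d, 0 < d & forall z', nr (z' - z) < d -> nr z' <= 1 -> P z' d.
  have [z1|z1] := leP (nr z) 1; first exact: h.
  exists (nr z - 1); first by rewrite subr_gt0.
  move=> z' zz' z'1; have := nr_tri z' z 0; rewrite !subr0 (nrBC z); lra.
have near_Q : \forall d \near 0^'+, K `<=` Q d.
  apply: ((compact_near_coveringP K).1 cK) => -[a b] _.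
  have [d d0 hd] := key (a +i* b)%C.
  exists (ball (a, b) (d / 2), [set i | 0 < i < d]).
    split => /=; first by apply: nbhsx_ballx; rewrite divr_gt0.
    near=> i; apply/andP; split; near: i; [exact: nbhs_right_gt | exact: nbhs_right_lt].
  move=> [[a' b'] i] /= [[/= ha hb] /andP[i0 id]] n1.
  apply: (mono _ d) => //; first exact: ltW.
  apply: hd n1; apply: le_lt_trans (nr_ReIm _) _ => /=.
  rewrite /ball /= in ha hb; rewrite (distrC a') (distrC b'); lra.
have [d [d0 hd]] : exists d, 0 < d /\ K `<=` Q d.
  have := filter_ex (filterI (nbhs_right_gt (0 : R)) near_Q).
  by move=> [d [d0 hd]]; exists d.
exists d => // z z1.
have := hd (complex.Re z, complex.Im z); rewrite /Q /=.
have -> : (complex.Re z +i* complex.Im z)%C = z by case: (z).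
apply => //; split => /=; rewrite in_itv /= -ler_norml.
  exact: le_trans (Re_le_nr z) z1.
exact: le_trans (Im_le_nr z) z1.
Unshelve. all: by end_near. Qed.

Lemma circle_uniform (P : C -> R -> Prop) :
  (forall z d d', 0 < d' -> d' <= d -> P z d -> P z d') ->
  (forall z, nr z = 1 -> exists2 d, 0 < d &
     forall z', nr (z' - z) < d -> nr z' = 1 -> P z' d) ->
  exists2 d, 0 < d & forall z, nr z = 1 -> P z d.
Proof.
move=> mono h.
have [||d d0 hd] := @disc_uniform (fun z d => nr z = 1 -> P z d).
- by move=> z d d' d'0 dd' hz z1; apply: mono (hz z1).
- move=> z z1; have [E|ne] := eqVneq (nr z) 1.
    by have [d d0 hd] := h z E; exists d => // z' zz' _; exact: hd.
  exists (1 - nr z); first by rewrite subr_gt0 lt_neqAle ne.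
  move=> z' zz' _ z'1; have := nr_tri z z' 0; rewrite !subr0 z'1; lra.
by exists d => // z z1; apply: hd; rewrite ?z1.
Qed.

Implicit Types V W : normedModType C.

(** The derivatives at a and b differ by at most e / 2 in norm, so the strict estimate at a survives
    when the derivative at b replaces the one at a. A radius common to all b near a is what the
    compactness argument on the disc asks for. *)
Lemma sdiff_local V W (f : V -> W) a L e : 0 < e -> sdiff f a L ->
  exists2 d, 0 < d & forall b L', nr (b - a) < d -> sdiff f b L' ->
    forall x y, nr (x - b) < d -> nr (y - b) < d ->
      nr (f x - f y - L' (x - y)) <= e * nr (x - y).
Proof.
move=> e0 [bL h]; have e2 : 0 < e / 2 by rewrite divr_gt0.
have [d d0 hd] := h _ e2.
have d2 : 0 < d / 2 by rewrite divr_gt0.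
exists (d / 2) => // b L' ba hb x y xb yb.
have bd : nr (b - a) < d by lra.
have E := sdiff_near hd (proj1 bL) bd hb (x - y).
have ex u : nr (u - b) < d / 2 -> nr (u - a) < d.
  by move=> ub; apply: le_lt_trans (nr_tri b _ _) _; lra.
have := hd x y (ex x xb) (ex y yb).
rewrite -[f x - f y - L' _](subrKA (L (x - y))) => H.
apply: le_trans (nrD _ _) _; rewrite [X in _ + X]nrBC; lra.
Qed.

Lemma sd_uniform V W (f : V -> W) (v w : V) e : 0 < e ->
  (forall z : C, nr z <= 1 -> sd f (v + z *: w)) ->
  exists2 d, 0 < d & forall z : C, nr z <= 1 ->
    forall x y, nr (x - (v + z *: w)) < d -> nr (y - (v + z *: w)) < d ->
    nr (f x - f y - 'D_(x - y) f (v + z *: w)) <= e * nr (x - y).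
Proof.
move=> e0 h; apply: disc_uniform => [z d d' d'0 dd' hz x y xd yd|z z1].
  by apply: hz; [exact: lt_le_trans xd dd' | exact: lt_le_trans yd dd'].
have [d d0 hd] := sdiff_local e0 (h z z1).
have w1 : 0 < nr w + 1 by rewrite ltr_wpDl ?nr_ge0.
exists (Num.min d (d / (nr w + 1))); first by rewrite lt_min d0 divr_gt0.
move=> z'; rewrite lt_min => /andP[_ zz'] z'1 x y; rewrite !lt_min => /andP[xd _] /andP[yd _].
apply: (hd _ (fun u => 'D_u f _) _ (h z' z'1)) => //.
rewrite opprD addrACA subrr add0r -scalerBl nrZ.
apply: le_lt_trans (_ : nr (z' - z) * (nr w + 1) < _); last by rewrite -ltr_pdivlMr.
by rewrite ler_wpM2l ?nr_ge0 // lerDl.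
Qed.

Lemma sd_bounded V (f : V -> C) (v w : V) :
  (forall z : C, nr z <= 1 -> sd f (v + z *: w)) ->
  exists2 M, 0 < M & forall z : C, nr z <= 1 ->
    nr (f (v + z *: w)) <= M /\ forall u, nr ('D_u f (v + z *: w)) <= M * nr u.
Proof.
move=> h.
(* Bounds are encoded as inverses of radii, so that a uniform radius is a uniform bound. *)
have [||d d0 hd] := @disc_uniform (fun z d =>
  nr (f (v + z *: w)) <= d^-1 /\ forall u, nr ('D_u f (v + z *: w)) <= d^-1 * nr u).
- move=> z d d' d'0 dd' [h1 h2]; have dd : d^-1 <= d'^-1.
    by rewrite lef_pV2 // posrE // (lt_le_trans d'0).
  split; first exact: le_trans h1 dd.
  by move=> u; apply: le_trans (h2 u) _; rewrite ler_wpM2r ?nr_ge0.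
- move=> z z1; have hz := h z z1.
  have [bL /(_ 1 ltr01)[d1 d10 hd1]] := hz; have [lL [K K0 hK]] := bL.
  have [d2 d20 hd2] := sdiff_continuous hz ltr01.
  have w1 : 0 < nr w + 1 by rewrite ltr_wpDl ?nr_ge0.
  pose M := Num.max (nr (f (v + z *: w)) + 1) (K + 1).
  have M0 : 0 < M by rewrite lt_max ltr_wpDl ?nr_ge0.
  exists (Num.min (M^-1) (Num.min (d1 / (nr w + 1)) (d2 / (nr w + 1)))).
    by rewrite !lt_min invr_gt0 M0 !divr_gt0.
  set d := Num.min _ _; have d0 : 0 < d by rewrite !lt_min invr_gt0 M0 !divr_gt0.
  have dM : M <= d^-1.
    by rewrite -[M]invrK lef_pV2 ?posrE ?invr_gt0 // ge_min lexx.
  move=> z' zd z'1.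
  have st e : 0 < e -> nr (z' - z) < e / (nr w + 1) ->
      nr (v + z' *: w - (v + z *: w)) < e.
    move=> e0 he; rewrite opprD addrACA subrr add0r -scalerBl nrZ.
    apply: le_lt_trans (_ : nr (z' - z) * (nr w + 1) < _); last by rewrite -ltr_pdivlMr.
    by rewrite ler_wpM2l ?nr_ge0 // lerDl.
  have zd1 : nr (z' - z) < d1 / (nr w + 1).
    by apply: lt_le_trans zd _; rewrite !ge_min lexx orbT.
  have zd2 : nr (z' - z) < d2 / (nr w + 1).
    by apply: lt_le_trans zd _; rewrite !ge_min lexx !orbT.
  split.
    apply: le_trans dM; rewrite le_max; apply/orP; left.
    rewrite -[f _](subrK (f (v + z *: w))); apply: le_trans (nrD _ _) _.
    by rewrite addrC lerD2l ltW // hd2 // st.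
  move=> u; apply: (@le_trans _ _ (M * nr u)); last by rewrite ler_wpM2r ?nr_ge0.
  have := sdiff_near hd1 lL (st _ d10 zd1) (h z' z'1) u; rewrite mul1r => E.
  apply: (@le_trans _ _ ((K + 1) * nr u)); last first.
    by rewrite ler_wpM2r ?nr_ge0 // le_max lexx orbT.
  rewrite -['D_u f _](subrK ('D_u f (v + z *: w))); apply: le_trans (nrD _ _) _.
  by rewrite mulrDl mul1r addrC lerD.
by exists d^-1; rewrite ?invr_gt0.
Qed.

End UniformityOnDisc.

(** * Taylor coefficients, higher derivatives and Cauchy estimates *)

Section TaylorCoefficients.
Variable R : realType.
Local Notation C := (Cplx R).
Local Notation rc := (@rc R).
Implicit Types V : normedModType C.

(* The k-th Taylor coefficient of [z |-> f (v + z w)] at 0, as the average of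
   [f (v + z w) z^-k] over the unit circle. *)
Definition taylor V (k : nat) (w : V) (f : V -> C) (v : V) : C :=
  glim (fun N => mean N (fun z => f (v + z *: w) * z ^- k)).

Lemma nr_pow_circle (z : C) k : nr z = 1 -> nr (z ^- k) = 1.
Proof. by move=> z1; rewrite nrV nrX z1 expr1n invr1. Qed.

Lemma scaleCE (a b : C) : a *: (b : (C : normedModType C)) = a * b.
Proof. by []. Qed.

Lemma eq_ler1 (x : R) : x = 1 -> x <= 1.
Proof. by move=> ->. Qed.

Lemma circle_neq0 (z : C) : nr z = 1 -> z != 0.
Proof. by move=> z1; apply/eqP => z0; move: z1; rewrite z0 nr0; lra. Qed.

Lemma bdd_mean (f : C -> C) M : 0 <= M -> (forall z, nr z = 1 -> nr (f z) <= M) ->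
  bdd (fun N => mean N f).
Proof. by move=> M0 h; exists M => N; exact: mean_bound. Qed.

Lemma mean_inv_pow k : glim (fun N => mean N (fun z : C => z ^- k)) = (k == 0%N)%:R.
Proof.
have b : bdd (fun N => mean N (fun z : C => z ^- k)).
  by apply: (@bdd_mean _ 1) => // z z1; rewrite nr_pow_circle.
have b' : bdd (fun _ : nat => (k == 0%N)%:R : C) by exact: bdd_cst.
apply/eqP; rewrite -subr_eq0; apply/eqP/nr_le0.
rewrite -[X in _ - X](glim_cst ((k == 0%N)%:R : C)).
apply: (@glim_near _ _ _ _ (2 * k).+1) => // N hN.
case: k b b' hN => [|k] b b' hN.
  by rewrite (@eq_mean _ _ _ (fun _ => 1)) ?mean_cst ?subrr ?nr0 // => z _; rewrite expr0 invr1.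
by rewrite mean_pow // subrr nr0.
Qed.

Lemma bdd_taylor V (k : nat) (w : V) (f : V -> C) (v : V) M :
  0 <= M -> (forall z : C, nr z <= 1 -> nr (f (v + z *: w)) <= M) ->
  bdd (fun N => mean N (fun z => f (v + z *: w) * z ^- k)).
Proof.
move=> M0 h; apply: (@bdd_mean _ M) => // z z1.
by rewrite nrM nr_pow_circle // mulr1 h // z1.
Qed.

Lemma taylor_bound V (k : nat) (w : V) (f : V -> C) (v : V) M : 0 <= M ->
  (forall z : C, nr z <= 1 -> nr (f (v + z *: w)) <= M) -> nr (taylor k w f v) <= M.
Proof.
move=> M0 h; apply: (@glim_bound _ _ _ 0%N); first exact: bdd_taylor h.
move=> N _; apply: mean_bound => // z z1.
by rewrite nrM nr_pow_circle // mulr1 h // z1.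
Qed.

(* Homotopy from the point [a] to the unit circle. *)
Lemma cauchy_mean V (f : V -> C) (v w : V) (a : C) : nr a < 1 ->
  (forall z : C, nr z <= 1 -> sd f (v + z *: w)) ->
  forall e, 0 < e -> exists N0, forall N, (N0 <= N)%N ->
    nr (mean N (fun z => (f (v + z *: w) - f (v + a *: w)) / (1 - a / z))) <= e.
Proof.
move=> a1 h e e0.
have w1 : 0 < nr w + 1 by rewrite ltr_wpDl ?nr_ge0.
have [d d0 hd] := sd_uniform (divr_gt0 e0 w1) h.
have [N0 hN0] := uroot_cvg1 (divr_gt0 d0 w1).
exists (maxn N0 3) => N; rewrite geq_max => /andP[/hN0 wd N3].
pose pt (l z : C) : C := a + l * (z - a).
have pt1 l z : 0 <= l <= 1 -> nr z = 1 -> nr (pt (rc l) z) <= 1.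
  move=> /andP[l0 l1] z1; rewrite /pt.
  have -> : a + rc l * (z - a) = rc (1 - l) * a + rc l * z by rewrite rcB rc1; ring.
  apply: le_trans (nrD _ _) _; rewrite !nrM !nr_rc z1 !ger0_norm ?subr_ge0 //.
  have : (1 - l) * nr a <= (1 - l) * 1 by rewrite ler_wpM2l ?subr_ge0 // ltW.
  lra.
pose G (l : C) := mean N (fun z => f (v + pt l z *: w) / (1 - a / z)).
have za (z : C) : nr z = 1 -> z - a != 0.
  move=> z1; rewrite subr_eq0; apply/eqP => E; move: a1; rewrite -E z1; lra.
have one (z : C) : nr z = 1 -> 1 - a / z = (z - a) / z.
  by move=> z1; rewrite mulrBl divff // circle_neq0.
have sG l : 0 <= l <= 1 -> sdiff G (rc l) (fun h => mean N (fun z =>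
    'D_((h * (z - a)) *: w) f (v + pt (rc l) z *: w) / (1 - a / z))).
  move=> l01; rewrite /G /mean.
  apply: sdiff_ext; last first.
    apply: sdiff_eq.
      apply: (@sdiffZ _ _ _ _ _ _ (N%:R^-1)).
      apply: (@sdiff_sum _ _ _ _ (index_enum 'I_N) xpredT (fun j x =>
        (1 - a / uroot R N ^+ j)^-1 *: f (v + pt x (uroot R N ^+ j) *: w)) _ (fun j h =>
        (1 - a / uroot R N ^+ j)^-1 *:
        'D_((h * (uroot R N ^+ j - a)) *: w) f (v + pt (rc l) (uroot R N ^+ j) *: w))).
      move=> j _; apply: sdiffZ.
      set z := uroot R N ^+ j; have z1 : nr z = 1 := nr_urootX _ _ _.
      apply: (@sdiff_comp _ _ _ _ (fun x => v + pt x z *: w) f (rc l)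
         (fun h => (h * (z - a)) *: w)); last exact: h (pt1 _ _ l01 z1).
      have b : blin (fun h : C => (h * (z - a)) *: w).
        exact: (blin_scalel w (blin_scalel (z - a) (blin_id C))).
      apply: sdiff_ext (sdiff_eq (sdiffD (sdiff_cst (v + a *: w) (rc l)) (sdiff_lin _ b)) _).
        by exists 1 => // x _; rewrite /pt scalerDl addrA.
      by move=> x; rewrite add0r.
    by move=> x; apply: (congr1 (fun t => N%:R^-1 * t)); apply: eq_bigr => j _; exact: mulrC.
  exists 1 => // x _; apply: (congr1 (fun t => N%:R^-1 * t)).
  by apply: eq_bigr => j _; exact: mulrC.
have -> : mean N (fun z => (f (v + z *: w) - f (v + a *: w)) / (1 - a / z)) = G 1 - G 0.
  rewrite /G -meanB; apply: eq_mean => z z1.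
  by rewrite /pt mul1r mul0r addr0 (addrC a) subrK mulrBl.
apply: (@mean_value_sdiff _ _ G 1 0) => [l l01|l l01].
  rewrite add0r subr0 [_ *: _]mulr1; exact: sdiff_sd (sG l l01).
rewrite add0r subr0 [_ *: _]mulr1 (sdiff_derive _ (sG l l01)).
(* The weight 1 / (1 - a / z) = z / (z - a) cancels the velocity z - a of the homotopy: the
   derivative in l is an average of z times ['D_w f], a case of [mean_derivative]. *)
have -> : mean N (fun z => 'D_((1 * (z - a)) *: w) f (v + pt (rc l) z *: w) / (1 - a / z)) =
    mean N (fun z => z * 'D_w f (v + pt (rc l) z *: w)).
  apply: eq_mean => z z1; have [bL _] := h _ (pt1 _ _ l01 z1).
  rewrite mul1r (blinZ _ _ bL) scaleCE one // invf_div; field; exact: za.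
(* At l = 0 the integrand is z times a constant, whose primitive is linear; elsewhere the primitive
   is [f] along the homotopy divided by l. *)
have [l0|l0] := eqVneq l 0.
  rewrite l0 (@eq_mean _ _ _ (fun z => z * 'D_w f (v + a *: w))); last first.
    by move=> z _; rewrite /pt mul0r addr0.
  apply: (@mean_derivative _ _ (fun z => z * 'D_w f (v + a *: w)) _ _ _ (ltW e0) _ wd) => //.
  move=> z z' _ _ _; rewrite (_ : _ - _ = 0) ?nr0 ?mulr_ge0 ?nr_ge0 ?ltW //.
  by ring.
have lgt : 0 < l by case/andP: l01 => l0' _; rewrite lt_neqAle eq_sym l0.
apply: (@mean_derivative _ _ (fun z => (rc l)^-1 * f (v + pt (rc l) z *: w)) _ _ _ (ltW e0) _ wd) => //.
move=> z z' z1 z'1 zz'.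
have P1 := pt1 _ _ l01 z1.
have := hd _ P1 (v + pt (rc l) z' *: w) (v + pt (rc l) z *: w).
have Ed : v + pt (rc l) z' *: w - (v + pt (rc l) z *: w) = (rc l * (z' - z)) *: w.
  rewrite opprD addrACA subrr add0r -scalerBl; congr (_ *: _).
  by rewrite /pt; ring.
have [bL _] := h _ P1.
rewrite subrr nr0 Ed (blinZ _ _ bL) nrZ nrM nr_rc (gtr0_norm lgt) => H.
have l1 : l <= 1 by case/andP: l01.
have {}H := H _ d0.
have c1 : l * nr (z' - z) * nr w < d.
  apply: le_lt_trans (_ : nr (z' - z) * (nr w + 1) < _); last by rewrite -ltr_pdivlMr.
  rewrite ler_pM ?mulr_ge0 ?nr_ge0 ?(ltW lgt) // ?lerDl //.
  by rewrite -[leRHS]mul1r ler_wpM2r ?nr_ge0.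
have {}H := H c1.
have -> : (rc l)^-1 * f (v + pt (rc l) z' *: w) - (rc l)^-1 * f (v + pt (rc l) z *: w) -
   'D_w f (v + pt (rc l) z *: w) * (z' - z) = (rc l)^-1 *
   (f (v + pt (rc l) z' *: w) - f (v + pt (rc l) z *: w) -
     (rc l * (z' - z)) *: 'D_w f (v + pt (rc l) z *: w)).
  have rl0 : rc l != 0 by apply/eqP => E; move: (nr_rc l); rewrite E nr0 gtr0_norm //; lra.
  by rewrite scaleCE; field; exact: rl0.
rewrite nrM nrV nr_rc gtr0_norm // ler_pdivrMl //; apply: le_trans H _.
have q : e / (nr w + 1) * nr w <= e.
  by rewrite mulrAC ler_pdivrMr // ler_wpM2l ?(ltW e0) // lerDl.
have -> : e / (nr w + 1) * (l * nr (z' - z) * nr w) =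
    l * nr (z' - z) * (e / (nr w + 1) * nr w) by ring.
have -> : l * (e * nr (z' - z)) = l * nr (z' - z) * e by ring.
by rewrite ler_wpM2l // mulr_ge0 ?nr_ge0 // ltW.
Qed.

(** Cauchy's formula with 1 / (1 - a / z) replaced by a geometric sum. The remainder of that sum is
    (a / z)^(K+1) / (1 - a / z), of modulus at most |a|^(K+1) / (1 - |a|) on the circle. *)
Lemma taylor_expansion V (f : V -> C) (v w : V) (a : C) M K : nr a < 1 ->
  (forall z : C, nr z <= 1 -> sd f (v + z *: w)) ->
  (forall z : C, nr z <= 1 -> nr (f (v + z *: w)) <= M) ->
  nr (f (v + a *: w) - \sum_(k < K.+1) a ^+ k * taylor k w f v)
    <= 2 * M * nr a ^+ K.+1 / (1 - nr a).
Proof.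
move=> a1 h hM.
have M0 : 0 <= M by apply: le_trans (nr_ge0 _) (hM 0 _); rewrite nr0.
have b0 : 0 < 1 - nr a by rewrite subr_gt0.
set ga := f (v + a *: w).
have hga : nr ga <= M by apply: hM; exact: ltW.
have hd (z : C) : nr z = 1 -> 1 - nr a <= nr (1 - a / z).
  move=> z1; have := nrB (1 - a / z) (- (a / z)).
  by rewrite opprK subrK nr1 nrN nrM nrV z1 invr1 mulr1; lra.
have hg (z : C) : nr z = 1 -> nr (f (v + z *: w) - ga) <= 2 * M.
  move=> z1; apply: le_trans (nrB _ _) _.
  have := hM z; rewrite z1 => /(_ (lexx _)); lra.
have inv_b (z : C) : nr z = 1 -> nr (1 - a / z)^-1 <= (1 - nr a)^-1.
  by move=> z1; rewrite nrV lef_pV2 ?posrE ?hd // (lt_le_trans b0) // hd.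
pose A N := mean N (fun z => (f (v + z *: w) - ga) / (1 - a / z)).
have bA : bdd A.
  apply: (@bdd_mean _ (2 * M / (1 - nr a))); first by rewrite divr_ge0 ?mulr_ge0 // ltW.
  by move=> z z1; rewrite nrM ler_pM ?nr_ge0 ?hg ?inv_b.
have A0 : glim A = 0.
  by apply: glim_null => // e e0; exact: cauchy_mean.
(* The value [ga] is subtracted under the average, as in [cauchy_mean]; in the limit it contributes
   to the term k = 0 only, the averages of z^-k tending to 0 for k > 0. *)
pose u N := \sum_(k < K.+1) a ^+ k *
  (mean N (fun z => f (v + z *: w) * z ^- k) - ga * mean N (fun z => z ^- k)).
have bk (k : nat) : bdd (fun N => mean N (fun z => f (v + z *: w) * z ^- k)).
  exact: bdd_taylor hM.
have bi (k : nat) : bdd (fun N => mean N (fun z : C => z ^- k)).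
  by apply: (@bdd_mean _ 1) => // z z1; rewrite nr_pow_circle.
have bB (k : nat) : bdd (fun N => mean N (fun z => f (v + z *: w) * z ^- k)
    - ga * mean N (fun z => z ^- k)).
  have [m hm] := bddD (bk k) (bddZ (- ga) (bi k)).
  by exists m => N; have := hm N; rewrite mulNr.
have bu : bdd u by apply: bdd_sum => k _; exact: bddZ.
have gu : glim u = \sum_(k < K.+1) a ^+ k * taylor k w f v - ga.
  rewrite /u glim_sum; last by move=> k _; exact: bddZ.
  rewrite (eq_bigr (fun k : 'I_K.+1 => a ^+ k * taylor k w f v -
      a ^+ k * (ga * (k == 0%N :> nat)%:R))); last first.
    move=> k _; rewrite glimZ // glimB //; last exact: bddZ.
    by rewrite glimZ // mean_inv_pow mulrBr.
  rewrite sumrB; congr (_ - _).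
  rewrite big_ord_recl /= expr0 mul1r mulr1 big1 ?addr0 // => k _.
  by rewrite /= !mulr0.
rewrite nrBC -gu -[glim u]subr0 -A0.
apply: (@glim_near _ _ _ _ 0%N) => // N _.
have -> : u N - A N = mean N (fun z => - ((f (v + z *: w) - ga) * (a / z) ^+ K.+1 / (1 - a / z))).
  have -> : u N = mean N (fun z => \sum_(k < K.+1) a ^+ k *
      (f (v + z *: w) * z ^- k - ga * z ^- k)).
    rewrite mean_sum; apply: eq_bigr => k _.
    by rewrite meanZ meanB meanZ.
  rewrite /A -meanB; apply: eq_mean => z z1.
  have z0 := circle_neq0 z1.
  have q0 : 1 - a / z != 0.
    by apply/eqP => E; have := hd z z1; rewrite E nr0 leNgt b0.
  apply: (mulIf q0); rewrite mulrBl mulNr divfK // divfK //.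
  have -> : \sum_(k < K.+1) a ^+ k * (f (v + z *: w) * z ^- k - ga * z ^- k) =
     (f (v + z *: w) - ga) * \sum_(k < K.+1) (a / z) ^+ k.
    rewrite mulr_sumr; apply: eq_bigr => k _.
    by rewrite exprMn exprVn; ring.
  have := subrX1 (a / z) K.+1 => E.
  rewrite -mulrA [X in _ * X](_ : _ = 1 - (a / z) ^+ K.+1); first by ring.
  by rewrite mulrC -[1 - a / z]opprB mulNr -E opprB.
apply: mean_bound; first by rewrite divr_ge0 ?mulr_ge0 ?exprn_ge0 ?nr_ge0 // ltW.
move=> z z1; rewrite nrN nrM ler_pM ?nr_ge0 ?inv_b // nrM ler_pM ?nr_ge0 ?hg //.
by rewrite nrX nrM nrV z1 invr1 mulr1.
Qed.

Lemma taylor0 V (f : V -> C) (v w : V) :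
  (forall z : C, nr z <= 1 -> sd f (v + z *: w)) -> taylor 0 w f v = f v.
Proof.
move=> h; have [M M0 hM] := sd_bounded h.
have n0 : nr (0 : C) < 1 by rewrite nr0.
have := taylor_expansion 0 n0 h (fun z z1 => (hM z z1).1).
rewrite nr0 expr1 mulr0 mul0r big_ord1 expr0 mul1r scale0r addr0 => /nr_le0.
by move=> /eqP; rewrite subr_eq0 => /eqP ->.
Qed.

(** Strict differentiability and the first-order expansion both approximate f (v + a w) - f v, with
    errors o(a) and O(a^2); dividing by a small real a identifies the coefficients. *)
Lemma taylor1 V (f : V -> C) (v w : V) :
  (forall z : C, nr z <= 1 -> sd f (v + z *: w)) -> taylor 1 w f v = 'D_w f v.
Proof.
move=> h; have [M M0 hM] := sd_bounded h.
have hv : sd f v by have := h 0; rewrite nr0 scale0r addr0; apply; exact: ler01.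
apply/eqP; rewrite -subr_eq0; apply/eqP/nr_le0; apply/ler_addgt0Pr => e e0.
rewrite add0r.
have w1 : 0 < nr w + 1 by rewrite ltr_wpDl ?nr_ge0.
have e2 : 0 < e / 2 / (nr w + 1) by rewrite !divr_gt0.
have [bL /(_ _ e2)[d d0 hd]] := hv.
(* The three bounds ensure, in order, 1 - a >= 1/2, the strict estimate at v + a w, and 2 M a^2 / (1
   - a) <= a e / 2. *)
pose a := Num.min (1 / 2) (Num.min (d / (nr w + 1) / 2) (e / (8 * M))).
have a0 : 0 < a by rewrite !lt_min !divr_gt0 // mulr_gt0.
have [a2 ad ae] : [/\ a <= 1 / 2, a <= d / (nr w + 1) / 2 & a <= e / (8 * M)].
  by split; rewrite /a ge_min ?lexx //; apply/orP; right; rewrite ge_min lexx ?orbT.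
have na : nr (rc a) = a by rewrite nr_rc gtr0_norm.
have a1 : nr (rc a) < 1 by rewrite na; lra.
have := taylor_expansion 1 a1 h (fun z z1 => (hM z z1).1).
rewrite na !big_ord_recl big_ord0 /= addr0 expr0 mul1r taylor0 // expr1 => H1.
have := hd (v + rc a *: w) v; rewrite subrr nr0 [v + _ - v]addrAC subrr add0r => H2.
have awd : nr (rc a *: w) < d.
  rewrite nrZ na; apply: le_lt_trans (_ : a * (nr w + 1) < d).
    by rewrite ler_wpM2l ?(ltW a0) // lerDl.
  rewrite -ltr_pdivlMr //; apply: le_lt_trans ad _.
  by have : 0 < d / (nr w + 1) by [rewrite divr_gt0]; lra.
have {}H2 := H2 awd d0.
rewrite (blinZ _ _ bL) nrZ na in H2.
have : a * nr (taylor 1 w f v - 'D_w f v) <= a * e.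
  rewrite -{1}na -nrM.
  have -> : rc a * (taylor 1 w f v - 'D_w f v) =
    (f (v + rc a *: w) - f v - rc a *: 'D_w f v) -
    (f (v + rc a *: w) - (f v + rc a * taylor 1 w f v)).
    by rewrite scaleCE; ring.
  apply: le_trans (nrB _ _) _; apply: le_trans (lerD H2 H1) _.
  have c1 : e / 2 / (nr w + 1) * (a * nr w) <= a * (e / 2).
    rewrite mulrCA ler_pM2l // mulrAC ler_pdivrMr //.
    by rewrite ler_wpM2l ?divr_ge0 ?(ltW e0) // lerDl.
  have c2 : 2 * M * a ^+ 2 / (1 - a) <= a * (e / 2).
    have a12 : 0 < 1 - a by lra.
    rewrite ler_pdivrMr // -mulrA expr2 mulrCA mulrA mulrCA -!mulrA ler_pM2l //.
    have : a * (8 * M) <= e by rewrite -ler_pdivlMr ?mulr_gt0.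
    have : e / 2 * (1 / 2) <= e / 2 * (1 - a) by rewrite ler_pM2l ?divr_gt0 //; lra.
    lra.
  lra.
by rewrite ler_pM2l.
Qed.

Lemma eq_taylor V (k : nat) (w : V) (f g : V -> C) (v : V) :
  (forall z : C, nr z = 1 -> f (v + z *: w) = g (v + z *: w)) ->
  taylor k w f v = taylor k w g v.
Proof.
move=> h; congr glim; apply/funext => N; apply: eq_mean => z z1.
by rewrite h.
Qed.

Lemma taylor_lin V (k : nat) (w : V) (f g : V -> C) (v : V) (c : C) M :
  (forall z : C, nr z <= 1 -> nr (f (v + z *: w)) <= M) ->
  (forall z : C, nr z <= 1 -> nr (g (v + z *: w)) <= M) ->
  taylor k w (fun x => c * f x + g x) v = c * taylor k w f v + taylor k w g v.
Proof.
move=> hf hg.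
have M0 : 0 <= M by apply: le_trans (nr_ge0 _) (hf 0 _); rewrite nr0.
rewrite /taylor -glim_lin; [|exact: bdd_taylor hf|exact: bdd_taylor hg].
congr glim; apply/funext => N; rewrite -meanZ -meanD; apply: eq_mean => z _.
by ring.
Qed.

(** Differentiation under the average: on the compact disc the strict estimate of [f] holds with a
    single radius, by [sd_uniform]. *)
Lemma taylor_sdiff V (k : nat) (w : V) (f : V -> C) (v : V) :
  (forall z : C, nr z <= 1 -> sd f (v + z *: w)) ->
  sdiff (taylor k w f) v (fun u => taylor k w ('D_u f) v).
Proof.
move=> h; have [M M0 hM] := sd_bounded h.
have DM u (z : C) : nr z <= 1 -> nr ('D_u f (v + z *: w)) <= M * nr u.
  by move=> z1; exact: (hM z z1).2.
have bT u : nr (taylor k w ('D_u f) v) <= M * nr u.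
  by apply: taylor_bound (DM u); rewrite mulr_ge0 ?nr_ge0 // ltW.
split.
  split; last by exists M.
  move=> c u u'.
  have bm : 0 <= M * (nr u + nr u') by rewrite mulr_ge0 ?addr_ge0 ?nr_ge0 // ltW.
  rewrite [RHS](_ : _ = c * taylor k w ('D_u f) v + taylor k w ('D_u' f) v) //.
  rewrite -(@taylor_lin _ _ _ _ _ _ _ (M * (nr u + nr u'))).
  - apply: eq_taylor => z z1; have [[lL _] _] := h z (eq_ler1 z1); exact: lL.
  - move=> z z1; apply: le_trans (DM _ _ z1) _.
    by rewrite ler_pM2l // lerDl nr_ge0.
  - move=> z z1; apply: le_trans (DM _ _ z1) _.
    by rewrite ler_pM2l // lerDr nr_ge0.
move=> e e0; have [d d0 hd] := sd_uniform e0 h.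
exists d => // x y xv yv.
have sh (x' : V) (z : C) : x' + z *: w - (v + z *: w) = x' - v.
  by rewrite opprD addrACA subrr addr0.
have bd (x' : V) : nr (x' - v) < d -> exists2 m, 0 <= m & forall z : C, nr z <= 1 -> nr (f (x' + z *: w)) <= m.
  move=> x'v; exists ((M + e) * nr (x' - v) + M).
    by rewrite addr_ge0 ?mulr_ge0 ?addr_ge0 ?nr_ge0 // ltW.
  move=> z z1; have := hd z z1 (x' + z *: w) (v + z *: w).
  rewrite subrr nr0 sh => /(_ x'v d0) H.
  have := DM (x' - v) z z1.
  set A := f _ in H *; set B := f _ in H; set D := 'D_(x' - v) _ _ in H * => HD.
  have -> : A = (A - B - D) + (D + B) by ring.
  apply: le_trans (nrD _ _) _; apply: le_trans (lerD H (nrD _ _)) _.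
  have := (hM z z1).1; rewrite -/B; lra.
have [mx mx0 hmx] := bd x xv; have [my my0 hmy] := bd y yv.
have B1 := bdd_taylor k mx0 hmx; have B2 := bdd_taylor k my0 hmy.
have mD : 0 <= M * nr (x - y) by rewrite mulr_ge0 ?nr_ge0 // ltW.
have B3 := @bdd_taylor V k w ('D_(x - y) f) v _ mD (DM (x - y)).
rewrite /taylor -(glimB B1 B2).
have B12 : bdd (fun N => mean N (fun z => f (x + z *: w) * z ^- k) -
    mean N (fun z => f (y + z *: w) * z ^- k)).
  have [m hm] := bddD B1 (bddZ (-1) B2); exists m => N; have := hm N.
  by rewrite mulN1r.
apply: (@glim_near _ _ _ _ 0%N) => // N _.
rewrite -!meanB; apply: mean_bound; first by rewrite mulr_ge0 ?nr_ge0 // ltW.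
move=> z z1; have z1' := eq_ler1 z1.
have -> : f (x + z *: w) * z ^- k - f (y + z *: w) * z ^- k - 'D_(x - y) f (v + z *: w) * z ^- k =
  (f (x + z *: w) - f (y + z *: w) - 'D_(x - y) f (v + z *: w)) * z ^- k by ring.
rewrite nrM nr_pow_circle // mulr1.
have := hd z (eq_ler1 z1) (x + z *: w) (y + z *: w).
rewrite !sh opprD addrACA subrr addr0; exact.
Qed.

Lemma sdiff_invX (z : C) k : z != 0 ->
  sdiff (fun x : C => x ^- k) z (fun h => - (k%:R * z ^- k.+1) * h).
Proof.
move=> z0; elim: k => [|k IH].
  apply: (@sdiff_ext _ _ _ (fun _ : C => 1 : C)).
    by exists 1 => // x _; rewrite expr0 invr1.
  by apply: sdiff_eq (sdiff_cst (1 : C) z) _ => h; rewrite mul0r oppr0 mul0r.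
apply: sdiff_ext (sdiff_eq (sdiffM (sdiff_inv z0) IH) _) => [|h].
  by exists 1 => // x _; rewrite exprS invfM.
by rewrite -natr1 !exprS expr0; field; rewrite z0 expf_neq0.
Qed.

(** Integration by parts on the circle: the average of z times the derivative of f (v + z w)
    z^-(k+1) tends to 0 by [mean_derivative]. *)
Lemma taylor_derive V (k : nat) (w : V) (f : V -> C) (v : V) :
  (forall z : C, nr z <= 1 -> sd f (v + z *: w)) ->
  taylor k w ('D_w f) v = k.+1%:R * taylor k.+1 w f v.
Proof.
move=> h; have [M M0 hM] := sd_bounded h.
have Mw0 : 0 <= M * nr w by rewrite mulr_ge0 ?nr_ge0 // ltW.
have B1 := @bdd_taylor V k w ('D_w f) v _ Mw0 (fun z z1 => (hM z z1).2 w).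
have B2 := @bdd_taylor V k.+1 w f v _ (ltW M0) (fun z z1 => (hM z z1).1).
have B2' := bddZ k.+1%:R B2.
apply/eqP; rewrite -subr_eq0 /taylor -glimZ // -glimB //; apply/eqP.
apply: glim_null.
  have [m hm] := bddD B1 (bddZ (-1) B2'); exists m => N; have := hm N.
  by rewrite mulN1r.
move=> e e0.
pose phi (z : C) := f (v + z *: w) * z ^- k.+1.
pose phi' (z : C) := 'D_w f (v + z *: w) * z ^- k.+1 - k.+1%:R * f (v + z *: w) * z ^- k.+2.
have sphi z : nr z = 1 -> sdiff phi z (fun h => phi' z * h).
  move=> z1; have hz := h z (eq_ler1 z1).
  have sl : sdiff (fun x : C => v + x *: w) z (fun h => h *: w).
    apply: sdiff_eq (sdiffD (sdiff_cst v z) (sdiff_lin z (blin_scalel w (blin_id C)))) _.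
    by move=> x; rewrite add0r.
  apply: sdiff_eq (sdiffM (sdiff_comp sl hz) (sdiff_invX k.+1 (circle_neq0 z1))) _ => x.
  by have [bL _] := hz; rewrite (blinZ _ _ bL) scaleCE /phi'; ring.
have [||d d0 hd] := @circle_uniform R (fun z d => forall z', nr z' = 1 -> nr (z' - z) < d ->
    nr (phi z' - phi z - phi' z * (z' - z)) <= e * nr (z' - z)).
- move=> z d d' d'0 dd' H z' z'1 zz'; apply: H => //; exact: lt_le_trans dd'.
- move=> z z1; have [d d0 hd] := sdiff_local e0 (sphi z z1).
  exists d => // z' zz' z'1 z'' z''1 zz''.
  apply: (hd z' (fun h => phi' z' * h) zz' (sphi z' z'1)) => //.
  by rewrite subrr nr0.
have [N0 hN0] := uroot_cvg1 d0.
exists (maxn N0 3) => N; rewrite geq_max => /andP[/hN0 wd N3].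
rewrite -meanZ -meanB (@eq_mean _ _ _ (fun z => z * phi' z)); last first.
  move=> z z1; have z0 := circle_neq0 z1; rewrite /phi' !exprS.
  by field; rewrite z0 expf_neq0.
by apply: (@mean_derivative _ _ phi phi' _ _ (ltW e0) N3 wd) => z z' z1 z'1; exact: hd.
Qed.

Lemma disc_small V (A : set V) (a w : V) : open A -> A a ->
  exists r, 0 < r /\ exists2 d, 0 < d & forall v, nr (v - a) < d ->
    forall z : C, nr z <= 1 -> A (v + z *: (rc r *: w)).
Proof.
move=> /open_nrP/(_ a) h /h[d d0 hd].
have w1 : 0 < nr w + 1 by rewrite ltr_wpDl ?nr_ge0.
exists (d / 2 / (nr w + 1)); split; first by rewrite !divr_gt0.
exists (d / 2); first by rewrite divr_gt0.
move=> v va z z1; apply: hd; rewrite addrAC; apply: le_lt_trans (nrD _ _) _.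
rewrite !nrZ nr_rc gtr0_norm ?divr_gt0 //.
have : nr z * (d / 2 / (nr w + 1) * nr w) <= d / 2.
  apply: le_trans (_ : 1 * (d / 2 / (nr w + 1) * nr w) <= _).
    by rewrite ler_wpM2r // mulr_ge0 ?nr_ge0 // !divr_ge0 // ltW.
  rewrite mul1r mulrAC ler_pdivrMr // ler_wpM2l ?divr_ge0 ?(ltW d0) //.
  by rewrite lerDl.
lra.
Qed.

(** Up to the factor r, ['D_w f] is a first Taylor coefficient over discs of a fixed size near a,
    and such coefficients are strictly differentiable. Derivatives of all orders follow. *)
Lemma sdiff_derive_fun V (A : set V) (f : V -> C) (w : V) : open A ->
  (forall a, A a -> sd f a) -> forall a, A a ->
  exists r, [/\ 0 < r, forall z : C, nr z <= 1 -> A (a + z *: (rc r *: w)) &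
    sdiff ('D_w f) a (fun u => rc r^-1 * taylor 1 (rc r *: w) ('D_u f) a)].
Proof.
move=> oA hf a Aa; have [r [r0 [d d0 hd]]] := disc_small w oA Aa.
have rn : rc r != 0 by apply/eqP => E; move: (nr_rc r); rewrite E nr0 gtr0_norm //; lra.
have aa : nr (a - a) < d by rewrite subrr nr0.
exists r; split => //; first exact: hd.
apply: sdiff_ext (sdiffZ (rc r^-1) (taylor_sdiff 1 (fun z z1 => hf _ (hd a aa z z1)))).
exists d => // v va.
have hv z (z1 : nr z <= 1) := hf _ (hd v va z z1).
rewrite taylor1 // scaleCE.
have := hv 0; rewrite nr0 scale0r addr0 => /(_ ler01)[bL _].
by rewrite (blinZ _ _ bL) scaleCE mulrA -rcM mulVf ?gt_eqF // mul1r.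
Qed.

Lemma sd_derive V (A : set V) (f : V -> C) (w : V) : open A ->
  (forall a, A a -> sd f a) -> forall a, A a -> sd ('D_w f) a.
Proof.
move=> oA hf a Aa; have [r [_ _ h]] := sdiff_derive_fun w oA hf Aa.
exact: sdiff_sd h.
Qed.

(** Differentiating in direction u the Taylor coefficient that represents ['D_w f] gives the first
    Taylor coefficient of ['D_u f] along w. *)
Lemma derive_comm V (A : set V) (f : V -> C) (u w : V) : open A ->
  (forall a, A a -> sd f a) -> forall a, A a ->
  'D_u ('D_w f) a = 'D_w ('D_u f) a.
Proof.
move=> oA hf a Aa; have [r [r0 hr h]] := sdiff_derive_fun w oA hf Aa.
have E1 := sdiff_derive u h.
have sDu (z : C) (z1 : nr z <= 1) : sd ('D_u f) (a + z *: (rc r *: w)).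
  exact: (@sd_derive V A f u oA hf _ (hr z z1)).
have E2 := @taylor1 V ('D_u f) a (rc r *: w) sDu.
have [bL _] := @sd_derive V A f u oA hf a Aa.
have E3 : 'D_(rc r *: w) ('D_u f) a = rc r * 'D_w ('D_u f) a := blinZ (rc r) w bL.
apply: etrans E1 _; apply: etrans (congr1 (fun t => rc r^-1 * t) (etrans E2 E3)) _.
by move: ('D_w ('D_u f) a) => t; rewrite mulrA -rcM mulVf ?gt_eqF // mul1r.
Qed.

Lemma taylorZ V (k : nat) (w : V) (f : V -> C) (v : V) (c : C) M :
  (forall z : C, nr z <= 1 -> nr (f (v + z *: w)) <= M) ->
  taylor k w (fun x => c * f x) v = c * taylor k w f v.
Proof.
move=> hf; have M0 : 0 <= M by apply: le_trans (nr_ge0 _) (hf 0 _); rewrite nr0.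
rewrite /taylor -glimZ; last exact: bdd_taylor hf.
by congr glim; apply/funext => N; rewrite -meanZ; apply: eq_mean => z _; rewrite mulrA.
Qed.

Lemma sd_iter_derive V (A : set V) (f : V -> C) (w : V) k : open A ->
  (forall a, A a -> sd f a) ->
  forall a, A a -> sd (iter k (fun f : V -> C => 'D_w f) f) a.
Proof.
move=> oA hf; elim: k => [//|k IH] a Aa /=.
exact: (@sd_derive V A (iter k (fun f : V -> C => 'D_w f) f) w oA IH a Aa).
Qed.

(** All derivatives along w are read off one disc, so that [taylor_bound] yields Cauchy's bounds k!
    M / r^k without shrinking the domain at each order. *)
Lemma iter_derive_taylor V (A : set V) (w : V) (r : R) (k : nat) (a : V) (f : V -> C) :
  open A -> 0 < r ->
  (forall z : C, nr z <= 1 -> A (a + z *: (rc r *: w))) ->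
  (forall a, A a -> sd f a) ->
  iter k (fun f : V -> C => 'D_w f) f a = k`!%:R * (rc r^-1) ^+ k * taylor k (rc r *: w) f a.
Proof.
move=> oA r0 hr; elim: k f => [|k IH] f hf.
  by rewrite /= fact0 expr0 !mul1r taylor0 // => z z1; apply: hf; exact: hr.
have hf' z (z1 : nr z <= 1) := hf _ (hr z z1).
rewrite iterSr IH; last by move=> b Ab; exact: (@sd_derive V A f w oA hf b Ab).
have [M M0 hM] := sd_bounded hf'.
have -> : taylor k (rc r *: w) ('D_w f) a =
    taylor k (rc r *: w) (fun x => rc r^-1 * 'D_(rc r *: w) f x) a.
  apply: eq_taylor => z z1; have [bL _] := hf' z (eq_ler1 z1).
  by rewrite (blinZ _ _ bL) scaleCE mulrA -rcM mulVf ?gt_eqF // mul1r.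
rewrite (@taylorZ _ _ _ _ _ _ (M * nr (rc r *: w))); last by move=> z z1; exact: (hM z z1).2.
rewrite taylor_derive // factS natrM exprSr; ring.
Qed.

Lemma open_ball_nr V (a : V) d : open [set x : V | nr (x - a) < d].
Proof.
apply/open_nrP => x /= xa; exists (d - nr (x - a)); first by rewrite subr_gt0.
by move=> y yx; apply: le_lt_trans (nr_tri x _ _) _; lra.
Qed.

Lemma cauchy_estimate V (f : V -> C) (a z w : V) rho rho' M : rho' < rho ->
  (forall x, nr (x - a) < rho -> sd f x) ->
  (forall x, nr (x - a) < rho -> nr (f x) <= M) ->
  nr (z - a) < rho' -> nr ('D_w f z) <= 2 * M * nr w / (rho - rho').
Proof.
move=> rr hf hM za; have dz : nr (z - a) < rho by exact: lt_trans rr.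
have [bL _] := hf z dz; have [->|w0] := eqVneq w 0.
  by rewrite (blin0 bL) !nr0 mulr0 mul0r.
have wp := nr_gt0 w0; have d0 : 0 < rho - rho' by rewrite subr_gt0.
(* The disc of center z spanned by r w has radius (rho - rho') / 2 and stays inside the ball of
   radius rho. *)
pose r := (rho - rho') / (2 * nr w).
have r0 : 0 < r by rewrite divr_gt0 // mulr_gt0.
have rw : nr (rc r *: w) = (rho - rho') / 2.
  by rewrite nrZ nr_rc gtr0_norm // /r; field; rewrite gt_eqF.
have disc (x : C) : nr x <= 1 -> nr (z + x *: (rc r *: w) - a) < rho.
  move=> x1; rewrite addrAC; apply: le_lt_trans (nrD _ _) _; rewrite (nrZ x) rw.
  have : nr x * ((rho - rho') / 2) <= 1 * ((rho - rho') / 2).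
    by rewrite ler_wpM2r // divr_ge0 // ltW.
  lra.
have M0 : 0 <= M by exact: le_trans (nr_ge0 _) (hM z dz).
have T := taylor1 (fun x x1 => hf _ (disc x x1)).
have := taylor_bound 1 M0 (fun x x1 => hM _ (disc x x1)).
rewrite T (blinZ _ _ bL) nrZ nr_rc gtr0_norm // mulrC -ler_pdivlMr // => H.
apply: le_trans H _; rewrite le_eqVlt; apply/orP; left; apply/eqP.
by rewrite /r; field; rewrite !gt_eqF.
Qed.

(** Cauchy's estimate and the mean value inequality are each used twice, for [f] and for ['D_w f],
    on the radii rho, rho / 2 and rho / 4; whence 32 = 2 . 4 . 4. The constant depends on [M] and
    [rho] only, hence is common to all functions with the same bound. *)
Lemma quantitative_sdiff V (f : V -> C) (a x y : V) rho d M : 0 < rho -> d <= rho / 4 ->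
  (forall x, nr (x - a) < rho -> sd f x) ->
  (forall x, nr (x - a) < rho -> nr (f x) <= M) ->
  nr (x - a) < d -> nr (y - a) < d ->
  nr (f x - f y - 'D_(x - y) f a) <= 32 * M / rho ^+ 2 * d * nr (x - y).
Proof.
move=> rho0 dr hf hM xd yd.
have d0 : 0 < d by exact: le_lt_trans (nr_ge0 _) xd.
have aa : nr (a - a) < rho by rewrite subrr nr0.
have [bL _] := hf a aa.
have M0 : 0 <= M by exact: le_trans (nr_ge0 _) (hM a aa).
set w := x - y.
have -> : f x - f y - 'D_w f a = (f x - 'D_x f a) - (f y - 'D_y f a).
  have -> : 'D_w f a = 'D_x f a - 'D_y f a by exact: (blinB x y bL).
  by move: ('D_x f a) ('D_y f a) (f x) (f y) => *; ring.
have sg z : nr (z - a) < d -> sdiff (fun z => f z - 'D_z f a) z (fun u => 'D_u f z - 'D_u f a).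
  move=> zd; have zr : nr (z - a) < rho by lra.
  exact: sdiffB (hf z zr) (sdiff_lin z bL).
apply: (@mean_value_sdiff _ _ (fun z => f z - 'D_z f a)) => t t01.
  exact: sdiff_sd (sg _ (convex_ball t01 xd yd)).
have zd := convex_ball t01 xd yd; set z := y + _ in zd *.
rewrite (sdiff_derive _ (sg z zd)) -/w.
have sD b : nr (b - a) < rho / 2 -> sd ('D_w f) b.
  move=> bd; apply: (@sd_derive V _ f w (open_ball_nr a rho) hf b) => /=; lra.
have hD b : nr (b - a) < rho / 2 -> nr ('D_w f b) <= 4 * M * nr w / rho.
  move=> bd; have r2 : rho / 2 < rho by lra.
  apply: le_trans (cauchy_estimate w r2 hf hM bd) _.
  by rewrite le_eqVlt; apply/orP; left; apply/eqP; field; rewrite gt_eqF.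
have r4 : rho / 4 < rho / 2 by lra.
have ad : nr (a - a) < rho / 4 by rewrite subrr nr0 divr_gt0.
have zd4 : nr (z - a) < rho / 4 by lra.
apply: (@mean_value_sdiff _ _ ('D_w f)) => s s01.
  by apply: sD; have := convex_ball s01 zd4 ad; lra.
apply: le_trans (cauchy_estimate (z - a) r4 sD hD (convex_ball s01 zd4 ad)) _.
have -> : 2 * (4 * M * nr w / rho) * nr (z - a) / (rho / 2 - rho / 4) =
    32 * M / rho ^+ 2 * nr (z - a) * nr w.
  rewrite (_ : rho / 2 - rho / 4 = rho / 4); last by field.
  by field; rewrite gt_eqF.
rewrite ler_wpM2r ?nr_ge0 // ler_wpM2l ?(ltW zd) //.
by apply: divr_ge0; [apply: mulr_ge0 | exact: sqr_ge0].
Qed.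

(** Weierstrass's theorem on limits of holomorphic functions, for the generalized limit: the strict
    estimates have common constants by [quantitative_sdiff] and pass to the limit. *)
Lemma sdiff_glim V (P : nat -> V -> C) (f : V -> C) (a : V) rho M : 0 < rho ->
  (forall N x, nr (x - a) < rho -> sd (P N) x) ->
  (forall N x, nr (x - a) < rho -> nr (P N x) <= M) ->
  (forall x, nr (x - a) < rho -> f x = glim (fun N => P N x)) ->
  sdiff f a (fun u => glim (fun N => 'D_u (P N) a)).
Proof.
move=> rho0 hP hM hf.
have aa : nr (a - a) < rho by rewrite subrr nr0.
have M0 : 0 <= M by exact: le_trans (nr_ge0 _) (hM 0%N a aa).
have hD N u : nr ('D_u (P N) a) <= 4 * M * nr u / rho.
  have r2 : rho / 2 < rho by lra.
  apply: le_trans (cauchy_estimate u r2 (hP N) (hM N) (_ : nr (a - a) < _)) _.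
    by rewrite subrr nr0 divr_gt0.
  by rewrite le_eqVlt; apply/orP; left; apply/eqP; field; rewrite gt_eqF.
have bD u : bdd (fun N => 'D_u (P N) a) by exists (4 * M * nr u / rho).
split.
  split.
    move=> c u v; rewrite scaleCE -glim_lin //; congr glim; apply/funext => N.
    by have [[lL _] _] := hP N a aa; rewrite lL.
  exists (4 * (M + 1) / rho); first by rewrite divr_gt0 // mulr_gt0 // ltr_wpDl.
  move=> u; apply: (@glim_bound _ _ _ 0%N) => // N _; apply: le_trans (hD N u) _.
  rewrite mulrAC ler_wpM2r ?nr_ge0 // ler_wpM2r ?invr_ge0 ?(ltW rho0) //; lra.
move=> e e0; pose K := 32 * M / rho ^+ 2.
have K0 : 0 <= K by apply: divr_ge0; [apply: mulr_ge0 | exact: sqr_ge0].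
pose d := Num.min (rho / 4) (e / (K + 1)).
have K1 : 0 < K + 1 by rewrite ltr_wpDl.
have d0 : 0 < d by rewrite lt_min !divr_gt0.
have d4 : d <= rho / 4 by rewrite ge_min lexx.
have de : K * d <= e.
  have : d <= e / (K + 1) by rewrite ge_min lexx orbT.
  rewrite ler_pdivlMr // => H; apply: le_trans H; rewrite mulrC ler_wpM2l ?(ltW d0) //.
  by rewrite lerDl.
exists d => // x y xd yd.
have xr : nr (x - a) < rho by lra.
have yr : nr (y - a) < rho by lra.
have bP z : nr (z - a) < rho -> bdd (fun N => P N z) by move=> zr; exists M => N; exact: hM.
rewrite (hf x xr) (hf y yr) -(glimB (bP x xr) (bP y yr)).
apply: (@glim_near _ (fun N => P N x - P N y) (fun N => 'D_(x - y) (P N) a) _ 0%N) => //.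
  have [m hm] := bddD (bP x xr) (bddZ (-1) (bP y yr)).
  by exists m => N; have := hm N; rewrite mulN1r.
move=> N _; apply: le_trans (quantitative_sdiff rho0 d4 (hP N) (hM N) xd yd) _.
by rewrite ler_wpM2r ?nr_ge0.
Qed.

End TaylorCoefficients.

(** * The inverse function theorem *)

Section InverseFunction.
Variable R : realType.
Local Notation C := (Cplx R).
Local Notation rc := (@rc R).
Implicit Types V W : normedModType C.

(* Completeness, in the only form that fixed point iteration needs. *)
Definition geometrically_complete V := forall (u : nat -> V) (c : R), 0 <= c ->
  (forall n, nr (u n.+1 - u n) <= c / 2 ^+ n) ->
  exists l, forall n, nr (l - u n) <= 2 * c / 2 ^+ n.

Lemma geometric_dist V (u : nat -> V) (c : R) : 0 <= c ->
  (forall n, nr (u n.+1 - u n) <= c / 2 ^+ n) ->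
  forall n m, (n <= m)%N -> nr (u m - u n) <= 2 * c / 2 ^+ n.
Proof.
move=> c0 h n m /subnKC <-; set p := (m - n)%N.
suff : nr (u (n + p)%N - u n) <= 2 * c / 2 ^+ n - 2 * c / 2 ^+ (n + p).
  move=> H; apply: le_trans H _; rewrite lerBlDr lerDl.
  by rewrite divr_ge0 ?mulr_ge0 // exprn_ge0.
elim: p => [|p IH]; first by rewrite addn0 !subrr nr0.
apply: le_trans (nr_tri (u (n + p)%N) _ _) _; rewrite addnS.
apply: le_trans (lerD (h _) IH) _.
have -> : 2 * c / 2 ^+ (n + p).+1 = c / 2 ^+ (n + p).
  by rewrite exprS invfM; field; rewrite expf_neq0.
lra.
Qed.

(** The generalized limit exists as soon as the sequence is bounded, and the geometric distances
    show that it is the actual limit. *)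
Lemma geometrically_complete_C : geometrically_complete C.
Proof.
move=> u c c0 h; have hd := geometric_dist c0 h.
have bu : bdd u.
  exists (nr (u 0%N) + 2 * c) => n; rewrite -[u n](subrK (u 0%N)).
  apply: le_trans (nrD _ _) _; rewrite addrC lerD2l.
  by have := hd 0%N n (leq0n n); rewrite expr0 divr1.
exists (glim u) => n; rewrite -(glim_cst (u n)).
apply: (@glim_near _ _ _ _ n) => //; first exact: bdd_cst.
by move=> m nm; exact: hd.
Qed.

Lemma geometrically_complete_row m : geometrically_complete 'rV[C]_m.
Proof.
move=> u c c0 h.
have hj j : exists l, forall n, nr (l - u n 0 j) <= 2 * c / 2 ^+ n.
  apply: geometrically_complete_C => // n; apply: le_trans (h n).
  by have := nr_coord (u n.+1 - u n) j; rewrite !mxE.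
have [l hl] := choice hj; exists (\row_j l j) => n; apply: nr_rowP => [|j].
  by rewrite divr_ge0 ?mulr_ge0 // exprn_ge0.
by rewrite !mxE.
Qed.

Lemma geometrically_complete_pair V W : geometrically_complete V ->
  geometrically_complete W -> geometrically_complete (V * W)%type.
Proof.
move=> cV cW u c c0 h.
have [|l hl] := cV (fun n => (u n).1) c c0.
  by move=> n; apply: le_trans (h n); exact: (nr_pairl (u n.+1 - u n)).
have [|l' hl'] := cW (fun n => (u n).2) c c0.
  by move=> n; apply: le_trans (h n); exact: (nr_pairr (u n.+1 - u n)).
exists (l, l') => n; case: (u n) (hl n) (hl' n) => v w /= h1 h2.
by rewrite (_ : _ - _ = (l - v, l' - w)) // nr_pair ge_max h1.
Qed.

Section Perturbation.
Variables (V W : normedModType C) (Phi : V -> W) (a : V) (L : V -> W) (L' : W -> V).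
Variables (K e rho : R).
Hypotheses (bL : blin L) (bL' : blin L') (L'L : forall v, L' (L v) = v)
  (LL' : forall w, L (L' w) = w) (K0 : 0 < K) (hK : forall w, nr (L' w) <= K * nr w)
  (Ke : K * e <= 1 / 2).
Hypothesis near_L : forall x y, nr (x - a) < rho -> nr (y - a) < rho ->
  nr (Phi x - Phi y - L (x - y)) <= e * nr (x - y).

(** [L'] inverts [L] and the difference Phi - L has Lipschitz constant e, so x |-> x - L' (Phi x)
    contracts with ratio K e <= 1/2. *)
Lemma perturbation_contract x y : nr (x - a) < rho -> nr (y - a) < rho ->
  nr (x - y - L' (Phi x - Phi y)) <= nr (x - y) / 2.
Proof using bL' L'L K0 hK Ke near_L.
move=> xr yr; rewrite -{1}(L'L (x - y)) -(blinB _ _ bL') -nrN -(blinN _ bL') opprB.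
apply: le_trans (hK _) _; apply: le_trans (ler_wpM2l (ltW K0) (near_L xr yr)) _.
by have := ler_wpM2r (nr_ge0 (x - y)) Ke; lra.
Qed.

Lemma perturbation_inj x y : nr (x - a) < rho -> nr (y - a) < rho ->
  nr (x - y) <= 2 * K * nr (Phi x - Phi y).
Proof using bL' L'L K0 hK Ke near_L.
move=> xr yr; have H := perturbation_contract xr yr.
have := nrD (x - y - L' (Phi x - Phi y)) (L' (Phi x - Phi y)); rewrite subrK.
by have := hK (Phi x - Phi y); lra.
Qed.

(** Solutions of Phi x = y are the fixed points of T x = x - L' (Phi x - y). The iteration started
    at a first moves by at most c = K |Phi a - y|, hence by at most 2 c < rho in all. *)
Lemma perturbation_surj y : geometrically_complete V ->
  nr (y - Phi a) < rho / (4 * K) -> exists2 x, nr (x - a) < rho & Phi x = y.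
Proof.
move=> cV hy; pose T x := x - L' (Phi x - y).
pose c := K * nr (Phi a - y).
have c0 : 0 <= c by rewrite mulr_ge0 ?nr_ge0 // ltW.
have cr : 4 * c < rho.
  by move: hy; rewrite nrBC ltr_pdivlMr ?mulr_gt0 // /c; lra.
pose u n := iter n T a.
have TT x x' : nr (x - a) < rho -> nr (x' - a) < rho -> nr (T x - T x') <= nr (x - x') / 2.
  move=> xr xr'; have -> : T x - T x' = x - x' - L' (Phi x - Phi x').
    have <- : L' (Phi x - y) - L' (Phi x' - y) = L' (Phi x - Phi x').
      by rewrite -(blinB _ _ bL') opprB addrA subrK.
    by rewrite /T !opprD !opprK addrACA.
  exact: perturbation_contract.
have inv n : nr (u n - a) <= 2 * c * (1 - (2 ^+ n)^-1) /\ nr (u n.+1 - u n) <= c / 2 ^+ n.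
  elim: n => [|n [IH1 IH2]].
    rewrite /u /= subrr nr0 expr0 invr1 subrr mulr0 mulr1; split => //.
    by rewrite /T addrAC subrr add0r nrN; exact: hK.
  have p0 : 0 < (2 ^+ n)^-1 :> R by rewrite invr_gt0 exprn_gt0.
  have E : (2 ^+ n.+1)^-1 = (2 ^+ n)^-1 / 2 :> R by rewrite exprS invfM mulrC.
  have h1 : nr (u n.+1 - a) <= 2 * c * (1 - (2 ^+ n.+1)^-1).
    apply: le_trans (nr_tri (u n) _ _) _; rewrite E.
    by move: (2 ^+ n)^-1 p0 IH1 IH2 => q; lra.
  split => //; rewrite E mulrA; apply: le_trans (TT _ _ _ _) _.
  - apply: le_lt_trans h1 _; rewrite E; move: (2 ^+ n)^-1 p0 => q q0.
    have : 0 <= c * q by rewrite mulr_ge0 // ltW.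
    lra.
  - apply: le_lt_trans IH1 _; move: (2 ^+ n)^-1 p0 => q q0.
    have : 0 <= c * q by rewrite mulr_ge0 // ltW.
    lra.
  - by rewrite ler_pM2r ?invr_gt0.
have [l hl] := cV u c c0 (fun n => (inv n).2).
have lr : nr (l - a) < rho by have := hl 0%N; rewrite expr0 divr1 /u /=; lra.
exists l => //.
have ur n : nr (u n - a) < rho.
  apply: le_lt_trans (inv n).1 _.
  have q0 : 0 < (2 ^+ n)^-1 :> R by rewrite invr_gt0 exprn_gt0.
  have : 0 <= c * (2 ^+ n)^-1 by rewrite mulr_ge0 // ltW.
  lra.
have Tl n : nr (T l - l) <= 4 * c / 2 ^+ n.
  apply: le_trans (nr_tri (u n.+1) _ _) _.
  have h1 := TT l (u n) lr (ur n); have h2 := hl n; have h3 := hl n.+1.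
  rewrite (nrBC (u n.+1)); have E : T (u n) = u n.+1 by [].
  have E2 : (2 ^+ n.+1)^-1 = (2 ^+ n)^-1 / 2 :> R by rewrite exprS invfM mulrC.
  have q0 : 0 <= c / 2 ^+ n by rewrite divr_ge0 // exprn_ge0.
  rewrite E in h1; rewrite E2 in h3.
  by move: (2 ^+ n)^-1 q0 h1 h2 h3 => q; lra.
have T0 : nr (T l - l) <= 0.
  apply/ler_addgt0Pr => eps eps0; rewrite add0r.
  have b0 : 0 <= 4 * c / eps by apply: divr_ge0; [apply: mulr_ge0 | exact: ltW].
  pose n := Num.bound (4 * c / eps); apply: le_trans (Tl n) _.
  rewrite ler_pdivrMr ?exprn_gt0 // [eps * _]mulrC -ler_pdivrMr //.
  apply: le_trans (ltW (archi_boundP b0)) _.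
  by rewrite -/n -natrX ler_nat ltnW // ltn_expl.
have : L' (Phi l - y) = 0.
  by have := nr_le0 T0; rewrite /T addrAC subrr add0r => /eqP; rewrite oppr_eq0 => /eqP.
move=> E; apply/eqP; rewrite -subr_eq0 -(LL' (Phi l - y)) E.
by rewrite (blin0 bL).
Qed.

End Perturbation.

(** [L] is itself a perturbation of [L0] on balls of any size: the nonlinear statements, applied at
    0 with a radius adapted to the given vectors, show that it is bijective with bounded inverse. *)
Lemma perturbed_inverse V W (L0 L0' : _) (L : V -> W) (K e : R) :
  geometrically_complete V -> @blin R V W L0 -> @blin R W V L0' ->
  (forall v, L0' (L0 v) = v) -> (forall w, L0 (L0' w) = w) -> 0 < K ->
  (forall w, nr (L0' w) <= K * nr w) -> K * e <= 1 / 2 -> blin L ->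
  (forall v, nr (L v - L0 v) <= e * nr v) ->
  exists L' : W -> V, [/\ blin L', forall v, L' (L v) = v, forall w, L (L' w) = w &
    forall w, nr (L' w) <= 2 * K * nr w].
Proof.
move=> cV bL0 bL0' L'L LL' K0 hK Ke bL hL.
have nL rho (x y : V) : nr (x - 0) < rho -> nr (y - 0) < rho ->
    nr (L x - L y - L0 (x - y)) <= e * nr (x - y).
  by move=> _ _; rewrite -(blinB _ _ bL).
have inj (x y : V) : nr (x - y) <= 2 * K * nr (L x - L y).
  have := @perturbation_inj V W L 0 L0 L0' K e (nr x + nr y + 1) bL0' L'L K0 hK Ke (nL _).
  by apply; rewrite subr0; have := nr_ge0 x; have := nr_ge0 y; lra.
have surj w : exists x, L x = w.
  have [||x _ <-] := @perturbation_surj V W L 0 L0 L0' K e (4 * K * (nr w + 1)) bL0 bL0' L'L LL' K0 hK Ke (nL _) w => //.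
    rewrite (blin0 bL) subr0 mulrAC divff ?gt_eqF ?mulr_gt0 // mul1r.
    by rewrite ltrDl.
  by exists x.
have [L' hL'] := choice surj.
have Linj x y : L x = L y -> x = y.
  move=> E; have := inj x y; rewrite E subrr nr0 mulr0 => /nr_le0/eqP.
  by rewrite subr_eq0 => /eqP.
have bd w : nr (L' w) <= 2 * K * nr w.
  by have := inj (L' w) 0; rewrite hL' (blin0 bL) !subr0.
exists L'; split => //; last by move=> v; apply: Linj; rewrite hL'.
split; last by exists (2 * K) => //; rewrite mulr_gt0.
move=> c u v; apply: Linj; rewrite hL' (blinD _ _ bL) (blinZ _ _ bL) !hL'.
by [].
Qed.

(** Near a the derivative of [Phi] is close to [L], hence invertible by [perturbed_inverse]; this
    gives strict differentiability of the inverse on a whole ball and not only at Phi a. *)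
Lemma inverse_function V W (Phi : V -> W) (a : V) L L' rho0 :
  geometrically_complete V -> 0 < rho0 ->
  (forall x, nr (x - a) < rho0 -> sd Phi x) -> sdiff Phi a L -> blin L' ->
  (forall v, L' (L v) = v) -> (forall w, L (L' w) = w) ->
  exists rho kappa (tau : W -> V), [/\ 0 < rho <= rho0, 0 < kappa &
    [/\ forall y, nr (y - Phi a) < kappa -> nr (tau y - a) < rho /\ Phi (tau y) = y,
       forall x y, nr (x - a) < rho -> nr (y - a) < rho -> Phi x = Phi y -> x = y &
       forall y, nr (y - Phi a) < kappa -> sd tau y]].
Proof.
move=> cV r00 hPhi [bL hL] bL' L'L LL'.
have [_ [K K0 hK]] := bL'.
pose e := (2 * K)^-1; have e0 : 0 < e by rewrite invr_gt0 mulr_gt0.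
have Ke : K * e <= 1 / 2.
  by rewrite /e invfM mulrCA divff ?gt_eqF // mulr1 mul1r.
have [d d0 hd] := hL e e0.
pose rho := Num.min d rho0; have rp : 0 < rho by rewrite lt_min d0.
have rd : rho <= d by rewrite ge_min lexx.
have rr : rho <= rho0 by rewrite ge_min lexx orbT.
have nL x y : nr (x - a) < rho -> nr (y - a) < rho ->
    nr (Phi x - Phi y - L (x - y)) <= e * nr (x - y).
  by move=> xr yr; apply: hd; exact: lt_le_trans rd.
have inj := @perturbation_inj V W Phi a L L' K e rho bL' L'L K0 hK Ke nL.
have surj := @perturbation_surj V W Phi a L L' K e rho bL bL' L'L LL' K0 hK Ke nL _ cV.
pose kappa := rho / (4 * K); have k0 : 0 < kappa by rewrite divr_gt0 // mulr_gt0.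
have ex y : exists x, nr (y - Phi a) < kappa -> nr (x - a) < rho /\ Phi x = y.
  have [hy|hy] := ltP (nr (y - Phi a)) kappa; last by exists a.
  by have [x xr xy] := surj y hy; exists x.
have [tau htau] := choice ex.
exists rho, kappa, tau; split; first by rewrite rp.
  by [].
split => //.
  move=> x y xr yr E; have := inj x y xr yr; rewrite E subrr nr0 mulr0 => /nr_le0/eqP.
  by rewrite subr_eq0 => /eqP.
move=> y hy; have [tr ty] := htau y hy.
have hx := hPhi (tau y) (lt_le_trans tr rr).
have [bLx hLx] := hx.
have hLxL := sdiff_near hd (proj1 bL) (lt_le_trans tr rd) hx.
have [Lx' [bLx' Lx'L LLx' bd]] := perturbed_inverse cV bL bL' L'L LL' K0 hK Ke bLx hLxL.
apply: (@sdiff_sd _ _ _ _ _ Lx'); split => // eps eps0.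
have K2 : 0 < 2 * K by rewrite mulr_gt0.
(* The inverse derivative costs a factor 2 K and the Lipschitz bound of [tau] another one, whence
   eps / (2 K)^2. *)
have [d1 d10 hd1] := hLx _ (divr_gt0 eps0 (mulr_gt0 K2 K2)).
exists (Num.min (kappa - nr (y - Phi a)) (d1 / (2 * K))).
  by rewrite lt_min subr_gt0 hy divr_gt0.
have near_y z : nr (z - y) < kappa - nr (y - Phi a) -> nr (z - Phi a) < kappa.
  by move=> zy; apply: le_lt_trans (nr_tri y _ _) _; lra.
move=> y1 y2; rewrite !lt_min => /andP[/near_y h1 h1'] /andP[/near_y h2 h2'].
have [t1 E1] := htau _ h1; have [t2 E2] := htau _ h2.
have lip z1 z2 : nr (z1 - Phi a) < kappa -> nr (z2 - Phi a) < kappa ->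
    nr (tau z1 - tau z2) <= 2 * K * nr (z1 - z2).
  move=> k1 k2; have [s1 F1] := htau _ k1; have [s2 F2] := htau _ k2.
  by rewrite -{2}F1 -{2}F2; exact: inj.
have c1 : nr (tau y1 - tau y) < d1.
  by apply: le_lt_trans (lip _ _ h1 hy) _; rewrite mulrC -ltr_pdivlMr.
have c2 : nr (tau y2 - tau y) < d1.
  by apply: le_lt_trans (lip _ _ h2 hy) _; rewrite mulrC -ltr_pdivlMr.
have := hd1 _ _ c1 c2; rewrite E1 E2 => H.
rewrite -{1}(Lx'L (tau y1 - tau y2)) -(blinB _ _ bLx') -nrN -(blinN _ bLx') opprB.
apply: le_trans (bd _) _; apply: le_trans (ler_wpM2l (ltW K2) H) _.
apply: le_trans (ler_wpM2l (ltW K2) (ler_wpM2l _ (lip _ _ h1 h2))) _.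
  by rewrite divr_ge0 // ltW // mulr_gt0.
rewrite le_eqVlt; apply/orP; left; apply/eqP; field; by rewrite gt_eqF.
Qed.

Lemma sdiff_inj V W (Phi : V -> W) (a : V) L L' :
  sdiff Phi a L -> blin L' -> (forall v, L' (L v) = v) ->
  exists2 rho, 0 < rho & forall x y, nr (x - a) < rho -> nr (y - a) < rho ->
    Phi x = Phi y -> x = y.
Proof.
move=> [bL hL] bL' L'L; have [_ [K K0 hK]] := bL'.
pose e := (2 * K)^-1; have e0 : 0 < e by rewrite invr_gt0 mulr_gt0.
have Ke : K * e <= 1 / 2.
  by rewrite /e invfM mulrCA divff ?gt_eqF // mulr1 mul1r.
have [d d0 hd] := hL e e0; exists d => // x y xd yd E.
have := @perturbation_inj V W Phi a L L' K e d bL' L'L K0 hK Ke hd x y xd yd.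
by rewrite E subrr nr0 mulr0 => /nr_le0/eqP; rewrite subr_eq0 => /eqP.
Qed.

End InverseFunction.

(** * Double integration from Q = 0 along rays *)

Section Rays.
Variable R : realType.
Local Notation C := (Cplx R).
Local Notation rc := (@rc R).

Lemma is_derive_expRM (c k x : R) :
  is_derive x 1 (fun x => c * expR (k * x)) (c * k * expR (k * x)).
Proof.
apply/is_derive_epsP => e e0.
have c1 : 0 < `|c| + 1 by rewrite ltr_wpDl.
have k1 : 0 < `|k| + 1 by rewrite ltr_wpDl.
have e1 : 0 < e / (`|c| + 1) / (`|k| + 1) by rewrite !divr_gt0.
have /is_derive_epsP/(_ _ e1)[d d0 hd] := is_derive_expR (k * x).
exists (d / (`|k| + 1)); first by rewrite divr_gt0.
move=> y yx.
have h1 : `|k * y - k * x| <= (`|k| + 1) * `|y - x|.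
  by rewrite -mulrBr normrM ler_wpM2r // lerDl.
have h2 : `|k * y - k * x| < d.
  by apply: le_lt_trans h1 _; rewrite mulrC -ltr_pdivlMr.
have -> : c * expR (k * y) - c * expR (k * x) - (y - x) * (c * k * expR (k * x)) =
  c * (expR (k * y) - expR (k * x) - (k * y - k * x) * expR (k * x)) by ring.
rewrite normrM; apply: le_trans (ler_wpM2l (normr_ge0 _) (hd _ h2)) _.
apply: (@le_trans _ _ ((`|c| + 1) * (e / (`|c| + 1) / (`|k| + 1) * ((`|k| + 1) * `|y - x|)))).
  apply: ler_pM => //; first by rewrite mulr_ge0 // ltW.
    by rewrite lerDl.
  by rewrite ler_pM2l.
by rewrite le_eqVlt; apply/orP; left; apply/eqP; field; rewrite !gt_eqF.
Qed.

(** No bound on [g1] is assumed. Below y it varies by at most (c / k) e^(k y); a larger value of |g1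
    y| would make [g] grow linearly as s -> -oo, although [g] tends to 0. Once [g1] is bounded, a
    second integration gives the factor 1 / k^2. *)
Lemma ray_double_integral (g g1 g2 : R -> C) (b c k : R) : 0 <= c -> 0 < k ->
  (forall s, s <= b -> rderiv g s (g1 s)) ->
  (forall s, s <= b -> rderiv g1 s (g2 s)) ->
  (forall s, s <= b -> nr (g2 s) <= c * expR (k * s)) ->
  (forall e, 0 < e -> exists B, forall s, s <= B -> nr (g s) <= e) ->
  forall s, s <= b -> nr (g s) <= c / k ^+ 2 * expR (k * s).
Proof.
move=> c0 k0 hg hg1 hg2 lim0 s sb.
have ck0 : 0 <= c / k by rewrite divr_ge0 // ltW.
have step1 x y : x <= y -> y <= b -> nr (g1 y - g1 x) <= c / k * expR (k * y).
  move=> xy yb.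
  have := @mean_value R g1 g2 (fun z => c / k * expR (k * z)) (fun z => c / k * k * expR (k * z)) x y xy.
  have le z : x <= z <= y -> z <= b by case/andP=> _ /le_trans; apply.
  move=> H; apply: le_trans (H _ _ _) _.
  - by move=> z /le; exact: hg1.
  - by move=> z _; exact: is_derive_expRM.
  - by move=> z /le zb; rewrite divfK ?gt_eqF // hg2.
  by rewrite lerBlDr lerDl mulr_ge0 ?expR_ge0.
have step2 y : y <= b -> nr (g1 y) <= c / k * expR (k * y).
  move=> yb; set C0 := c / k * expR (k * y).
  have [B hB] := lim0 1 ltr01.
  apply/ler_addgt0Pr => e e0.
  (* The point x chosen below y lies at distance at least [T], long enough for the bounded values of
     [g] to contribute at most e to the mean slope. *)
  pose T := Num.max 1 ((nr (g y) + 1) / e).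
  have T1 : 1 <= T by rewrite le_max lexx.
  have T0 : 0 < T by exact: lt_le_trans ltr01 T1.
  have Te : (nr (g y) + 1) <= T * e by rewrite -ler_pdivrMr // le_max lexx orbT.
  pose x := Num.min B (y - T).
  have xB : x <= B by rewrite ge_min lexx.
  have xT : x <= y - T by rewrite ge_min lexx orbT.
  have xy : x <= y by lra.
  have le z : x <= z <= y -> z <= b by case/andP=> _ /le_trans; apply.
  have H : nr ((g y - rc y * g1 y) - (g x - rc x * g1 y)) <= C0 * y - C0 * x.
    apply: (@mean_value R (fun z => g z - rc z * g1 y) (fun z => g1 z - g1 y) (fun z => C0 * z) (fun _ => C0) x y xy).
    - move=> z /le zb; apply: rderivB; first exact: hg.
      move=> e1 e10; exists 1 => // t _.
      have -> : rc t * g1 y - rc z * g1 y - rc (t - z) * g1 y = 0 by rewrite rcB; ring.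
      by rewrite nr0 mulr_ge0 // ltW.
    - move=> z _; apply/is_derive_epsP => e1 e10; exists 1 => // t _.
      have -> : C0 * t - C0 * z - (t - z) * C0 = 0 by ring.
      by rewrite normr0 mulr_ge0 // ltW.
    - by move=> z /andP[_ zy]; rewrite nrBC; exact: step1.
  have gx := hB x xB.
  have d0 : 0 < y - x by lra.
  have : (y - x) * nr (g1 y) <= C0 * (y - x) + (nr (g y) + 1).
    rewrite -{1}(gtr0_norm d0) -nr_rc -nrM rcB.
    have -> : (rc y - rc x) * g1 y = (g y - g x) - ((g y - rc y * g1 y) - (g x - rc x * g1 y)) by ring.
    apply: le_trans (nrB _ _) _; have := nrB (g y) (g x); lra.
  have : T * e <= (y - x) * e by rewrite ler_pM2r //; lra.
  move=> q1 q2; rewrite -(ler_pM2l d0); lra.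
have step3 x : x <= s -> nr (g s - g x) <= c / k ^+ 2 * expR (k * s).
  move=> xs.
  have := @mean_value R g g1 (fun z => c / k ^+ 2 * expR (k * z)) (fun z => c / k ^+ 2 * k * expR (k * z)) x s xs.
  have le z : x <= z <= s -> z <= b by case/andP=> _ h; exact: le_trans sb.
  move=> H; apply: le_trans (H _ _ _) _.
  - by move=> z /le; exact: hg.
  - by move=> z _; exact: is_derive_expRM.
  - move=> z /le zb; rewrite (_ : c / k ^+ 2 * k = c / k) ?step2 //.
    by field; rewrite gt_eqF.
  by rewrite lerBlDr lerDl mulr_ge0 ?expR_ge0 // divr_ge0 // sqr_ge0.
apply/ler_addgt0Pr => e e0; have [B hB] := lim0 e e0.
pose x := Num.min B s.
have xB : x <= B by rewrite ge_min lexx.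
have xs : x <= s by rewrite ge_min lexx orbT.
have := nrD (g s - g x) (g x); rewrite subrK.
have := hB x xB; have := step3 x xs; lra.
Qed.

End Rays.

(** * Odd periods along the coordinate cross *)

Section FrobeniusAlgebra.
Variable R : realType.
Local Notation C := (Cplx R).

Section Algebra.
Variables (m : nat) (M : frobenius_data R m).
Hypothesis hM : frobenius_manifold M.

Lemma fmul_euler t v : fmul M t (feuler M t) v = v *m (Umx M t)^T.
Proof.
apply/rowP => g; rewrite !mxE exchange_big; apply: eq_bigr => b _.
rewrite !mxE mulr_sumr; apply: eq_bigr => e _; ring.
Qed.

Lemma fmul_delta t a v : fmul M t (delta_mx 0 a) v = v *m (Cmx M t a)^T.
Proof.
apply/rowP => g; rewrite !mxE exchange_big; apply: eq_bigr => b _.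
rewrite !mxE (bigD1 a) //= mxE !eqxx mul1r big1 ?addr0 // => i ia.
by rewrite mxE eqxx (negbTE ia) !mul0r.
Qed.

Lemma mulmx_row_inj (k : nat) (A B : 'M[C]_(m, k)) :
  (forall v : 'rV_m, v *m A = v *m B) -> A = B.
Proof. by move=> h; apply/row_matrixP => i; rewrite !rowE. Qed.

(** Up to transposition both matrices are multiplications in a commutative associative algebra. *)
Lemma Cmx_Umx_comm t a : fdom M t -> Cmx M t a *m Umx M t = Umx M t *m Cmx M t a.
Proof.
move=> Mt; apply: trmx_inj; apply: mulmx_row_inj => v.
rewrite !trmx_mul !mulmxA -!fmul_euler -!fmul_delta.
by rewrite !(fmulA hM) // (fmulC hM (delta_mx 0 a) (feuler M t) Mt).
Qed.

Lemma Cmx_unity t i : fdom M t -> funity M = delta_mx 0 i -> Cmx M t i = 1%:M.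
Proof.
move=> Mt e; apply: trmx_inj; apply: mulmx_row_inj => v.
by rewrite -fmul_delta -e (fmul1 hM) // trmx1 mulmx1.
Qed.

Lemma trmx_inv_eta : (invmx (flat_metric M))^T = invmx (flat_metric M).
Proof. by rewrite trmx_inv (eta_sym hM). Qed.

Lemma intersection_formE t w1 w2 : fdom M t ->
  intersection_form M t w1 w2 =
  (w1 *m (Umx M t *m invmx (flat_metric M)) *m w2^T) 0 0.
Proof.
move=> Mt; rewrite /intersection_form /comul.
have -> : (fmul M t (sharp M w1) (sharp M w2) *m flat_metric M *m (feuler M t)^T) 0 0 =
  fpair M (sharp M w1) (fmul M t (sharp M w2) (feuler M t)).
  by rewrite -(fpair_invariant hM).
rewrite (fmulC hM (sharp M w2) (feuler M t) Mt) fmul_euler /fpair /sharp !trmx_mul trmxK trmx_inv_eta.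
by rewrite (mulmxKV (eta_nondegenerate hM)) !mulmxA.
Qed.

(** The Gram matrix of the intersection form is U eta^-1. *)
Lemma Umx_unit t : (fdom M `\` discriminant M) t -> Umx M t \in unitmx.
Proof.
move=> [Mt nd]; apply: contrapT => nU; apply: nd; split => //.
apply/negP => h; apply: nU.
suff E : (\matrix_(a, b) intersection_form M t (delta_mx 0 a) (delta_mx 0 b)) =
    Umx M t *m invmx (flat_metric M).
  by move: h; rewrite E unitmx_mul => /andP[].
apply/matrixP => a b; rewrite mxE intersection_formE // -rowE.
by rewrite trmx_delta -colE !mxE.
Qed.

Lemma intersection_formC t w1 w2 : fdom M t ->
  intersection_form M t w1 w2 = intersection_form M t w2 w1.
Proof. by move=> Mt; rewrite /intersection_form /comul (fmulC hM). Qed.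

(* Since [U] is invertible off the discriminant, an odd period satisfies
   [d_a xi = d_1 xi C_a]. *)
Lemma odd_period_hessian D w y i a b : odd_period M D w -> D y ->
  funity M = delta_mx 0 i ->
  'D_(delta_mx 0 a) ('D_(delta_mx 0 b) w) y =
  \sum_c 'D_(delta_mx 0 i) ('D_(delta_mx 0 c) w) y * strc M y a b c.
Proof.
move=> [oD Ds hw eqw] Dy ue.
have sw : forall z, D z -> sd w z by exact: holomorphic_sd.
have sg : sdiff (gradient w) y (fun u => \row_c 'D_u ('D_(delta_mx 0 c) w) y).
  apply: sdiff_row => c.
  apply: sdiff_ext (sdiff_eq (@sd_derive R _ D w (delta_mx 0 c) oD sw y Dy) _) => [|v].
    by exists 1 => // z _; rewrite mxE.
  by rewrite mxE.
have My : fdom M y by have [] := Ds y Dy.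
have Uy := Umx_unit (Ds y Dy).
pose X u := 'D_u (gradient w) y.
have E1 : X (delta_mx 0 i) *m Umx M y = gradient w y *m Vmx M y.
  by rewrite /X eqw // (Cmx_unity My ue) mulmx1.
have E2 : X (delta_mx 0 a) = X (delta_mx 0 i) *m Cmx M y a.
  apply: (can_inj (mulmxK Uy)).
  by rewrite [LHS]eqw // -E1 -!mulmxA Cmx_Umx_comm.
have gen (r1 r2 : 'I_m -> C) : (\row_c r1 c) 0 b = (\row_c r2 c *m Cmx M y a) 0 b ->
    r1 b = \sum_c r2 c * strc M y a b c.
  by rewrite !mxE => ->; apply: eq_bigr => c _; rewrite !mxE.
move: E2; rewrite /X !(sdiff_derive _ sg) => /rowP/(_ b).
exact: (gen (fun c => 'D_(delta_mx 0 a) ('D_(delta_mx 0 c) w) y)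
  (fun c => 'D_(delta_mx 0 i) ('D_(delta_mx 0 c) w) y)).
Qed.

End Algebra.

(** * Structure constants of the quantum cohomology of the projective line *)

Section QuantumCohomologyP1.

Local Notation V2 := ('rV[C]_2 : normedModType C).

Definition QHP1_potential (t : 'rV[C]_2) : C := t 0 0 ^+ 2 * t 0 1 / 2 + cexp (t 0 1).

Lemma sdiff_row_coord k (t : 'rV[C]_k) j :
  @sdiff R 'rV[C]_k C (fun t => t 0 j) t (fun u => u 0 j).
Proof. by apply: sdiff_lin; exact: blin_coord. Qed.

Lemma derive_potential_s : 'D_(delta_mx 0 1) QHP1_potential =
  (fun t : 'rV[C]_2 => t 0 0 ^+ 2 / 2 + cexp (t 0 1)).
Proof.
apply/funext => t.
have h0 := sdiff_row_coord t 0; have h1 := sdiff_row_coord t 1.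
have hc := sdiff_comp h1 (sdiff_cexp (t 0 1)).
have hp := sdiffZ (2^-1) (sdiffM (sdiffM h0 h0) h1).
have h : sdiff QHP1_potential t (fun u =>
    t 0 0 * t 0 1 * u 0 0 + (t 0 0 ^+ 2 / 2 + cexp (t 0 1)) * u 0 1).
  apply: sdiff_ext (sdiff_eq (sdiffD hp hc) _) => [|u].
    by exists 1 => // z _; rewrite /QHP1_potential scaleCE expr2 mulrC.
  by rewrite scaleCE; field.
apply: etrans (sdiff_derive _ h) _; rewrite !mxE /=; ring.
Qed.

Lemma derive_potential_1 : 'D_(delta_mx 0 0) QHP1_potential =
  (fun t : 'rV[C]_2 => t 0 0 * t 0 1).
Proof.
apply/funext => t.
have h0 := sdiff_row_coord t 0; have h1 := sdiff_row_coord t 1.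
have hc := sdiff_comp h1 (sdiff_cexp (t 0 1)).
have hp := sdiffZ (2^-1) (sdiffM (sdiffM h0 h0) h1).
apply: etrans (sdiff_derive _ (sdiff_ext _ (sdiffD hp hc))) _.
  by exists 1 => // z _; rewrite /QHP1_potential scaleCE expr2 mulrC.
by rewrite !mxE /= scaleCE; field.
Qed.

Lemma derive_potential_ss : 'D_(delta_mx 0 1) (fun t : 'rV[C]_2 => t 0 0 ^+ 2 / 2 + cexp (t 0 1)) =
  (fun t : 'rV[C]_2 => cexp (t 0 1)).
Proof.
apply/funext => t.
have h0 := sdiff_row_coord t 0; have h1 := sdiff_row_coord t 1.
have hc := sdiff_comp h1 (sdiff_cexp (t 0 1)).
have hp := sdiffZ (2^-1) (sdiffM h0 h0).
apply: etrans (sdiff_derive _ (sdiff_ext _ (sdiffD hp hc))) _.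
  by exists 1 => // z _; rewrite scaleCE expr2 mulrC.
by rewrite !mxE /= scaleCE; field.
Qed.

(** The polynomial part of the potential is linear in s, so two derivatives in s leave only the
    exponential. *)
Lemma QHP1_strc_ss t k :
  'D_(delta_mx 0 1) ('D_(delta_mx 0 1) ('D_(delta_mx 0 k) QHP1_potential)) t =
  if k == 1 then cexp (t 0 1) else 0.
Proof.
have h0 := sdiff_row_coord t 0; have h1 := sdiff_row_coord t 1.
have [->|k1] := eqVneq k 1.
  apply: etrans (congr1 (fun f => 'D_(delta_mx 0 1) f t) (etrans (congr1 (fun f => 'D_(delta_mx 0 1) f)
    derive_potential_s) derive_potential_ss)) _.
  by apply: etrans (sdiff_derive _ (sdiff_comp h1 (sdiff_cexp (t 0 1)))) _; rewrite !mxE mulr1.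
have -> : k = 0 by case: k k1 => [[|[|//]] k2] // _; exact/val_inj.
have E : 'D_(delta_mx 0 1) (fun t : 'rV[C]_2 => t 0 0 * t 0 1) = (fun t => t 0 0).
  apply/funext => t'.
  apply: etrans (sdiff_derive _ (sdiffM (sdiff_row_coord t' 0) (sdiff_row_coord t' 1))) _.
  by rewrite !mxE /=; ring.
apply: etrans (congr1 (fun f => 'D_(delta_mx 0 1) f t) (etrans (congr1 (fun f => 'D_(delta_mx 0 1) f)
    derive_potential_1) E)) _.
by apply: etrans (sdiff_derive _ h0) _; rewrite !mxE.
Qed.

Lemma QHP1_metric_inv : invmx (flat_metric (QHP1 R)) = \matrix_(i, j) (i != j)%:R.
Proof.
rewrite /=; set h := \matrix_(i, j) _.
have hh : h *m h = 1%:M.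
  apply/matrixP => i j; rewrite !mxE !big_ord_recl big_ord0 !mxE.
  by case: i => [[|[|//]] i2]; case: j => [[|[|//]] j2]; rewrite /= ?(mul0r, mulr0, mul1r, addr0, add0r).
have [hu _] := mulmx1_unit hh.
by rewrite -[LHS]mulmx1 -hh mulKmx.
Qed.

Lemma QHP1_mul s : fmul (QHP1 R) (s *: delta_mx 0 1) (delta_mx 0 1) (delta_mx 0 1) =
  cexp s *: delta_mx 0 0.
Proof.
apply/rowP => g; rewrite fmul_delta -rowE mxE mxE mxE.
have E : strc (QHP1 R) (s *: delta_mx 0 1) 1 1 g = (\sum_k 'D_(delta_mx 0 1) ('D_(delta_mx 0 1) ('D_(delta_mx 0 k) (fun t : 'rV[C]_2 => t 0 0 ^+ 2 * t 0 1 / 2 + cexp (t 0 1))))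
  (s *: delta_mx 0 1) * invmx (flat_metric (QHP1 R)) k g).
  by [].
rewrite E {E}.
rewrite (eq_bigr (fun k : 'I_2 => (if k == 1 then cexp s else 0) * (k != g)%:R)); last first.
  move=> k _; rewrite QHP1_metric_inv mxE; congr (_ * _).
  by apply: etrans (QHP1_strc_ss _ _) _; rewrite !mxE eqxx mulr1.
rewrite !big_ord_recl big_ord0 !mxE /=.
by case: g => [[|[|//]] g2]; rewrite /= ?(mul0r, mulr0, mulr1, addr0, add0r).
Qed.

End QuantumCohomologyP1.

(** Let W be the Jacobian of (X, Y). Canonical brackets mean that W P W^T is the standard symplectic
    matrix; inverting this relation expresses the symplectic form P^-1 as the pull-back of the
    standard one. That [eta] and [V] anticommute makes P antisymmetric, which supplies the brackets
    of Y with X. *)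
Lemma symplectic_inverse (m : nat) (GX GY : 'M[C]_(m, m + m)) (eta V : 'M[C]_(m + m)) :
  eta^T = eta -> eta \in unitmx -> V^T = V -> eta *m V = - (V *m eta) ->
  forall P, P = invmx eta *m V^T ->
  GX *m P *m GX^T = 0 -> GY *m P *m GY^T = 0 -> GX *m P *m GY^T = 1%:M ->
  V *m (GY^T *m GX - GX^T *m GY) = eta /\ col_mx GX GY \in unitmx.
Proof.
move=> eT eU VT eV P PE XX YY XY.
have PT : P^T = - P.
  rewrite PE trmx_mul trmxK trmx_inv eT VT.
  apply: (can_inj (mulmxK eU)); rewrite mulmxKV //.
  apply: (can_inj (mulKmx eU)); rewrite eV mulNmx mulmxN !mulmxA mulmxV //.
  by rewrite mul1mx.
have YX : GY *m P *m GX^T = - 1%:M.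
  have := congr1 trmx XY; rewrite trmx_mul trmxK (trmx_mul GX P) PT trmx1 mulNmx mulmxN mulmxA => <-.
  by rewrite opprK.
pose W := col_mx GX GY.
have WPW : W *m P *m W^T = block_mx 0 1%:M (- 1%:M) 0.
  by rewrite /W tr_col_mx mul_col_mx mul_col_row XX XY YX YY.
pose J : 'M[C]_(m + m) := block_mx 0 (- 1%:M) 1%:M 0.
have JJ : block_mx 0 1%:M (- 1%:M) 0 *m J = 1%:M.
  rewrite /J mulmx_block !mul0mx !mulmx0 !mul1mx !add0r !addr0 mulNmx mulmxN opprK mul1mx.
  by rewrite -scalar_mx_block.
have WI : W *m (P *m W^T *m J) = 1%:M by rewrite !mulmxA WPW.
have [WU _] := mulmx1_unit WI; split => //.
have IW := mulmx1C WI.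
have E : W^T *m J *m W = GY^T *m GX - GX^T *m GY.
  rewrite /W /J tr_col_mx mul_row_block mul_row_col !mulmx0 !add0r !addr0 mulmxN !mulmx1.
  by rewrite mulNmx.
rewrite -E -[V]VT -(mulKVmx eU (V^T *m _)); move: IW; rewrite PE -!mulmxA => ->.
by rewrite mulmx1.
Qed.

Lemma mx_entryE (p q : nat) (B : 'M[C]_(p, q)) a b :
  ((delta_mx 0 a : 'rV[C]_p) *m B *m (delta_mx b 0 : 'cV[C]_q)) 0 0 = B a b.
Proof. by rewrite -rowE -colE !mxE. Qed.

Section HolomorphicRow.

Lemma derive_coord (V : normedModType C) k (f : V -> 'rV[C]_k) t v j : differentiable f t ->
  differentiable (fun t => f t 0 j) t /\ 'D_v (fun t => f t 0 j) t = ('D_v f t) 0 j.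
Proof.
move=> df; have [dc dcE] := sdiff_differentiable (sdiff_row_coord (f t) j).
have dg : differentiable (fun t => f t 0 j) t.
  exact: (@differentiable_comp _ _ _ _ f (fun u : 'rV[C]_k => u 0 j)).
split => //; rewrite !deriveE //.
have -> : 'd (fun t => f t 0 j) t = 'd (fun u : 'rV[C]_k => u 0 j) (f t) \o 'd f t :> (V -> C).
  exact: (@diff_comp _ _ _ _ f (fun u : 'rV[C]_k => u 0 j)).
by rewrite /= dcE.
Qed.

Lemma holomorphic_coord (V : normedModType C) k (A : set V) (f : V -> 'rV[C]_k) j : open A ->
  holomorphic A f -> holomorphic A (fun t => f t 0 j).
Proof.
move=> oA hf t At; have [df cf] := hf t At.
split; first by have [] := derive_coord 0 j df.
move=> v; apply/cvg_nrP => e e0; apply/nbhs_nrP.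
have /cvg_nrP/(_ e e0)/nbhs_nrP[d d0 hd] := cf v.
have /open_nrP/(_ t At)[d' d'0 hA] := oA.
exists (Num.min d d'); first by rewrite lt_min d0.
move=> y; rewrite lt_min => /andP[yd yd'].
have [dy _] := hf y (hA y yd').
have [_ ->] := derive_coord v j dy; have [_ ->] := derive_coord v j df.
apply: le_lt_trans (hd y yd).
by have := nr_coord ('D_v f y - 'D_v f t) j; rewrite !mxE.
Qed.

Lemma holomorphic_sd_row m k (A : set 'rV[C]_m) (f : 'rV[C]_m -> 'rV[C]_k) : open A ->
  holomorphic A f -> forall a, A a -> sd f a.
Proof.
move=> oA hf a Aa; apply: sdiff_row => j.
have h := holomorphic_sd oA (holomorphic_coord j oA hf) Aa.
have [df _] := hf a Aa.
apply: sdiff_eq h _ => v; by have [_ ->] := derive_coord v j df.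
Qed.

End HolomorphicRow.

(** * The tensor product along the coordinate cross *)

Section TensorProduct.
Variables (n : nat) (M : frobenius_data R n.+1) (mu : 'rV[C]_n.+1)
  (N : frobenius_data R (n.+1 + n.+1)).
Hypotheses (hM : frobenius_manifold M) (hunity : funity M = delta_mx 0 ord0)
  (heta : forall a b, flat_metric M a b = (b == rev_ord a)%:R)
  (hV : forall t, fdom M t -> Vmx M t = diag_mx mu)
  (hmu : forall a, mu 0 a != 2^-1)
  (hmu_rev : forall a, mu 0 a + mu 0 (rev_ord a) = 0)
  (heuler : forall t a, fdom M t -> mu 0 a != (2 - fcharge M) / 2 ->
       feuler M t 0 a = ((2 - fcharge M) / 2 - mu 0 a) * t 0 a)
  (hN : tensor_QHP1 M mu N).

(** Homogeneity of the product applied to e . e = e gives [E, e] = - e, and the bracket with a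
    constant field is minus the derivative of E. *)
Lemma derive_euler_unity t : fdom M t -> 'D_(delta_mx 0 ord0) (feuler M) t = delta_mx 0 ord0.
Proof.
move=> Mt; set e : 'rV[C]_n.+1 := delta_mx 0 ord0.
have oM := fdom_open hM.
have hc : holomorphic (fdom M) (fun _ : 'rV[C]_n.+1 => e).
  by apply: sd_holomorphic => // a _; exact: sdiff_sd (sdiff_cst e a).
have ee y u : fdom M y -> fmul M y e u = u by rewrite /e -hunity => My; rewrite (fmul1 hM).
have := euler_fmul hM hc hc Mt; rewrite /lie_bracket.
have -> : 'D_(feuler M t) (fun _ => e) t = 0 by rewrite (sdiff_derive _ (sdiff_cst e t)).
have -> : 'D_(feuler M t) (fun t' => fmul M t' e e) t = 0.
  have /open_nrP/(_ t Mt)[d d0 hd] := oM.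
  have h : sdiff (fun t' => fmul M t' e e) t (fun _ => 0).
    by apply: sdiff_ext (sdiff_cst e t); exists d => // y /hd My; rewrite ee.
  exact: (sdiff_derive _ h).
rewrite ee // !sub0r ee // (fmulC hM _ e Mt) ee // opprK.
by rewrite addNr add0r.
Qed.

Lemma mu_unity t : fdom M t -> mu 0 ord0 = - fcharge M / 2.
Proof.
move=> Mt; have := congr1 (fun A : 'M[C]_(n.+1) => A ord0 ord0) (hV Mt).
rewrite /Vmx !mxE eqxx !mulr1n => <-.
have dE : differentiable (feuler M) t by have [] := euler_holomorphic hM Mt.
have := deriveEjacobian (delta_mx 0 ord0) dE; rewrite derive_euler_unity // -rowE.
move=> /rowP/(_ ord0); by rewrite !mxE eqxx => <- /=; field.
Qed.

(** For d = 1 the eigenvalue paired with mu_1 = - d / 2 would be 1/2, which is excluded. *)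
Lemma charge_neq1 t : fdom M t -> 1 - fcharge M != 0.
Proof.
move=> Mt; have := hmu (rev_ord ord0); apply: contraNneq => E.
have := hmu_rev ord0; rewrite (mu_unity Mt) => /eqP; rewrite addrC addr_eq0 => /eqP ->.
apply/eqP; have -> : fcharge M = 1 by apply/eqP; rewrite eq_sym -subr_eq0 E.
by rewrite mulNr opprK mul1r.
Qed.

Lemma euler_last t : fdom M t ->
  feuler M t 0 (rev_ord ord0) = (1 - fcharge M) * t 0 (rev_ord ord0).
Proof.
move=> Mt; have muE : mu 0 (rev_ord ord0) = fcharge M / 2.
  have := hmu_rev ord0; rewrite (mu_unity Mt) => /eqP; rewrite addrC addr_eq0 => /eqP ->.
  by rewrite mulNr opprK.
rewrite heuler //; rewrite muE; first by congr (_ * _); field.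
apply: contraNneq (charge_neq1 Mt) => E.
have -> : 1 - fcharge M = (2 - fcharge M) / 2 - fcharge M / 2 by field.
by rewrite E subrr.
Qed.

(** By homogeneity of the flat coordinates, E has components (1 - d) / 2 x^a in the chart [x]. In
    the metric inverse to the intersection form the square of E is <E, e>, because multiplication by
    E sends e to E; and <E, e> = E^n = (1 - d) t^n, where t^n = t_1. *)
Lemma hamiltonian_quadratic A x G t : flat_chart M A x G -> A t ->
  2 / (1 - fcharge M) * (\sum_a flat_metric M ord0 a * t 0 a) = Gquad G (x t) / 2.
Proof.
move=> hx At; have [Mt nd] := chart_regular hx At.
have Ut := Umx_unit hM (conj Mt nd).
have dx : differentiable x t by have [] := chart_holomorphic hx At.
set J := 'J x t.
have JU : J \in unitmx := chart_jacobian hx At.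
have eU := eta_nondegenerate hM.
have grad a : gradient (fun t' => x t' 0 a) t = (col a J)^T.
  apply/rowP => b; rewrite [LHS]mxE [RHS]mxE [RHS]mxE.
  have [_ ->] := derive_coord (delta_mx 0 b) a dx.
  by rewrite deriveEjacobian // -rowE mxE.
have EJ : feuler M t *m J = ((1 - fcharge M) / 2) *: x t.
  by rewrite -deriveEjacobian // (chart_euler hx At).
clearbody J.
have GE : G = J^T *m (Umx M t *m invmx (flat_metric M)) *m J.
  apply/matrixP => a b; rewrite -(chart_gram hx a b At) intersection_formE // !grad trmxK.
  by rewrite tr_col rowE colE -[RHS]mx_entryE !mulmxA.
have c0 := charge_neq1 Mt.
have xE : x t = (2 / (1 - fcharge M)) *: (feuler M t *m J).
  by rewrite EJ scalerA mulrA divfK // divff ?scale1r // pnatr_eq0.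
have GI : invmx G = invmx J *m (flat_metric M *m invmx (Umx M t)) *m (invmx J)^T.
  have I : G *m (invmx J *m (flat_metric M *m invmx (Umx M t)) *m (invmx J)^T) = 1%:M.
    rewrite GE -!mulmxA (mulKVmx JU) (mulKmx eU) (mulKVmx Ut).
    by rewrite trmx_inv mulmxV // unitmx_tr.
  have [GU _] := mulmx1_unit I.
  by rewrite -[LHS]mulmx1 -I mulKmx.
have Ue : invmx (Umx M t) *m (feuler M t)^T = (funity M)^T.
  have -> : (feuler M t)^T = Umx M t *m (funity M)^T.
    apply: trmx_inj; rewrite trmx_mul !trmxK -fmul_euler.
    by rewrite (fmulC hM _ (funity M) Mt) (fmul1 hM).
  by rewrite mulKmx.
have Gq : Gquad G (x t) = (2 / (1 - fcharge M)) ^+ 2 * ((1 - fcharge M) * t 0 (rev_ord ord0)).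
  rewrite /Gquad xE GI linearZ /= -!scalemxAl -scalemxAr [LHS]mxE [X in _ * X]mxE expr2 -mulrA.
  congr (_ * (_ * _)).
  have -> : feuler M t *m J *m (invmx J *m (flat_metric M *m invmx (Umx M t)) *m (invmx J)^T) *m
      (feuler M t *m J)^T = feuler M t *m flat_metric M *m (funity M)^T.
    rewrite trmx_mul -!mulmxA (mulmxA (invmx J)^T) -trmx_mul mulmxV // trmx1 mul1mx.
    by rewrite (mulKVmx JU) Ue.
  rewrite hunity trmx_delta -colE !mxE (bigD1 (rev_ord ord0)) //= heta rev_ordK eqxx mulr1.
  rewrite big1 ?addr0 ?euler_last // => i ine.
  rewrite heta; case: eqP => [E|]; last by rewrite mulr0.
  by move: ine; rewrite E rev_ordK eqxx.
rewrite Gq (bigD1 (rev_ord ord0)) //= heta eqxx mul1r big1 ?addr0; last first.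
  by move=> i ine; rewrite heta (negbTE ine) mul0r.
by field.
Qed.

Let i1 : 'I_(n.+1 + n.+1) := lshift n.+1 ord0.
Let iS : 'I_(n.+1 + n.+1) := rshift n.+1 ord0.

Lemma tensor_unityE : funity N = delta_mx 0 i1.
Proof.
rewrite (tensor_unity hN) /tens hunity /= !mxE /= scale1r scale0r.
by rewrite /i1 delta_mx_lshift.
Qed.

Lemma tens_1 j : tens (delta_mx 0 j) (delta_mx 0 0) = delta_mx 0 (lshift n.+1 j) :> 'rV[C]_(n.+1 + n.+1).
Proof. by rewrite /tens !mxE /= scale1r scale0r delta_mx_lshift. Qed.

Lemma tens_s j : tens (delta_mx 0 j) (delta_mx 0 1) = delta_mx 0 (rshift n.+1 j) :> 'rV[C]_(n.+1 + n.+1).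
Proof. by rewrite /tens !mxE /= scale1r scale0r delta_mx_rshift. Qed.

Lemma odd_period_cross D w t s : odd_period N D w -> fdom M t -> D (cross_pt t s) ->
  'D_(delta_mx 0 iS) ('D_(delta_mx 0 iS) w) (cross_pt t s) =
  cexp s * 'D_(delta_mx 0 i1) ('D_(delta_mx 0 i1) w) (cross_pt t s).
Proof.
move=> hw Mt Dy; set y := cross_pt t s.
(* On the cross the structure constants come from e_1 . e_1 = e_1 in M and e_2 . e_2 = Q e_1 in the
   second factor. *)
have hs c : strc N y iS iS c = cexp s * (c == i1)%:R.
  have -> : strc N y iS iS c = (fmul N y (delta_mx 0 iS) (delta_mx 0 iS)) 0 c.
    by rewrite fmul_delta -rowE !mxE.
  rewrite -tens_s (tensor_fmul hN) // QHP1_mul -{1}hunity (fmul1 hM) //.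
  have -> : tens (delta_mx 0 ord0) (cexp s *: delta_mx 0 0) = cexp s *: delta_mx 0 i1.
    by rewrite -tens_1 /tens scale_row_mx !scalerA !mxE.
  by rewrite !mxE eqxx.
have gen (r : 'I_(n.+1 + n.+1) -> C) : \sum_c r c * strc N y iS iS c = cexp s * r i1.
  rewrite (bigD1 i1) //= hs eqxx mulr1 mulrC big1 ?addr0 // => c ci.
  by rewrite hs (negbTE ci) !mulr0.
apply: etrans (odd_period_hessian (tensor_frobenius hN) iS iS hw Dy tensor_unityE) _.
exact: (gen (fun c => 'D_(delta_mx 0 i1) ('D_(delta_mx 0 c) w) y)).
Qed.

Lemma tensor_metricE : flat_metric N = block_mx 0 (flat_metric M) (flat_metric M) 0.
Proof.
have fE (k : nat) (Q : frobenius_data R k) i j : flat_metric Q i j = fpair Q (delta_mx 0 i) (delta_mx 0 j).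
  by rewrite /fpair -rowE trmx_delta -colE !mxE.
apply/matrixP => a b; rewrite fE.
rewrite -(fintype.splitK a) -(fintype.splitK b).
case: (fintype.split a) => i; case: (fintype.split b) => j /=.
- by rewrite block_mxEul -!tens_1 (tensor_fpair hN) -!fE !mxE /= mulr0.
- by rewrite block_mxEur -tens_1 -tens_s (tensor_fpair hN) -!fE !mxE /= mulr1.
- by rewrite block_mxEdl -tens_1 -tens_s (tensor_fpair hN) -!fE !mxE /= mulr1.
- by rewrite block_mxEdr -!tens_s (tensor_fpair hN) -!fE !mxE /= mulr0.
Qed.

(** The metric pairs mu_a with - mu_a, and the shift -1/2 of the first block with the shift +1/2 of
    the second. *)
Lemma tensor_metric_V y : fdom N y ->
  flat_metric N *m Vmx N y = - (Vmx N y *m flat_metric N).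
Proof.
move=> Ny; rewrite (tensor_V hN Ny) tensor_metricE.
have mu_eta i j : flat_metric M i j * (mu 0 i + mu 0 j) = 0.
  rewrite heta; case: eqP => [->|_]; last by rewrite mul0r.
  by rewrite hmu_rev mulr0.
apply/matrixP => a b; rewrite mul_mx_diag mxE [RHS]mxE mul_diag_mx [in RHS]mxE.
rewrite -(fintype.splitK a) -(fintype.splitK b).
case: (fintype.split a) => i; case: (fintype.split b) => j /=.
- by rewrite block_mxEul !mxE mul0r mulr0 oppr0.
- rewrite block_mxEur row_mxEr row_mxEl !mxE; apply/eqP; rewrite -subr_eq0 opprK.
  have := mu_eta i j; rewrite [flat_metric M i j](heta i j) => <-; apply/eqP; ring.
- rewrite block_mxEdl row_mxEr row_mxEl !mxE; apply/eqP; rewrite -subr_eq0 opprK.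
  have := mu_eta i j; rewrite [flat_metric M i j](heta i j) => <-; apply/eqP; ring.
- by rewrite block_mxEdr !mxE mul0r mulr0 oppr0.
Qed.

Section Canonical.
Variables (X Y : 'rV[C]_(n.+1 + n.+1) -> 'rV[C]_n.+1).
Variables (t : 'rV[C]_n.+1) (s : C).
Hypotheses (Mt : fdom M t)
  (hXY : forall a b, poisson_bracket N (fun z => X z 0 a) (fun z => Y z 0 b) (cross_pt t s)
     = (a == b)%:R)
  (hXX : forall a b, poisson_bracket N (fun z => X z 0 a) (fun z => X z 0 b) (cross_pt t s) = 0)
  (hYY : forall a b, poisson_bracket N (fun z => Y z 0 a) (fun z => Y z 0 b) (cross_pt t s) = 0).

Let y := cross_pt t s.
Let jac (Z : 'rV[C]_(n.+1 + n.+1) -> 'rV[C]_n.+1) : 'M[C]_(n.+1, n.+1 + n.+1) :=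
  \matrix_(c, b) 'D_(delta_mx 0 b) (fun z => Z z 0 c) y.

Lemma canonical_symplectic :
  Vmx N y *m ((jac Y)^T *m jac X - (jac X)^T *m jac Y) = flat_metric N /\
  col_mx (jac X) (jac Y) \in unitmx.
Proof.
have Ny : fdom N y := tensor_dom hN s Mt.
have hP (Z Z' : 'rV[C]_(n.+1 + n.+1) -> 'rV[C]_n.+1) a b :
    poisson_bracket N (fun z => Z z 0 a) (fun z => Z' z 0 b) y =
    (jac Z *m (invmx (flat_metric N) *m (Vmx N y)^T) *m (jac Z')^T) a b.
  rewrite -mx_entryE /poisson_bracket trmx_mul.
  have rE (W : 'rV[C]_(n.+1 + n.+1) -> 'rV[C]_n.+1) c :
      gradient (fun z => W z 0 c) y = delta_mx 0 c *m jac W.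
    by rewrite -rowE; apply/rowP => k; rewrite !mxE.
  by rewrite !rE trmx_mul trmx_delta !mulmxA.
apply: (@symplectic_inverse _ _ _ _ _ _ _ _ _ (invmx (flat_metric N) *m (Vmx N y)^T)) => //.
- exact: eta_sym (tensor_frobenius hN).
- exact: eta_nondegenerate (tensor_frobenius hN).
- by rewrite (tensor_V hN Ny) tr_diag_mx.
- exact: tensor_metric_V.
- by apply/matrixP => a b; rewrite -hP hXX mxE.
- by apply/matrixP => a b; rewrite -hP hYY mxE.
- by apply/matrixP => a b; rewrite -hP hXY !mxE.
Qed.

(** The symplectic form is evaluated on two tangent vectors of the cross, the second one without
    s-component. As L_s is Lagrangian, only the product of [al] with dH (b) survives. *)
Lemma canonical_cross_form (a b : 'rV[C]_n.+1) (al : C) :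
  (forall c, sd (fun z => X z 0 c) y) -> (forall c, sd (fun z => Y z 0 c) y) ->
  \sum_c ('D_(cross_pt a al) (fun z => Y z 0 c) y * 'D_(cross_pt b 0) (fun z => X z 0 c) y
    - 'D_(cross_pt a al) (fun z => X z 0 c) y * 'D_(cross_pt b 0) (fun z => Y z 0 c) y) =
  al * (2 / (1 - fcharge M) * \sum_j flat_metric M ord0 j * b 0 j).
Proof.
move=> sX sY; have Ny : fdom N y := tensor_dom hN s Mt.
have [VB _] := canonical_symplectic.
set B := _ - _ in VB.
have DE (Z : 'rV[C]_(n.+1 + n.+1) -> 'rV[C]_n.+1) u c : sd (fun z => Z z 0 c) y ->
    'D_u (fun z => Z z 0 c) y = (u *m (jac Z)^T) 0 c.
  move=> [bL _]; rewrite [in LHS](row_sum_coord u).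
  apply: etrans (blin_sum _ _ _ bL) _; rewrite mxE; apply: eq_bigr => k _.
  apply: etrans (blinZ _ _ bL) _; by rewrite !mxE.
have gen (u v : 'rV[C]_(n.+1 + n.+1)) (P Q : 'M[C]_(n.+1, n.+1 + n.+1)) :
    (u *m (P^T *m Q) *m v^T) 0 0 = \sum_c (u *m P^T) 0 c * (v *m Q^T) 0 c.
  rewrite !mulmxA -mulmxA -[Q *m v^T]trmxK trmx_mul trmxK mxE; apply: eq_bigr => c _.
  by rewrite [X in _ * X]mxE.
have gen2 (u v : 'rV[C]_(n.+1 + n.+1)) (P Q : 'M[C]_(n.+1, n.+1 + n.+1)) :
    \sum_c ((u *m P^T) 0 c * (v *m Q^T) 0 c - (u *m Q^T) 0 c * (v *m P^T) 0 c) =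
    (u *m (P^T *m Q - Q^T *m P) *m v^T) 0 0.
  by rewrite sumrB -!gen mulmxBr mulmxBl [RHS]mxE [X in _ = _ + X]mxE.
transitivity (\sum_c ((cross_pt a al *m (jac Y)^T) 0 c * (cross_pt b 0 *m (jac X)^T) 0 c
    - (cross_pt a al *m (jac X)^T) 0 c * (cross_pt b 0 *m (jac Y)^T) 0 c)).
  by apply: eq_bigr => c _; congr (_ * _ - _ * _); apply: DE.
rewrite gen2 -/B; clearbody B.
(* The first tangent vector is (u1, u2) V. On the first block V acts by mu_i - 1/2, nonzero by
   [hmu], and on the s-direction by mu_1 + 1/2 = (1 - d) / 2, whose inverse is the constant in H. *)
pose u1 : 'rV[C]_n.+1 := \row_i (a 0 i / (mu 0 i - 2^-1)).
pose u2 : 'rV[C]_n.+1 := (al / (mu 0 ord0 + 2^-1)) *: delta_mx 0 ord0.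
have muE : mu 0 ord0 + 2^-1 = (1 - fcharge M) / 2.
  by rewrite (mu_unity Mt); field.
have mu0 : mu 0 ord0 + 2^-1 != 0.
  by rewrite muE mulf_neq0 ?(charge_neq1 Mt) // invr_eq0 pnatr_eq0.
have -> : cross_pt a al = row_mx u1 u2 *m Vmx N y.
  rewrite (tensor_V hN Ny) mul_mx_diag /cross_pt; apply/rowP => k; rewrite [RHS]mxE.
  rewrite -(fintype.splitK k); case: (fintype.split k) => i /=.
    rewrite !row_mxEl !mxE divfK // subr_eq0; exact: hmu.
  rewrite !row_mxEr !mxE; have [->|i0] := eqVneq i ord0.
    by rewrite !mulr1 divfK.
  by rewrite !mulr0 mul0r.
rewrite -(mulmxA _ _ B) VB tensor_metricE mul_row_block !mulmx0 add0r addr0.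
rewrite /cross_pt scale0r tr_row_mx mul_row_col trmx0 mulmx0 addr0.
rewrite /u2 -!scalemxAl mxE -rowE muE invf_div -[LHS]mulrA; congr (_ * (_ * _)).
by rewrite mxE; apply: eq_bigr => j _; rewrite !mxE.
Qed.

End Canonical.
End TensorProduct.
End FrobeniusAlgebra.

(** * Series of holomorphic functions *)

Section Series.
Variable R : realType.
Local Notation C := (Cplx R).
Local Notation rc := (@rc R).
Implicit Types V W : normedModType C.

Lemma geometric_sum_le (k l : nat) : \sum_(k <= i < l) (2 ^+ i)^-1 <= 2 / 2 ^+ k :> R.
Proof.
have p n : 0 < (2 ^+ n)^-1 :> R by rewrite invr_gt0 exprn_gt0.
have [lk|kl] := leqP l k; first by rewrite big_geq // divr_ge0 // exprn_ge0.
suff : \sum_(k <= i < l) (2 ^+ i)^-1 = 2 / 2 ^+ k - 2 / 2 ^+ l :> R.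
  by move=> ->; rewrite lerBlDr lerDl divr_ge0 // exprn_ge0.
elim: l kl => // l IH; rewrite ltnS leq_eqVlt => /orP[/eqP <-|kl].
  rewrite big_nat1 exprS invfM; field; by rewrite expf_neq0.
by rewrite big_nat_recr ?(ltnW kl) //= IH // exprS; field; rewrite !expf_neq0.
Qed.

Lemma partial_sums_dist (u : nat -> C) (M : R) : (forall k, nr (u k) <= M / 2 ^+ k) ->
  forall K L, (K <= L)%N -> nr (\sum_(k < L) u k - \sum_(k < K) u k) <= 2 * M / 2 ^+ K.
Proof.
move=> h K L KL.
have M0 : 0 <= M by have := h 0%N; rewrite expr0 divr1; apply: le_trans (nr_ge0 _).
rewrite -!(big_mkord xpredT u) (big_cat_nat (leq0n K) KL) /= [X in X - _]addrC addrK.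
apply: le_trans (nr_sum _ _ _) _.
apply: (@le_trans _ _ (\sum_(K <= i < L) M / 2 ^+ i)); first exact: ler_sum.
rewrite -mulr_sumr -mulrA mulrCA; rewrite ler_wpM2l //; exact: geometric_sum_le.
Qed.

Lemma partial_sums_bdd (u : nat -> C) (M : R) : (forall k, nr (u k) <= M / 2 ^+ k) ->
  bdd (fun K => \sum_(k < K) u k).
Proof.
move=> h; exists (2 * M) => K; have := partial_sums_dist h (leq0n K).
by rewrite big_ord0 subr0 expr0 divr1.
Qed.

Lemma glim_series_dist (u : nat -> C) (M : R) : (forall k, nr (u k) <= M / 2 ^+ k) ->
  forall K, nr (glim (fun K => \sum_(k < K) u k) - \sum_(k < K) u k) <= 2 * M / 2 ^+ K.
Proof.
move=> h K; rewrite -[X in _ - X]glim_cst.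
apply: (@glim_near _ (fun K => \sum_(k < K) u k) _ _ K) => //.
- exact: partial_sums_bdd h.
- exact: bdd_cst.
- by move=> L KL; exact: partial_sums_dist.
Qed.

Lemma pow2_small (M e : R) : 0 < e -> exists N, forall n, (N <= n)%N -> M / 2 ^+ n < e.
Proof.
move=> e0; exists (Num.bound (`|M| / e)) => n hn.
have b0 : 0 <= `|M| / e by rewrite divr_ge0 // ltW.
rewrite ltr_pdivrMr ?exprn_gt0 // mulrC -ltr_pdivrMr //.
apply: le_lt_trans (_ : `|M| / e < _).
  by rewrite ler_wpM2r ?invr_ge0 ?(ltW e0) // ler_norm.
apply: lt_le_trans (archi_boundP b0) _.
by rewrite -natrX ler_nat (leq_trans hn) // ltnW // ltn_expl.
Qed.

Lemma cvg_pow2 (u : nat -> C) (l : C) (M : R) :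
  (forall K, nr (l - u K) <= M / 2 ^+ K) -> u @ \oo --> l.
Proof.
move=> h; apply/cvg_seqP => e e0; have [N hN] := pow2_small M e0.
by exists N => n nN; rewrite nrBC; apply: le_lt_trans (h n) (hN n nN).
Qed.

Lemma cvg_pow2_unique (u : nat -> C) (l l' : C) (M M' : R) :
  (forall K, nr (l - u K) <= M / 2 ^+ K) -> (forall K, nr (l' - u K) <= M' / 2 ^+ K) -> l = l'.
Proof.
move=> h h'; apply/eqP; rewrite -subr_eq0; apply/eqP/nr_le0/ler_addgt0Pr => e e0.
have [N hN] := pow2_small (M + M') e0; rewrite add0r.
have := nr_tri (u N) l l'; rewrite (nrBC (u N)).
have := h N; have := h' N; have := hN N (leqnn N); rewrite mulrDl; lra.
Qed.

Section SeriesSdiff.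
Variables (V : normedModType C) (f : nat -> V -> C) (a : V) (rho M : R).
Hypotheses (hf : forall k x, nr (x - a) < rho -> sd (f k) x)
  (hM : forall k x, nr (x - a) < rho -> nr (f k x) <= M / 2 ^+ k).

(** The generalized limit makes the sum a total function; where the terms are geometrically bounded
    it is the actual sum, by [glim_series_dist]. *)
Definition series_sum (x : V) : C := glim (fun K => \sum_(k < K) f k x).

Lemma series_sum_sdiff x : nr (x - a) < rho ->
  sdiff series_sum x (fun u => glim (fun K => \sum_(k < K) 'D_u (f k) x)).
Proof.
move=> xa; pose rho' := rho - nr (x - a); have r0 : 0 < rho' by rewrite subr_gt0.
have xr y : nr (y - x) < rho' -> nr (y - a) < rho.
  by move=> yx; apply: le_lt_trans (nr_tri x _ _) _; rewrite /rho' in yx; lra.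
have sP N y : nr (y - a) < rho ->
    sdiff (fun y => \sum_(k < N) f k y) y (fun u => \sum_(k < N) 'D_u (f k) y).
  move=> ya; apply: (@sdiff_sum _ _ _ _ (index_enum 'I_N) xpredT (fun k => f k)) => k _.
  exact: hf.
have h := @sdiff_glim _ V (fun N y => \sum_(k < N) f k y) series_sum x rho' (2 * M) r0.
apply: sdiff_eq (h _ _ _) _ => //.
- by move=> N y /xr ya; exact: sdiff_sd (sP N y ya).
- move=> N y /xr ya; have := partial_sums_dist (fun k => hM k ya) (leq0n N).
  by rewrite big_ord0 subr0 expr0 divr1.
move=> u; congr glim; apply/funext => N; exact: (sdiff_derive u (sP N x xa)).
Qed.

Lemma series_sum_dist x K : nr (x - a) < rho ->
  nr (series_sum x - \sum_(k < K) f k x) <= 2 * M / 2 ^+ K.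
Proof. by move=> xa; apply: (@glim_series_dist (fun k => f k x)) => k; exact: hM. Qed.

End SeriesSdiff.

(** From k to k + 1 the left side is multiplied by (2k + 2)(2k + 1) and the right side by (2k +
    2)^2. This lets the (k!)^2 of the expansion absorb the (2k)! of Cauchy's estimates, whence
    convergence for small Q. *)
Lemma fact_double_le k : ((2 * k)`! <= 4 ^ k * (k`! ^ 2))%N.
Proof.
elim: k => [//|k IH].
rewrite (_ : (2 * k.+1)`! = (2 * k).+2 * ((2 * k).+1 * (2 * k)`!))%N; last by rewrite mulnS !factS.
rewrite (_ : 4 ^ k.+1 * (k.+1`! ^ 2) = (4 * k.+1 ^ 2) * (4 ^ k * k`! ^ 2))%N; last first.
  by rewrite factS expnS expnMn mulnACA.
rewrite mulnA leq_mul //.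
have -> : (4 * k.+1 ^ 2 = (2 * k).+2 * (2 * k).+2)%N.
  by rewrite -[(2 * k).+2]/(2 + 2 * k)%N -mulnS -(expnMn 2 _ 2).
by rewrite leq_mul2l leqnSn.
Qed.

Lemma sdiff_cexpX (z : C) k :
  sdiff (fun z => cexp z ^+ k) z (fun h => k%:R * cexp z ^+ k * h).
Proof.
have b : blin (fun h : C => k%:R * h) := blin_scale k%:R (blin_id C).
apply: sdiff_ext (sdiff_eq (sdiff_comp (sdiff_lin z b) (sdiff_cexp _)) _) => [|h].
  by exists 1 => // x _; rewrite cexp_sum.
by rewrite cexp_sum; ring.
Qed.

(** The identity theorem, by strong induction: once the lower coefficients vanish, c_k Q^k is
    compensated by a tail of order Q^(k+1). Points of [P] accumulating at 0 are enough, which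
    matters because the sums are known on a sector only. *)
Lemma power_series_eq0 (c : nat -> C) (Q0 : C) (M : R) (P : set C) : Q0 != 0 ->
  (forall k, nr (c k * Q0 ^+ k) <= M) ->
  (forall e, 0 < e -> exists Q, [/\ P Q, 0 < nr Q & nr Q < e]) ->
  (forall Q, P Q -> (fun K => \sum_(k < K) c k * Q ^+ k) @ \oo --> (0 : C)) ->
  forall k, c k = 0.
Proof.
move=> Q00 hM acc hP; have q00 := nr_gt0 Q00.
have M0 : 0 <= M by exact: le_trans (nr_ge0 _) (hM 0%N).
have hc k (Q : C) : nr Q <= nr Q0 / 2 -> nr (c k * Q ^+ k) <= M / 2 ^+ k.
  move=> hQ; rewrite nrM nrX.
  have : nr (c k) * nr Q ^+ k <= nr (c k) * (nr Q0 / 2) ^+ k.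
    by rewrite ler_wpM2l ?nr_ge0 // lerXn2r ?nnegrE ?nr_ge0 // divr_ge0 ?nr_ge0.
  move=> h; apply: le_trans h _; have := hM k; rewrite nrM nrX => h.
  by rewrite expr_div_n mulrA ler_wpM2r // invr_ge0 exprn_ge0.
elim/ltn_ind => k IH; apply: nr_le0; apply/ler_addgt0Pr => e e0; rewrite add0r.
(* The tail bound 2 M q^(k+1), q = |Q| / |Q0|, gives |c_k| <= 2 M |Q| / |Q0|^(k+1), at most e for
   |Q| < e1; the 1 in 2 M + 1 covers M = 0. *)
pose e1 := Num.min (nr Q0 / 2) (e * nr Q0 ^+ k.+1 / (2 * M + 1) / 2 ).
have M1 : 0 < 2 * M + 1 by lra.
have e10 : 0 < e1 by rewrite lt_min !divr_gt0 // mulr_gt0 // exprn_gt0.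
have [Q [PQ Q1 Q2]] := acc e1 e10.
move: Q2; rewrite lt_min => /andP[Q2 Q3].
pose q := nr Q / nr Q0.
have q0 : 0 < q by rewrite divr_gt0.
have q2 : q <= 1 / 2 by rewrite ler_pdivrMr //; lra.
have tail K : (k < K)%N -> nr (\sum_(i < K) c i * Q ^+ i - c k * Q ^+ k) <= 2 * M * q ^+ k.+1.
  move=> kK; rewrite -(big_mkord xpredT (fun i => c i * Q ^+ i)) (big_cat_nat (leq0n k.+1) kK) /=.
  rewrite big_nat_recr //= big1_seq ?add0r; last first.
    move=> i; rewrite mem_index_iota => /andP[_ ik]; by rewrite IH // mul0r.
  rewrite [X in X - _]addrC addrK; apply: le_trans (nr_sum _ _ _) _.
  apply: (@le_trans _ _ (\sum_(k.+1 <= i < K) M * q ^+ k.+1 * (2 ^+ k.+1 / 2 ^+ i))).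
    rewrite !big_seq; apply: ler_sum => i; rewrite mem_index_iota => /andP[ki _].
    have h := hM i; rewrite nrM nrX in h.
    rewrite nrM nrX (_ : nr Q = q * nr Q0); last by rewrite divfK // gt_eqF.
    rewrite exprMn mulrCA mulrC; apply: le_trans (ler_wpM2r _ h) _.
      by rewrite exprn_ge0 // ltW.
    rewrite -mulrA ler_wpM2l // -{1}(subnKC ki) exprD ler_wpM2l ?exprn_ge0 ?(ltW q0) //.
    have -> : 2 ^+ k.+1 / 2 ^+ i = (1 / 2) ^+ (i - k.+1) :> R.
      rewrite -{1}(subnKC ki) exprD expr_div_n expr1n; field; by rewrite !expf_neq0.
    by rewrite lerXn2r ?nnegrE // ltW.
  rewrite -mulr_sumr -mulr_sumr.
  have g := geometric_sum_le k.+1 K.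
  have : 2 ^+ k.+1 * (\sum_(k.+1 <= i < K) (2 ^+ i)^-1) <= 2 :> R.
    rewrite mulrC -ler_pdivlMr ?exprn_gt0 //.
  move=> /(ler_wpM2l (_ : 0 <= M * q ^+ k.+1)) h; apply: le_trans (h _) _.
    by rewrite mulr_ge0 // exprn_ge0 // ltW.
  by rewrite mulrC mulrA.
have key : nr (c k * Q ^+ k) <= 2 * M * q ^+ k.+1.
  apply/ler_addgt0Pr => d d0; have /cvg_seqP/(_ d d0)[N hN] := hP Q PQ.
  have := hN (maxn N k.+1) (leq_maxl _ _); rewrite subr0 => h1.
  have h2 := tail (maxn N k.+1) (leq_maxr _ _).
  have := nrB (\sum_(i < maxn N k.+1) c i * Q ^+ i) (\sum_(i < maxn N k.+1) c i * Q ^+ i - c k * Q ^+ k).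
  rewrite opprB addrCA subrr addr0; lra.
move: key; rewrite nrM nrX /q expr_div_n exprS => key.
have Qk : 0 < nr Q ^+ k by rewrite exprn_gt0.
have Q0k : 0 < nr Q0 ^+ k.+1 by rewrite exprn_gt0.
rewrite -(ler_pM2r Qk); apply: le_trans key _.
rewrite (_ : 2 * M * (nr Q * nr Q ^+ k / nr Q0 ^+ k.+1) =
  (2 * M * nr Q / nr Q0 ^+ k.+1) * nr Q ^+ k); last by ring.
rewrite ler_pM2r // ler_pdivrMr //.
apply: (@le_trans _ _ ((2 * M + 1) * nr Q)); first by rewrite ler_pM2r //; lra.
have : 0 < e * nr Q0 ^+ k.+1 / (2 * M + 1) by rewrite divr_gt0 // mulr_gt0.
move: Q3; set B := e * nr Q0 ^+ k.+1 / (2 * M + 1) => Q3 B0.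
have : nr Q <= B by lra.
by rewrite /B ler_pdivlMr // mulrC.
Qed.

End Series.

(** * Expansion of the coordinates X in powers of Q *)

Section RayExpansion.
Variable R : realType.
Local Notation C := (Cplx R).
Local Notation rc := (@rc R).
Implicit Types V W : normedModType C.

Lemma taylor_dist V W (k : nat) (w v : V) (f : V -> C) (w' v' : W) (g : W -> C) (M e : R) :
  0 <= e -> (forall z : C, nr z <= 1 -> nr (f (v + z *: w)) <= M) ->
  (forall z : C, nr z <= 1 -> nr (g (v' + z *: w')) <= M) ->
  (forall z : C, nr z <= 1 -> nr (f (v + z *: w) - g (v' + z *: w')) <= e) ->
  nr (taylor k w f v - taylor k w' g v') <= e.
Proof.
move=> e0 hf hg he.
have M0 : 0 <= M by apply: le_trans (nr_ge0 _) (hf 0 _); rewrite nr0.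
apply: (@glim_near _ _ _ _ 0%N); [exact: bdd_taylor hf|exact: bdd_taylor hg|].
move=> N _; rewrite -meanB; apply: mean_bound => // z z1.
by rewrite -mulrBl nrM nr_pow_circle // mulr1 he // eq_ler1.
Qed.

Lemma derive_scale V (O : set V) (f : V -> C) (w : V) (c : C) : open O ->
  (forall z, O z -> sd f z) -> forall z, O z ->
  'D_(c *: w) ('D_(c *: w) f) z = c * (c * 'D_w ('D_w f) z).
Proof.
move=> oO hf z Oz.
have h := @sd_derive _ V O f w oO hf z Oz.
have [d d0 hd] := (open_nrP O).1 oO z Oz.
have E : sdiff ('D_(c *: w) f) z (fun u => c *: 'D_u ('D_w f) z).
  apply: sdiff_ext (sdiffZ c h); exists d => // y /hd Oy.
  by have [bL _] := hf y Oy; rewrite (blinZ _ _ bL).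
apply: etrans (sdiff_derive _ E) _; have [bL _] := h.
exact: (congr1 (fun t => c * t) (blinZ c w bL)).
Qed.

Section Ray.
Variables (V0 : normedModType C) (phi : (V0 * C)%type -> C) (x : V0 -> C) (e1 t : V0).
Variables (r theta b K : R) (O : set (V0 * C)%type).
Local Notation V := ((V0 * C)%type : normedModType C).
Let w1 : V := (e1, 0).
Let ws : V := (0, 1).
Let rw : V0 := rc r *: e1.
Let W1 : V := rc r *: w1.
Let ray (s : R) : V := (t, (0 +i* theta)%C) + rc s *: ws.
Hypotheses (r0 : 0 < r) (K0 : 0 <= K) (oO : open O) (sphi : forall z, O z -> sd phi z)
  (eqphi : forall z, O z -> 'D_ws ('D_ws phi) z = cexp z.2 * 'D_w1 ('D_w1 phi) z)
  (discO : forall s (z : C), s <= b -> nr z <= 1 -> O (ray s + z *: W1))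
  (sx : forall z : C, nr z <= 1 -> sd x (t + z *: rw))
  (close : forall s (z : C), s <= b -> nr z <= 1 ->
    nr (phi (ray s + z *: W1) - x (t + z *: rw)) <= K * expR s).

(** Times [kap k], a Taylor coefficient of order 2k is a derivative of order 2k along [e1]: of [x]
    at [t] for [alpha k], of [phi] on the ray for [B k]. What is left of [B k] after J + 1 terms of
    its expansion in Q is [rem J k]. All orders use the same disc of radius r, which keeps the
    bounds geometric. *)
Let kap k : C := (2 * k)`!%:R * (rc r^-1) ^+ (2 * k).
Let alpha k : C := kap k * taylor (2 * k) rw x t.
Let Q (s : R) : C := cexp (ray s).2.
Let B k s : C := kap k * taylor (2 * k) W1 phi (ray s).
Let rem J k s : C := B k s - \sum_(j < J.+1) Q s ^+ j * (alpha (k + j) / (j`!%:R ^+ 2)).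
Let bnd J k : R := K * (2 * (k + J))`!%:R * r^-1 ^+ (2 * (k + J)) / (J.+1`!%:R ^+ 2).

Lemma ray_second s : (ray s).2 = (s +i* theta)%C.
Proof. by rewrite /ray /= /GRing.scale /= mulr1 /rc; apply/eqP; rewrite eq_complex /= !(add0r, addr0) !eqxx. Qed.

Lemma nr_Q s : nr (Q s) = expR s.
Proof. by rewrite /Q ray_second nr_cexp. Qed.

Lemma ray_disc_second s (z : C) : (ray s + z *: W1).2 = (ray s).2.
Proof. by rewrite /= /GRing.scale /= !mulr0 !addr0. Qed.

(** The equation d_s^2 = Q d_1^2 is taken under the average over the disc, on which Q is constant:
    two derivatives in s raise the index k by one and produce a factor Q. *)
Lemma taylor_ray_eq k s : s <= b ->
  kap k * taylor (2 * k) W1 ('D_ws ('D_ws phi)) (ray s) = Q s * B k.+1 s.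
Proof.
move=> sb.
have O1 (z : C) : nr z <= 1 -> O (ray s + z *: W1) by exact: discO.
have sD1 (z : C) (z1 : nr z <= 1) : sd ('D_W1 phi) (ray s + z *: W1).
  exact: (@sd_derive _ V O phi W1 oO sphi _ (O1 z z1)).
have sD2 (z : C) (z1 : nr z <= 1) : sd ('D_W1 ('D_W1 phi)) (ray s + z *: W1).
  exact: (@sd_derive _ V O ('D_W1 phi) W1 oO (fun y Oy => @sd_derive _ V O phi W1 oO sphi y Oy) _ (O1 z z1)).
have rn : rc r != 0.
  by apply/eqP => E; have := nr_rc r; rewrite E nr0 gtr0_norm // => h; move: r0; rewrite -h ltxx.
have [M M0 hM] := sd_bounded sD2.
have gen (a ro ri d2 D2 : C) : D2 = ro * (ro * d2) -> ri = ro^-1 -> ro != 0 -> a * d2 = a * ri ^+ 2 * D2.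
  by move=> -> -> ro0; field.
have -> : taylor (2 * k) W1 ('D_ws ('D_ws phi)) (ray s) =
    taylor (2 * k) W1 (fun z => (Q s * rc r^-1 ^+ 2) * 'D_W1 ('D_W1 phi) z) (ray s).
  apply: eq_taylor => z z1; have Oz := O1 z (eq_ler1 z1).
  apply: etrans (eqphi Oz) _; rewrite ray_disc_second -/(Q s).
  have E : 'D_W1 ('D_W1 phi) (ray s + z *: W1) = rc r * (rc r * 'D_w1 ('D_w1 phi) (ray s + z *: W1)).
    exact: (@derive_scale V O phi w1 (rc r) oO sphi _ Oz).
  exact: (gen _ _ _ _ _ E (rcV _) rn).
rewrite (@taylorZ _ V (2 * k) W1 ('D_W1 ('D_W1 phi)) (ray s) _ M (fun z z1 => (hM z z1).1)).
rewrite (@taylor_derive _ V (2 * k) W1 ('D_W1 phi) (ray s) sD1) (@taylor_derive _ V (2 * k).+1 W1 phi (ray s) (fun z z1 => sphi (O1 z z1))).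
rewrite /B /kap (_ : (2 * k.+1 = (2 * k).+2)%N); last by rewrite mulnS.
rewrite !factS !natrM !exprS expr0; ring.
Qed.

(** The asymptotics hold on the whole disc, and Taylor coefficients are averages over it. *)
Lemma ray_base k s : s <= b -> nr (rem 0 k s) <= bnd 0 k * expR s.
Proof.
move=> sb; rewrite /rem big_ord_recl big_ord0 /= expr0 mul1r addr0 fact0 expr1n divr1 addn0.
rewrite /bnd addn0 /B /alpha -mulrBr nrM expr1n divr1.
have -> : nr (kap k) = (2 * k)`!%:R * r^-1 ^+ (2 * k).
  by rewrite /kap nrM nr_nat nrX nr_rc gtr0_norm // invr_gt0.
have O1 (z : C) : nr z <= 1 -> O (ray s + z *: W1) by exact: discO.
have [M M0 hM] := sd_bounded (fun z z1 => sphi (O1 z z1)).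
have [M' M'0 hM'] := sd_bounded sx.
have Ke : 0 <= K * expR s by rewrite mulr_ge0 // expR_ge0.
have := @taylor_dist V V0 (2 * k) W1 (ray s) phi rw t x (Num.max M M') (K * expR s) Ke.
move=> H; rewrite [leRHS](_ : _ = (2 * k)`!%:R * r^-1 ^+ (2 * k) * (K * expR s)); last by ring.
rewrite ler_wpM2l //.
  by rewrite mulr_ge0 // exprn_ge0 // invr_ge0 ltW.
apply: H => z z1.
- by rewrite le_max (hM z z1).1.
- by rewrite le_max (hM' z z1).1 orbT.
- exact: close.
Qed.

Lemma sdiff_Qsum (z : V) (J : nat) (beta : nat -> C) :
  sdiff (fun z : V => \sum_(j < J) cexp z.2 ^+ j * beta j) z
    (fun u => \sum_(j < J) (j%:R * cexp z.2 ^+ j * u.2) * beta j).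
Proof.
apply: (@sdiff_sum _ _ _ _ (index_enum 'I_J) xpredT (fun (j : 'I_J) (z : V) => cexp z.2 ^+ j * beta j)).
move=> j _.
have h := sdiff_comp (sdiff_lin z (blin_snd V0 C)) (sdiff_cexpX z.2 j).
apply: sdiff_ext (sdiff_eq (sdiffZ (beta j) h) _) => [|u]; last by rewrite scaleCE mulrC.
by exists 1 => // y _; rewrite scaleCE mulrC.
Qed.

Lemma expR_small e : 0 < e -> exists b0, forall s : R, s <= b0 -> expR s <= e.
Proof.
move=> e0; exists (ln e) => s h; rewrite -[e]lnK ?posrE //.
by rewrite ler_expR.
Qed.

(* By the equation along the cross, the second derivative in [s] of the
   remainder of order [J + 1] at index [k] is [Q] times the remainder of order [J]
   at index [k + 1]. *)
Lemma ray_remainder J k s : s <= b -> nr (rem J k s) <= bnd J k * expR (J.+1%:R * s).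
Proof.
elim: J k s => [|J IH] k s sb; first by rewrite mul1r; exact: ray_base.
pose beta j := alpha (k + j) / (j`!%:R ^+ 2).
pose g0 (z : V) := kap k * taylor (2 * k) W1 phi z - \sum_(j < J.+2) cexp z.2 ^+ j * beta j.
pose g1 (z : V) := kap k * taylor (2 * k) W1 ('D_ws phi) z
  - \sum_(j < J.+2) cexp z.2 ^+ j * (j%:R * beta j).
pose g2 (z : V) := kap k * taylor (2 * k) W1 ('D_ws ('D_ws phi)) z
  - \sum_(j < J.+2) cexp z.2 ^+ j * (j%:R * (j%:R * beta j)).
have sDs y : O y -> sd ('D_ws phi) y by exact: (@sd_derive _ V O phi ws oO sphi y).
have d0 s' : s' <= b -> rderiv (fun s => g0 (ray s)) s' (g1 (ray s')).
  move=> s'b; have O1 (z : C) : nr z <= 1 -> O (ray s' + z *: W1) by exact: discO.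
  have h := sdiffB (sdiffZ (kap k) (taylor_sdiff (2 * k) (fun z z1 => sphi (O1 z z1))))
    (sdiff_Qsum (ray s') J.+2 beta).
  have -> : g1 (ray s') = kap k * taylor (2 * k) W1 ('D_ws phi) (ray s') -
     \sum_(j < J.+2) (j%:R * cexp (ray s').2 ^+ j * ws.2) * beta j.
    by rewrite /g1; congr (_ - _); apply: eq_bigr => j _; rewrite /=; ring.
  exact: (sdiff_rderiv h).
have d1 s' : s' <= b -> rderiv (fun s => g1 (ray s)) s' (g2 (ray s')).
  move=> s'b; have O1 (z : C) : nr z <= 1 -> O (ray s' + z *: W1) by exact: discO.
  have h := sdiffB (sdiffZ (kap k) (taylor_sdiff (2 * k) (fun z z1 => sDs _ (O1 z z1))))
    (sdiff_Qsum (ray s') J.+2 (fun j => j%:R * beta j)).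
  have -> : g2 (ray s') = kap k * taylor (2 * k) W1 ('D_ws ('D_ws phi)) (ray s') -
     \sum_(j < J.+2) (j%:R * cexp (ray s').2 ^+ j * ws.2) * (j%:R * beta j).
    by rewrite /g2; congr (_ - _); apply: eq_bigr => j _; rewrite /=; ring.
  exact: (sdiff_rderiv h).
have g2E s' : s' <= b -> g2 (ray s') = Q s' * rem J k.+1 s'.
  (* The factor j^2 of the second derivative kills the term j = 0; after a shift of j by one, (j +
     1)^2 / ((j + 1)!)^2 = 1 / (j!)^2. *)
  move=> s'b; rewrite /g2 taylor_ray_eq // /rem mulrBr; congr (_ - _).
  rewrite big_ord_recl /= mul0r mulr0 add0r mulr_sumr; apply: eq_bigr => j _.
  rewrite /= /bump /= add1n /beta -/(Q s') addnS -addSn exprS factS natrM.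
  have n1 : (j.+1%:R : C) != 0 by rewrite pnatr_eq0.
  have n2 : (j`!%:R : C) != 0 by rewrite pnatr_eq0 -lt0n fact_gt0.
  move: (j.+1%:R : C) (j`!%:R : C) n1 n2 (alpha _) (Q s' ^+ j) (Q s') => m1 m2 n1 n2 A B' B1.
  by field; rewrite n1 n2.
pose c := bnd J k.+1.
have c0 : 0 <= c.
  rewrite /c /bnd divr_ge0 ?sqr_ge0 // !mulr_ge0 // exprn_ge0 // invr_ge0 ltW //.
have b2 s' : s' <= b -> nr (g2 (ray s')) <= c * expR (J.+2%:R * s').
  move=> s'b; rewrite g2E // nrM nr_Q; have := IH k.+1 s' s'b.
  rewrite -/c (_ : J.+2%:R * s' = s' + J.+1%:R * s'); last by rewrite -[J.+2%:R]natr1; ring.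
  by rewrite expRD mulrCA ler_pM2l ?expR_gt0.
(* The double integration starts from the vanishing of the remainder as Q -> 0: it is the remainder
   of order 0 minus terms carrying at least one factor Q. *)
have lim0 e : 0 < e -> exists b0, forall s', s' <= b0 -> nr (g0 (ray s')) <= e.
  move=> e0; pose T := bnd 0 k + \sum_(j < J.+1) nr (beta j.+1).
  have T0 : 0 <= T.
    rewrite addr_ge0 ?sumr_ge0 // => [|j _]; last exact: nr_ge0.
    by rewrite /bnd divr_ge0 ?sqr_ge0 // !mulr_ge0 // exprn_ge0 // invr_ge0 ltW.
  have T1 : 0 < T + 1 by lra.
  have [b0 hb0] := expR_small (divr_gt0 e0 T1).
  exists (Num.min b0 (Num.min b 0)) => s'; rewrite !le_min => /and3P[s1 s2 s3].
  have q := hb0 s' s1; rewrite ler_pdivlMr // in q.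
  suff H : nr (g0 (ray s')) <= T * expR s'.
    by apply: le_trans H _; apply: le_trans q; rewrite mulrC ler_pM2l ?expR_gt0 //; lra.
  have -> : g0 (ray s') = rem 0 k s' - \sum_(j < J.+1) Q s' ^+ j.+1 * beta j.+1.
    rewrite /g0 /rem -/(B k s') big_ord_recl [in RHS]big_ord_recl big_ord0 addr0 opprD addrA.
    by congr (_ - _ - _).
  rewrite mulrDl mulr_suml; apply: le_trans (nrB _ _) _; apply: lerD; first exact: ray_base.
  apply: le_trans (nr_sum _ _ _) _; apply: ler_sum => j _.
  rewrite nrM mulrC ler_wpM2l ?nr_ge0 // nrX nr_Q.
  rewrite -expRM_natl ler_expR.
  have : j.+1%:R * s' <= 1 * s' by rewrite ler_wnM2r // ler1n.
  by rewrite mul1r mulr_natl.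
have H := ray_double_integral c0 (ltr0n R J.+2 : 0 < J.+2%:R) d0 d1 b2 lim0 sb.
have -> : rem J.+1 k s = g0 (ray s) by [].
(* Double integration divides by (J + 2)^2, which turns ((J + 1)!)^2 into ((J + 2)!)^2. *)
apply: le_trans H _; rewrite ler_pM2r ?expR_gt0 // /c /bnd addSnnS (factS J.+1) natrM exprMn.
rewrite le_eqVlt; apply/orP; left; apply/eqP.
have n1 : (J.+2%:R : R) != 0 by rewrite pnatr_eq0.
have n2 : (J.+1`!%:R : R) != 0 by rewrite pnatr_eq0 -lt0n fact_gt0.
have gen (a x' y' : R) : a / x' ^+ 2 / y' ^+ 2 = a / (y' ^+ 2 * x' ^+ 2) by rewrite [in RHS]invfM [RHS]mulrA [RHS]mulrAC.
exact: gen.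
Qed.

(** This is the remainder at k = 0, where (2J)! / ((J + 1)!)^2 <= 4^J leaves the geometric ratio 4
    |Q| / r^2. *)
Lemma ray_expansion s J : s <= b ->
  nr (phi (ray s) - \sum_(j < J.+1) Q s ^+ j * (alpha j / (j`!%:R ^+ 2))) <=
  K * expR s * (4 * expR s / r ^+ 2) ^+ J.
Proof.
move=> sb; have := ray_remainder J 0 sb; rewrite /rem /B /kap muln0 fact0 expr0 !mul1r.
rewrite taylor0; last by move=> z z1; apply: sphi; exact: discO.
move=> h; apply: le_trans h _; rewrite /bnd add0n.
have E0 := expR_gt0 s.
have -> : expR (J.+1%:R * s) = expR s * expR s ^+ J.
  by rewrite -exprS -expRM_natl mulr_natl.
have -> : r^-1 ^+ (2 * J) = (r ^+ 2)^-1 ^+ J by rewrite exprM exprVn.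
rewrite !exprMn.
have f0 : 0 < (J`!%:R : R) by rewrite ltr0n fact_gt0.
have h : ((2 * J)`!%:R : R) / J.+1`!%:R ^+ 2 <= 4 ^+ J.
  rewrite ler_pdivrMr ?exprn_gt0 ?ltr0n ?fact_gt0 //.
  apply: (@le_trans _ _ (4 ^+ J * J`!%:R ^+ 2)).
    by rewrite -!natrX -natrM ler_nat fact_double_le.
  rewrite ler_wpM2l ?exprn_ge0 // lerXn2r ?nnegrE // ler_nat factS.
  by rewrite leq_pmull.
have P : 0 <= K * expR s * (expR s ^+ J * (r ^+ 2)^-1 ^+ J).
  by rewrite !mulr_ge0 ?exprn_ge0 ?invr_ge0 ?sqr_ge0 // ltW.
have := ler_wpM2l P h; move: (r ^+ 2)^-1 => A; lra.
Qed.

End Ray.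
End RayExpansion.

(** * The expansion of X as a holomorphic function of (t, Q) *)

Section BesselSeries.
Variable R : realType.
Local Notation C := (Cplx R).
Local Notation rc := (@rc R).

(* Formally the series is [I_0 (2 sqrt Q D_e) f], with [I_0] the modified Bessel
   function. *)
Definition bessel_term (V : normedModType C) (e : V) (f : V -> C) (k : nat)
    (z : (V * C)%type) : C :=
  z.2 ^+ k * (iter (2 * k) (fun f : V -> C => 'D_e f) f z.1 / (k`!%:R ^+ 2)).

Definition bessel_series (V : normedModType C) (e : V) (f : V -> C) :=
  series_sum (bessel_term e f : nat -> ((V * C)%type : normedModType C) -> C).

Variables (V : normedModType C) (A : set V) (f : V -> C) (e : V).
Hypotheses (oA : open A) (hf : forall a, A a -> sd f a).
Local Notation VC := ((V * C)%type : normedModType C).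

Lemma sd_power (W : normedModType C) (g : W -> C) (a : W) k : sd g a -> sd (fun z => g z ^+ k) a.
Proof.
move=> hg; elim: k => [|k IH]; first exact: (sdiff_sd (@sdiff_cst R W C 1 a)).
by apply: sdiff_sd (sdiff_ext _ (sdiffM hg IH)); exists 1 => // z _; rewrite exprS.
Qed.

Lemma sd_bessel_term k (z : VC) : A z.1 -> sd (bessel_term e f k : VC -> C) z.
Proof.
move=> Az; have h1 := sdiff_comp (sdiff_lin z (blin_fst V C)) (@sd_iter_derive R V A f e (2 * k) oA hf z.1 Az).
have h2 := sd_power k (sdiff_sd (sdiff_lin z (blin_snd V C))).
have := sdiffM h2 (sdiffZ (k`!%:R ^+ 2)^-1 h1) => h; apply: sdiff_sd (sdiff_ext _ h).
by exists 1 => // y _; rewrite /bessel_term scaleCE [_^-1 * _]mulrC.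
Qed.

Lemma small_disc (a : V) : A a -> exists2 r, 0 < r & exists2 d, 0 < d & exists2 M, 0 < M &
  forall v, nr (v - a) < d -> forall z : C, nr z <= 1 ->
    A (v + z *: (rc r *: e)) /\ nr (f (v + z *: (rc r *: e))) <= M.
Proof.
move=> Aa; have [d0 d00 hd0] := (open_nrP A).1 oA a Aa.
have [d1 d10 hd1] := sdiff_continuous (hf Aa) ltr01.
pose d := Num.min d0 d1.
have d_0 : 0 < d by rewrite lt_min d00.
have ne : 0 < 2 * (nr e + 1) by have := nr_ge0 e; lra.
pose r := d / (2 * (nr e + 1)); have r0 : 0 < r by rewrite divr_gt0.
exists r => //; exists (d / 2); first by rewrite divr_gt0.
exists (nr (f a) + 1); first by have := nr_ge0 (f a); lra.
move=> v va z z1.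
have hz : nr (v + z *: (rc r *: e) - a) < d.
  have -> : v + z *: (rc r *: e) - a = (v - a) + z *: (rc r *: e) by rewrite addrAC.
  apply: le_lt_trans (nrD _ _) _; rewrite !nrZ nr_rc gtr0_norm //.
  have h1 : nr z * (r * nr e) <= 1 * (r * nr e).
    by rewrite ler_wpM2r // mulr_ge0 ?nr_ge0 // ltW.
  have h2 : r * nr e <= d / 2.
    rewrite /r mulrAC ler_pdivrMr // [leRHS](_ : _ = d * (nr e + 1)); last by field.
    by rewrite ler_wpM2l; lra.
  lra.
split; first by apply: hd0; apply: lt_le_trans hz _; rewrite ge_min lexx.
have := hd1 _ (lt_le_trans hz _); rewrite ge_min lexx orbT => /(_ isT) h.
rewrite -[f _](subrK (f a)); apply: le_trans (nrD _ _) _; lra.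
Qed.

Lemma bessel_seriesP (a : V) : A a -> exists2 r, 0 < r & exists2 M, 0 < M &
  forall z : VC, nr (z - (a, 0)) < r ->
    A z.1 /\ forall k, nr (bessel_term e f k z) <= M / 2 ^+ k.
Proof.
move=> Aa; have [r r0 [d d0 [M M0 hM]]] := small_disc Aa.
(* For |Q| < r^2 / 8 the ratio 4 |Q| / r^2 that governs the terms is at most 1/2. *)
exists (Num.min d (r ^+ 2 / 8)).
  by rewrite lt_min d0 divr_gt0 // exprn_gt0.
exists M => // z; rewrite lt_min => /andP[zd zr].
have zd1 : nr (z.1 - a) < d := le_lt_trans (nr_pairl (z - (a, 0) : VC)) zd.
have zr2 : nr z.2 < r ^+ 2 / 8.
  have := le_lt_trans (nr_pairr (z - (a, 0) : VC)) zr.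
  by rewrite /= subr0.
have h := hM _ zd1.
have Az : A z.1 by have := (h 0 _).1; rewrite nr0 scale0r addr0; apply.
split=> // k.
have -> : bessel_term e f k z = z.2 ^+ k * ((2 * k)`!%:R * (rc r^-1) ^+ (2 * k) *
    taylor (2 * k) (rc r *: e) f z.1 / (k`!%:R ^+ 2)).
  rewrite /bessel_term; congr (_ * (_ / _)).
  exact: (iter_derive_taylor (2 * k) oA r0 (fun w w1 => (h w w1).1) hf).
have T : nr (taylor (2 * k) (rc r *: e) f z.1) <= M.
  by apply: taylor_bound; [exact: ltW | move=> w w1; exact: (h w w1).2].
rewrite !nrM nrV !nrX nr_rc !nr_nat gtr0_norm ?invr_gt0 //.
set T' := nr (taylor _ _ _ _) in T *; have T'0 : 0 <= T' by exact: nr_ge0.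
have F0 : 0 < (k`!%:R : R) by rewrite ltr0n fact_gt0.
have h1 : ((2 * k)`!%:R : R) / k`!%:R ^+ 2 <= 4 ^+ k.
  rewrite ler_pdivrMr ?exprn_gt0 // -!natrX -natrM ler_nat.
  exact: fact_double_le.
have h2 : nr z.2 ^+ k * (r^-1) ^+ (2 * k) * 4 ^+ k <= (2 ^+ k)^-1.
  rewrite [r^-1 ^+ _]exprM -!exprMn -exprVn lerXn2r ?nnegrE ?invr_ge0 //.
    by rewrite mulr_ge0 // mulr_ge0 ?nr_ge0 // exprn_ge0 // invr_ge0 ltW.
  have : nr z.2 * 8 <= r ^+ 2 by lra.
  rewrite -[leRHS]mul1r -ler_pdivrMr ?exprn_gt0 // -exprVn => q; lra.
have P : 0 <= nr z.2 ^+ k * (r^-1) ^+ (2 * k).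
  by rewrite mulr_ge0 ?exprn_ge0 ?nr_ge0 // invr_ge0 ltW.
have h3 := ler_wpM2l P h1.
have h4 : nr z.2 ^+ k * (r^-1) ^+ (2 * k) * (((2 * k)`!%:R : R) / k`!%:R ^+ 2) <= (2 ^+ k)^-1.
  exact: le_trans h3 h2.
rewrite [leLHS](_ : _ = (nr z.2 ^+ k * (r^-1) ^+ (2 * k) * (((2 * k)`!%:R : R) / k`!%:R ^+ 2)) * T').
  by rewrite [leRHS]mulrC ler_pM // !mulr_ge0 ?invr_ge0 ?sqr_ge0 // ?exprn_ge0 ?nr_ge0 // invr_ge0 ltW.
by move: (_^-1) => i; ring.
Qed.

Lemma bessel_series_null t : A t -> bessel_series e f (t, 0) = f t.
Proof.
move=> At; have [r r0 [M M0 hM]] := bessel_seriesP At.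
have [|_ hb] := hM (t, 0); first by rewrite subrr nr0.
have S k : \sum_(j < k.+1) bessel_term e f j (t, 0) = f t.
  rewrite big_ord_recl /bessel_term /= fact0 expr0 mul1r expr1n divr1 big1 ?addr0 // => j _.
  by rewrite expr0n mul0r.
apply: (@cvg_pow2_unique _ (fun K => \sum_(j < K.+1) bessel_term e f j (t, 0)) _ _ (2 * M) 0) => K.
  have := glim_series_dist hb K.+1; rewrite -/(series_sum _ _) => h; apply: le_trans h _.
  rewrite ler_wpM2l ?lef_pV2 ?posrE ?exprn_gt0 //; first by lra.
  by rewrite ler_weXn2l // ler1n.
by rewrite S subrr nr0 mul0r.
Qed.

End BesselSeries.

(** * Odd periods as sums of their expansions *)

Section CrossExpansion.
Variable R : realType.
Local Notation C := (Cplx R).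
Local Notation rc := (@rc R).

Lemma blin_cross n : blin (fun z : ('rV[C]_n.+1 * C)%type => cross_pt z.1 z.2).
Proof.
apply: blin_row => j; rewrite /cross_pt; case: (split_ordP j) => k ->.
  suff -> : (fun v : ('rV[C]_n.+1 * C)%type : normedModType C =>
      row_mx v.1 (v.2 *: (delta_mx 0 ord0 : 'rV[C]_n.+1)) 0 (lshift n.+1 k)) = (fun v => v.1 0 k).
    have h1 := blin_fst ('rV[C]_n.+1 : normedModType C) C.
    have h2 := @blin_coord R n.+1 k.
    have h3 := blin_comp h1 h2.
    exact: h3.
  by apply/funext => z; rewrite row_mxEl.
suff -> : (fun v : ('rV[C]_n.+1 * C)%type : normedModType C =>
    row_mx v.1 (v.2 *: (delta_mx 0 ord0 : 'rV[C]_n.+1)) 0 (rshift n.+1 k)) =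
    (fun v => (k == ord0)%:R *: (v.2 : (C : normedModType C))).
  exact: blin_scale (blin_snd _ _).
by apply/funext => z; rewrite row_mxEr !mxE eqxx scaleCE mulrC.
Qed.

(** In terms of Q: |Q| < e^rho and p < arg Q < q, on a branch of the logarithm. These sets form a
    base of [Qto0]. *)
Definition sector (p q rho : R) : set C :=
  [set s | p < complex.Im s < q /\ complex.Re s < rho].

Lemma open_sector p q rho : open (sector p q rho).
Proof.
apply/open_nrP => s [/andP[h1 h2] h3].
exists (Num.min (complex.Im s - p) (Num.min (q - complex.Im s) (rho - complex.Re s))).
  by rewrite !lt_min !subr_gt0 h1 h2 h3.
move=> y; rewrite !lt_min => /and3P[y1 y2 y3].
have E : nr (y - s) = nr (y - s) by [].
have hI := Im_le_nr (y - s); have hR := Re_le_nr (y - s).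
have eI : complex.Im (y - s) = complex.Im y - complex.Im s by case: (y) (s) => [? ?] [? ?].
have eR : complex.Re (y - s) = complex.Re y - complex.Re s by case: (y) (s) => [? ?] [? ?].
rewrite eI in hI; rewrite eR in hR; move: hI hR; rewrite !ler_norml => /andP[a1 a2] /andP[b1 b2].
by split; [apply/andP; split; lra|lra].
Qed.

Lemma Qto0_near (V : normedModType C) (p q : R) (z : V) (P : V -> C -> Prop) :
  (\forall y \near z & s \near Qto0 p q, P y s) <->
  exists2 d, 0 < d & exists rho, forall y s, nr (y - z) < d -> sector p q rho s -> P y s.
Proof.
split.
  case=> -[/= B1 B2] [/nbhs_nrP[d d0 hd] [rho hrho]] hP.
  exists d => //; exists rho => y s yd [s1 s2]; apply: (hP (y, s)).
  by split=> /=; [exact: hd|exact: hrho].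
case=> d d0 [rho h]; exists ([set y | nr (y - z) < d], sector p q rho).
  split; first by apply/nbhs_nrP; exists d.
  by exists rho => s s1 s2; split.
by move=> [y s] [/= h1 h2]; exact: h.
Qed.

Variables (n : nat) (M : frobenius_data R n.+1) (mu : 'rV[C]_n.+1)
  (N : frobenius_data R (n.+1 + n.+1)).
Hypotheses (hM : frobenius_manifold M) (hunity : funity M = delta_mx 0 ord0)
  (hN : tensor_QHP1 M mu N).
Variables (D : set 'rV[C]_(n.+1 + n.+1)) (w : 'rV[C]_(n.+1 + n.+1) -> C).
Hypothesis hw : odd_period N D w.
Local Notation vec := ('rV[C]_n.+1).
Local Notation VC := ((vec * C)%type : normedModType C).
Local Notation e1 := (delta_mx 0 ord0 : vec).
Let phi (z : VC) : C := w (cross_pt z.1 z.2).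

Lemma sdiff_cross (f : 'rV[C]_(n.+1 + n.+1) -> C) (z : VC) :
  (forall y, D y -> sd f y) -> D (cross_pt z.1 z.2) ->
  sdiff (fun z : VC => f (cross_pt z.1 z.2)) z (fun u => 'D_(cross_pt u.1 u.2) f (cross_pt z.1 z.2)).
Proof.
move=> hf Dz; exact: (sdiff_comp (sdiff_lin z (blin_cross n)) (hf _ Dz)).
Qed.

Lemma cross_pt_s : cross_pt (0 : vec) 1 = delta_mx 0 (rshift n.+1 ord0) :> 'rV[C]__.
Proof.
apply/rowP => j; rewrite /cross_pt !mxE; case: (fintype.split_ordP j) => k ->.
  by rewrite mxE eq_lrshift andbF.
by rewrite !mxE eq_rshift /= mul1r.
Qed.

Lemma cross_pt_1 : cross_pt e1 0 = delta_mx 0 (lshift n.+1 ord0) :> 'rV[C]__.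
Proof.
apply/rowP => j; rewrite /cross_pt !mxE; case: (fintype.split_ordP j) => k ->.
  by rewrite !mxE eq_lshift.
by rewrite !mxE eq_rlshift mul0r andbF.
Qed.

Lemma derive2_cross (u : VC) (z : VC) (O : set VC) : open O -> O z ->
  (forall z, O z -> D (cross_pt z.1 z.2)) ->
  'D_u ('D_u phi) z = 'D_(cross_pt u.1 u.2) ('D_(cross_pt u.1 u.2) w) (cross_pt z.1 z.2).
Proof.
move=> oO Oz hO; have [oD _ holw _] := hw.
have sw y : D y -> sd w y by exact: holomorphic_sd oD holw y.
have sDw v y : D y -> sd ('D_v w) y by exact: (@sd_derive _ _ D w v oD sw y).
have [d d0 hd] := (open_nrP O).1 oO z Oz.
have E : sdiff ('D_u phi) z
    (fun v => 'D_(cross_pt v.1 v.2) ('D_(cross_pt u.1 u.2) w) (cross_pt z.1 z.2)).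
  apply: (sdiff_ext _ (sdiff_cross (sDw (cross_pt u.1 u.2)) (hO _ Oz))).
  exists d; first exact: d0.
  move=> y yd; have Oy := hd y yd.
  have h := sdiff_cross sw (hO y Oy).
  have h' := sdiff_derive u h.
  exact: esym h'.
exact: (sdiff_derive u E).
Qed.

(** Restricted to the cross, [w] meets the hypotheses of [ray_expansion] on the ray with the
    argument of Q = e^s; the bound on |Q| makes the ratio 4 |Q| / r^2 at most 1/2. *)
Lemma odd_period_series (x : vec -> C) (A : set vec) (t : vec) (d K rho r : R) : open A ->
  (forall a, A a -> sd x a) -> 0 < r -> 0 <= K -> fdom M t ->
  (forall z : C, nr z <= 1 -> A (t + z *: (rc r *: e1)) /\ nr (t + z *: (rc r *: e1) - t) < d) ->
  (forall y, nr (y - t) < d -> fdom M y) ->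
  forall s p q, sector p q rho s ->
  (forall y s, nr (y - t) < d -> sector p q rho s -> D (cross_pt y s) /\
     nr (w (cross_pt y s) - x y) <= K * expR (complex.Re s)) ->
  expR (complex.Re s) <= r ^+ 2 / 8 ->
  exists M', forall J,
    nr (w (cross_pt t s) - \sum_(j < J.+1) bessel_term e1 x j (t, cexp s)) <= M' / 2 ^+ J.
Proof.
move=> oA sx r0 K0 Mt hA hMd s p q [hs1 hs2] hD hQ.
have [oD _ holw _] := hw.
have sw y : D y -> sd w y by exact: holomorphic_sd oD holw y.
pose O : set VC := [set z | nr (z.1 - t) < d /\ sector p q rho z.2].
have oO : open O.
  apply/open_nrP => z [z1 z2].
  have [d2 d20 hd2] := (open_nrP _).1 (@open_sector p q rho) _ z2.
  have [d1 d10 hd1] := (open_nrP _).1 (@open_ball_nr R vec t d) z.1 z1.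
  exists (Num.min d1 d2) => [|y]; first by rewrite lt_min d10.
  rewrite lt_min => /andP[y1 y2]; split.
    exact: hd1 (le_lt_trans (nr_pairl (y - z)) y1).
  exact: hd2 (le_lt_trans (nr_pairr (y - z)) y2).
have hO z : O z -> D (cross_pt z.1 z.2) by case=> z1 z2; exact: (hD _ _ z1 z2).1.
have sphi z : O z -> sd phi z by move=> Oz; exact: sdiff_sd (sdiff_cross sw (hO _ Oz)).
have eqphi z : O z -> 'D_((0, 1) : VC) ('D_((0, 1) : VC) phi) z =
    cexp z.2 * 'D_((e1, 0) : VC) ('D_((e1, 0) : VC) phi) z.
  move=> Oz; apply: etrans (derive2_cross ((0, 1) : VC) oO Oz hO) _.
  apply: etrans _ (congr1 (fun c => cexp z.2 * c) (esym (derive2_cross ((e1, 0) : VC) oO Oz hO))).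
  have := odd_period_cross hM hunity hN hw (hMd _ Oz.1) (hO _ Oz).
  by rewrite -cross_pt_s -cross_pt_1.
have sc (s' : R) : sector p q rho (s' +i* complex.Im s)%C = (s' < rho) :> Prop.
  by apply/propext; split => [[]|h] //; split.
have ray2 (s' : R) (z : C) :
    (((t, (0 +i* complex.Im s)%C) : VC) + rc s' *: ((0, 1) : VC)) + z *: (rc r *: ((e1, 0) : VC)) =
    (t + z *: (rc r *: e1), (s' +i* complex.Im s)%C).
  have pairE (a b : VC) : a.1 = b.1 -> a.2 = b.2 -> a = b by case: a b => [? ?] [? ?] /= -> ->.
  apply: pairE => /=; first by rewrite scaler0 addr0.
  rewrite /GRing.scale /= mulr1 !mulr0 addr0.
  by apply/eqP; rewrite eq_complex /= !(add0r, addr0) !eqxx.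
have ray0 : ((t, (0 +i* complex.Im s)%C) : VC) + rc (complex.Re s) *: ((0, 1) : VC) = (t, s).
  have := ray2 (complex.Re s) 0; rewrite !scale0r !addr0 => ->; by case: (s).
have H := @ray_expansion R vec phi x e1 t r (complex.Im s) (complex.Re s) K O r0 K0 oO sphi eqphi.
exists (K * expR (complex.Re s)) => J.
have := H _ _ _ (complex.Re s) J (lexx _); rewrite ray0 /=.
have -> : \sum_(j < J.+1) bessel_term e1 x j (t, cexp s) = \sum_(j < J.+1) cexp s ^+ j *
   ((2 * j)`!%:R * (rc r^-1) ^+ (2 * j) * taylor (2 * j) (rc r *: e1) x t / (j`!%:R ^+ 2)).
  apply: eq_bigr => j _; rewrite /bessel_term; congr (_ * (_ / _)).
  exact: (iter_derive_taylor (2 * j) oA r0 (fun w w1 => (hA w w1).1) sx).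
move=> {}H; apply: le_trans (H _ _ _) _.
- move=> s' z s'b z1; rewrite ray2; split => /=; first by have := (hA z z1).2.
  by split=> //; exact: le_lt_trans s'b hs2.
- by move=> z z1; apply: sx; exact: (hA z z1).1.
- move=> s' z s'b z1; rewrite ray2 /phi /=; apply: (hD _ _ (hA z z1).2 _).2.
  by split=> //; exact: le_lt_trans s'b hs2.
rewrite ler_wpM2l ?mulr_ge0 ?expR_ge0 // -exprVn lerXn2r ?nnegrE ?invr_ge0 //.
  by rewrite divr_ge0 ?exprn_ge0 ?mulr_ge0 ?expR_ge0 // ltW.
rewrite ler_pdivrMr ?exprn_gt0 //; lra.
Qed.

End CrossExpansion.

Section LinearRow.
Variable R : realType.
Local Notation C := (Cplx R).

Lemma blin_linear_row m (W : normedModType C) (L : 'rV[C]_m -> W) : linear L -> blin L.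
Proof.
move=> hL; split=> //.
have L0 : L 0 = 0.
  have := hL 1 0 0; rewrite !scale1r addr0 -{1}[L 0]addr0.
  by move/addrI => <-.
have LD u v : L (u + v) = L u + L v by have := hL 1 u v; rewrite !scale1r.
have LZ c u : L (c *: u) = c *: L u by have := hL c u 0; rewrite L0 !addr0.
exists (\sum_k nr (L (delta_mx 0 k)) + 1).
  by apply: ltr_wpDl => //; apply: sumr_ge0 => k _; exact: nr_ge0.
move=> v; rewrite {1}(row_sum_coord v) (@big_morph _ _ L 0 +%R 0 +%R LD L0).
apply: le_trans (nr_sum _ _ _) _; rewrite mulrDl mul1r.
apply: (@le_trans _ _ (\sum_k nr (L (delta_mx 0 k)) * nr v)).
  apply: ler_sum => k _; rewrite LZ nrZ mulrC ler_wpM2l ?nr_ge0 //; exact: nr_coord.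
by rewrite mulr_suml lerDl nr_ge0.
Qed.

Lemma derive_jacobian m k (f : 'rV[C]_m -> 'rV[C]_k) t v : differentiable f t ->
  'D_v f t = v *m 'J f t.
Proof. by move=> df; rewrite deriveE // /jacobian mul_rV_lin1. Qed.

Lemma pairE (V W : normedModType C) (a b : (V * W)%type) : a.1 = b.1 -> a.2 = b.2 -> a = b.
Proof. by case: a b => [? ?] [? ?] /= -> ->. Qed.
End LinearRow.

(** * The map (t, Q) |-> (X, Q) and its local inverse *)

Section LocalData.
Variable R : realType.
Local Notation C := (Cplx R).
Local Notation rc := (@rc R).
Variables (n : nat) (M : frobenius_data R n.+1) (mu : 'rV[C]_n.+1)
  (N : frobenius_data R (n.+1 + n.+1))
  (A : set 'rV[C]_n.+1) (x : 'rV[C]_n.+1 -> 'rV[C]_n.+1) (G : 'M[C]_n.+1)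
  (F : 'rV[C]_n.+1 -> C) (p q : R) (D : set 'rV[C]_(n.+1 + n.+1))
  (X Y : 'rV[C]_(n.+1 + n.+1) -> 'rV[C]_n.+1).
Hypotheses (hM : frobenius_manifold M) (hunity : funity M = delta_mx 0 ord0)
  (hN : tensor_QHP1 M mu N) (hx : flat_chart M A x G)
  (hXY : canonical_coordinates p q N A x G F D X Y).
Local Notation vec := ('rV[C]_n.+1).
Local Notation VC := ((vec * C)%type : normedModType C).
Local Notation e1 := (delta_mx 0 ord0 : vec).

(** The sum of the expansion of X, a function of Q on a full neighbourhood of 0, while X itself is
    known on a sector in log Q only. *)
Definition Xseries (z : vec * C) : vec :=
  \row_a bessel_series e1 (fun t => x t 0 a) (z : VC).

Definition chart_cross (z : vec * C) : vec * C := (Xseries z, z.2).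

Lemma chart_coord_sd t a : A t -> sd (fun t => x t 0 a) t.
Proof.
have oA := chart_open hx; move=> At.
exact: holomorphic_sd oA (holomorphic_coord a oA (chart_holomorphic hx)) t At.
Qed.

Lemma chart_sd t : A t -> sd x t.
Proof. exact: holomorphic_sd_row (chart_open hx) (chart_holomorphic hx) t. Qed.

Lemma Xseries_null t : A t -> Xseries (t, 0) = x t.
Proof.
move=> At; apply/rowP => a; rewrite mxE.
exact: (bessel_series_null e1 (chart_open hx) (fun t At => chart_coord_sd a At) At).
Qed.

Lemma Xseries_sd t0 : A t0 -> exists2 r, 0 < r & forall z : VC, nr (z - (t0, 0)) < r ->
  [/\ A z.1, sd (Xseries : VC -> vec) z & forall a, exists Ma, forall K,
    nr (Xseries z 0 a - \sum_(k < K) bessel_term e1 (fun t => x t 0 a) k z) <= Ma / 2 ^+ K].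
Proof.
move=> At0; have oA := chart_open hx.
have sx a t : A t -> sd (fun t => x t 0 a) t by exact: chart_coord_sd.
have [r r0 hr] : exists2 r, 0 < r & forall a, exists M0, forall z : VC, nr (z - (t0, 0)) < r ->
    A z.1 /\ forall k, nr (bessel_term e1 (fun t => x t 0 a) k z) <= M0 / 2 ^+ k.
  apply: finite_min => [a e e' ee' [M0 h]|a]; last first.
    by have [r r0 [M0 _ h]] := bessel_seriesP e1 oA (sx a) At0; exists r => //; exists M0.
  by exists M0 => z ze; apply: h; exact: lt_le_trans ze ee'.
exists r => // z zr; split.
- by have [M0 h] := hr ord0; exact: (h z zr).1.
- pose L a u := glim (fun K => \sum_(k < K) 'D_u (bessel_term e1 (fun t => x t 0 a) k : VC -> C) z).
  apply: (@sdiff_sd _ _ _ _ _ (fun u => \row_a L a u)); apply: sdiff_row => a.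
  have [M0 h] := hr a.
  have E : sdiff (fun z : VC => Xseries z 0 a) z (L a).
    have H := @series_sum_sdiff R VC (bessel_term e1 (fun t => x t 0 a)) (t0, 0) r M0
      (fun k z zr => @sd_bessel_term R vec A _ e1 oA (sx a) k z (h z zr).1) (fun k z zr => (h z zr).2 k) z zr.
    apply: (sdiff_ext _ H); exists 1; first exact: ltr01.
    by move=> y _; rewrite mxE.
  by apply: sdiff_eq E _ => u; rewrite mxE.
- move=> a; have [M0 h] := hr a; exists (2 * M0) => K; rewrite mxE.
  exact: (@series_sum_dist R VC _ (t0, 0) r M0 (fun k z zr => (h z zr).2 k) z K zr).
Qed.

(** On a small sector X and [Xseries] are limits of the same partial sums with geometric errors,
    hence equal. *)
Lemma cross_data t0 : A t0 -> exists2 r, 0 < r & exists rho,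
  (forall z : VC, nr (z - (t0, 0)) < r -> A z.1 /\ sd (Xseries : VC -> vec) z) /\
  (forall t s, nr (t - t0) < r -> sector p q rho s ->
    [/\ A t, D (cross_pt t s), X (cross_pt t s) = Xseries (t, cexp s) &
      X_expansion x t s (X (cross_pt t s))]).
Proof.
move=> At0; have oA := chart_open hx; have [r1 r10 h1] := Xseries_sd At0.
have sx a t : A t -> sd (fun t => x t 0 a) t by exact: chart_coord_sd.
have [d1 d10 [rho1 hD]] := (Qto0_near _ _ _ _).1 (canonical_dom hXY At0).
have [d d0 hd] : exists2 d, 0 < d & forall a, exists K rho, forall y s, nr (y - t0) < d ->
    sector p q rho s -> nr (X (cross_pt y s) 0 a - x y 0 a) <= K * expR (complex.Re s).
  apply: finite_min => [a e e' ee' [K [rho h]]|a].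
    by exists K, rho => y s ye; apply: h; exact: lt_le_trans ye ee'.
  have [K hK] := canonical_X_asymptotic hXY a At0.
  have [d d0 [rho h]] := (Qto0_near _ _ _ _).1 hK; exists d => //.
  (* The constant of the asymptotics is complex; an inequality in the order of C compares real
     parts. *)
  exists (complex.Re K), rho => y s yd hs; have := h y s yd hs.
  rewrite /= !nrE -nr_cexp => q1.
  have : (rc (nr (X (cross_pt y s) 0 a - x y 0 a))) <= K * rc (nr (cexp s)) by exact: q1.
  rewrite lecE => /andP[_]; rewrite /rc /=; move: (nr _) (nr (cexp s)) => u v.
  by case: (K) => k1 k2 /=; rewrite mulr0 subr0.
(* Within [d'] of t0 the asymptotics and the domains are all available; one half, [rr], is left to t
   and the other half to the disc around t. *)
pose d' := Num.min d (Num.min d1 r1).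
have d'0 : 0 < d' by rewrite !lt_min d0 d10.
pose rr := d' / 2; have rr0 : 0 < rr by rewrite divr_gt0.
pose ne := nr e1 + 1; have ne0 : 0 < ne by rewrite /ne; have := nr_ge0 e1; lra.
pose ra := rr / (2 * ne); have ra0 : 0 < ra by rewrite divr_gt0 // mulr_gt0.
have small (z : C) : nr z <= 1 -> nr (z *: (rc ra *: e1)) < rr.
  move=> z1; rewrite !nrZ nr_rc gtr0_norm //.
  have h2 : ra * nr e1 <= rr / 2.
    rewrite /ra mulrAC ler_pdivrMr ?mulr_gt0 // [leRHS](_ : _ = rr * ne); last by field.
    by rewrite ler_wpM2l // /ne; [exact: ltW | lra].
  have h3 : nr z * (ra * nr e1) <= 1 * (ra * nr e1).
    by rewrite ler_wpM2r // mulr_ge0 ?nr_ge0 // ltW.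
  lra.
have [b hb] := expR_small (divr_gt0 (exprn_gt0 2 ra0) (ltr0n R 8)).
have [b' hb'] := expR_small rr0.
have /choice[Kf hKf] := hd.
have [rhof hrho] : exists rho, forall a s, sector p q rho s ->
    [/\ forall y, nr (y - t0) < d -> nr (X (cross_pt y s) 0 a - x y 0 a) <= Kf a * expR (complex.Re s),
       sector p q rho1 s, complex.Re s <= b & complex.Re s <= b'].
  have /choice[rhof hrhof] := hKf.
  exists (Num.min rho1 (Num.min (Num.min b b') (\big[Num.min/0]_a rhof a))) => a s [s1].
  rewrite !lt_min => /and3P[s2 /andP[s3 s3'] s4]; split; [| |exact: ltW|exact: ltW]; last by split.
  move=> y yd; apply: hrhof => //; split=> //; apply: lt_le_trans s4 _.
  by rewrite (bigminD1 a) //= ge_min lexx.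
exists rr => //; exists rhof; split=> [z zr|t s tr hs].
  have [|? ? _] := h1 z; last by split.
  apply: lt_le_trans zr _; rewrite /rr /d'.
  have : Num.min d (Num.min d1 r1) <= r1 by rewrite !ge_min lexx !orbT.
  by move: d'0; rewrite /d'; move: (Num.min _ _) => ?; lra.
have dd : d' <= d by rewrite ge_min lexx.
have dd1 : d' <= d1 by rewrite !ge_min lexx !orbT.
have dr1 : d' <= r1 by rewrite !ge_min lexx !orbT.
have td (y : vec) : nr (y - t) < rr -> nr (y - t0) < d'.
  have half (u v c : R) : u < c / 2 -> v < c / 2 -> u + v < c by lra.
  by move=> yt; apply: le_lt_trans (nr_tri t y t0) (half _ _ _ yt tr).
have tt0 : nr (t - t0) < d' by apply: td; rewrite subrr nr0.
have [_ hs1 sb sb'] := hrho ord0 s hs.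
have At : A t.
  have [|//] := h1 (t, 0); apply: le_lt_trans (_ : nr (t - t0) < r1); last by lra.
  have -> : ((t, 0) : VC) - (t0, 0) = (t - t0, 0) by apply: pairE; rewrite //= subr0.
  by rewrite nr_pair nr0 ge_max lexx nr_ge0.
have key a : exists M', forall J, nr (X (cross_pt t s) 0 a -
    \sum_(j < J.+1) bessel_term e1 (fun t => x t 0 a) j (t, cexp s)) <= M' / 2 ^+ J.
  pose Ka := Num.max (Kf a) 0.
  apply: (@odd_period_series R n M mu N hM hunity hN D _ (canonical_X hXY a)
    (fun t => x t 0 a) A t rr Ka rhof ra oA (sx a) ra0 _ _ _ _ s p q hs) => //.
  - by rewrite le_max lexx orbT.
  - exact: (chart_regular hx At).1.
  - move=> z z1; have h := small z z1; split; last by rewrite [X in nr X]addrAC subrr add0r.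
    have [|//] := h1 (t + z *: (rc ra *: e1), 0).
    have -> : ((t + z *: (rc ra *: e1), 0) : VC) - (t0, 0) = (t + z *: (rc ra *: e1) - t0, 0).
      by apply: pairE; rewrite //= subr0.
    rewrite nr_pair nr0; apply: le_lt_trans (lt_le_trans (td (t + z *: (rc ra *: e1)) _) dr1).
      by rewrite ge_max lexx nr_ge0.
    by rewrite [X in nr X]addrAC subrr add0r.
  - move=> y yt; have [|Ay _ _] := h1 (y, 0); last exact: (chart_regular hx Ay).1.
    have -> : ((y, 0) : VC) - (t0, 0) = (y - t0, 0) by apply: pairE; rewrite //= subr0.
    by rewrite nr_pair nr0; apply: le_lt_trans (lt_le_trans (td y yt) dr1); rewrite ge_max lexx nr_ge0.
  - move=> y s' yt hs'; have [h2 hs1' _ _] := hrho a s' hs'; split.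
      by apply: (hD y s') hs1'; exact: lt_le_trans (td y yt) dd1.
    apply: le_trans (h2 y (lt_le_trans (td y yt) dd)) _.
    by rewrite ler_wpM2r ?expR_ge0 // le_max lexx.
  - exact: hb.
have Qr : nr (((t, cexp s) : VC) - (t0, 0)) < r1.
  have -> : ((t, cexp s) : VC) - (t0, 0) = (t - t0, cexp s) by apply: pairE; rewrite //= subr0.
  rewrite nr_pair nr_cexp gt_max; apply/andP; split; first by lra.
  by apply: le_lt_trans (hb' _ sb') _; rewrite /rr; lra.
have [_ _ hXs] := h1 _ Qr.
have XE : X (cross_pt t s) = Xseries (t, cexp s).
  apply/rowP => a; have [M' hM'] := key a; have [Ma hMa] := hXs a.
  apply: (@cvg_pow2_unique _ _ _ _ M' Ma hM') => K.
  apply: le_trans (hMa K.+1) _; rewrite ler_wpM2l //; last first.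
    by rewrite lef_pV2 ?posrE ?exprn_gt0 // ler_weXn2l // ler1n.
  have := hMa 0%N; rewrite expr0 divr1; apply: le_trans; exact: nr_ge0.
split=> //; first exact: (hD t s (lt_le_trans tt0 dd1) hs1).
move=> a; have [M' hM'] := key a.
have /cvg_seqP cv := cvg_pow2 hM'.
(* The partial sums of [key] have J + 1 terms, the first being x^a itself; hence the shift by
   one. *)
apply/cvg_seqP => e e0; have [K0 hK0] := cv e e0; exists K0.+1 => -[//|K] KK.
have := hK0 K KK; rewrite big_ord_recl.
have -> : bessel_term e1 (fun t => x t 0 a) (@ord0 K) (t, cexp s) = x t 0 a.
  by rewrite /bessel_term /= fact0 expr0 mul1r expr1n divr1.
rewrite big_add1 /= big_mkord; congr (nr (_ + _ - _) < e); apply: eq_bigr => j _.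
have gen (u v w : C) : u * (v / w) = u / w * v by rewrite mulrA mulrAC.
exact: gen.
Qed.

(* [tau] is the inverse of [(t, Q) |-> (X (t, Q), Q)] near [(t0, 0)]. *)
Definition local_data t0 (r rho kappa : R) (tau : vec * C -> vec * C) : Prop :=
  [/\ 0 < r, 0 < kappa, forall z : VC, nr (z - (t0, 0)) < r -> A z.1 /\ sd (Xseries : VC -> vec) z,
   forall t s, nr (t - t0) < r -> sector p q rho s ->
    [/\ A t, D (cross_pt t s), X (cross_pt t s) = Xseries (t, cexp s) &
      X_expansion x t s (X (cross_pt t s))] &
   [/\ forall y : VC, nr (y - (x t0, 0)) < kappa ->
         nr ((tau y : VC) - (t0, 0)) < r /\ chart_cross (tau y) = y,
      forall z z' : VC, nr (z - (t0, 0)) < r -> nr (z' - (t0, 0)) < r ->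
         chart_cross z = chart_cross z' -> z = z' &
      forall y : VC, nr (y - (x t0, 0)) < kappa -> sd (tau : VC -> VC) y]].

(** At Q = 0 the map restricts to the chart [x], so its derivative at (t0, 0) is block triangular,
    with the Jacobian of the chart and 1 on the diagonal; [L'] solves this system. *)
Lemma local_data_ex t0 : A t0 -> exists r rho kappa tau, local_data t0 r rho kappa tau.
Proof.
move=> At0; have [r1 r10 [rho [h1 h2]]] := cross_data At0.
have z0 : nr (((t0, 0) : VC) - (t0, 0)) < r1 by rewrite subrr nr0.
have [_ s0] := h1 _ z0.
pose J := 'J x t0; pose v1 := 'D_((0, 1) : VC) (Xseries : VC -> vec) (t0, 0).
have uJ : J \in unitmx := chart_jacobian hx At0.
have Xu u : 'D_((u, 0) : VC) (Xseries : VC -> vec) (t0, 0) = u *m J.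
  rewrite -(derive_jacobian u (chart_holomorphic hx At0).1).
  have hi : sdiff (fun t : vec => ((t, 0) : VC)) t0 (fun u : vec => ((u, 0) : VC)).
    exact: (sdiff_pair (sdiff_id t0) (@sdiff_cst R vec C 0 t0)).
  have h3 := sdiff_comp hi s0.
  have h4 : sdiff x t0 (fun u => 'D_((u, 0) : VC) (Xseries : VC -> vec) (t0, 0)).
    apply: (sdiff_ext _ h3); have [d d0 hd] := (open_nrP A).1 (chart_open hx) t0 At0.
    exists d; first exact: d0.
    by move=> t td; rewrite Xseries_null //; exact: hd.
  by symmetry; exact: (sdiff_derive u h4).
pose L (u : VC) : VC := (u.1 *m J + u.2 *: v1, u.2).
pose L' (w : VC) : VC := ((w.1 - w.2 *: v1) *m invmx J, w.2).
have sPhi (z : VC) : nr (z - (t0, 0)) < r1 -> sd (chart_cross : VC -> VC) z.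
  move=> zr; have [_ sz] := h1 z zr.
  exact: sdiff_sd (sdiff_pair sz (sdiff_lin z (blin_snd vec C))).
have sL : sdiff (chart_cross : VC -> VC) (t0, 0) L.
  have h3 := sdiff_pair s0 (sdiff_lin ((t0, 0) : VC) (blin_snd vec C)).
  apply: (sdiff_eq h3) => u; apply: pairE => //=.
  have -> : u = ((u.1, 0) : VC) + u.2 *: ((0, 1) : VC).
    by apply: pairE; rewrite /= ?scaler0 ?addr0 // add0r /GRing.scale /= mulr1.
  have [bL _] := s0; rewrite (blinD _ _ bL) (blinZ _ _ bL) Xu /= scaler0 !addr0 add0r.
  by rewrite [u.2 *: 1]scaleCE mulr1.
have bL' : blin L'.
  apply: (@blin_pair R VC vec C (fun w : VC => (w.1 - w.2 *: v1) *m invmx J)); last exact: blin_snd.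
  have b1 : blin (fun w : VC => w.1 - w.2 *: v1).
    have := blin_add (blin_fst vec C) (blin_scale (-1) (blin_scalel v1 (blin_snd vec C))).
    congr blin; apply/funext => w; by rewrite scaleN1r.
  apply: (@blin_comp R VC vec vec _ (fun v => v *m invmx J) b1).
  by apply: blin_linear_row => c u v; rewrite mulmxDl scalemxAl.
have L'L v : L' (L v) = v.
  by apply: pairE => //=; rewrite addrK mulmxK.
have LL' w : L (L' w) = w.
  by apply: pairE => //=; rewrite mulmxKV // subrK.
have gc : geometrically_complete (VC : normedModType C).
  exact: geometrically_complete_pair (@geometrically_complete_row R n.+1) (@geometrically_complete_C R).
have [r [kappa [tau [/andP[r0 rr1] k0 [H1 H2 H3]]]]] := inverse_function gc r10 sPhi sL bL' L'L LL'.
have E0 : chart_cross (t0, 0) = (x t0, 0) by rewrite /chart_cross Xseries_null.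
rewrite E0 in H1 H3.
exists r, rho, kappa, tau; split=> //.
- by move=> z zr; apply: h1; exact: lt_le_trans zr rr1.
- by move=> t s tr; apply: h2; exact: lt_le_trans tr rr1.
Qed.

End LocalData.

(** * The generating function *)

Section Power.
Variable R : realType.

Lemma lt_quarter (u k : R) : 0 < k -> u < k / 4 -> u < k.
Proof. by move=> k0 h; lra. Qed.

Local Notation C := (Cplx R).

Lemma sdiff_pow (z : C) k : sdiff (fun x : C => x ^+ k) z (fun h => k%:R * z ^+ k.-1 * h).
Proof.
elim: k => [|k IH].
  by apply: sdiff_eq (@sdiff_cst R C C 1 z) _ => h; rewrite mul0r mul0r.
apply: sdiff_eq (sdiff_ext _ (sdiffM (sdiff_id z) IH)) _ => [|h].
  by exists 1; [exact: ltr01 | move=> y _; rewrite exprS].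
case: k {IH} => [|k] /=; first by rewrite !expr0; ring.
by rewrite exprS -[k.+2%:R]natr1; ring.
Qed.
End Power.

(** * The power series part of the generating function *)

Section LocalGeneratingFunction.
Variable R : realType.
Local Notation C := (Cplx R).
Local Notation rc := (@rc R).
Variables (n : nat) (M : frobenius_data R n.+1)
  (A : set 'rV[C]_n.+1) (x : 'rV[C]_n.+1 -> 'rV[C]_n.+1) (G : 'M[C]_n.+1)
  (p q : R) (D : set 'rV[C]_(n.+1 + n.+1))
  (X : 'rV[C]_(n.+1 + n.+1) -> 'rV[C]_n.+1).
Hypotheses (hx : flat_chart M A x G).
Local Notation vec := ('rV[C]_n.+1).
Local Notation VC := ((vec * C)%type : normedModType C).
Variable (Ham : vec -> C).
Hypotheses (bHam : blin Ham) (HamE : forall t, A t -> Ham t = Gquad G (x t) / 2).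

Definition hamiltonian_at (tau : vec * C -> vec * C) (y : VC) : C := Ham (tau y).1.

(* The coefficient of [Q^k] in the expansion of the Hamiltonian at [(v, Q)],
   computed on the disc of radius [kappa / 2], where [tau] is defined. *)
Definition coef (kappa : R) tau (k : nat) (v : vec) : C :=
  (rc (kappa / 2))^-1 ^+ k * taylor k ((0, rc (kappa / 2)) : VC) (hamiltonian_at tau) ((v, 0) : VC).

(* Since [0^-1 = 0], the term of index 0 vanishes. *)
Definition action_term kappa tau (k : nat) (z : VC) : C :=
  coef kappa tau k z.1 / k%:R * z.2 ^+ k.

Lemma sdiff_Gquad v : (invmx G)^T = invmx G ->
  sdiff (Gquad G) v (fun u : vec => 2 * (u *m invmx G *m v^T) 0 0).
Proof.
move=> Gs; have gE (u w : vec) : (u *m invmx G *m w^T) 0 0 = \sum_j (u *m invmx G) 0 j * w 0 j.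
  by rewrite mxE; apply: eq_bigr => j _; rewrite [w^T _ _]mxE.
have bG : blin (fun u : vec => u *m invmx G).
  by apply: blin_linear_row => c u w; rewrite mulmxDl scalemxAl.
have sym (u w : vec) : (u *m invmx G *m w^T) 0 0 = (w *m invmx G *m u^T) 0 0.
  transitivity ((u *m invmx G *m w^T)^T 0 0); first by rewrite [RHS]mxE.
  by rewrite !trmx_mul trmxK Gs mulmxA.
have h : sdiff (fun v : vec => \sum_j (v *m invmx G) 0 j * v 0 j) v
    (fun u => \sum_j ((v *m invmx G) 0 j * u 0 j + (u *m invmx G) 0 j * v 0 j)).
  apply: (@sdiff_sum _ _ _ _ (index_enum 'I_n.+1) xpredT (fun j (v : vec) => (v *m invmx G) 0 j * v 0 j)).
  move=> j _; have h1 := sdiff_coord j (sdiff_lin v bG); have h2 := sdiff_lin v (@blin_coord R n.+1 j).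
  exact: (sdiffM h1 h2).
apply: sdiff_eq (sdiff_ext _ h) _ => [|u].
  by exists 1; [exact: ltr01 | move=> w _; rewrite /Gquad gE].
by rewrite big_split /= -!gE sym mulrDl mul1r.
Qed.

Section At.
Variables (t0 : vec) (r rho kappa : R) (tau : vec * C -> vec * C).
Hypothesis hl : local_data A x p q D X t0 r rho kappa tau.
Local Notation h := (hamiltonian_at tau).
Local Notation c := (coef kappa tau).

Lemma tau_fst y : nr ((y : VC) - (x t0, 0)) < kappa ->
  [/\ A (tau y).1, (tau y).2 = y.2, Xseries x (tau y) = y.1 & nr ((tau y).1 - t0) < r].
Proof.
case: hl => r0 k0 h1 _ [h2 _ _] hy; have [h3 h4] := h2 y hy; have [h5 _] := h1 _ h3.
split=> //; first by rewrite -[in RHS]h4.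
  by rewrite -[in RHS]h4.
exact: le_lt_trans (nr_pairl (tau y - (t0, 0) : VC)) h3.
Qed.

Lemma hamiltonian_sd y : nr ((y : VC) - (x t0, 0)) < kappa -> sd h y.
Proof.
case: hl => r0 k0 h1 _ [_ _ h2] hy.
have e1 := sdiff_comp (h2 y hy) (sdiff_lin (tau y : VC) (blin_fst vec C)).
exact: sdiff_sd (sdiff_comp e1 (sdiff_lin _ bHam)).
Qed.

Lemma hamiltonian_bound : exists2 B, 0 < B &
  forall y, nr ((y : VC) - (x t0, 0)) < kappa -> nr (h y) <= B.
Proof.
case: bHam => _ [K K0 hK]; have r0 : 0 < r by case: hl.
exists (K * (nr t0 + r)); first by rewrite mulr_gt0 // ltr_wpDl // nr_ge0.
move=> y hy; have [_ _ _ h1] := tau_fst hy.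
apply: le_trans (hK _) _; rewrite ler_pM2l //.
rewrite -[(tau y).1](subrK t0); apply: le_trans (nrD _ _) _; lra.
Qed.

Lemma ball_pair v (Q : C) e : nr (v - x t0) < e -> nr Q < e -> nr (((v, Q) : VC) - (x t0, 0)) < e.
Proof.
move=> h1 h2; have -> : ((v, Q) : VC) - (x t0, 0) = (v - x t0, Q) by apply: pairE; rewrite //= subr0.
by rewrite nr_pair gt_max h1.
Qed.

Lemma tau_null v : nr (v - x t0) < kappa ->
  [/\ A (tau (v, 0)).1, x (tau (v, 0)).1 = v & tau (v, 0) = ((tau (v, 0)).1, 0)].
Proof.
move=> hv; have k0 : 0 < kappa by case: hl.
have hy : nr (((v, 0) : VC) - (x t0, 0)) < kappa by apply: ball_pair; rewrite ?nr0.
have [At e2 e1 _] := tau_fst hy.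
have E : tau (v, 0) = ((tau (v, 0)).1, 0) by move: e2; case: (tau _) => ? ? /= ->.
by split=> //; rewrite -(Xseries_null hx At) -E e1.
Qed.

Lemma hamiltonian_null v : nr (v - x t0) < kappa -> h (v, 0) = Gquad G v / 2.
Proof.
move=> hv; have [At E _] := tau_null hv.
by rewrite /hamiltonian_at (HamE At) E.
Qed.

Lemma disc_in_ball v (z : C) : nr (v - x t0) < kappa / 2 -> nr z <= 1 ->
  nr (((v, 0) : VC) + z *: ((0, rc (kappa / 2)) : VC) - (x t0, 0)) < kappa.
Proof.
move=> hv z1; have k0 : 0 < kappa by case: hl.
have -> : ((v, 0) : VC) + z *: ((0, rc (kappa / 2)) : VC) - (x t0, 0) = (v - x t0, z * rc (kappa / 2)).
  by apply: pairE; rewrite /= ?scaler0 ?addr0 // add0r subr0.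
rewrite nr_pair nrM nr_rc gtr0_norm ?divr_gt0 // gt_max; apply/andP; split; first by lra.
have : nr z * (kappa / 2) <= 1 * (kappa / 2) by rewrite ler_wpM2r // divr_ge0 // ltW.
lra.
Qed.

Lemma coef_bound B k v : 0 <= B ->
  (forall y, nr ((y : VC) - (x t0, 0)) < kappa -> nr (h y) <= B) ->
  nr (v - x t0) < kappa / 2 -> nr (c k v) <= (kappa / 2)^-1 ^+ k * B.
Proof.
move=> B0 hB hv; have k0 : 0 < kappa by case: hl.
have k2 : 0 < kappa / 2 by rewrite divr_gt0.
rewrite /coef nrM nrX nrV nr_rc gtr0_norm // ler_wpM2l ?exprn_ge0 ?invr_ge0 ?(ltW k2) //.
by apply: taylor_bound => // z z1; apply: hB; exact: disc_in_ball.
Qed.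

Lemma coef_sd k v : nr (v - x t0) < kappa / 2 -> sd (c k) v.
Proof.
move=> hv.
have e1 : sdiff (fun v : vec => ((v, 0) : VC)) v (fun u : vec => ((u, 0) : VC)).
  exact: (sdiff_pair (sdiff_id v) (@sdiff_cst R vec C 0 v)).
have e2 := @taylor_sdiff R VC k ((0, rc (kappa / 2)) : VC) h ((v, 0) : VC)
  (fun z z1 => hamiltonian_sd (disc_in_ball hv z1)).
exact: sdiff_sd (sdiffZ _ (sdiff_comp e1 e2)).
Qed.

Lemma coef_null v : nr (v - x t0) < kappa / 2 -> c 0 v = Gquad G v / 2.
Proof.
move=> hv; have k0 : 0 < kappa by case: hl.
rewrite /coef expr0 mul1r taylor0; last by move=> z z1; exact: hamiltonian_sd (disc_in_ball hv z1).
by apply: hamiltonian_null; lra.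
Qed.

Section Bound.
Variable B : R.
Hypotheses (B0 : 0 <= B)
  (hB : forall y, nr ((y : VC) - (x t0, 0)) < kappa -> nr (h y) <= B).

(** The coefficients come from a disc of radius kappa / 2 and |Q| is less than half of it, whence
    the ratio 1/2. *)
Lemma coef_term_bound k v (Q : C) : nr (v - x t0) < kappa / 2 -> nr Q < kappa / 4 ->
  nr (c k v * Q ^+ k) <= B / 2 ^+ k.
Proof.
move=> hv hQ; have k0 : 0 < kappa by case: hl.
have k2 : 0 < kappa / 2 by rewrite divr_gt0.
rewrite nrM nrX; have := coef_bound k B0 hB hv.
move: (nr (c k v)) (nr_ge0 (c k v)) => cc cc0 h1.
have h2 : nr Q ^+ k <= (kappa / 4) ^+ k.
  by rewrite lerXn2r ?nnegrE ?nr_ge0 // ?divr_ge0 // ltW.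
have h3 : cc * nr Q ^+ k <= ((kappa / 2)^-1 ^+ k * B) * (kappa / 4) ^+ k.
  by rewrite ler_pM // exprn_ge0 // nr_ge0.
apply: le_trans h3 _; rewrite mulrAC -exprMn.
have -> : (kappa / 2)^-1 * (kappa / 4) = 2^-1 by field; rewrite gt_eqF.
by rewrite exprVn mulrC.
Qed.

Lemma coef_expansion (Q : C) v K : nr (v - x t0) < kappa / 2 -> nr Q < kappa / 4 ->
  nr (h (v, Q) - \sum_(k < K) c k v * Q ^+ k) <= 4 * B / 2 ^+ K.
Proof.
move=> hv hQ; have k0 : 0 < kappa by case: hl.
case: K => [|K].
  rewrite big_ord0 subr0 expr0 divr1; have : nr (h (v, Q)) <= B.
    by apply: hB; apply: ball_pair; lra.
  by move=> hh; apply: le_trans hh _; rewrite ler_peMl // ler1n.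
have k2 : 0 < kappa / 2 by rewrite divr_gt0.
have rk : rc (kappa / 2) != 0 by rewrite -(rc0 R); apply/eqP => /rcI E; rewrite E ltxx in k2.
(* Q in units of the radius kappa / 2: as |a| <= 1/2, the factor 1 / (1 - |a|) of [taylor_expansion]
   is at most 2. *)
pose a := Q / rc (kappa / 2).
have na : nr a <= 1 / 2.
  rewrite /a nrM nrV nr_rc gtr0_norm // ler_pdivrMr //; lra.
have na0 : 0 <= nr a := nr_ge0 a.
have := @taylor_expansion R VC h ((v, 0) : VC) ((0, rc (kappa / 2)) : VC) a B K _
  (fun z z1 => hamiltonian_sd (disc_in_ball hv z1)) (fun z z1 => hB (disc_in_ball hv z1)).
have -> : ((v, 0) : VC) + a *: ((0, rc (kappa / 2)) : VC) = (v, Q).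
  by apply: pairE; rewrite /= ?scaler0 ?addr0 // add0r scaleCE /a mulfVK.
have -> : \sum_(k < K.+1) c k v * Q ^+ k =
   \sum_(k < K.+1) a ^+ k * taylor k ((0, rc (kappa / 2)) : VC) h (v, 0).
  apply: eq_bigr => k _; rewrite /coef /a exprMn.
  move: (taylor _ _ _ _) (_ ^+ k) (Q ^+ k) => T u w; exact: etrans (mulrC _ _) (mulrA _ _ _).
move=> H; apply: le_trans (H _) _; first lra.
have e1 : nr a ^+ K.+1 <= (1 / 2) ^+ K.+1 by rewrite lerXn2r ?nnegrE //; lra.
rewrite ler_pdivrMr; last by lra.
have e2 : 2 * B * nr a ^+ K.+1 <= 2 * B * (1 / 2) ^+ K.+1 by rewrite ler_wpM2l // mulr_ge0.
apply: le_trans e2 _; rewrite mul1r exprVn.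
have : 0 <= B / 2 ^+ K.+1 by rewrite divr_ge0 // exprn_ge0.
move: (2 ^+ K.+1)^-1 => i Bi.
have : B * i * (1 / 2) <= B * i * (1 - nr a) by rewrite ler_wpM2l //; lra.
lra.
Qed.

Lemma sd_action_term k z : nr ((z : VC) - (x t0, 0)) < kappa / 4 ->
  sdiff (action_term kappa tau k : VC -> C) z (fun u => c k z.1 / k%:R * (k%:R * z.2 ^+ k.-1 * u.2)
    + ('D_u.1 (c k) z.1 / k%:R) * z.2 ^+ k).
Proof.
move=> hz; have k0 : 0 < kappa by case: hl.
have hv : nr (z.1 - x t0) < kappa / 2.
  by apply: le_lt_trans (nr_pairl (z - (x t0, 0) : VC)) _; lra.
have e1 := sdiffZ (k%:R^-1) (sdiff_comp (sdiff_lin z (blin_fst vec C)) (coef_sd k hv)).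
have e2 := sdiff_comp (sdiff_lin z (blin_snd vec C)) (@sdiff_pow R z.2 k).
apply: sdiff_eq (sdiff_ext _ (sdiffM e1 e2)) _ => [|u].
  by exists 1; [exact: ltr01 | move=> y _; rewrite /action_term scaleCE [_^-1 * _]mulrC].
by rewrite !scaleCE ![_^-1 * _]mulrC.
Qed.

Lemma action_term_bound k z : nr ((z : VC) - (x t0, 0)) < kappa / 4 ->
  nr (action_term kappa tau k z) <= B / 2 ^+ k.
Proof.
move=> hz; have k0 : 0 < kappa by case: hl.
have hv : nr (z.1 - x t0) < kappa / 2.
  by apply: le_lt_trans (nr_pairl (z - (x t0, 0) : VC)) _; lra.
have hQ : nr z.2 < kappa / 4.
  by apply: le_lt_trans hz; have := nr_pairr (z - (x t0, 0) : VC); rewrite /= subr0.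
rewrite /action_term mulrAC nrM; apply: le_trans (coef_term_bound k hv hQ).
rewrite -[leRHS]mulr1 ler_wpM2l ?nr_ge0 // nrV nr_nat.
by case: k => [|k]; rewrite ?invr0 // invf_le1 ?ltr0n // ler1n.
Qed.

Lemma action_dist z K : nr ((z : VC) - (x t0, 0)) < kappa / 4 ->
  nr (series_sum (action_term kappa tau : nat -> VC -> C) z -
     \sum_(k < K) action_term kappa tau k z) <= 2 * B / 2 ^+ K.
Proof. exact: (series_sum_dist (fun k z => @action_term_bound k z)). Qed.

End Bound.

(** With h_k the coefficients of the Hamiltonian, this is the sum of h_k Q^k / k: the primitive in Q
    of (H - h_0) / Q that vanishes at Q = 0. *)
Definition action := series_sum (action_term kappa tau : nat -> VC -> C).

Lemma action_sdiff z : nr ((z : VC) - (x t0, 0)) < kappa / 4 ->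
  sdiff action z (fun u => glim (fun K => \sum_(k < K) 'D_u (action_term kappa tau k : VC -> C) z)).
Proof.
have [B B0 hB] := hamiltonian_bound.
exact: (series_sum_sdiff (fun k z hz => sdiff_sd (sd_action_term k hz))
   (fun k z hz => action_term_bound (ltW B0) hB k hz)).
Qed.

Lemma action_null v : action (v, 0) = 0.
Proof.
rewrite /action /series_sum -[RHS](@glim_cst R); congr glim; apply/funext => K.
by apply: big1 => -[[|k] /= _] _; rewrite /action_term /= ?invr0 ?mulr0 ?mul0r // expr0n mulr0.
Qed.

(** In direction (0, Q) the derivative is Q d/dQ, that is, d/ds; it multiplies the k-th term by k
    and restores h_k Q^k. The missing term of index 0 is h_0 = G_ab X^a X^b / 2. *)
Lemma action_euler z : nr ((z : VC) - (x t0, 0)) < kappa / 4 ->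
  'D_((0, z.2) : VC) action z = h z - Gquad G z.1 / 2.
Proof.
move=> hz; have [B B0 hB] := hamiltonian_bound; have k0 : 0 < kappa by case: hl.
have hv : nr (z.1 - x t0) < kappa / 2.
  by apply: le_lt_trans (nr_pairl (z - (x t0, 0) : VC)) _; lra.
have hQ : nr z.2 < kappa / 4.
  by apply: le_lt_trans hz; have := nr_pairr (z - (x t0, 0) : VC); rewrite /= subr0.
pose w k := if k is k'.+1 then c k z.1 * z.2 ^+ k else 0.
apply: etrans (sdiff_derive _ (action_sdiff hz)) _.
have -> : (fun K => \sum_(k < K) 'D_((0, z.2) : VC) (action_term kappa tau k : VC -> C) z) =
    (fun K => \sum_(k < K) w k).
  apply/funext => K; apply: eq_bigr => k _.
  apply: etrans (sdiff_derive _ (sd_action_term k hz)) _ => /=.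
  have [b0 _] := coef_sd k hv; rewrite (blin0 b0) mul0r mul0r addr0.
  case: (nat_of_ord k) => [|k'] /=; first by rewrite invr0 mulr0 mul0r.
  have n0 : (k'.+1%:R : C) != 0 by rewrite pnatr_eq0.
  move: (c _ _) (k'.+1%:R : C) n0 => c' m n0; rewrite exprSr -[m * _ * _]mulrA.
  by rewrite mulrA mulfVK.
have wB k : nr (w k) <= B / 2 ^+ k.
  case: k => [|k]; first by rewrite nr0 divr_ge0 // ?exprn_ge0 // ltW.
  exact: (coef_term_bound (ltW B0) hB k.+1 hv hQ).
apply: (@cvg_pow2_unique _ (fun K => \sum_(k < K.+1) w k) _ _ (2 * B) (4 * B)) => K.
  apply: le_trans (glim_series_dist wB K.+1) _; rewrite ler_wpM2l ?lef_pV2 ?posrE ?exprn_gt0 //.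
    by rewrite mulr_ge0 // ltW.
  by rewrite ler_weXn2l // ler1n.
have := coef_expansion (ltW B0) hB K.+1 hv hQ.
rewrite big_ord_recl [X in _ -> nr (_ - X) <= _]big_ord_recl add0r expr0 mulr1 (coef_null hv) opprD addrA.
rewrite -surjective_pairing => H; apply: le_trans H _; rewrite ler_wpM2l ?lef_pV2 ?posrE ?exprn_gt0 //.
  by rewrite mulr_ge0 // ltW.
by rewrite ler_weXn2l // ler1n.
Qed.

End At.

(* Both [tau] and [tau1] select the preimage of [(v, Q)] near the same point,
   because the chart is injective. *)
Lemma coef_unique t0 r rho kappa tau t1 r1 rho1 kappa1 tau1 k v :
  local_data A x p q D X t0 r rho kappa tau -> local_data A x p q D X t1 r1 rho1 kappa1 tau1 ->
  nr (v - x t0) < kappa / 2 -> nr (v - x t1) < kappa1 / 2 ->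
  coef kappa tau k v = coef kappa1 tau1 k v.
Proof.
move=> hl hl1 hv hv1.
have k0 : 0 < kappa by case: hl. have k10 : 0 < kappa1 by case: hl1.
have [B B0 hB] := hamiltonian_bound hl; have [B1 B10 hB1] := hamiltonian_bound hl1.
have hv' : nr (v - x t0) < kappa by lra. have hv1' : nr (v - x t1) < kappa1 by lra.
have [At xt tE] := tau_null hl hv'; have [At1 xt1 tE1] := tau_null hl1 hv1'.
have tt : tau (v, 0) = tau1 (v, 0).
  by rewrite tE tE1; congr pair; apply: (chart_inj hx) => //; rewrite xt xt1.
have [_ _ _ _ [H1 H2 _]] := hl; have [_ _ _ _ [H3 _ H4]] := hl1.
have hb Q : nr Q < kappa -> nr (((v, Q) : VC) - (x t0, 0)) < kappa by exact: ball_pair.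
have hb1 Q : nr Q < kappa1 -> nr (((v, Q) : VC) - (x t1, 0)) < kappa1 by exact: ball_pair.
have z0 : nr (0 : C) < kappa by rewrite nr0.
have z1 : nr (0 : C) < kappa1 by rewrite nr0.
have [a1 _] := H1 _ (hb 0 z0).
have a2 : 0 < r - nr ((tau (v, 0) : VC) - (t0, 0)) by rewrite subr_gt0.
have [d d0 hd] := sdiff_continuous (H4 _ (hb1 0 z1)) a2.
(* For |Q| < e both preimages exist, and the one given by [tau1] lies in the ball around (t0, 0) on
   which [chart_cross] is injective. *)
pose e := Num.min d (Num.min (kappa / 4) (kappa1 / 4)).
have e0 : 0 < e by rewrite !lt_min d0 !divr_gt0.
have same Q : nr Q < e -> hamiltonian_at tau (v, Q) = hamiltonian_at tau1 (v, Q).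
  rewrite !lt_min => /and3P[q1 q2 q3]; congr (Ham _.1).
  have s1 := lt_quarter k0 q2; have s2 := lt_quarter k10 q3.
  have [b1 b2] := H1 _ (hb Q s1); have [_ b3] := H3 _ (hb1 Q s2).
  apply: H2; [exact: b1| |by rewrite b2 b3].
  have := hd (v, Q) _; rewrite -tt => /(_ _) h.
  have {}h : nr ((tau1 (v, Q) : VC) - tau (v, 0)) < r - nr ((tau (v, 0) : VC) - (t0, 0)).
    apply: h; have -> : ((v, Q) : VC) - (v, 0) = (0, Q) by apply: pairE; rewrite /= ?subrr ?subr0.
    by rewrite nr_pair nr0 gt_max q1 d0.
  by apply: le_lt_trans (nr_tri (tau (v, 0) : VC) _ _) _; rewrite -ltrBrDr.
have Q0E : nr (rc (e / 2)) = e / 2 by rewrite nr_rc gtr0_norm // divr_gt0.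
have [em1 em2] : e <= kappa / 4 /\ e <= kappa1 / 4 by rewrite !ge_min !lexx !orbT.
have := @power_series_eq0 R (fun k => coef kappa tau k v - coef kappa1 tau1 k v) (rc (e / 2)) (B + B1)
  [set Q | nr Q < e].
have ub (b : R) j : 0 < b -> b / 2 ^+ j <= b.
  by move=> b0; rewrite ler_pdivrMr ?exprn_gt0 // ler_peMr ?(ltW b0) // exprn_ege1 // ler1n.
move=> H; have {}H : coef kappa tau k v - coef kappa1 tau1 k v = 0; last by apply/eqP; rewrite -subr_eq0 H.
apply: H.
- by apply/eqP => E; move: Q0E; rewrite E nr0; lra.
- move=> j; rewrite mulrBl; apply: le_trans (nrB _ _) _; apply: lerD.
    apply: le_trans (ub _ j B0); apply: (coef_term_bound hl (ltW B0) hB _ hv); lra.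
  apply: le_trans (ub _ j B10); apply: (coef_term_bound hl1 (ltW B10) hB1 _ hv1); lra.
- move=> e' e'0; exists (rc (Num.min e e' / 2)).
  have m0 : 0 < Num.min e e' by rewrite lt_min e0.
  have m1 : Num.min e e' <= e by rewrite ge_min lexx.
  have m2 : Num.min e e' <= e' by rewrite ge_min lexx orbT.
  rewrite nr_rc gtr0_norm ?divr_gt0 //; split; [|lra|lra].
  by rewrite /mkset nr_rc gtr0_norm ?divr_gt0 //; lra.
move=> Q /= Qe; apply: (@cvg_pow2 _ _ _ (4 * B + 4 * B1)) => K.
have q1 : nr Q < kappa / 4 by lra. have q2 : nr Q < kappa1 / 4 by lra.
have E1 := coef_expansion hl (ltW B0) hB K hv q1.
have E2 := coef_expansion hl1 (ltW B10) hB1 K hv1 q2.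
rewrite (_ : 0 - _ = (hamiltonian_at tau (v, Q) - \sum_(k < K) coef kappa tau k v * Q ^+ k) -
   (hamiltonian_at tau1 (v, Q) - \sum_(k < K) coef kappa1 tau1 k v * Q ^+ k)).
  by rewrite mulrDl; apply: le_trans (nrB _ _) (lerD E1 E2).
rewrite (same Q Qe) sub0r; under eq_bigr do rewrite mulrBl.
by rewrite sumrB; ring.
Qed.

End LocalGeneratingFunction.

Section Estimate.
Variable R : realType.
Local Notation C := (Cplx R).

(** Four errors, in this order: the asymptotics of Y, log Q times the change from x to v, the change
    in the derivative of F, and the derivative of the action. *)
Lemma defect_bound (e : R) (Yv lx lv sp Fx Fv Pa : C) : nr (Yv - (lx * sp - 2 * Fx)) < e / 5 ->
  nr ((lx - lv) * sp) <= e / 5 -> nr (Fx - Fv) < e / 20 -> nr Pa < e / 5 ->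
  nr (Yv - (lv * sp - 2 * Fv + Pa)) <= e.
Proof.
move=> g1 g2 g3 g4; have := nr_ge0 Pa.
have -> : Yv - (lv * sp - 2 * Fv + Pa) =
  (Yv - (lx * sp - 2 * Fx)) + (lx - lv) * sp - (2 * (Fx - Fv)) - Pa by ring.
have := nrB ((Yv - (lx * sp - 2 * Fx)) + (lx - lv) * sp - (2 * (Fx - Fv))) Pa.
have := nrB ((Yv - (lx * sp - 2 * Fx)) + (lx - lv) * sp) (2 * (Fx - Fv)).
have := nrD (Yv - (lx * sp - 2 * Fx)) ((lx - lv) * sp).
rewrite [nr (2 * (Fx - Fv))]nrM (nr_nat R 2).
move: (nr _) (nr _) (nr _) (nr _) (nr _) (nr _) g1 g2 g3 g4 => *; lra.
Qed.
End Estimate.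

(** * The Lagrangian manifolds near a point of the chart *)

Section LocalLagrangian.
Variable R : realType.
Local Notation C := (Cplx R).
Local Notation rc := (@rc R).
Variables (n : nat) (M : frobenius_data R n.+1) (mu : 'rV[C]_n.+1)
  (N : frobenius_data R (n.+1 + n.+1))
  (A : set 'rV[C]_n.+1) (x : 'rV[C]_n.+1 -> 'rV[C]_n.+1) (G : 'M[C]_n.+1)
  (F : 'rV[C]_n.+1 -> C) (p q : R) (D : set 'rV[C]_(n.+1 + n.+1))
  (X Y : 'rV[C]_(n.+1 + n.+1) -> 'rV[C]_n.+1).
Hypotheses (hM : frobenius_manifold M) (hunity : funity M = delta_mx 0 ord0)
  (heta : forall a b, flat_metric M a b = (b == rev_ord a)%:R)
  (hV : forall t, fdom M t -> Vmx M t = diag_mx mu)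
  (hmu : forall a, mu 0 a != 2^-1)
  (hmu_rev : forall a, mu 0 a + mu 0 (rev_ord a) = 0)
  (heuler : forall t a, fdom M t -> mu 0 a != (2 - fcharge M) / 2 ->
       feuler M t 0 a = ((2 - fcharge M) / 2 - mu 0 a) * t 0 a)
  (hN : tensor_QHP1 M mu N) (hx : flat_chart M A x G) (hF : dual_potential M A x G F)
  (hXY : canonical_coordinates p q N A x G F D X Y).
Local Notation vec := ('rV[C]_n.+1).
Local Notation VC := ((vec * C)%type : normedModType C).

Definition hamiltonian (t : vec) : C :=
  2 / (1 - fcharge M) * (\sum_a flat_metric M ord0 a * t 0 a).

Lemma blin_hamiltonian : blin hamiltonian.
Proof.
apply: blin_linear_row => c u v; rewrite /hamiltonian scaleCE.
rewrite mulrCA -mulrDr [c * _]mulr_sumr -big_split; congr (_ * _); apply: eq_bigr => a _.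
by rewrite !mxE /=; ring.
Qed.

Lemma hamiltonianE t : A t -> hamiltonian t = Gquad G (x t) / 2.
Proof. exact: (hamiltonian_quadratic hM hunity heta hV hmu hmu_rev heuler hx). Qed.

Lemma chart_gram_sym : A !=set0 -> (invmx G)^T = invmx G.
Proof.
case=> t At; rewrite trmx_inv; congr invmx; apply/matrixP => a b; rewrite mxE.
rewrite -(chart_gram hx a b At) -(chart_gram hx b a At).
apply: (intersection_formC hM); exact: (chart_regular hx At).1.
Qed.

Variables (t0 : vec) (r rho kappa : R) (tau : vec * C -> vec * C).
Hypotheses (At0 : A t0) (hl : local_data A x p q D X t0 r rho kappa tau).
Local Notation h := (hamiltonian_at hamiltonian tau).
Local Notation P := (action hamiltonian kappa tau).
Let Gs : (invmx G)^T = invmx G.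
Proof. by apply: chart_gram_sym; exists t0. Qed.
Let k0 : 0 < kappa.
Proof. by case: hl. Qed.

Definition local_S (z : VC) : C := Gquad G z.1 / 2 * z.2 - 2 * F z.1 + P (z.1, cexp z.2).

Lemma chart_image v : nr (v - x t0) < kappa -> (x @` A) v.
Proof. by move=> hv; have [At E _] := tau_null hx hl hv; exists (tau (v, 0)).1. Qed.

Lemma potential_sd v : (x @` A) v -> sd F v.
Proof. exact: holomorphic_sd (chart_image_open hx) hF.1 v. Qed.

Lemma sdiff_exp_snd (z : VC) : sdiff (fun z : VC => ((z.1, cexp z.2) : VC)) z
  (fun u : VC => ((u.1, cexp z.2 * u.2) : VC)).
Proof.
exact: (sdiff_pair (sdiff_lin z (blin_fst vec C)) (sdiff_comp (sdiff_lin z (blin_snd vec C)) (sdiff_cexp z.2))).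
Qed.

Lemma local_S_sdiff z : nr (z.1 - x t0) < kappa / 4 -> nr (cexp z.2) < kappa / 4 ->
  sdiff local_S z (fun u : VC => (u.1 *m invmx G *m z.1^T) 0 0 * z.2 + Gquad G z.1 / 2 * u.2
    - 2 * 'D_u.1 F z.1 + 'D_((u.1, cexp z.2 * u.2) : VC) P (z.1, cexp z.2)).
Proof.
move=> h1 h2; have hb := ball_pair h1 h2.
have d1 := sdiff_comp (sdiff_lin z (blin_fst vec C)) (sdiff_Gquad z.1 Gs).
have d2 := sdiffM (sdiffZ (2^-1) d1) (sdiff_lin z (blin_snd vec C)).
have v1 : nr (z.1 - x t0) < kappa := lt_quarter k0 h1.
have d3 := sdiffZ 2 (sdiff_comp (sdiff_lin z (blin_fst vec C)) (potential_sd (chart_image v1))).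
have d4 := sdiff_comp (sdiff_exp_snd z) (sdiff_sd (action_sdiff blin_hamiltonian hl hb)).
apply: sdiff_eq (sdiff_ext _ (sdiffD (sdiffB d2 d3) d4)) _ => [|u].
  by exists 1; [exact: ltr01 | move=> y _; rewrite /local_S !scaleCE [_^-1 * _]mulrC].
rewrite !scaleCE; congr (_ - _ + _).
move: (Gquad _ _) ((_ *m _ *m _) 0 0) => g w; have n2 : (2 : C) != 0 by rewrite pnatr_eq0.
by rewrite mulrA mulVf // mul1r addrC [2^-1 * _]mulrC.
Qed.

Lemma local_S_sd z : nr (z.1 - x t0) < kappa / 4 -> nr (cexp z.2) < kappa / 4 -> sd local_S z.
Proof. by move=> h1 h2; exact: sdiff_sd (local_S_sdiff h1 h2). Qed.

Lemma derive_local_S_s z : nr (z.1 - x t0) < kappa / 4 -> nr (cexp z.2) < kappa / 4 ->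
  'D_((0, 1) : VC) local_S z = h (z.1, cexp z.2).
Proof.
move=> h1 h2; apply: etrans (sdiff_derive _ (local_S_sdiff h1 h2)) _.
have v1 : nr (z.1 - x t0) < kappa := lt_quarter k0 h1.
rewrite /= !mul0mx [X in X * _]mxE mul0r add0r !mulr1.
have [bF _] := potential_sd (chart_image v1); rewrite (blin0 bF) mulr0 subr0.
have := action_euler hx blin_hamiltonian hamiltonianE hl (ball_pair h1 h2).
by rewrite /=; move: ('D_ _ _ _) => T ->; rewrite addrC subrK.
Qed.

Lemma derive_local_S_x z a : nr (z.1 - x t0) < kappa / 4 -> nr (cexp z.2) < kappa / 4 ->
  'D_((delta_mx 0 a, 0) : VC) local_S z = (invmx G *m z.1^T) a 0 * z.2 - 2 * 'D_(delta_mx 0 a) F z.1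
    + 'D_((delta_mx 0 a, 0) : VC) P (z.1, cexp z.2).
Proof.
move=> h1 h2; apply: etrans (sdiff_derive _ (local_S_sdiff h1 h2)) _.
rewrite /= !mulr0 addr0; congr (_ * _ - _ + _).
by rewrite -mulmxA -rowE mxE.
Qed.

(** For z = (v, s), the point of L_s over X = v. *)
Definition lagrangian_pt (z : VC) : 'rV[C]_(n.+1 + n.+1) := cross_pt (tau (z.1, cexp z.2)).1 z.2.

Lemma lagrangian_ptP z : nr (z.1 - x t0) < kappa -> nr (cexp z.2) < kappa -> sector p q rho z.2 ->
  [/\ D (lagrangian_pt z), X (lagrangian_pt z) = z.1, A (tau (z.1, cexp z.2)).1 &
    fdom M (tau (z.1, cexp z.2)).1].
Proof.
move=> h1 h2 hs; have hb := ball_pair h1 h2; have [At e2 e1 tr] := tau_fst hl hb.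
have [_ _ _ H _] := hl; have [_ Dt XE _] := H _ _ tr hs; split=> //.
  rewrite /lagrangian_pt XE -[RHS]e1 /=; congr Xseries.
  by move: e2; case: (tau _) => ? ? /= ->.
exact: (chart_regular hx At).1.
Qed.

Let Dtau (z u : VC) : vec := ('D_((u.1, cexp z.2 * u.2) : VC) (tau : VC -> VC) (z.1, cexp z.2)).1.

Lemma sdiff_tau1 z : nr (z.1 - x t0) < kappa -> nr (cexp z.2) < kappa ->
  sdiff (fun z : VC => (tau (z.1, cexp z.2)).1) z (Dtau z).
Proof.
move=> h1 h2; have [_ _ _ _ [_ _ st]] := hl.
have d1 := sdiff_comp (sdiff_exp_snd z) (st _ (ball_pair h1 h2)).
exact: (sdiff_comp d1 (sdiff_lin _ (blin_fst vec C))).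
Qed.

Lemma sdiff_lagrangian_pt z : nr (z.1 - x t0) < kappa -> nr (cexp z.2) < kappa ->
  sdiff lagrangian_pt z (fun u => cross_pt (Dtau z u) u.2).
Proof.
move=> h1 h2; have d1 := sdiff_pair (sdiff_tau1 h1 h2) (sdiff_lin z (blin_snd vec C)).
exact: (sdiff_comp d1 (sdiff_lin _ (blin_cross R n))).
Qed.

Section Sector.
Variable rho' : R.
Hypotheses (rr : rho' <= rho) (rk : expR rho' <= kappa / 4).
Let O : set VC := [set z | nr (z.1 - x t0) < kappa / 4 /\ sector p q rho' z.2].

Lemma sectorP s : sector p q rho' s -> sector p q rho s /\ nr (cexp s) < kappa / 4.
Proof.
case=> h1 h2; split; first by split=> //; exact: lt_le_trans h2 rr.
by rewrite nr_cexp; apply: lt_le_trans rk; rewrite ltr_expR.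
Qed.

Lemma open_prod (W : normedModType C) (w0 : W) (d : R) (B : set C) : open B ->
  open [set z : (W * C)%type | nr (z.1 - w0) < d /\ B z.2].
Proof.
move=> oB; apply/open_nrP => z [z1 z2].
have [d2 d20 hd2] := (open_nrP _).1 oB _ z2.
have [d1 d10 hd1] := (open_nrP _).1 (@open_ball_nr R W w0 d) z.1 z1.
exists (Num.min d1 d2) => [|y]; first by rewrite lt_min d10.
rewrite lt_min => /andP[y1 y2]; split.
  exact: hd1 (le_lt_trans (nr_pairl (y - z : (W * C)%type)) y1).
exact: hd2 (le_lt_trans (nr_pairr (y - z : (W * C)%type)) y2).
Qed.

Let oO : open O := @open_prod vec (x t0) (kappa / 4) _ (@open_sector R p q rho').

Lemma sector_domain z : O z -> [/\ nr (z.1 - x t0) < kappa / 4, nr (cexp z.2) < kappa / 4,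
  nr (z.1 - x t0) < kappa, nr (cexp z.2) < kappa & sector p q rho z.2].
Proof.
case=> h1 /sectorP[h2 h3]; split=> //; exact: lt_quarter.
Qed.

(** X composed with [lagrangian_pt] is the first projection. *)
Lemma derive_lagrangian_X z u c : O z ->
  'D_(cross_pt (Dtau z u) u.2) (fun y => X y 0 c) (lagrangian_pt z) = u.1 0 c.
Proof.
move=> Oz; have [_ _ h1 h2 hs] := sector_domain Oz.
have [Dz _ _ _] := lagrangian_ptP h1 h2 hs.
have [oD _ holX _] := canonical_X hXY c.
have d1 := sdiff_comp (sdiff_lagrangian_pt h1 h2) (holomorphic_sd oD holX Dz).
have d2 := sdiff_comp (sdiff_lin z (blin_fst vec C)) (sdiff_lin z.1 (@blin_coord R n.+1 c)).
have [d d0 hd] := (open_nrP O).1 oO z Oz.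
have d3 : sdiff (fun z : VC => z.1 0 c) z
    (fun u => 'D_(cross_pt (Dtau z u) u.2) (fun y => X y 0 c) (lagrangian_pt z)).
  apply: (sdiff_ext _ d1); exists d; first exact: d0.
  move=> y yd; have [_ _ y1 y2 ys] := sector_domain (hd y yd).
  by have [_ -> _ _] := lagrangian_ptP y1 y2 ys.
exact: (sdiff_unique d3 d2 u).
Qed.

(** The form of [canonical_cross_form] is evaluated on the fields d/ds and d/dX^a of the coordinates
    (X, s) of the cross. There dX vanishes on d/ds and is the a-th unit vector on d/dX^a, so that
    the sum reduces to dY_a (d/ds) = dH (d/dX^a). *)
Lemma derive_lagrangian_Y z a : O z ->
  'D_((0, 1) : VC) (fun z : VC => Y (lagrangian_pt z) 0 a) z =
  'D_((delta_mx 0 a, 0) : VC) ('D_((0, 1) : VC) local_S) z.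
Proof.
move=> Oz; have [k1 k2 h1 h2 hs] := sector_domain Oz.
have [Dz _ Az Mz] := lagrangian_ptP h1 h2 hs.
have sX c : sd (fun y => X y 0 c) (lagrangian_pt z).
  by have [oD _ holX _] := canonical_X hXY c; exact: holomorphic_sd oD holX _ Dz.
have sY c : sd (fun y => Y y 0 c) (lagrangian_pt z).
  by have [oD _ holY _] := canonical_Y hXY c; exact: holomorphic_sd oD holY _ Dz.
have e1 : 'D_((0, 1) : VC) (fun z : VC => Y (lagrangian_pt z) 0 a) z =
    'D_(cross_pt (Dtau z (0, 1)) 1) (fun y => Y y 0 a) (lagrangian_pt z).
  exact: (sdiff_derive _ (sdiff_comp (sdiff_lagrangian_pt h1 h2) (sY a))).
have e2 : 'D_((delta_mx 0 a, 0) : VC) ('D_((0, 1) : VC) local_S) z =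
    hamiltonian (Dtau z (delta_mx 0 a, 0)).
  have d1 := sdiff_comp (sdiff_tau1 h1 h2) (sdiff_lin _ blin_hamiltonian).
  have [d d0 hd] := (open_nrP O).1 oO z Oz.
  have d2 : sdiff ('D_((0, 1) : VC) local_S) z (fun u => hamiltonian (Dtau z u)).
    apply: (sdiff_ext _ d1); exists d; first exact: d0.
    move=> y yd; have [y1 y2 _ _ _] := sector_domain (hd y yd).
    exact: esym (derive_local_S_s y1 y2).
  exact: (sdiff_derive _ d2).
have := canonical_cross_form hM hunity heta hV hmu hmu_rev hN Mz
  (fun a b => canonical_XY hXY a b Dz) (fun a b => canonical_XX hXY a b Dz)
  (fun a b => canonical_YY hXY a b Dz) (Dtau z (0, 1)) (Dtau z (delta_mx 0 a, 0)) 1 sX sY.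
rewrite -/(lagrangian_pt z) mul1r -/(hamiltonian _) => E.
apply: etrans e1 _; apply: etrans _ (esym e2); rewrite -E.
have gen (y x1 x2 y2 u1 u2 : C) : x2 = u2 -> x1 = u1 -> u1 = 0 -> y * x2 - x1 * y2 = y * u2.
  by move=> -> -> ->; rewrite mul0r subr0.
have zero c : ((0, 1) : VC).1 0 c = 0 by rewrite /= mxE.
rewrite (bigD1 a) //= big1 => [|c ca].
  rewrite addr0; apply: esym; apply: etrans (gen _ _ _ _ _ _ (derive_lagrangian_X (delta_mx 0 a, 0) a Oz)
    (derive_lagrangian_X (0, 1) a Oz) (zero a)) _.
  by rewrite /= mxE !eqxx mulr1.
apply: etrans (gen _ _ _ _ _ _ (derive_lagrangian_X (delta_mx 0 a, 0) c Oz)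
    (derive_lagrangian_X (0, 1) c Oz) (zero c)) _.
by rewrite /= mxE (negPf ca) andbF mulr0.
Qed.

Let g a (z : VC) : C := Y (lagrangian_pt z) 0 a - 'D_((delta_mx 0 a, 0) : VC) local_S z.

(** Mixed derivatives of [local_S] commute, so [derive_lagrangian_Y] cancels the s-derivative of the
    defect. *)
Lemma defect_sdiff a z : O z -> exists2 L, sdiff (g a) z L & L ((0, 1) : VC) = 0.
Proof.
move=> Oz; have [k1 k2 h1 h2 hs] := sector_domain Oz.
have [Dz _ _ _] := lagrangian_ptP h1 h2 hs.
have [oD _ holY _] := canonical_Y hXY a.
have sS y : O y -> sd local_S y by move=> /sector_domain[y1 y2 _ _ _]; exact: local_S_sd.
have d1 := sdiff_comp (sdiff_lagrangian_pt h1 h2) (holomorphic_sd oD holY Dz).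
have d2 := @sd_derive R VC O local_S ((delta_mx 0 a, 0) : VC) oO sS z Oz.
eexists; first exact: (sdiffB d1 d2).
have e1 := sdiff_derive ((0, 1) : VC) d1; have e2 := derive_lagrangian_Y a Oz.
have e3 := @derive_comm R VC O local_S ((0, 1) : VC) ((delta_mx 0 a, 0) : VC) oO sS z Oz.
by rewrite /= -e1 e3 e2 subrr.
Qed.

(** This is Q log Q -> 0, with |s| + T as a bound of |log Q|. One half of the exponent absorbs |s|,
    the other half is small. *)
Lemma exp_linear_small (T e : R) : 0 <= T -> 0 < e ->
  exists b : R, forall s : R, s <= b -> expR s * (`|s| + T) <= e.
Proof.
move=> T0 e0; have T2 : 0 < T + 2 by lra.
have [b hb] := expR_small (divr_gt0 e0 T2).
exists (Num.min 0 (2 * b)) => s; rewrite le_min => /andP[s0 sb].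
have := hb (s / 2) _; have {}sb : s / 2 <= b by lra.
move=> /(_ sb); rewrite ler_pdivlMr // => h1.
have h2 : expR s = expR (s / 2) * expR (s / 2) by rewrite -expRD; congr expR; lra.
have h3 : expR (s / 2) <= 1 by rewrite -[leRHS]expR0 ler_expR; lra.
have h4 : expR (s / 2) * `|s| <= 2.
  rewrite ler0_norm //; have := expR_ge1Dx (- (s / 2)); rewrite expRN.
  have E := expR_gt0 (s / 2); rewrite -(ler_pM2l E) mulfV ?gt_eqF //.
  have : 0 <= expR (s / 2) by exact: ltW.
  lra.
have E := expR_gt0 (s / 2).
rewrite h2 -mulrA; apply: le_trans h1; rewrite ler_pM2l // mulrDr addrC.
apply: lerD => //; rewrite -[leRHS]mul1r ler_wpM2r //.
Qed.

(** As Q -> 0 the point of L_s over v moves, its t-component tending to [tv] with x tv = v; the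
    asymptotics of Y apply along it because they are uniform near [tv]. *)
Lemma defect_limit a v th e : nr (v - x t0) < kappa / 4 -> p < th < q -> 0 < e ->
  exists b : R, forall s : R, s <= b -> nr (g a (v, (s +i* th)%C)) <= e.
Proof.
move=> hv hth e0.
have v1 : nr (v - x t0) < kappa := lt_quarter k0 hv.
have [Atv xv tauv] := tau_null hx hl v1; set tv := (tau (v, 0)).1 in Atv xv tauv.
have [_ _ _ _ [_ _ st]] := hl.
have n0 : nr (0 : C) < kappa by rewrite nr0.
have hb0 : nr (((v, 0) : VC) - (x t0, 0)) < kappa by exact: ball_pair.
pose t1 (y : VC) := (tau y).1.
have st1 := sdiff_comp (st _ hb0) (sdiff_lin (tau (v, 0) : VC) (blin_fst vec C)).
have sxi := sdiff_comp st1 (chart_sd hx Atv).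
have e5 : 0 < e / 5 by rewrite divr_gt0.
have hB : nbhs (0 : C) [set y : C | nr y < e / 5].
  by apply/nbhs_nrP; exists (e / 5) => // y; rewrite subr0.
have [d d0 [rhoe hY]] := (Qto0_near p q tv (fun t s => nr (Y (cross_pt t s) 0 a -
   ((invmx G *m (x t)^T) a 0 * s - 2 * 'D_(delta_mx 0 a) F (x t))) < e / 5)).1
   (canonical_Y_asymptotic hXY a Atv hB).
have [d1 d10 h1] := sdiff_continuous st1 d0.
have [K [K0 [d2 d20 h2]]] := sdiff_cont sxi.
pose l (u : vec) : C := (invmx G *m u^T) a 0.
have [lL [K' K'0 hK']] : blin l.
  by apply: blin_linear_row => c u w; rewrite /l linearP mulmxDr -scalemxAr !mxE.
have iv : (x @` A) (x tv) by exists tv.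
have sF := @sd_derive R vec (x @` A) F (delta_mx 0 a) (chart_image_open hx) potential_sd _ iv.
have e20 : 0 < e / 20 by rewrite divr_gt0.
have [d3 d30 h3] := sdiff_continuous (sdiff_comp sxi sF) e20.
have kap : 0 < kappa / 4 by rewrite divr_gt0.
have oB := @open_ball_nr R VC (x t0, 0) (kappa / 4).
have hb4 : nr (((v, 0) : VC) - (x t0, 0)) < kappa / 4 by apply: ball_pair; rewrite ?nr0.
have sP (y : VC) : nr (y - (x t0, 0)) < kappa / 4 -> sd P y.
  by move=> hy; exact: sdiff_sd (action_sdiff blin_hamiltonian hl hy).
have sPa := @sd_derive R VC _ P ((delta_mx 0 a, 0) : VC) oB sP _ hb4.
have [d4 d40 h4] := sdiff_continuous sPa e5.
(* The action vanishes identically at Q = 0, hence so does its derivative in X. *)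
have Pa0 : 'D_((delta_mx 0 a, 0) : VC) P (v, 0) = 0.
  have hi : sdiff (fun t : vec => ((t, 0) : VC)) v (fun u : vec => ((u, 0) : VC)).
    exact: (sdiff_pair (sdiff_id v) (@sdiff_cst R vec C 0 v)).
  have c1 := sdiff_comp hi (sP (v, 0) hb4).
  have c2 : sdiff (fun t : vec => P (t, 0)) v (fun _ => 0).
    apply: (sdiff_ext _ (@sdiff_cst R vec C 0 v)); exists 1; first exact: ltr01.
    by move=> y _; rewrite action_null.
  exact: (sdiff_unique c1 c2 (delta_mx 0 a)).
pose m := Num.min d1 (Num.min d2 (Num.min d3 (Num.min d4 (kappa / 4)))).
have m0 : 0 < m by rewrite !lt_min d10 d20 d30 d40.
have m2 : 0 < m / 2 by rewrite divr_gt0.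
have [b1 hb1] := expR_small m2.
have KK : 0 < e / 5 / (K' * K) by rewrite divr_gt0 // mulr_gt0.
have [b2 hb2] := exp_linear_small (normr_ge0 th) KK.
exists (Num.min b1 (Num.min b2 (Num.min (rho' - 1) (rhoe - 1)))) => s.
rewrite !le_min => /and4P[s1 s2 s3 s4].
pose s' : C := (s +i* th)%C; pose y : VC := (v, cexp s').
have ny : nr (y - (v, 0)) = expR s.
  have -> : y - (v, 0) = (0, cexp s') by apply: pairE; rewrite /= ?subrr ?subr0.
  by rewrite nr_pair nr0 nr_cexp /= max_r // expR_ge0.
have : expR s < m by apply: le_lt_trans (hb1 s s1) _; rewrite gtr_pMr // invf_lt1 // ltr1n.
rewrite !lt_min -[expR s]ny => /and5P[y1 y2 y3 y4 y5].
have Os : O (v, s').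
  by split=> //; split=> //=; apply: le_lt_trans s3 _; rewrite gtrBl.
have Ot : sector p q rhoe s'.
  by split=> //=; apply: le_lt_trans s4 _; rewrite gtrBl.
have k2 : nr (cexp s') < kappa / 4 by have [] := sector_domain Os.
have E1 := hY (tau y).1 s' (h1 y y1) Ot.
have E2 : nr (x (tau y).1 - v) <= K * expR s.
  have := h2 y (v, 0) y2 _; rewrite -/tv xv ny; apply; by rewrite subrr nr0.
have E3 := h3 y y3; have E4 := h4 y y4; rewrite Pa0 subr0 in E4.
rewrite -/tv xv in E3.
have D1 := @derive_local_S_x (v, s') a hv k2.
(* Here the unbounded log Q meets the difference x - v = O(Q). *)
have E5 : nr ((l (x (tau y).1) - l v) * s') <= e / 5.
  rewrite nrM -(blinB _ _ (conj lL (ex_intro2 _ _ K' K'0 hK'))).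
  have ns : nr s' <= `|s| + `|th| := nr_ReIm s'.
  have f1 : nr (l (x (tau y).1 - v)) <= K' * (K * expR s).
    by apply: le_trans (hK' _) _; rewrite ler_pM2l.
  have f2 : nr (l (x (tau y).1 - v)) * nr s' <= K' * (K * expR s) * (`|s| + `|th|).
    by rewrite ler_pM // nr_ge0.
  apply: le_trans f2 _; have := hb2 s s2; rewrite ler_pdivlMr ?mulr_gt0 //.
  by move=> f3; apply: le_trans f3; rewrite le_eqVlt; apply/orP; left; apply/eqP; ring.
apply: (@eq_ind_r C _ (fun t => nr (Y (lagrangian_pt (v, s')) 0 a - t) <= e) _ _ D1).
exact: defect_bound E1 E5 E3 E4.
Qed.

(* Both sides have the same derivative in [s], by the symplectic form, and the
   same asymptotics as [Q -> 0]. *)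
Lemma lagrangian_Y a z : O z -> Y (lagrangian_pt z) 0 a = 'D_((delta_mx 0 a, 0) : VC) local_S z.
Proof.
move=> Oz; apply/eqP; rewrite -subr_eq0; apply/eqP; apply: nr_le0.
rewrite -[X in X <= _]/(nr (g a z)); apply/ler_addgt0Pr => e e0; rewrite add0r.
have [hv [hth hs]] := Oz.
have [b hb] := defect_limit a hv hth e0.
pose z0 : VC := (z.1, (0 +i* complex.Im z.2)%C).
have rayE (s : R) : z0 + rc s *: ((0, 1) : VC) = (z.1, (s +i* complex.Im z.2)%C).
  apply: pairE; rewrite /= ?scaler0 ?addr0 // /GRing.scale /= mulr1 /rc.
  by apply/eqP; rewrite eq_complex /= !(add0r, addr0) !eqxx.
have zE : z = z0 + rc (complex.Re z.2) *: ((0, 1) : VC).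
  by rewrite rayE; case: (z) => ? [? ?].
pose s0 := complex.Re z.2; pose s1 := Num.min b s0.
have s10 : s1 <= s0 by rewrite ge_min lexx orbT.
have mv := @mean_value R (fun s => g a (z0 + rc s *: ((0, 1) : VC))) (fun _ => 0) (fun _ => 0) (fun _ => 0)
  s1 s0 s10.
have {mv} : nr (g a (z0 + rc s0 *: ((0, 1) : VC)) - g a (z0 + rc s1 *: ((0, 1) : VC))) <= 0 - 0.
  apply: mv => s /andP[sa sb].
  - have Os : O (z0 + rc s *: ((0, 1) : VC)).
      by rewrite rayE; split=> //; split=> //=; exact: le_lt_trans sb hs.
    by have [L hL <-] := defect_sdiff a Os; exact: sdiff_rderiv hL.
  - by rewrite nr0.
have fin (u v w : C) : u = v -> nr (v - w) <= 0 - 0 -> nr w <= e -> nr u <= e.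
  by move=> ->; rewrite subrr => /nr_le0 /eqP; rewrite subr_eq0 => /eqP ->.
move=> Hm; apply: (fin _ _ _ (congr1 (g a) zE) Hm).
apply: (@eq_ind_r VC _ (fun z => nr (g a z) <= e) _ _ (rayE s1)).
by apply: hb; rewrite ge_min lexx.
Qed.

End Sector.
End LocalLagrangian.

(** * Termwise differentiation in s *)

Section ExponentialSeries.
Variable R : realType.
Local Notation C := (Cplx R).
Local Notation rc := (@rc R).

Lemma sum_from1 (f : nat -> C) K :
  \sum_(1 <= k < K) f k = \sum_(k < K) (if nat_of_ord k is k'.+1 then f k else 0).
Proof.
case: K => [|K]; first by rewrite big_geq // big_ord0.
by rewrite big_add1 big_mkord big_ord_recl add0r; apply: eq_bigr => k _.
Qed.

Lemma rderiv_unique (g : R -> C) s (l m : C) : rderiv g s l -> rderiv g s m -> l = m.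
Proof.
move=> hl hm; have h := rderivB hl hm; apply/eqP; rewrite -subr_eq0; apply/eqP.
apply: nr_le0; apply/ler_addgt0Pr => e e0; rewrite add0r.
have [d d0 hd] := h e e0; have := hd (s + d / 2) _.
have d2 : 0 < d / 2 by rewrite divr_gt0.
rewrite addrAC subrr add0r gtr0_norm // => H.
have {}H : nr (rc (d / 2) * (l - m)) <= e * (d / 2).
  have := H _; rewrite gtr_pMr // invf_lt1 // ltr1n => /(_ isT).
  by rewrite [X in nr X](_ : _ = - (rc (d / 2) * (l - m))) ?nrN //; ring.
by move: H; rewrite nrM nr_rc gtr0_norm // mulrC ler_pM2r.
Qed.

Lemma series_terms_bounded (a : nat -> C) (l : C) :
  (fun K => \sum_(1 <= k < K) a k) @ \oo --> l ->
  exists2 B, 0 < B & forall k, (0 < k)%N -> nr (a k) <= B.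
Proof.
move=> /cvg_seqP /(_ 1 ltr01)[N hN].
exists (2 + \sum_(k < N) nr (a k)).
  by apply: ltr_pwDl => //; apply: sumr_ge0 => k _; exact: nr_ge0.
move=> k k0; have S0 : 0 <= \sum_(k < N) nr (a k) by apply: sumr_ge0 => i _; exact: nr_ge0.
case: (ltnP k N) => [kN|Nk].
  have : nr (a k) <= \sum_(k < N) nr (a k).
    by rewrite (bigD1 (Ordinal kN)) //= lerDl; apply: sumr_ge0 => i _; exact: nr_ge0.
  lra.
have h1 := hN k Nk; have := hN k.+1 (leqW Nk).
rewrite big_nat_recr //= => h2.
have -> : a k = (\sum_(1 <= i < k) a i + a k - l) - (\sum_(1 <= i < k) a i - l) by ring.
apply: le_trans (nrB _ _) _; lra.
Qed.

(** As e^x <= 1/4, one factor 2^-k absorbs k <= 2^k and another one remains. *)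
Lemma exp_pow_bound (x : R) k : x <= -2 -> k%:R * expR x ^+ k <= (2 ^+ k)^-1 /\ expR x ^+ k <= (2 ^+ k)^-1.
Proof.
move=> hx; have h : expR x <= (4)^-1.
  apply: (@le_trans _ _ (expR (- 1) * expR (- 1))).
    by rewrite -expRD ler_expR; lra.
  have h1 : (2 : R) <= expR 1 by have := expR_ge1Dx (1 : R); lra.
  rewrite expRN -invfM lef_pV2 ?posrE ?mulr_gt0 ?expR_gt0 //.
  by move: (expR 1) h1 => E hE; nra.
have h2 : expR x ^+ k <= (4 ^+ k)^-1.
  by rewrite -exprVn lerXn2r ?nnegrE ?expR_ge0 ?invr_ge0.
have k2 : (k%:R : R) <= 2 ^+ k by rewrite -natrX ler_nat ltnW // ltn_expl.
have P : 0 < (2 ^+ k : R) by rewrite exprn_gt0.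
have E4 : (4 ^+ k : R)^-1 = (2 ^+ k)^-1 * (2 ^+ k)^-1.
  by rewrite -invfM -exprMn; congr (_ ^+ k)^-1; lra.
split.
  apply: (@le_trans _ _ (2 ^+ k * (4 ^+ k)^-1)).
    by rewrite ler_pM // exprn_ge0 // expR_ge0.
  by rewrite E4 mulrA mulfV ?gt_eqF // mul1r.
apply: le_trans h2 _; by rewrite E4 ler_piMr ?invr_ge0 ?(ltW P) // invf_le1 // exprn_ege1 // ler1n.
Qed.

(** Abel's argument. Convergence at a point with Re s = rho - 1 bounds the terms there; two units
    further to the left the terms and their derivatives decay like 2^-k, and the series may be
    differentiated term by term. Whence the loss of 3. *)
Lemma exponential_series (a : nat -> C) (f : C -> C) (p q rho : R) s :
  (forall s, sector p q rho s -> (fun K => \sum_(1 <= k < K) a k * cexp s ^+ k) @ \oo --> f s) ->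
  sector p q (rho - 3) s ->
  exists B f', sdiff f s (fun u : C => f' * u) /\
    forall K, nr (f' - \sum_(k < K) k%:R * a k * cexp s ^+ k) <= B / 2 ^+ K.
Proof.
move=> hf [hs1 hs2].
have rr1 : rho - 1 < rho by rewrite gtrBl.
have [B B0 hB] := series_terms_bounded (hf ((rho - 1) +i* complex.Im s)%C (conj hs1 rr1)).
pose a' k := if k is k'.+1 then a k else 0.
have ha k : nr (a' k) * expR (rho - 1) ^+ k <= B.
  case: k => [|k]; first by rewrite nr0 mul0r ltW.
  by have := hB k.+1 isT; rewrite nrM nrX nr_cexp.
have small (t : C) : complex.Re t < rho - 3 -> expR (complex.Re t) = expR (rho - 1) * expR (complex.Re t - (rho - 1)) /\
    complex.Re t - (rho - 1) <= -2.
  by move=> ht; split; [rewrite -expRD; congr expR; ring | lra].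
have bnd k (t : C) : complex.Re t < rho - 3 -> nr (a' k * cexp t ^+ k) <= B / 2 ^+ k /\
    nr (k%:R * a' k * cexp t ^+ k) <= B / 2 ^+ k.
  move=> /small[h1 h2]; have [h3 h4] := exp_pow_bound k h2.
  rewrite !nrM nr_nat nrX nr_cexp h1 exprMn; have A0 := nr_ge0 (a' k).
  have E0 : 0 <= expR (rho - 1) ^+ k by rewrite exprn_ge0 // expR_ge0.
  have E1 : 0 <= expR (complex.Re t - (rho - 1)) ^+ k by rewrite exprn_ge0 // expR_ge0.
  have := ha k; move: (nr (a' k)) A0 (expR (rho - 1) ^+ k) E0 => A A0 E E0 hE.
  move: (expR (complex.Re t - (rho - 1)) ^+ k) h3 h4 E1 => e h3 h4 E1.
  split; first by rewrite mulrA ler_pM // mulr_ge0.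
  rewrite (_ : k%:R * A * (E * e) = (A * E) * (k%:R * e)); last by ring.
  by rewrite ler_pM // mulr_ge0.
pose d := rho - 3 - complex.Re s; have d0 : 0 < d by rewrite subr_gt0.
have near t : nr (t - s) < d -> complex.Re t < rho - 3.
  move=> td; have := Re_le_nr (t - s).
  rewrite (_ : complex.Re (t - s) = complex.Re t - complex.Re s); last by case: (t) (s) => ? ? [].
  by rewrite ler_norml /d in td * => /andP[_]; move: td; rewrite /d; lra.
have sT k t : sdiff (fun t => a' k * cexp t ^+ k) t (fun u => a' k * (k%:R * cexp t ^+ k * u)).
  exact: sdiffZ (a' k) (sdiff_cexpX t k).
have hs := @series_sum_sdiff R C (fun k t => a' k * cexp t ^+ k) s d B
  (fun k t _ => sdiff_sd (sT k t)) (fun k t td => (bnd k t (near t td)).1) s.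
rewrite subrr nr0 in hs; have {}hs := hs d0.
have [dl dl0 hdl] := (open_nrP _).1 (@open_sector R p q (rho - 3)) s (conj hs1 hs2).
have fE t : nr (t - s) < dl -> series_sum (fun k t => a' k * cexp t ^+ k : C) t = f t.
  move=> td; have [ht1 ht2] := hdl t td.
  have ht : sector p q rho t by split=> //; apply: lt_trans ht2 _; rewrite gtrBl.
  have c1 := hf t ht.
  have c2 : (fun K => \sum_(1 <= k < K) a k * cexp t ^+ k) @ \oo -->
      (series_sum (fun k t => a' k * cexp t ^+ k : C) t : C).
    rewrite (_ : (fun K => _) = (fun K => \sum_(k < K) a' k * cexp t ^+ k)).
      exact: cvg_pow2 (glim_series_dist (fun k => (bnd k t ht2).1)).
    apply/funext => K; rewrite sum_from1; apply: eq_bigr => -[[|k] /= _] _ //.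
    by rewrite mul0r.
  exact: (cvg_unique _ c2 c1).
pose f' := glim (fun K => \sum_(k < K) k%:R * a' k * cexp s ^+ k).
exists (2 * B), f'; split.
  apply: sdiff_eq (sdiff_ext _ hs) _ => [|u]; first by exists dl.
  rewrite mulrC /f' -glimZ; last exact: partial_sums_bdd (fun k => (bnd k s hs2).2).
  congr glim; apply/funext => K; rewrite mulr_sumr; apply: eq_bigr => k _.
  by rewrite (sdiff_derive u (sT k s)); ring.
move=> K; have := glim_series_dist (fun k => (bnd k s hs2).2) K; rewrite -/f'.
congr (nr (_ - _) <= _); apply: eq_bigr => -[[|k] /= _] _ //.
by rewrite !mul0r.
Qed.

End ExponentialSeries.

Section LocalInjectivity.
Variable R : realType.
Local Notation C := (Cplx R).

(** The inverse of the stacked Jacobian, split into two blocks, is a left inverse of the derivative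
    of (X, Y). *)
Lemma jacobian_pair_inj m k (X : 'rV[C]_(m + k) -> 'rV[C]_m) (Y : 'rV[C]_(m + k) -> 'rV[C]_k) y
    (JX : 'M[C]_(m, m + k)) (JY : 'M[C]_(k, m + k)) :
  (forall c, sd (fun z => X z 0 c) y) -> (forall c, sd (fun z => Y z 0 c) y) ->
  JX = \matrix_(c, b) 'D_(delta_mx 0 b) (fun z => X z 0 c) y ->
  JY = \matrix_(c, b) 'D_(delta_mx 0 b) (fun z => Y z 0 c) y ->
  col_mx JX JY \in unitmx ->
  exists2 d, 0 < d & forall z z', nr (z - y) < d -> nr (z' - y) < d ->
    X z = X z' -> Y z = Y z' -> z = z'.
Proof.
move=> sX sY eX eY uJ.
have lin l (Z : 'rV[C]_(m + k) -> 'rV[C]_l) : (forall c, sd (fun z => Z z 0 c) y) ->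
    sdiff Z y (fun u => u *m (\matrix_(c, b) 'D_(delta_mx 0 b) (fun z => Z z 0 c) y)^T).
  move=> sZ; apply: sdiff_row => c; apply: sdiff_eq (sZ c) _ => u.
  have [bL _] := sZ c; rewrite {1}(row_sum_coord u) (blin_sum _ _ _ bL) mxE.
  by apply: eq_bigr => b _; rewrite (blinZ _ _ bL) !mxE scaleCE.
have dX := lin _ _ sX; have dY := lin _ _ sY; rewrite -eX in dX; rewrite -eY in dY.
have dP := sdiff_pair dX dY.
pose B := invmx (row_mx JX^T JY^T).
pose L' (w : ('rV[C]_m * 'rV[C]_k)%type) : 'rV[C]_(m + k) := w.1 *m usubmx B + w.2 *m dsubmx B.
have bmul l j (E : 'M[C]_(l, j)) : blin (fun u : 'rV[C]_l => u *m E).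
  by apply: blin_linear_row => c u v; rewrite mulmxDl scalemxAl.
have bL' : blin L'.
  exact: blin_add (blin_comp (blin_fst _ _) (bmul _ _ _)) (blin_comp (blin_snd _ _) (bmul _ _ _)).
have [u|d d0 hd] := sdiff_inj dP bL'; last first.
  exists d => // z z' h1 h2 e1 e2; apply: hd; [exact: h1|exact: h2|by rewrite e1 e2].
rewrite /L' /= -mul_row_col vsubmxK -mul_mx_row -mulmxA mulmxV ?mulmx1 //.
by rewrite -tr_col_mx unitmx_tr.
Qed.

End LocalInjectivity.

(** * Gluing of the local generating functions, and uniqueness *)

Section GeneratingFunction.
Variable R : realType.
Local Notation C := (Cplx R).
Local Notation rc := (@rc R).
Variables (n : nat) (M : frobenius_data R n.+1) (mu : 'rV[C]_n.+1)
  (N : frobenius_data R (n.+1 + n.+1))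
  (A : set 'rV[C]_n.+1) (x : 'rV[C]_n.+1 -> 'rV[C]_n.+1) (G : 'M[C]_n.+1)
  (F : 'rV[C]_n.+1 -> C) (p q : R) (D : set 'rV[C]_(n.+1 + n.+1))
  (X Y : 'rV[C]_(n.+1 + n.+1) -> 'rV[C]_n.+1).
Hypotheses (hM : frobenius_manifold M) (hunity : funity M = delta_mx 0 ord0)
  (heta : forall a b, flat_metric M a b = (b == rev_ord a)%:R)
  (hV : forall t, fdom M t -> Vmx M t = diag_mx mu)
  (hmu : forall a, mu 0 a != 2^-1)
  (hmu_rev : forall a, mu 0 a + mu 0 (rev_ord a) = 0)
  (heuler : forall t a, fdom M t -> mu 0 a != (2 - fcharge M) / 2 ->
       feuler M t 0 a = ((2 - fcharge M) / 2 - mu 0 a) * t 0 a)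
  (hN : tensor_QHP1 M mu N) (hx : flat_chart M A x G) (hF : dual_potential M A x G F)
  (hpq : p < q)
  (hXY : canonical_coordinates p q N A x G F D X Y).
Local Notation vec := ('rV[C]_n.+1).
Local Notation VC := ((vec * C)%type : normedModType C).
Local Notation Ham := (hamiltonian M).

(** The sizes are matched so that (t, s) |-> (X, e^s) carries the box of size [d] into the domain of
    [tau], and the two maps are inverse to each other in both orders. *)
Definition local_box t0 (d r rho rho' kappa : R) tau : Prop :=
  [/\ local_data A x p q D X t0 r rho kappa tau, 0 < d & rho' <= rho] /\
  [/\ expR rho' <= kappa / 4,
     forall v s, nr (v - x t0) < kappa / 4 -> sector p q rho' s ->
       nr ((tau (v, cexp s)).1 - t0) < d ->
       X (cross_pt (tau (v, cexp s)).1 s) = v &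
     forall t s, nr (t - t0) < d -> sector p q rho' s ->
       [/\ A t, D (cross_pt t s), nr (X (cross_pt t s) - x t0) < kappa / 4,
         tau (X (cross_pt t s), cexp s) = (t, cexp s) & X_expansion x t s (X (cross_pt t s))]].

Lemma local_box_ex t0 : A t0 -> exists d r rho rho' kappa tau, local_box t0 d r rho rho' kappa tau.
Proof.
move=> At0; have [r [rho [kappa [tau hl]]]] := local_data_ex hM hunity hN hx hXY At0.
have [r0 k0 hX hcr [htau hinj _]] := hl.
have k4 : 0 < kappa / 4 by rewrite divr_gt0.
have z0 : nr (((t0, 0) : VC) - (t0, 0)) < r by rewrite subrr nr0.
have [e e0 he] := sdiff_continuous (hX _ z0).2 k4.
rewrite (Xseries_null hx At0) in he.
pose d := Num.min e r / 2.
have m0 : 0 < Num.min e r by rewrite lt_min e0.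
have d0 : 0 < d by rewrite divr_gt0.
have [dr de] : d < r /\ d < e.
  have : d < Num.min e r by rewrite gtr_pMr // invf_lt1 // ltr1n.
  by rewrite lt_min => /andP[].
have [b1 hb1] := expR_small k4; have [b2 hb2] := expR_small d0.
pose rho' := Num.min rho (Num.min b1 b2).
exists d, r, rho, rho', kappa, tau; split; first by split=> //; rewrite ge_min lexx.
have sec s : sector p q rho' s -> [/\ sector p q rho s, nr (cexp s) < kappa & nr (cexp s) <= d].
  move=> [s1 s2]; have [h1 h2 h3] : [/\ complex.Re s < rho, complex.Re s <= b1 & complex.Re s <= b2].
    by move: s2; rewrite !lt_min => /and3P[? /ltW ? /ltW ?]; split.
  rewrite !nr_cexp; split; [by split| |exact: hb2].
  by apply: le_lt_trans (hb1 _ h2) _; rewrite gtr_pMr // invf_lt1 // ltr1n.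
have main t s : nr (t - t0) < d -> sector p q rho' s ->
    [/\ A t, D (cross_pt t s), X (cross_pt t s) = Xseries x (t, cexp s),
      nr (((t, cexp s) : VC) - (t0, 0)) < r /\ nr (((t, cexp s) : VC) - (t0, 0)) < e &
      X_expansion x t s (X (cross_pt t s))].
  move=> td hs; have [s1 s2 s3] := sec s hs.
  have [a1 a2 a3 a4] := hcr t s (lt_trans td dr) s1.
  have E : ((t, cexp s) : VC) - (t0, 0) = (t - t0, cexp s) by apply: pairE; rewrite //= subr0.
  split=> //; rewrite E nr_pair !gt_max.
  by rewrite (lt_trans td dr) (le_lt_trans s3 dr) (lt_trans td de) (le_lt_trans s3 de).
split.
- by apply: hb1; rewrite !ge_min lexx !orbT.
- move=> v s hv hs td; have [_ _ -> _ _] := main _ s td hs.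
  have [_ s2 _] := sec s hs.
  have [_ e2 e1 _] := tau_fst hl (ball_pair (lt_quarter k0 hv) s2).
  by rewrite -[RHS]e1 /=; congr Xseries; move: e2; case: (tau _) => ? ? /= ->.
move=> t s td hs; have [a1 a2 a3 [a4 a5] a6] := main t s td hs; have [_ s2 _] := sec s hs.
have k3 : nr (X (cross_pt t s) - x t0) < kappa / 4 by rewrite a3; exact: he.
split=> //.
have [h1 h2] := htau _ (ball_pair (lt_quarter k0 k3) s2).
apply: hinj; [exact: h1|exact: a4|].
by rewrite h2 /chart_cross a3.
Qed.

Variables (df rf rhof rhof' kf : vec -> R) (tf : vec -> vec * C -> vec * C) (pre : vec -> vec).
Hypotheses (hbox : forall t0, A t0 -> local_box t0 (df t0) (rf t0) (rhof t0) (rhof' t0) (kf t0) (tf t0))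
  (hpre : forall v, (x @` A) v -> A (pre v) /\ x (pre v) = v).

(** At v the local inverse attached to the preimage of v is used; by [coef_unique] any base point
    close enough gives the same value. For k = 0 the value is 0. *)
Definition Sk (k : nat) (v : vec) : C := coef Ham (kf (pre v)) (tf (pre v)) k v / k%:R.

Definition Sfun (z : VC) : C := Gquad G z.1 / 2 * z.2 - 2 * F z.1 +
  glim (fun K => \sum_(1 <= k < K) Sk k z.1 * cexp z.2 ^+ k).

Definition boxes : set (vec * C) :=
  [set z | exists t0, [/\ A t0, nr (z.1 - t0) < df t0 & sector p q (rhof' t0) z.2]].

Let chart (z : vec * C) : vec * C := (X (cross_pt z.1 z.2), z.2).
Let DS : set (vec * C) := [set chart z | z in boxes].
Let bH := blin_hamiltonian M.
Let HE := hamiltonianE hM hunity heta hV hmu hmu_rev heuler hx.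

Section At.
Variable t0 : vec.
Hypothesis At0 : A t0.
Local Notation d := (df t0).
Local Notation r := (rf t0).
Local Notation rho := (rhof t0).
Local Notation rho' := (rhof' t0).
Local Notation kappa := (kf t0).
Local Notation tau := (tf t0).
Let O : set VC := [set z | nr (z.1 - x t0) < kappa / 4 /\ sector p q rho' z.2].
Let hl : local_data A x p q D X t0 r rho kappa tau.
Proof. by have [[]] := hbox At0. Qed.
Let k0 : 0 < kappa.
Proof. by case: hl. Qed.
Let rr : rho' <= rho.
Proof. by have [[]] := hbox At0. Qed.
Let rk : expR rho' <= kappa / 4.
Proof. by have [_ []] := hbox At0. Qed.
Local Notation Sloc := (local_S M G F kappa tau).

Lemma open_O : open O.
Proof. exact: (@open_prod R vec (x t0) (kappa / 4) _ (@open_sector R p q rho')). Qed.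

Lemma O_small z : O z -> [/\ nr (z.1 - x t0) < kappa / 4, nr (cexp z.2) < kappa / 4,
  nr (z.1 - x t0) < kappa / 2 & sector p q rho z.2].
Proof.
case=> h1 h2; have [h3 h4] := sectorP rr rk h2; split=> //.
by have := k0; move: h1; lra.
Qed.

Lemma Sk_local k v : nr (v - x t0) < kappa / 2 -> Sk k v = coef Ham kappa tau k v / k%:R.
Proof.
move=> hv; have v1 : nr (v - x t0) < kappa by have := k0; lra.
have [Ap xp] := hpre (chart_image hx hl v1).
have [[hl' _ _] _] := hbox Ap; have kp : 0 < kf (pre v) by case: hl'.
have v2 : nr (v - x (pre v)) < kf (pre v) / 2 by rewrite xp subrr nr0 divr_gt0.
by rewrite /Sk (coef_unique hx bH k hl' hl v2 hv).
Qed.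

Lemma partial_sum_local z K : O z ->
  \sum_(1 <= k < K) Sk k z.1 * cexp z.2 ^+ k = \sum_(k < K) action_term Ham kappa tau k (z.1, cexp z.2).
Proof.
move=> /O_small[_ _ h2 _]; rewrite sum_from1; apply: eq_bigr => -[[|k] /= _] _.
  by rewrite /action_term invr0 mulr0 mul0r.
by rewrite Sk_local.
Qed.

Lemma S_local z : O z -> Sfun z = Sloc z.
Proof.
move=> Oz; rewrite /Sfun /local_S; congr (_ + _); rewrite /action /series_sum.
by congr glim; apply/funext => K; exact: partial_sum_local.
Qed.

Lemma S_expansion z : O z -> (fun K : nat => Gquad G z.1 / 2 * z.2 - 2 * F z.1 +
  \sum_(1 <= k < K) Sk k z.1 * cexp z.2 ^+ k) @ \oo --> Sfun z.
Proof.
move=> Oz; have [h1 h2 _ _] := O_small Oz.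
have [B B0 hB] := hamiltonian_bound bH hl.
apply: (@cvg_pow2 _ _ _ (2 * B)) => K; rewrite (S_local Oz) (partial_sum_local K Oz) /local_S.
rewrite opprD addrACA subrr add0r.
exact: (action_dist hl (ltW B0) hB K (ball_pair h1 h2)).
Qed.

Lemma S_sd z : O z -> sd Sfun z.
Proof.
move=> Oz; have [h1 h2 _ _] := O_small Oz.
have hS := local_S_sd hM hx hF At0 hl h1 h2.
apply: sdiff_sd (sdiff_ext _ hS); have [e e0 he] := (open_nrP _).1 open_O z Oz.
by exists e; [exact: e0 | move=> y /he Oy; rewrite S_local].
Qed.

Lemma derive_S z u : O z -> 'D_u Sfun z = 'D_u Sloc z.
Proof.
move=> Oz; have [h1 h2 _ _] := O_small Oz.
have hS := local_S_sd hM hx hF At0 hl h1 h2.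
apply: sdiff_derive; apply: sdiff_ext hS; have [e e0 he] := (open_nrP _).1 open_O z Oz.
by exists e; [exact: e0 | move=> y /he Oy; rewrite S_local].
Qed.

Lemma box_O t s : nr (t - t0) < d -> sector p q rho' s ->
  [/\ A t, D (cross_pt t s), O (chart (t, s)), tau (X (cross_pt t s), cexp s) = (t, cexp s) &
    X_expansion x t s (X (cross_pt t s))].
Proof.
by move=> td hs; have [_ [_ _ h]] := hbox At0; have [? ? ? ? ?] := h t s td hs.
Qed.

Lemma box_DS v s : nr (v - x t0) < kappa / 4 -> sector p q rho' s ->
  nr ((tau (v, cexp s)).1 - t0) < d -> DS (v, s).
Proof.
move=> hv hs td; have [_ [_ h _]] := hbox At0.
exists ((tau (v, cexp s)).1, s); first by exists t0.
by rewrite /chart /= h.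
Qed.

End At.

Lemma boxes_nbhd : Q0_nbhd p q A boxes.
Proof.
split.
  apply/open_nrP => z [t0 [At0 h1 h2]].
  have oB := @open_prod R vec t0 (df t0) _ (@open_sector R p q (rhof' t0)).
  have [e e0 he] := (open_nrP _).1 oB z (conj h1 h2); exists e => // y /he[y1 y2].
  by exists t0.
move=> t0 At0; apply/Qto0_near; have [[_ d0 _] _] := hbox At0.
by exists (df t0) => //; exists (rhof' t0) => t s td hs; exists t0.
Qed.

(** Near a point of [DS] the inverse [tau] is continuous, hence keeps its values in the box, and
    [box_DS] returns to the image. *)
Lemma open_DS : open DS.
Proof.
apply/open_nrP => _ [[t s] [t0 [At0 td hs]] <-].
have [At Dt Oz tE _] := box_O At0 td hs.
have [[hl d0 _] _] := hbox At0; have k0 : 0 < kf t0 by case: hl.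
have [h1 h2 _ hs'] := O_small At0 Oz.
have c := sdiff_tau1 hl (lt_quarter k0 h1) (lt_quarter k0 h2).
have e0 : 0 < df t0 - nr (t - t0) by rewrite subr_gt0.
have [e1 e10 he1] := sdiff_continuous c e0.
have [e2 e20 he2] := (open_nrP _).1 (@open_O t0) _ Oz.
exists (Num.min e1 e2) => [|y]; first by rewrite lt_min e10.
rewrite lt_min => /andP[y1 y2]; have [Oy1 Oy2] := he2 y y2.
rewrite [y]surjective_pairing; apply: (box_DS At0) => //.
have := he1 y y1; rewrite /= tE /= => h.
by apply: le_lt_trans (nr_tri t _ _) _; rewrite -ltrBrDr.
Qed.

Lemma DS_nbhd : Q0_nbhd p q (x @` A) DS.
Proof.
split; first exact: open_DS.
move=> _ [t0 At0 <-]; apply/Qto0_near; have [[hl d0 _] _] := hbox At0.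
have k0 : 0 < kf t0 by case: hl.
have [_ _ _ _ [_ _ st]] := hl.
have v0 : nr (x t0 - x t0) < kf t0 by rewrite subrr nr0.
have hb : nr (((x t0, 0) : VC) - (x t0, 0)) < kf t0 by rewrite subrr nr0.
have [At1 xt1 tE] := tau_null hx hl v0.
have tt : (tf t0 (x t0, 0)).1 = t0 by apply: (chart_inj hx); [exact: At1 | exact: At0 | exact: xt1].
have c := sdiff_comp (st _ hb) (sdiff_lin (tf t0 (x t0, 0) : VC) (blin_fst vec C)).
have [e e0 he] := sdiff_continuous c d0; rewrite tt in he.
have [b hb'] := expR_small (divr_gt0 e0 (ltr0n R 2)).
have k4 : 0 < kf t0 / 4 by rewrite divr_gt0.
exists (Num.min e (kf t0 / 4)); first by rewrite lt_min e0.
exists (Num.min b (rhof' t0)) => v s; rewrite lt_min => /andP[v1 v2] [s1].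
rewrite lt_min => /andP[s2 s3]; apply: (box_DS At0) => //.
apply: he; have -> : ((v, cexp s) : VC) - (x t0, 0) = (v - x t0, cexp s) by apply: pairE; rewrite //= subr0.
rewrite nr_pair gt_max v1 nr_cexp; apply: le_lt_trans (hb' _ (ltW s2)) _.
by rewrite gtr_pMr // invf_lt1 // ltr1n.
Qed.

Lemma DS_O z : DS z -> exists t0, A t0 /\ nr (z.1 - x t0) < kf t0 / 4 /\ sector p q (rhof' t0) z.2.
Proof.
case=> -[t s] [t0 [At0 td hs]] <-; exists t0; split=> //.
by have [_ _ Oz _ _] := box_O At0 td hs.
Qed.

Lemma Sk_holomorphic k : holomorphic (x @` A) (Sk k).
Proof.
apply: sd_holomorphic; first exact: chart_image_open hx.
move=> _ [t0 At0 <-]; have [[hl _ _] _] := hbox At0.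
have k0 : 0 < kf t0 by case: hl.
have k2 : 0 < kf t0 / 2 by rewrite divr_gt0.
have v0 : nr (x t0 - x t0) < kf t0 / 2 by rewrite subrr nr0.
apply: sdiff_sd (sdiff_ext _ (sdiffZ (k%:R^-1) (coef_sd bH hl k v0))).
by exists (kf t0 / 2) => // v hv; rewrite (Sk_local At0) // scaleCE mulrC.
Qed.

Lemma S_generating : generating_expansion p q (x @` A) G F Sk DS Sfun.
Proof.
split; [exact: DS_nbhd| |by move=> k _; exact: Sk_holomorphic|].
  apply: sd_holomorphic; first exact: open_DS.
  by move=> z /DS_O[t0 [At0 Oz]]; exact: (S_sd At0 Oz).
by move=> z /DS_O[t0 [At0 Oz]]; exact: (S_expansion At0 Oz).
Qed.

Lemma S_hamilton t s : boxes (t, s) -> 'D_(0, 1) Sfun (X (cross_pt t s), s) = Ham t.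
Proof.
case=> t0 [At0 td hs]; have [_ _ Oz tE _] := box_O At0 td hs.
have [[hl _ _] _] := hbox At0; have [h1 h2 _ _] := O_small At0 Oz.
apply: etrans (derive_S At0 ((0, 1) : VC) Oz) _.
apply: etrans (derive_local_S_s hM hunity heta hV hmu hmu_rev heuler hx hF At0 hl h1 h2) _.
by rewrite /hamiltonian_at /= tE.
Qed.

(* A point [y] with [Y = dS] and the point of [L_s] over [X y] have the same image
   under [(X, Y)], which is locally injective. *)
Lemma S_lagrangian t s : boxes (t, s) -> \forall y \near cross_pt t s,
  lagrangian M s y <-> forall a, Y y 0 a = 'D_((delta_mx 0 a, 0) : VC) Sfun (X y, s).
Proof.
case=> t0 [At0 td hs]; have [At Dt Oz tE _] := box_O At0 td hs.
have [[hl d0 rr] [rk _ _]] := hbox At0; have [h1 h2 _ hs'] := O_small At0 Oz.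
have k0 : 0 < kf t0 by case: hl.
have Mt := (chart_regular hx At).1.
have dS z a : nr (z.1 - x t0) < kf t0 / 4 /\ sector p q (rhof' t0) z.2 ->
    Y (lagrangian_pt (tf t0) z) 0 a = 'D_((delta_mx 0 a, 0) : VC) Sfun z.
  move=> Oy; apply: etrans _ (esym (derive_S At0 _ Oy)).
  exact: (lagrangian_Y hM hunity heta hV hmu hmu_rev heuler hN hx hF hXY At0 hl rr rk a Oy).
have sX c : sd (fun z => X z 0 c) (cross_pt t s).
  by have [oD _ holX _] := canonical_X hXY c; exact: holomorphic_sd oD holX _ Dt.
have sY c : sd (fun z => Y z 0 c) (cross_pt t s).
  by have [oD _ holY _] := canonical_Y hXY c; exact: holomorphic_sd oD holY _ Dt.
have [_ uJ] := canonical_symplectic heta hmu_rev hN Mt (fun a b => canonical_XY hXY a b Dt)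
  (fun a b => canonical_XX hXY a b Dt) (fun a b => canonical_YY hXY a b Dt).
have [e e0 inj] := jacobian_pair_inj sX sY erefl erefl uJ.
pose z0 : VC := (X (cross_pt t s), s).
have ptE : lagrangian_pt (tf t0) z0 = cross_pt t s by rewrite /lagrangian_pt /= tE.
have [e1 e10 he1] := sdiff_continuous (sdiff_lagrangian_pt hl (lt_quarter k0 h1) (lt_quarter k0 h2)) e0.
have [e2 e20 he2] := (open_nrP _).1 (@open_O t0) _ Oz.
have sXv : sdiff X (cross_pt t s) (fun u => \row_c 'D_u (fun z => X z 0 c) (cross_pt t s)).
  by apply: sdiff_row => c; apply: sdiff_eq (sX c) _ => u; rewrite mxE.
have e12 : 0 < Num.min e1 e2 by rewrite lt_min e10.
have [e3 e30 he3] := sdiff_continuous sXv e12.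
have e4 : 0 < df t0 - nr (t - t0) by rewrite subr_gt0.
apply/nbhs_nrP; exists (Num.min e (Num.min e3 (df t0 - nr (t - t0)))).
  by rewrite !lt_min e0 e30.
move=> y; rewrite !lt_min => /and3P[y1 y2 y3]; split.
  case=> t' Mt' yE a.
  (* The first block of y is t', so |t' - t| is bounded by the distance from y to [cross_pt t s]. *)
  have t'd : nr (t' - t0) < df t0.
    apply: le_lt_trans (nr_tri t _ _) _; rewrite -ltrBrDr; apply: le_lt_trans y3.
    apply: nr_rowP => [|j]; first exact: nr_ge0.
    have E : (y - cross_pt t s) 0 (lshift n.+1 j) = (t' - t) 0 j.
      by rewrite yE mxE [X in _ + X = _]mxE /cross_pt !row_mxEl [RHS]mxE [X in _ = _ + X]mxE.
    by rewrite -E; exact: nr_coord.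
  have [_ _ Oz' tE' _] := box_O At0 t'd hs.
  by rewrite yE -(dS (X (cross_pt t' s), s) a Oz') /lagrangian_pt /= tE'.
move=> hY; pose w : VC := (X y, s).
have nw : nr (w - z0) < Num.min e1 e2.
  have -> : w - z0 = (X y - X (cross_pt t s), 0) by apply: pairE; rewrite //= subrr.
  by rewrite nr_pair nr0 gt_max e12 andbT; exact: he3.
move: nw; rewrite lt_min => /andP[w1 w2].
have Ow := he2 w w2; have [k1 k2 _ k3] := O_small At0 Ow.
have [_ XE _ Mw] := lagrangian_ptP hx hl (lt_quarter k0 k1) (lt_quarter k0 k2) k3.
have := he1 w w1; rewrite -/z0 ptE => near.
have -> : y = lagrangian_pt (tf t0) w.
  apply: inj => //; apply/rowP => a; rewrite hY; exact: esym (dS w a Ow).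
by exists (tf t0 (X y, cexp s)).1.
Qed.

(** At fixed v, differentiating the expansion of [S'] in s gives h_0 plus the sum of k S'_k Q^k,
    which the Hamilton-Jacobi equation identifies with H; the identity theorem compares
    coefficients. *)
Lemma S_unique D' S' Sk' : generating_expansion p q (x @` A) G F Sk' D' S' ->
  hamilton_jacobi p q A x Ham D' S' ->
  forall k v, (0 < k)%N -> (x @` A) v -> Sk' k v = Sk k v.
Proof.
move=> [[oD' hD'] hS' _ exS'] [T' [_ hT'] hj] k v kpos vA; have [t0 At0 xv] := vA.
have [[hl d0 rr] [rk _ _]] := hbox At0; have k0 : 0 < kf t0 by case: hl.
have [d1 d10 [r1 hD1]] := (Qto0_near p q v (fun y s => D' (y, s))).1 (hD' v vA).
have [d2 d20 [r2 hT1]] := (Qto0_near p q t0 (fun y s => T' (y, s))).1 (hT' t0 At0).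
have v0 : nr (v - x t0) < kf t0 by rewrite xv subrr nr0.
have v4 : nr (v - x t0) < kf t0 / 4 by rewrite xv subrr nr0 divr_gt0.
have v2 : nr (v - x t0) < kf t0 / 2 by rewrite xv subrr nr0 divr_gt0.
have [At1 xt1 tE] := tau_null hx hl v0.
have tt : (tf t0 (v, 0)).1 = t0 by apply: (chart_inj hx); [exact: At1 | exact: At0 | rewrite xt1 xv].
have hb : nr (((v, 0) : VC) - (x t0, 0)) < kf t0 by apply: ball_pair; rewrite ?nr0.
have [_ _ _ _ [_ _ st]] := hl.
have c := sdiff_comp (st _ hb) (sdiff_lin (tf t0 (v, 0) : VC) (blin_fst vec C)).
have m0 : 0 < Num.min d2 (df t0) by rewrite lt_min d20.
have [e e0 he] := sdiff_continuous c m0; rewrite tt in he.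
have [b hb'] := expR_small (divr_gt0 e0 (ltr0n R 2)).
pose rho := Num.min b (Num.min (rhof' t0) (Num.min r1 r2)).
pose h := hamiltonian_at Ham (tf t0).
(* The preimage t of (v, Q) tends to t0, where [T'] and the box are available; v is the sum of the
   expansion of X at that t, so the equation applies at (v, s). *)
have sec s : sector p q rho s -> [/\ sector p q (rhof' t0) s, nr (cexp s) < e, D' (v, s) &
    'D_((0, 1) : VC) S' (v, s) = h (v, cexp s)].
  move=> [s1]; rewrite !lt_min => /and4P[sb s2 s3 s4].
  have hs : sector p q (rhof' t0) s by [].
  have Q1 : nr (cexp s) < e.
    by rewrite nr_cexp; apply: le_lt_trans (hb' _ (ltW sb)) _; rewrite gtr_pMr // invf_lt1 // ltr1n.
  have tn : nr ((tf t0 (v, cexp s)).1 - t0) < Num.min d2 (df t0).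
    apply: he; have -> : ((v, cexp s) : VC) - (v, 0) = (0, cexp s) by apply: pairE; rewrite /= ?subrr ?subr0.
    by rewrite nr_pair nr0 gt_max e0.
  move: tn; rewrite lt_min => /andP[tn1 tn2].
  have D1 : D' (v, s) by apply: hD1; [rewrite subrr nr0 | split].
  split=> //; have [_ [_ hXv _]] := hbox At0.
  have [_ _ _ _ Xe] := box_O At0 tn2 hs; rewrite (hXv v s v4 hs tn2) in Xe.
  by apply: hj Xe D1; apply: hT1 => //; split.
(* Removing the part that contains log Q leaves a pure power series in Q. *)
have ex s : sector p q rho s -> (fun K => \sum_(1 <= k < K) Sk' k v * cexp s ^+ k) @ \oo -->
    (S' (v, s) - (Gquad G v / 2 * s - 2 * F v) : C).
  move=> /sec[_ _ D1 _]; have /cvg_seqP H := exS' (v, s) D1.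
  apply/cvg_seqP => e' e'0; have [K0 hK] := H e' e'0; exists K0 => K KK.
  by have := hK K KK; congr (nr _ < _); rewrite /=; ring.
have der s : sector p q (rho - 3) s -> exists B, forall K,
    nr (h (v, cexp s) - Gquad G v / 2 - \sum_(k < K) k%:R * Sk' k v * cexp s ^+ k) <= B / 2 ^+ K.
  move=> hs; have [B [f' [df' hB]]] := exponential_series ex hs; exists B => K.
  suff <- : f' = h (v, cexp s) - Gquad G v / 2 by [].
  have hs3 : sector p q rho s.
    by case: hs => s1 s2; split=> //; apply: lt_trans s2 _; rewrite gtrBl.
  have [_ _ D1 <-] := sec s hs3; have [dS' _] := hS' (v, s) D1.
  have a1 : (v, s) + rc 0 *: ((0, 1) : VC) = (v, s) by rewrite scale0r addr0.
  have a2 : s + rc 0 *: (1 : C) = s by rewrite scale0r addr0.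
  (* [S'] is differentiable in the pair and the series in s alone; the two derivatives are compared
     along the real direction, where [rderiv_unique] applies. *)
  have g1 : rderiv (fun y => S' (((v, s) : VC) + rc y *: ((0, 1) : VC))) 0 ('d S' (v, s) ((0, 1) : VC)).
    have := @differentiable_rderiv R VC S' (v, s) ((0, 1) : VC) 0; rewrite a1; exact.
  have g2 : rderiv (fun y => S' (v, s + rc y *: (1 : C)) - (Gquad G v / 2 * (s + rc y *: (1 : C)) - 2 * F v)) 0 (f' * 1).
    have := @sdiff_rderiv R C (fun s => S' (v, s) - (Gquad G v / 2 * s - 2 * F v)) s 1 _ 0.
    by rewrite a2; apply; exact: df'.
  have g3 : rderiv (fun y => Gquad G v / 2 * (s + rc y *: (1 : C)) - 2 * F v) 0 (Gquad G v / 2 * 1).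
    have := @sdiff_rderiv R C (fun s => Gquad G v / 2 * s - 2 * F v) s 1 (fun u => Gquad G v / 2 * u) 0.
    rewrite a2; apply; have := sdiffB (sdiffZ (Gquad G v / 2) (sdiff_id s)) (@sdiff_cst R C C (2 * F v) s).
    by move=> H; apply: sdiff_eq H _ => u; rewrite subr0.
  have g4 := rderivB g1 g3.
  have E : (fun y => S' (((v, s) : VC) + rc y *: ((0, 1) : VC)) - (Gquad G v / 2 * (s + rc y *: (1 : C)) - 2 * F v)) =
     (fun y => S' (v, s + rc y *: (1 : C)) - (Gquad G v / 2 * (s + rc y *: (1 : C)) - 2 * F v)).
    apply/funext => y; congr (S' _ - _); apply: pairE; rewrite //= scaler0 addr0 //.
  rewrite E in g4; have := rderiv_unique g4 g2; rewrite !mulr1 => <-.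
  by rewrite deriveE.
have [B B0 hB] := hamiltonian_bound bH hl.
have [b3 hb3] := expR_small (divr_gt0 k0 (ltr0n R 8)).
pose rho4 := Num.min (rho - 3) b3.
(* The middle argument of the sector, which p < q makes nonempty. *)
pose th := (p + q) / 2.
have hth : p < th < q by rewrite /th; apply/andP; split; have := hpq; lra.
(* The defect h_j - j S'_j; the entry of index 0 is 0, h_0 having been accounted for by the
   logarithmic term. *)
pose cc j : C := (if j is j'.+1 then coef Ham (kf t0) (tf t0) j v else 0) - j%:R * Sk' j v.
have bnd s : sector p q rho4 s -> exists B', forall K,
    nr (0 - \sum_(j < K.+1) cc j * cexp s ^+ j) <= B' / 2 ^+ K.
  case=> s1; rewrite lt_min => /andP[s2 s3].
  have Qk : nr (cexp s) < kf t0 / 4.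
    by rewrite nr_cexp; apply: le_lt_trans (hb3 _ (ltW s3)) _; have := k0; lra.
  have [B' hB'] := der s (conj s1 s2).
  exists (4 * B + `|B'|) => K.
  have E1 := coef_expansion bH hl (ltW B0) hB K.+1 v2 Qk; have E2 := hB' K.+1.
  have -> : 0 - \sum_(j < K.+1) cc j * cexp s ^+ j =
     (h (v, cexp s) - \sum_(j < K.+1) coef Ham (kf t0) (tf t0) j v * cexp s ^+ j) -
     (h (v, cexp s) - Gquad G v / 2 - \sum_(j < K.+1) j%:R * Sk' j v * cexp s ^+ j).
    have -> : \sum_(j < K.+1) cc j * cexp s ^+ j = \sum_(j < K.+1) coef Ham (kf t0) (tf t0) j v * cexp s ^+ j
       - Gquad G v / 2 - \sum_(j < K.+1) j%:R * Sk' j v * cexp s ^+ j.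
      have c0 := coef_null hx bH HE hl v2.
      rewrite [X in _ = X - _ - _]big_ord_recl /= c0 expr0 mulr1.
      have gen (u w w' : C) : u + w - u - w' = w - w' by rewrite [u + w]addrC addrK.
      rewrite gen big_ord_recl [X in _ = _ - X]big_ord_recl /cc !mul0r subrr mul0r !add0r.
      by rewrite -sumrB; apply: eq_bigr => j _; rewrite mulrBl.
    by ring.
  have P2 : 0 <= (2 ^+ K : R)^-1 by rewrite invr_ge0 exprn_ge0.
  have P3 : (2 ^+ K.+1 : R)^-1 <= (2 ^+ K)^-1 by rewrite lef_pV2 ?posrE ?exprn_gt0 // ler_weXn2l // ler1n.
  apply: le_trans (nrB _ _) _; rewrite mulrDl; apply: lerD.
    by apply: le_trans E1 _; rewrite ler_wpM2l // mulr_ge0 // ltW.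
  apply: le_trans E2 _; apply: (@le_trans _ _ (`|B'| / 2 ^+ K.+1)).
    by rewrite ler_wpM2r ?ler_norm // invr_ge0 exprn_ge0.
  by rewrite ler_wpM2l.
pose pt (y : R) : C := (y +i* th)%C.
have spt y : y < rho4 -> sector p q rho4 (pt y) by move=> hy; split.
have r41 : rho4 - 1 < rho4 by rewrite gtrBl.
have [B' hB'] := bnd _ (spt _ r41).
have B'0 : 0 <= B' by have := hB' 0%N; rewrite expr0 divr1; apply: le_trans; exact: nr_ge0.
pose U K := \sum_(j < K.+1) cc j * cexp (pt (rho4 - 1)) ^+ j.
have hU K : nr (U K) <= B'.
  have := hB' K; rewrite sub0r nrN => H; apply: le_trans H _.
  by rewrite ler_pdivrMr ?exprn_gt0 // ler_peMr // exprn_ege1 // ler1n.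
have cc0 : cc k = 0.
  apply: (@power_series_eq0 R cc (cexp (pt (rho4 - 1))) (B' + B') [set cexp s | s in sector p q rho4]).
  - exact: cexp_neq0.
  (* A single term is a difference of consecutive partial sums, which are bounded by [hU]. *)
  - case=> [|j]; last first.
      have -> : cc j.+1 * cexp (pt (rho4 - 1)) ^+ j.+1 = U j.+1 - U j.
        have gen (u w : C) : w = u + w - u by rewrite [u + w]addrC addrK.
        by rewrite /U [X in _ = X - _]big_ord_recr; exact: gen.
      by apply: le_trans (nrB _ _) _; apply: lerD.
    by rewrite /cc mul0r subrr mul0r nr0 addr_ge0.
  - move=> e' e'0; have [b5 hb5] := expR_small (divr_gt0 e'0 (ltr0n R 2)).
    pose y := Num.min (rho4 - 1) b5; exists (cexp (pt y)).
    rewrite nr_cexp expR_gt0; split=> //.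
      by exists (pt y) => //; apply: spt; apply: (@le_lt_trans _ _ (rho4 - 1)); rewrite ?gtrBl // ge_min lexx.
    apply: (@le_lt_trans _ _ (e' / 2)); first by apply: hb5; rewrite ge_min lexx orbT.
    by rewrite gtr_pMr // invf_lt1 // ltr1n.
  - move=> _ [s hs <-]; have [B1 hB1] := bnd s hs.
    apply/cvg_seqP => e' e'0; have [K0 hK] := pow2_small B1 e'0; exists K0.+1 => -[//|K] KK.
    by rewrite -nrBC; apply: le_lt_trans (hB1 K) (hK K KK).
rewrite (Sk_local At0 k v2); case: k kpos cc0 => // k _; rewrite /cc => /eqP.
have n0 : (k.+1%:R : C) != 0 by rewrite pnatr_eq0.
by rewrite subr_eq0 => /eqP ->; rewrite mulrAC mulfV // mul1r.
Qed.

End GeneratingFunction.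

Theorem theorem17 (R : realType) (n : nat)
    (M : frobenius_data R n.+1) (mu : 'rV[Cplx R]_n.+1)
    (N : frobenius_data R (n.+1 + n.+1))
    (A : set 'rV[Cplx R]_n.+1) (x : 'rV[Cplx R]_n.+1 -> 'rV[Cplx R]_n.+1)
    (G : 'M[Cplx R]_n.+1) (F : 'rV[Cplx R]_n.+1 -> Cplx R)
    (p q : R) (D : set 'rV[Cplx R]_(n.+1 + n.+1))
    (X Y : 'rV[Cplx R]_(n.+1 + n.+1) -> 'rV[Cplx R]_n.+1)
    (hM : frobenius_manifold M)
    (hunity : funity M = delta_mx 0 ord0)
    (heta : forall a b, flat_metric M a b = (b == rev_ord a)%:R)
    (hV : forall t, fdom M t -> Vmx M t = diag_mx mu)
    (hmu : forall a, mu 0 a != 2^-1)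
    (hmu_rev : forall a, mu 0 a + mu 0 (rev_ord a) = 0)
    (heuler : forall t a, fdom M t -> mu 0 a != (2 - fcharge M) / 2 ->
       feuler M t 0 a = ((2 - fcharge M) / 2 - mu 0 a) * t 0 a)
    (hN : tensor_QHP1 M mu N)
    (hx : flat_chart M A x G)
    (hF : dual_potential M A x G F)
    (hpq : p < q)
    (hXY : canonical_coordinates p q N A x G F D X Y) :
  let H := fun t : 'rV[Cplx R]_n.+1 =>
    2 / (1 - fcharge M) * (\sum_a flat_metric M ord0 a * t 0 a) in
  (forall t, A t -> H t = Gquad G (x t) / 2) /\
  exists (T DS : set ('rV[Cplx R]_n.+1 * Cplx R))
         (S : 'rV[Cplx R]_n.+1 * Cplx R -> Cplx R)
         (Sk : nat -> 'rV[Cplx R]_n.+1 -> Cplx R),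
    Q0_nbhd p q A T /\
    DS = [set (X (cross_pt z.1 z.2), z.2) | z in T] /\
    generating_expansion p q (x @` A) G F Sk DS S /\
    (forall t s, T (t, s) -> A t /\ D (cross_pt t s) /\
      \forall y \near cross_pt t s,
        lagrangian M s y <->
        forall a, Y y 0 a = 'D_(delta_mx 0 a, 0) S (X y, s)) /\
    (forall t s, T (t, s) -> X_expansion x t s (X (cross_pt t s))) /\
    (forall t s, T (t, s) -> 'D_(0, 1) S (X (cross_pt t s), s) = H t) /\
    (forall (D' : set ('rV[Cplx R]_n.+1 * Cplx R))
            (S' : 'rV[Cplx R]_n.+1 * Cplx R -> Cplx R)
            (Sk' : nat -> 'rV[Cplx R]_n.+1 -> Cplx R),
      generating_expansion p q (x @` A) G F Sk' D' S' ->
      hamilton_jacobi p q A x H D' S' ->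
      forall k v, (0 < k)%N -> (x @` A) v -> Sk' k v = Sk k v).
Proof.
move=> H; have HE : forall t, A t -> H t = Gquad G (x t) / 2.
  by move=> t At; exact: (hamiltonian_quadratic hM hunity heta hV hmu hmu_rev heuler hx At).
split=> //.
have /choice[f hf] : forall t0, exists z : R * R * (R * R) * (R * (_ -> _)), A t0 ->
    local_box A x p q D X t0 z.1.1.1 z.1.1.2 z.1.2.1 z.1.2.2 z.2.1 z.2.2.
  (* Dummy data outside [A], to have a choice function on all points. *)
  move=> t0; have [At0|nA] := pselect (A t0); last by exists (0, 0, (0, 0), (0, id)).
  have [d [r [rho [rho' [kappa [tau h]]]]]] := local_box_ex hM hunity hN hx hXY At0.
  by exists (d, r, (rho, rho'), (kappa, tau)).
have /choice[pre hpre] : forall v, exists t, (x @` A) v -> A t /\ x t = v.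
  by move=> v; have [[t At <-]|nv] := pselect ((x @` A) v); [exists t | exists 0].
pose rho' t0 := (f t0).1.2.2; pose kappa t0 := (f t0).2.1; pose tau t0 := (f t0).2.2.
exists (boxes A p q (fun t0 => (f t0).1.1.1) rho'); eexists.
exists (Sfun M G F kappa tau pre), (Sk M kappa tau pre).
split; first exact: boxes_nbhd hf.
split; first by [].
split; first exact: (S_generating hM hx hF hf hpre).
split.
  move=> t s Tts; have [t0 [At0 td hs]] := Tts; have [At Dt _ _ _] := box_O hf At0 td hs.
  split=> //; split=> //.
  exact: (S_lagrangian hM hunity heta hV hmu hmu_rev heuler hN hx hF hXY hf hpre Tts).
split.
  by move=> t s [t0 [At0 td hs]]; have [] := box_O hf At0 td hs.
split; first by move=> t s; exact: (S_hamilton hM hunity heta hV hmu hmu_rev heuler hx hF hf hpre).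
exact: (S_unique hM hunity heta hV hmu hmu_rev heuler hx hpq hf hpre).
Qed.
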